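(* Let $\mu>0$ satisfy $2+2\mu(\mu+\sqrt{1+\mu^2})>2m+1$. Let $\alpha_0,\beta,\gamma$ satisfy $$\frac1{1+\mu(\mu+\sqrt{1+\mu^2})}\le\alpha_0\le\frac2{2m+1},\qquad\beta>0,\qquad\frac{\alpha_0+\beta}2<\gamma<\frac1{2m+1}.$$ Then for every $u_0\in\mathcal C^{-\alpha_0}$ and every $\underline Z\in\mathcal L$ there exists a unique $v\in C((0,\infty);\mathcal C^\beta)$ which is a mild solution, up to every time $T>0$, of $\partial_tv=[(\mathrm i+\mu)\Delta-1]v+\Psi(v,\underline Z)$, $v(0)=u_0$.
   Context: $\mathbb T^2=\mathbb R^2/\mathbb Z^2$; $\nu,\tau\in\mathbb C$ with $\mathrm{Re}\,\nu>0$, $m\ge1$ integer. $\mathcal C^\alpha=\mathcal B^\alpha_{\infty,\infty}$ is the complex-valued Besov–Hölder space on $\mathbb T^2$. $A=(\mathrm i+\mu)\Delta-1$, $P_t=e^{tA}$. Let $L=\{(i,j)\in\mathbb N^2:0\le i\le m+1,\ 0\le j\le m,\ i\ge j,\ i+j>1\}$. For $\alpha,\alpha'\in(0,1)$, $T>0$ and $\underline Z=(Z_t,Z^{(i,j)}_t)_{(i,j)\in L}$ with $Z\in C([0,T];\mathcal C^{-\alpha})$, $Z^{(i,j)}\in C((0,T];\mathcal C^{-\alpha})$, set $\|\underline Z\|_{\alpha,\alpha',T}=\sup_{0\le t\le T}\big(\|Z_t\|_{\mathcal C^{-\alpha}}\vee\sup_{(i,j)\in L}t^{(i+j-1)\alpha'}\|Z^{(i,j)}_t\|_{\mathcal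 C^{-\alpha}}\big)$. $\mathcal L$ is the set of such families defined on $(0,\infty)$ with $\|\underline Z\|_{\alpha,\alpha',T}<\infty$ for all $\alpha,\alpha'\in(0,1)$, $T>0$. The (fixed) $\alpha,\alpha'$ used below are sufficiently small. Notation: $Z^{:1,0:}_t=Z_t$, $Z^{:0,1:}_t=\overline{Z_t}$, $Z^{:0,0:}_t=1$, $Z^{:i,j:}_t=Z^{(i,j)}_t$ and $Z^{:j,i:}_t=\overline{Z^{(i,j)}_t}$ for $(i,j)\in L$. Define $\Psi(v_t,\underline Z_t)=-\nu\sum_{i=0}^{m+1}\sum_{j=0}^m\binom{m+1}i\binom mj v_t^i\overline{v_t}^{\,j}Z^{:m+1-i,m-j:}_t+(\tau+1)(v_t+Z_t)$. A mild solution up to time $T$ is $v\in C((0,T];\mathcal C^\beta)$ with $\sup_{0<t\le T}t^\gamma\|v_t\|_{\mathcal C^\beta}<\infty$ and $v_t=P_tu_0+\int_0^tP_{t-s}\Psi(v_s,\underline Z_s)ds$, $t\le T$. *)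

(* Defs.v *)
(* Distributions on T^2 = R^2/Z^2 are represented
   by their Fourier coefficients  f^(k), k in Z^2  (f = sum_k f^(k) e^{2 pi i k.x}). *)
From Stdlib Require Import Reals Lra ZArith List.
From Coquelicot Require Import Coquelicot.
Open Scope R_scope.

Definition fdist := (Z * Z)%type -> C.

Definition znorm (k : Z * Z) : R := sqrt (IZR (fst k) ^ 2 + IZR (snd k) ^ 2).

Definition smooth (f : R -> R) : Prop := forall (n : nat) (x : R), ex_derive_n f n x.

(** (radial profiles of) a smooth dyadic partition of unity (chi, rho):
    chi(|xi|) + sum_{j>=0} rho(2^{-j}|xi|) = 1 *)
Definition dyadic_partition (chi rho : R -> R) : Prop :=
  smooth chi /\ smooth rho /\
  (forall r, 0 <= chi r <= 1) /\ (forall r, 0 <= rho r <= 1) /\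
  (forall r, 4/3 <= Rabs r -> chi r = 0) /\
  (forall r, (Rabs r <= 3/4 \/ 8/3 <= Rabs r) -> rho r = 0) /\
  (forall r, 0 <= r -> is_series (fun j : nat => rho (r / 2 ^ j)) (1 - chi r)).

(** Littlewood--Paley multiplier of block number n; block n corresponds to
    Delta_{n-1} (so block 0 = Delta_{-1}). *)
Definition blk (chi rho : R -> R) (n : nat) (k : Z * Z) : R :=
  match n with
  | O => chi (znorm k)
  | S n' => rho (znorm k / 2 ^ n')
  end.

Definition zrange (B : nat) : list Z :=
  map (fun i => (Z.of_nat i - Z.of_nat B)%Z) (seq 0 (2 * B + 1)).
Definition box (B : nat) : list (Z * Z) :=
  flat_map (fun a => map (fun b => (a, b)) (zrange B)) (zrange B).

Definition csum (l : list C) : C := fold_right Cplus (RtoC 0) l.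

Definition ek (k : Z * Z) (x : R * R) : C :=
  let th := 2 * PI * (IZR (fst k) * fst x + IZR (snd k) * snd x) in
  (cos th, sin th).

(** Delta_{n-1} f (x); the multiplier vanishes outside box (3*2^n) *)
Definition LPblock (chi rho : R -> R) (n : nat) (f : fdist) (x : R * R) : C :=
  csum (map (fun k => Cmult (Cmult (RtoC (blk chi rho n k)) (f k)) (ek k x))
            (box (3 * 2 ^ n))).

Definition besov_le (chi rho : R -> R) (a : R) (f : fdist) (M : R) : Prop :=
  forall (n : nat) (x : R * R),
    Rpower 2 ((INR n - 1) * a) * Cmod (LPblock chi rho n f x) <= M.

Definition in_besov (chi rho : R -> R) (a : R) (f : fdist) : Prop :=
  exists M, besov_le chi rho a f M.

Definition dsub (f g : fdist) : fdist := fun k => Cminus (f k) (g k).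
Definition dconj (f : fdist) : fdist :=
  fun k => Cconj (f ((- fst k)%Z, (- snd k)%Z)).
Definition done : fdist :=
  fun k => if (Z.eqb (fst k) 0 && Z.eqb (snd k) 0)%bool then RtoC 1 else RtoC 0.

Definition cont_on (chi rho : R -> R) (I : R -> Prop) (a : R) (v : R -> fdist) : Prop :=
  (forall t, I t -> in_besov chi rho a (v t)) /\
  (forall t, I t -> forall eps, 0 < eps -> exists delta, 0 < delta /\
     forall s, I s -> Rabs (s - t) < delta -> besov_le chi rho a (dsub (v s) (v t)) eps).

(** Product of distributions: limit of (S_N f)(S_N g) where
    S_N = sum_{j = -1}^{N-1} Delta_j (well defined for f in C^b, g in C^{-a}, b > a). *)
Definition sN (chi rho : R -> R) (N : nat) (k : Z * Z) : R :=
  fold_right Rplus 0 (map (fun n => blk chi rho n k) (seq 0 (S N))).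

Definition dmul_approx (chi rho : R -> R) (N : nat) (f g : fdist) (k : Z * Z) : C :=
  csum (map (fun l =>
     let kl := ((fst k - fst l)%Z, (snd k - snd l)%Z) in
     Cmult (Cmult (RtoC (sN chi rho N l)) (f l))
           (Cmult (RtoC (sN chi rho N kl)) (g kl)))
     (box (3 * 2 ^ N))).

Definition dmul (chi rho : R -> R) (f g : fdist) : fdist := fun k =>
  (real (Lim_seq (fun N => fst (dmul_approx chi rho N f g k))),
   real (Lim_seq (fun N => snd (dmul_approx chi rho N f g k)))).

Fixpoint dpow (chi rho : R -> R) (f : fdist) (n : nat) : fdist :=
  match n with
  | O => done
  | S n' => dmul chi rho (dpow chi rho f n') f
  end.

Fixpoint binom (n k : nat) : nat :=
  match n, k with
  | _, O => 1%nat
  | O, S _ => 0%nat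
  | S n', S k' => (binom n' k' + binom n' k)%nat
  end.

Definition inL (m i j : nat) : Prop :=
  (i <= m + 1)%nat /\ (j <= m)%nat /\ (j <= i)%nat /\ (1 < i + j)%nat.

Definition Zcolon (Zt : fdist) (Zft : nat -> nat -> fdist) (a b : nat) : fdist :=
  match a, b with
  | O, O => done
  | 1%nat, O => Zt
  | O, 1%nat => dconj Zt
  | _, _ => if Nat.leb b a then Zft a b else dconj (Zft b a)
  end.

Definition Psi (chi rho : R -> R) (m : nat) (nu tau : C)
  (vt Zt : fdist) (Zft : nat -> nat -> fdist) : fdist := fun k =>
  Cplus
   (Cmult (Copp nu)
     (csum (map (fun i => csum (map (fun j =>
        Cmult (RtoC (INR (binom (m + 1) i) * INR (binom m j)))
          (dmul chi rho (dmul chi rho (dpow chi rho vt i) (dpow chi rho (dconj vt) j))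
                (Zcolon Zt Zft (m + 1 - i) (m - j)) k))
        (seq 0 (S m)))) (seq 0 (m + 2)))))
   (Cmult (Cplus tau (RtoC 1)) (Cplus (vt k) (Zt k))).

(** Fourier multiplier of P_t = e^{tA}, A = (i+mu)Delta - 1, Delta e_k = -4pi^2|k|^2 e_k *)
Definition Pmult (mu t : R) (k : Z * Z) : C :=
  let L := 4 * PI ^ 2 * znorm k ^ 2 in
  (exp (- t * (1 + mu * L)) * cos (t * L), - (exp (- t * (1 + mu * L)) * sin (t * L))).

Definition in_calL (chi rho : R -> R) (m : nat) (Z0 : R -> fdist)
  (Zf : nat -> nat -> R -> fdist) : Prop :=
  forall a a' T, 0 < a < 1 -> 0 < a' < 1 -> 0 < T ->
    cont_on chi rho (fun t => 0 <= t <= T) (- a) Z0 /\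
    (forall i j, inL m i j -> cont_on chi rho (fun t => 0 < t <= T) (- a) (Zf i j)) /\
    exists M,
      (forall t, 0 <= t <= T -> besov_le chi rho (- a) (Z0 t) M) /\
      (forall i j t, inL m i j -> 0 < t <= T ->
         forall n x, Rpower t ((INR (i + j) - 1) * a')
           * (Rpower 2 ((INR n - 1) * (- a)) * Cmod (LPblock chi rho n (Zf i j t) x)) <= M).

Definition mild_solution (chi rho : R -> R) (m : nat) (mu : R) (nu tau : C)
  (beta gamma : R) (u0 : fdist) (Z0 : R -> fdist) (Zf : nat -> nat -> R -> fdist)
  (T : R) (v : R -> fdist) : Prop :=
  cont_on chi rho (fun t => 0 < t <= T) beta v /\
  (exists M, forall t, 0 < t <= T -> forall n x,
     Rpower t gamma * (Rpower 2 ((INR n - 1) * beta) * Cmod (LPblock chi rho n (v t) x)) <= M) /\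
  (forall t, 0 < t <= T -> forall k,
     is_RInt_gen (V := C_R_NormedModule)
       (fun s => Cmult (Pmult mu (t - s) k)
                   (Psi chi rho m nu tau (v s) (Z0 s) (fun i j => Zf i j s) k))
       (at_right 0) (at_point t)
       (Cminus (v t k) (Cmult (Pmult mu t k) (u0 k)))).

(* Main.v *)
From Stdlib Require Import Reals Lra Lia ZArith List Permutation Classical FunctionalExtensionality ClassicalEpsilon.
From Coquelicot Require Import Coquelicot.
Require Import Defs.
Open Scope R_scope.

(** Everything is done mode by mode on the Fourier side.  Littlewood-Paley multipliers have kernels that
    are uniformly bounded in L^1, which gives Schauder estimates for P_t and the paraproduct bounds that
    make [Psi] locally Lipschitz from C^beta to C^{-alpha}; since (2m+1) gamma < 1, a Picard iteration yields a
    unique local solution whose lifespan depends only on a C^{-alpha0}-bound of the data.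

    Global existence follows from an L^{2q} energy estimate, with 2m+1 < 2q < 2 + 2 mu (mu + sqrt(1+mu^2)) and
    1/q + beta < 2 gamma.  With h = 1 + |S_N v|^2, testing the equation truncated by S_N against
    h^{q-1} S_N v: the linear part is coercive exactly because (q-1)^2 < mu^2 (2q-1); the leading
    nonlinear term is -Re nu times the integral of h^{q+m}, up to lower order; all terms containing Wick
    powers are controlled by the duality of W^{1,1} and C^{-alpha} and absorbed.  The resulting bound on the
    integral of h^q is uniform in N, and L^{2q} embeds into C^{-1/q}, where the local theory restarts. *)

(** * Finite sums and trigonometric polynomials *)

(** Testing against [h^(q-1) S_N v] needs a trigonometric polynomial, but [S_N] does not commute
    with [Psi]. The commutator is harmless: it tends to 0 in C^{-al}, at a rate depending on a
    merely qualitative bound on v. For N large it is a forcing of norm at most 1, and the final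
    estimate does not see that qualitative bound. Every term with a Wick power carries a power of h
    strictly below q+m. Measured by K = 1 + dissipation + integral of h^(q+m), it is at most a
    constant times K^(1-1/(4(q+m))), provided al is at most 1/(16(q+m)). It is therefore absorbed
    without a Gronwall argument, and the energy grows at most linearly in time. The estimate starts
    at a time a > 0, where the Wick powers are no longer singular and v(a) lies in C^beta. The upper
    end of the window for q, namely 1 + mu(mu+sqrt(1+mu^2)), is the root of (q-1)^2 = mu^2(2q-1)
    above 1. Its inverse is the lower bound imposed on alpha0, so q just below it leaves 1/q + beta
    < 2 gamma. *)

Ltac rmin a b := pose proof (Rmin_l a b); pose proof (Rmin_r a b).

Lemma Rpower_pos x y : 0 < Rpower x y.
Proof. apply exp_pos. Qed.

Definition Csum {A : Type} (l : list A) (f : A -> C) : C := csum (map f l).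
Definition Rsum {A : Type} (l : list A) (f : A -> R) : R := fold_right Rplus 0 (map f l).

Lemma Csum_cons {A} (a : A) l f : Csum (a :: l) f = Cplus (f a) (Csum l f).
Proof. reflexivity. Qed.
Lemma Rsum_cons {A} (a : A) l f : Rsum (a :: l) f = f a + Rsum l f.
Proof. reflexivity. Qed.

Lemma Csum_ext {A} (l : list A) f g : (forall a, In a l -> f a = g a) -> Csum l f = Csum l g.
Proof.
  induction l as [|a l IH]; intros H; [reflexivity|].
  rewrite !Csum_cons, H, IH; auto with datatypes.
Qed.
Lemma Rsum_ext {A} (l : list A) f g : (forall a, In a l -> f a = g a) -> Rsum l f = Rsum l g.
Proof.
  induction l as [|a l IH]; intros H; [reflexivity|].
  rewrite !Rsum_cons, H, IH; auto with datatypes.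
Qed.

Lemma Csum_0 {A} (l : list A) f : (forall a, In a l -> f a = RtoC 0) -> Csum l f = RtoC 0.
Proof.
  induction l as [|a l IH]; intros H; [reflexivity|].
  rewrite Csum_cons, H, IH; auto with datatypes. apply Cplus_0_l.
Qed.

Lemma Csum_plus {A} (l : list A) f g :
  Csum l (fun a => Cplus (f a) (g a)) = Cplus (Csum l f) (Csum l g).
Proof.
  induction l as [|a l IH]; [symmetry; apply Cplus_0_l|].
  rewrite !Csum_cons, IH. ring.
Qed.
Lemma Rsum_plus {A} (l : list A) f g : Rsum l (fun a => f a + g a) = Rsum l f + Rsum l g.
Proof.
  induction l as [|a l IH]; [unfold Rsum; simpl; ring|].
  rewrite !Rsum_cons, IH. ring.
Qed.

Lemma Csum_scal {A} (l : list A) c f : Csum l (fun a => Cmult c (f a)) = Cmult c (Csum l f).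
Proof.
  induction l as [|a l IH]; [symmetry; apply Cmult_0_r|].
  rewrite !Csum_cons, IH. ring.
Qed.
Lemma Csum_scal_r {A} (l : list A) c f : Csum l (fun a => Cmult (f a) c) = Cmult (Csum l f) c.
Proof.
  rewrite (Cmult_comm _ c), <- Csum_scal. apply Csum_ext. intros; ring.
Qed.
Lemma Rsum_scal {A} (l : list A) c f : Rsum l (fun a => c * f a) = c * Rsum l f.
Proof.
  induction l as [|a l IH]; [unfold Rsum; simpl; ring|].
  rewrite !Rsum_cons, IH. ring.
Qed.

Lemma Csum_minus {A} (l : list A) f g :
  Csum l (fun a => Cminus (f a) (g a)) = Cminus (Csum l f) (Csum l g).
Proof.
  induction l as [|a l IH]; [unfold Csum; simpl; ring|].
  rewrite !Csum_cons, IH. ring.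
Qed.

Lemma Csum_exch {A B} (l : list A) (l' : list B) f :
  Csum l (fun a => Csum l' (fun b => f a b)) = Csum l' (fun b => Csum l (fun a => f a b)).
Proof.
  induction l as [|a l IH].
  - symmetry. apply Csum_0. reflexivity.
  - rewrite Csum_cons, IH, <- Csum_plus. reflexivity.
Qed.
Lemma Rsum_le {A} (l : list A) f g : (forall a, In a l -> f a <= g a) -> Rsum l f <= Rsum l g.
Proof.
  induction l as [|a l IH]; intros H; [apply Rle_refl|].
  rewrite !Rsum_cons. apply Rplus_le_compat; auto with datatypes.
Qed.
Lemma Rsum_ge0 {A} (l : list A) f : (forall a, In a l -> 0 <= f a) -> 0 <= Rsum l f.
Proof.
  induction l as [|a l IH]; intros H; [apply Rle_refl|].
  rewrite Rsum_cons. apply Rplus_le_le_0_compat; auto with datatypes.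
Qed.
Lemma Rsum_const {A} (l : list A) c : Rsum l (fun _ => c) = INR (length l) * c.
Proof.
  induction l as [|a l IH]; [unfold Rsum; simpl; ring|].
  rewrite Rsum_cons, IH. simpl length. rewrite S_INR. ring.
Qed.
Lemma Rsum_app {A} (l l' : list A) f : Rsum (l ++ l') f = Rsum l f + Rsum l' f.
Proof.
  induction l as [|a l IH]; [unfold Rsum; simpl; ring|].
  simpl app. rewrite !Rsum_cons, IH. ring.
Qed.
Lemma Csum_app {A} (l l' : list A) f : Csum (l ++ l') f = Cplus (Csum l f) (Csum l' f).
Proof.
  induction l as [|a l IH]; [unfold Csum; simpl; ring|].
  simpl app. rewrite !Csum_cons, IH. ring.
Qed.

Lemma Cmod_Csum {A} (l : list A) f : Cmod (Csum l f) <= Rsum l (fun a => Cmod (f a)).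
Proof.
  induction l as [|a l IH].
  - unfold Csum, Rsum; simpl. rewrite Cmod_0. lra.
  - rewrite Csum_cons, Rsum_cons. eapply Rle_trans; [apply Cmod_triangle|]. lra.
Qed.
Lemma Cmod_Csum_le {A} (l : list A) f c :
  (forall a, In a l -> Cmod (f a) <= c) -> Cmod (Csum l f) <= INR (length l) * c.
Proof.
  intros H. eapply Rle_trans; [apply Cmod_Csum|]. rewrite <- Rsum_const. now apply Rsum_le.
Qed.

Lemma Re_Csum {A} (l : list A) f : Re (Csum l f) = Rsum l (fun a => Re (f a)).
Proof. induction l as [|a l IH]; [reflexivity|]. rewrite Csum_cons, Rsum_cons, <- IH. reflexivity. Qed.
Lemma Cconj_Csum {A} (l : list A) f : Cconj (Csum l f) = Csum l (fun a => Cconj (f a)).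
Proof.
  induction l as [|a l IH].
  - unfold Csum, Cconj; simpl. now rewrite Ropp_0.
  - rewrite !Csum_cons, <- IH. unfold Cconj, Cplus; simpl. f_equal; ring.
Qed.

Lemma Csum_map {A B} (l : list A) (g : A -> B) f : Csum (map g l) f = Csum l (fun a => f (g a)).
Proof. unfold Csum. now rewrite map_map. Qed.

Lemma csum_perm l l' : Permutation l l' -> csum l = csum l'.
Proof.
  induction 1; simpl; try congruence. unfold csum; simpl. ring.
Qed.

Lemma Csum_nonzero {A} (l : list A) (f : A -> C) :
  exists l', incl l' l /\ (NoDup l -> NoDup l') /\ Csum l f = Csum l' f /\
    (forall a, In a l' <-> In a l /\ f a <> RtoC 0).
Proof.
  induction l as [|a l (l' & H1 & H2 & H3 & H4)].
  - exists nil. split; [easy|split; [auto|split; [reflexivity|simpl; tauto]]].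
  - destruct (classic (f a = RtoC 0)) as [Ha|Ha].
    + exists l'. split; [|split; [|split]].
      * intros b Hb. right. auto.
      * intros H; inversion H; auto.
      * rewrite Csum_cons, Ha, H3. apply Cplus_0_l.
      * intros b. rewrite H4. split; [intuition|]. intros [[->|?] ?]; tauto.
    + exists (a :: l'). split; [|split; [|split]].
      * intros b [->|Hb]; [left|right]; auto.
      * intros H; inversion H; subst. constructor; auto.
      * rewrite !Csum_cons, H3. reflexivity.
      * intros b. simpl. rewrite H4. split; [intros [->|?]|]; tauto.
Qed.

(** Both sums are pruned to their nonzero terms ([Csum_nonzero]); the pruned lists have no
    duplicates and the same members, hence are permutations of each other. Changes of box, shifts
    and reflections of frequencies all reduce to this. *)
Lemma Csum_support {A} (l l' : list A) (f : A -> C) :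
  NoDup l -> NoDup l' -> (forall a, f a <> RtoC 0 -> (In a l <-> In a l')) ->
  Csum l f = Csum l' f.
Proof.
  intros N N' H.
  destruct (Csum_nonzero l f) as (l1 & _ & P1 & -> & Q1).
  destruct (Csum_nonzero l' f) as (l2 & _ & P2 & -> & Q2).
  apply csum_perm, Permutation_map, NoDup_Permutation; auto.
  intros a. rewrite Q1, Q2. split; intros [? ?]; split; auto; now apply H.
Qed.

Definition inbox (B : nat) (k : Z * Z) : Prop :=
  (Z.abs (fst k) <= Z.of_nat B)%Z /\ (Z.abs (snd k) <= Z.of_nat B)%Z.

Lemma In_zrange B a : In a (zrange B) <-> (Z.abs a <= Z.of_nat B)%Z.
Proof.
  unfold zrange. rewrite in_map_iff. split.
  - intros (i & <- & Hi). apply in_seq in Hi. lia.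
  - intros H. exists (Z.to_nat (a + Z.of_nat B)). split; [lia|]. apply in_seq. lia.
Qed.
Lemma In_box B k : In k (box B) <-> inbox B k.
Proof.
  unfold box, inbox. rewrite in_flat_map. destruct k as [a b]; simpl. split.
  - intros (x & Hx & H). apply in_map_iff in H. destruct H as (y & E & Hy).
    injection E as -> ->. now rewrite <- !In_zrange.
  - intros [Ha Hb]. exists a. rewrite In_zrange. split; auto. apply in_map_iff.
    exists b. rewrite In_zrange. auto.
Qed.
Lemma NoDup_map_inj {A B} (f : A -> B) l :
  (forall x y, f x = f y -> x = y) -> NoDup l -> NoDup (map f l).
Proof. intros Hf. induction 1; simpl; constructor; auto. intros H1; apply in_map_iff in H1.
  destruct H1 as (y & E & Hy). apply Hf in E; subst; auto. Qed.
Lemma NoDup_zrange B : NoDup (zrange B).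
Proof. apply NoDup_map_inj; [intros; lia|]. apply seq_NoDup. Qed.
Lemma NoDup_box B : NoDup (box B).
Proof.
  unfold box. cut (forall l, NoDup l ->
    NoDup (flat_map (fun a : Z => map (fun b : Z => (a, b)) (zrange B)) l)).
  { intros H; apply H, NoDup_zrange. }
  induction l as [|a l IH]; simpl; intros N; [constructor|].
  inversion N; subst. apply NoDup_app; auto.
  - apply NoDup_map_inj; [congruence|apply NoDup_zrange].
  - intros [x y] H H'. apply in_map_iff in H. destruct H as (? & E & _). injection E as -> ->.
    apply in_flat_map in H'. destruct H' as (z & Hz & H'). apply in_map_iff in H'.
    destruct H' as (? & E & _). injection E as -> ->. auto.
Qed.
Lemma length_box B : length (box B) = ((2 * B + 1) * (2 * B + 1))%nat.
Proof.
  unfold box. assert (L : length (zrange B) = (2 * B + 1)%nat).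
  { unfold zrange. now rewrite length_map, length_seq. }
  assert (H : forall l : list Z, length (flat_map (fun a => map (fun b => (a, b)) (zrange B)) l)
     = (length l * (2 * B + 1))%nat).
  { induction l as [|a l IH]; [reflexivity|]. simpl. rewrite length_app, length_map, IH. lia. }
  now rewrite H, L.
Qed.

Definition Bsum (B : nat) (f : Z * Z -> C) : C := Csum (box B) f.
Definition supp (B : nat) (f : Z * Z -> C) : Prop := forall k, ~ inbox B k -> f k = RtoC 0.

Lemma supp_in B f k : supp B f -> f k <> RtoC 0 -> inbox B k.
Proof. intros H H1. apply NNPP. intros H2. apply H1, H, H2. Qed.
Lemma supp_le B B' f : (B <= B')%nat -> supp B f -> supp B' f.
Proof. intros H S k Hk. apply S. intros [? ?]. apply Hk. split; lia. Qed.

Lemma Bsum_supp B B' f : supp B f -> supp B' f -> Bsum B f = Bsum B' f.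
Proof.
  intros S S'. apply Csum_support; try apply NoDup_box.
  intros a Ha. rewrite !In_box. split; intros _; eapply supp_in; eauto.
Qed.

Definition ksub (k l : Z * Z) : Z * Z := ((fst k - fst l)%Z, (snd k - snd l)%Z).
Definition kopp (k : Z * Z) : Z * Z := ((- fst k)%Z, (- snd k)%Z).

Lemma Bsum_shift B B' k f : supp B f -> (forall l, inbox B l -> inbox B' (ksub l (kopp k))) ->
  Bsum B' (fun l => f (ksub l k)) = Bsum B f.
Proof.
  intros S H. unfold Bsum.
  rewrite <- (Csum_map (box B') (fun l => ksub l k) f).
  apply Csum_support; try apply NoDup_box.
  - apply NoDup_map_inj; [|apply NoDup_box].
    intros [x1 x2] [y1 y2] E. unfold ksub in E; simpl in E. injection E as E1 E2. f_equal; lia.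
  - intros a Ha. rewrite In_box, in_map_iff. pose proof (supp_in _ _ _ S Ha) as Hb. split; auto.
    intros _. exists (ksub a (kopp k)). split.
    + destruct a, k; unfold ksub, kopp; simpl; f_equal; lia.
    + apply In_box; auto.
Qed.
Lemma Bsum_opp B f : Bsum B (fun k => f (kopp k)) = Bsum B f.
Proof.
  unfold Bsum. rewrite <- (Csum_map (box B) kopp f).
  apply Csum_support; try apply NoDup_box.
  - apply NoDup_map_inj; [|apply NoDup_box].
    intros [x1 x2] [y1 y2] E. unfold kopp in E; simpl in E. injection E as E1 E2. f_equal; lia.
  - intros a _. rewrite In_box, in_map_iff. split.
    + intros (x & <- & Hx). apply In_box in Hx. unfold inbox, kopp in *; simpl. lia.
    + intros Ha. exists (kopp a). split; [destruct a; unfold kopp; simpl; f_equal; lia|].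
      apply In_box. unfold inbox, kopp in *; simpl. lia.
Qed.
Lemma Bsum_single B k0 f : inbox B k0 -> (forall k, k <> k0 -> f k = RtoC 0) -> Bsum B f = f k0.
Proof.
  intros H S. transitivity (Csum (k0 :: nil) f).
  - apply Csum_support; [apply NoDup_box|repeat constructor; auto|].
    intros a Ha. assert (a = k0) as -> by (apply NNPP; intros E; apply Ha, S, E).
    rewrite In_box. simpl. tauto.
  - unfold Csum; simpl. ring.
Qed.

(** The box is only a device to have a finite sum: for coefficients supported in it the value does
    not depend on [B] ([ev_supp]), so boxes are enlarged whenever two polynomials must be
    compared. *)
Definition ev (B : nat) (f : fdist) (x : R * R) : C := Bsum B (fun k => Cmult (f k) (ek k x)).

Lemma supp_mult B (f g : Z * Z -> C) : supp B f -> supp B (fun k => Cmult (f k) (g k)).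
Proof. intros S k Hk. rewrite S by auto. ring. Qed.

Lemma ev_supp B B' f x : supp B f -> supp B' f -> ev B f x = ev B' f x.
Proof. intros. apply Bsum_supp; now apply supp_mult. Qed.
Lemma ev_ext B f g x : (forall k, inbox B k -> f k = g k) -> ev B f x = ev B g x.
Proof. intros H. apply Csum_ext. intros k Hk. rewrite H; auto. now apply In_box. Qed.
Lemma ev_plus B f g x : ev B (fun k => Cplus (f k) (g k)) x = Cplus (ev B f x) (ev B g x).
Proof. unfold ev, Bsum. rewrite <- Csum_plus. apply Csum_ext. intros; ring. Qed.
Lemma ev_minus B f g x : ev B (fun k => Cminus (f k) (g k)) x = Cminus (ev B f x) (ev B g x).
Proof. unfold ev, Bsum. rewrite <- Csum_minus. apply Csum_ext. intros; ring. Qed.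
Lemma ev_scal B c f x : ev B (fun k => Cmult c (f k)) x = Cmult c (ev B f x).
Proof. unfold ev, Bsum. rewrite <- Csum_scal. apply Csum_ext. intros; ring. Qed.
Lemma ev_Csum {A} B (l : list A) (f : A -> fdist) x :
  ev B (fun k => Csum l (fun a => f a k)) x = Csum l (fun a => ev B (f a) x).
Proof.
  unfold ev, Bsum. rewrite Csum_exch. apply Csum_ext. intros. now rewrite Csum_scal_r.
Qed.

Lemma Cmod_ek k x : Cmod (ek k x) = 1.
Proof.
  unfold ek, Cmod. cbv zeta. simpl fst; simpl snd.
  set (th := 2 * PI * _). generalize (sin2_cos2 th). unfold Rsqr. intros H.
  replace (cos th ^ 2 + sin th ^ 2) with 1 by (simpl; lra). apply sqrt_1.
Qed.
Lemma ek_mult k l x : Cmult (ek k x) (ek l x) = ek ((fst k + fst l)%Z, (snd k + snd l)%Z) x.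
Proof.
  unfold ek, Cmult; simpl. rewrite !plus_IZR.
  replace (2 * PI * ((IZR (fst k) + IZR (fst l)) * fst x + (IZR (snd k) + IZR (snd l)) * snd x))
    with (2 * PI * (IZR (fst k) * fst x + IZR (snd k) * snd x)
        + 2 * PI * (IZR (fst l) * fst x + IZR (snd l) * snd x)) by ring.
  rewrite cos_plus, sin_plus. f_equal. ring.
Qed.
Lemma ek_sub k l x : Cmult (ek l x) (ek (ksub k l) x) = ek k x.
Proof.
  rewrite ek_mult. destruct k, l; unfold ksub; simpl.
  f_equal. f_equal; lia.
Qed.
Lemma ek_0 x : ek (0%Z, 0%Z) x = RtoC 1.
Proof.
  unfold ek; simpl. replace (2 * PI * (0 * fst x + 0 * snd x)) with 0 by ring.
  now rewrite cos_0, sin_0.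
Qed.
Lemma ek_opp k x : ek (kopp k) x = Cconj (ek k x).
Proof.
  unfold ek, kopp, Cconj; simpl. rewrite !opp_IZR.
  replace (2 * PI * (- IZR (fst k) * fst x + - IZR (snd k) * snd x))
    with (- (2 * PI * (IZR (fst k) * fst x + IZR (snd k) * snd x))) by ring.
  now rewrite cos_neg, sin_neg.
Qed.

Lemma Cmod_ev B f x c : (forall k, inbox B k -> Cmod (f k) <= c) ->
  Cmod (ev B f x) <= (2 * INR B + 1) ^ 2 * c.
Proof.
  intros H. eapply Rle_trans; [apply Cmod_Csum_le with (c := c)|].
  - intros k Hk. rewrite Cmod_mult, Cmod_ek, Rmult_1_r. apply H. now apply In_box.
  - rewrite length_box, mult_INR, plus_INR, mult_INR. simpl. apply Req_le. ring.
Qed.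

Definition conv (B : nat) (f g : fdist) : fdist :=
  fun k => Bsum B (fun l => Cmult (f l) (g (ksub k l))).

Lemma supp_conv B1 B2 f g : supp B1 f -> supp B2 g -> supp (B1 + B2) (conv B1 f g).
Proof.
  intros S1 S2 k Hk. apply Csum_0. intros l Hl. apply In_box in Hl.
  rewrite (S2 (ksub k l)); [ring|]. intros H. apply Hk. unfold inbox, ksub in *; simpl in *. lia.
Qed.

Lemma ev_conv B1 B2 f g x : supp B1 f -> supp B2 g ->
  ev (B1 + B2) (conv B1 f g) x = Cmult (ev B1 f x) (ev B2 g x).
Proof.
  intros S1 S2. unfold ev at 1, conv, Bsum.
  transitivity (Csum (box B1) (fun l => Csum (box (B1 + B2)) (fun k =>
     Cmult (Cmult (f l) (ek l x)) (Cmult (g (ksub k l)) (ek (ksub k l) x))))).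
  - rewrite Csum_exch. apply Csum_ext. intros k _. rewrite <- Csum_scal_r. apply Csum_ext.
    intros l _. rewrite <- (ek_sub k l x). ring.
  - unfold ev at 1. unfold Bsum. rewrite <- Csum_scal_r. apply Csum_ext. intros l Hl.
    apply In_box in Hl. rewrite Csum_scal. f_equal.
    apply (Bsum_shift B2 (B1 + B2) l (fun k => Cmult (g k) (ek k x))).
    + now apply supp_mult.
    + intros k Hk. unfold inbox, ksub, kopp in *; simpl in *. lia.
Qed.

Definition mul (m : Z * Z -> R) (f : fdist) : fdist := fun k => Cmult (RtoC (m k)) (f k).

Lemma supp_mul B m f : supp B f -> supp B (mul m f).
Proof. intros S k Hk. unfold mul. rewrite S by auto. ring. Qed.
Lemma supp_mul_l B m f : (forall k, ~ inbox B k -> m k = 0) -> supp B (mul m f).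
Proof. intros S k Hk. unfold mul. rewrite S by auto. ring. Qed.

Lemma LPblock_ev chi rho n f x : LPblock chi rho n f x = ev (3 * 2 ^ n) (mul (blk chi rho n) f) x.
Proof. reflexivity. Qed.

Lemma ev_dconj B f x : ev B (dconj f) x = Cconj (ev B f x).
Proof.
  unfold ev, Bsum. rewrite Cconj_Csum.
  change (Csum (box B) (fun a : Z * Z => Cconj (Cmult (f a) (ek a x))))
    with (Bsum B (fun k => Cconj (Cmult (f k) (ek k x)))).
  rewrite <- Bsum_opp.
  apply Csum_ext. intros k _. rewrite Cmult_conj, ek_opp, Cconj_conj. reflexivity.
Qed.

(** * Integration on the torus *)

Lemma is_derive_cont (u : R -> R) x l : is_derive u x l -> continuous u x.
Proof.
  intros H. apply (ex_derive_continuous (K := R_AbsRing) (V := R_NormedModule) u x). now exists l.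
Qed.

(** Continuity on the whole plane, so that every iterated Riemann integral below exists; periodicity
    is requested separately, where boundary terms must cancel. *)
Definition cont2 (f : R * R -> R) : Prop :=
  forall p : R * R, continuous (U := R_UniformSpace) f p.

Lemma cont2_ext f g : (forall p, f p = g p) -> cont2 f -> cont2 g.
Proof. intros H Hf p. apply continuous_ext with (1 := H), Hf. Qed.
Lemma cont2_const c : cont2 (fun _ => c).
Proof. intros p. apply continuous_const. Qed.
Lemma cont2_fst : cont2 fst.
Proof. intros [x y]. apply (continuous_fst (U := R_UniformSpace) (V := R_UniformSpace)). Qed.
Lemma cont2_snd : cont2 snd.
Proof. intros [x y]. apply (continuous_snd (U := R_UniformSpace) (V := R_UniformSpace)). Qed.
Lemma cont2_plus f g : cont2 f -> cont2 g -> cont2 (fun p => f p + g p).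
Proof.
  intros Hf Hg p.
  apply (continuous_plus (K := R_AbsRing) (V := R_NormedModule) f g); [apply Hf|apply Hg].
Qed.
Lemma cont2_mult f g : cont2 f -> cont2 g -> cont2 (fun p => f p * g p).
Proof. intros Hf Hg p. apply (continuous_mult (K := R_AbsRing) f g); [apply Hf|apply Hg]. Qed.
Lemma cont2_comp (u : R -> R) f : (forall p, continuous u (f p)) -> cont2 f -> cont2 (fun p => u (f p)).
Proof. intros Hu Hf p. apply (continuous_comp f u); [apply Hf|apply Hu]. Qed.
Lemma cont2_opp f : cont2 f -> cont2 (fun p => - f p).
Proof.
  intros Hf. apply cont2_ext with (fun p => (-1) * f p); [intros; ring|].
  apply cont2_mult; auto. apply cont2_const.
Qed.
Lemma cont2_minus f g : cont2 f -> cont2 g -> cont2 (fun p => f p - g p).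
Proof. intros Hf Hg. apply cont2_plus; auto. now apply cont2_opp. Qed.
Lemma cont2_abs f : cont2 f -> cont2 (fun p => Rabs (f p)).
Proof. intros. apply (cont2_comp Rabs); auto. intros; apply continuous_Rabs. Qed.
Lemma cont2_sqrt f : cont2 f -> cont2 (fun p => sqrt (f p)).
Proof. intros. apply (cont2_comp sqrt); auto. intros; apply continuous_sqrt. Qed.
Lemma cont2_pow f n : cont2 f -> cont2 (fun p => f p ^ n).
Proof. intros H. induction n; [exact (cont2_const 1)|]. simpl. now apply cont2_mult. Qed.

Lemma cont2_2d f x y : cont2 f -> continuity_2d_pt (fun u v => f (u, v)) x y.
Proof.
  intros H. apply continuity_2d_pt_filterlim. cbv beta.
  apply (filterlim_ext f); [now intros [? ?]|]. apply (H (x, y)).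
Qed.

Lemma cont2_slice2 f x y : cont2 f -> continuous (fun v => f (x, v)) y.
Proof.
  intros H. apply (continuous_comp_2 (fun _ => x) (fun v : R => v) (fun u v => f (u, v))).
  - apply continuous_const.
  - apply continuous_id.
  - apply (continuous_ext f); [now intros [? ?]|apply H].
Qed.
Lemma cont2_slice1 f x y : cont2 f -> continuous (fun u => f (u, y)) x.
Proof.
  intros H. apply (continuous_comp_2 (fun u : R => u) (fun _ => y) (fun u v => f (u, v))).
  - apply continuous_id.
  - apply continuous_const.
  - apply (continuous_ext f); [now intros [? ?]|apply H].
Qed.

Lemma ex_RInt_cont (f : R -> R) a b : (forall x, continuous f x) -> ex_RInt f a b.
Proof. intros H. apply (ex_RInt_continuous (V := R_CompleteNormedModule)). intros; apply H. Qed.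
Lemma ex_RInt_s2 f x a b : cont2 f -> ex_RInt (fun v => f (x, v)) a b.
Proof. intros H. apply ex_RInt_cont. intros. now apply cont2_slice2. Qed.
Lemma ex_RInt_s1 f y a b : cont2 f -> ex_RInt (fun u => f (u, y)) a b.
Proof. intros H. apply ex_RInt_cont. intros. now apply cont2_slice1. Qed.

Definition swap (p : R * R) : R * R := (snd p, fst p).
Lemma cont2_swap f : cont2 f -> cont2 (fun p => f (swap p)).
Proof.
  intros H p. apply (continuous_comp_2 snd fst (fun u v => f (u, v))).
  - apply (cont2_snd p).
  - apply (cont2_fst p).
  - apply (continuous_ext f); [now intros [? ?]|apply H].
Qed.

Lemma cont_inner f a b : a <= b -> cont2 f -> forall x, continuous (fun u => RInt (fun v => f (u, v)) a b) x.
Proof.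
  intros Hab H x. apply filterlim_locally. intros eps.
  assert (E2 : 0 < eps / (2 * (b - a + 1))).
  { apply Rdiv_lt_0_compat; [apply cond_pos|lra]. }
  destruct (uniform_continuity_2d_1d' (fun u v => f (u, v)) a b x
     ltac:(intros; now apply cont2_2d) (mkposreal _ E2)) as [d Hd].
  exists d. intros u Hu. unfold ball in *; simpl in *. unfold AbsRing_ball, abs, minus, plus, opp in *; simpl in *.
  change (Rabs (RInt (fun v => f (u, v)) a b - RInt (fun v => f (x, v)) a b) < eps).
  rewrite <- (RInt_minus (V := R_CompleteNormedModule)) by (now apply ex_RInt_s2).
  eapply Rle_lt_trans.
  - apply abs_RInt_le_const with (M := eps / (2 * (b - a + 1))); auto.
    + apply (ex_RInt_minus (V := R_NormedModule)); now apply ex_RInt_s2.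
    + intros t Ht. apply Rlt_le. apply (Hd t x t u); try lra.
      * pose proof (cond_pos d); lra.
      * apply Rabs_def2 in Hu. lra.
      * rewrite Rminus_eq_0, Rabs_R0. apply cond_pos.
  - apply (Rmult_lt_reg_r (2 * (b - a + 1))); [lra|].
    replace ((b - a) * (eps / (2 * (b - a + 1))) * (2 * (b - a + 1))) with ((b - a) * eps) by (field; lra).
    pose proof (cond_pos eps). nra.
Qed.

(** The integral over the torus as an iterated Riemann integral over the unit square, which suffices
    because all integrands are continuous. *)
Definition TI (f : R * R -> R) : R := RInt (fun x => RInt (fun y => f (x, y)) 0 1) 0 1.

Lemma ex_outer f : cont2 f -> ex_RInt (fun x => RInt (fun y => f (x, y)) 0 1) 0 1.
Proof. intros H. apply ex_RInt_cont. apply cont_inner; auto; lra. Qed.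

Lemma TI_ext f g : (forall p, f p = g p) -> TI f = TI g.
Proof. intros H. apply RInt_ext. intros. apply RInt_ext. intros. apply H. Qed.
Lemma TI_plus f g : cont2 f -> cont2 g -> TI (fun p => f p + g p) = TI f + TI g.
Proof.
  intros Hf Hg. unfold TI.
  rewrite <- (RInt_plus (V := R_CompleteNormedModule)) by now apply ex_outer.
  apply RInt_ext. intros.
  apply (RInt_plus (V := R_CompleteNormedModule)); now apply ex_RInt_s2.
Qed.
Lemma TI_scal c f : cont2 f -> TI (fun p => c * f p) = c * TI f.
Proof.
  intros Hf. unfold TI.
  rewrite <- (RInt_scal (V := R_CompleteNormedModule)) by now apply ex_outer.
  apply RInt_ext. intros.
  apply (RInt_scal (V := R_CompleteNormedModule)); now apply ex_RInt_s2.
Qed.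
Lemma TI_opp f : cont2 f -> TI (fun p => - f p) = - TI f.
Proof.
  intros H. rewrite <- (Rmult_1_l (TI f)), <- Ropp_mult_distr_l_reverse, <- TI_scal by auto.
  apply TI_ext. intros; ring.
Qed.
Lemma TI_minus f g : cont2 f -> cont2 g -> TI (fun p => f p - g p) = TI f - TI g.
Proof.
  intros. unfold Rminus. rewrite TI_plus, TI_opp; auto. now apply cont2_opp.
Qed.
Lemma TI_const c : TI (fun _ => c) = c.
Proof.
  unfold TI. rewrite (RInt_ext _ (fun _ => c)).
  - rewrite RInt_const. unfold scal; simpl; unfold mult; simpl. ring.
  - intros. rewrite RInt_const. unfold scal; simpl; unfold mult; simpl. ring.
Qed.
Lemma TI_le f g : cont2 f -> cont2 g -> (forall p, f p <= g p) -> TI f <= TI g.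
Proof.
  intros Hf Hg H. apply RInt_le; try (now apply ex_outer); [lra|].
  intros x _. apply RInt_le; try (now apply ex_RInt_s2); [lra|]. intros; apply H.
Qed.
Lemma TI_ge0 f : cont2 f -> (forall p, 0 <= f p) -> 0 <= TI f.
Proof. intros Hf H. rewrite <- (TI_const 0). apply TI_le; auto. apply cont2_const. Qed.
Lemma TI_abs f : cont2 f -> Rabs (TI f) <= TI (fun p => Rabs (f p)).
Proof.
  intros H. apply Rabs_le. split.
  - rewrite <- TI_opp by (now apply cont2_abs). apply TI_le; auto.
    + now apply cont2_opp, cont2_abs.
    + intros p. generalize (Rle_abs (- f p)). rewrite Rabs_Ropp. lra.
  - apply TI_le; auto; [now apply cont2_abs|]. intros; apply Rle_abs.
Qed.

Lemma cont1_fst (g : R -> R) : (forall x, continuous g x) -> cont2 (fun p => g (fst p)).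
Proof. intros H. apply (cont2_comp g fst); auto. apply cont2_fst. Qed.
Lemma cont1_snd (g : R -> R) : (forall x, continuous g x) -> cont2 (fun p => g (snd p)).
Proof. intros H. apply (cont2_comp g snd); auto. apply cont2_snd. Qed.

Lemma TI_prod (f g : R -> R) : (forall x, continuous f x) -> (forall x, continuous g x) ->
  TI (fun p => f (fst p) * g (snd p)) = RInt f 0 1 * RInt g 0 1.
Proof.
  intros Hf Hg. unfold TI. simpl.
  rewrite (RInt_ext _ (fun x => scal (RInt g 0 1) (f x))).
  - rewrite (RInt_scal (V := R_CompleteNormedModule)) by now apply ex_RInt_cont.
    unfold scal; simpl; unfold mult; simpl. ring.
  - intros x _.
    rewrite (RInt_ext (V := R_CompleteNormedModule) _ (fun y => scal (f x) (g y))) by reflexivity.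
    rewrite (RInt_scal (V := R_CompleteNormedModule)) by now apply ex_RInt_cont.
    unfold scal; simpl; unfold mult; simpl. apply Rmult_comm.
Qed.

(** Both iterated integrals over [0,X] x [0,1] vanish at X = 0 and have the same derivative in X,
    namely the slice integral at X; hence they agree at X = 1. *)
Lemma Fubini f : cont2 f -> TI f = TI (fun p => f (swap p)).
Proof.
  intros Hf. unfold TI, swap; simpl.
  set (F := fun X : R => RInt (fun x => RInt (fun y => f (x, y)) 0 1) 0 X).
  set (G := fun X : R => RInt (fun y => RInt (fun x => f (x, y)) 0 X) 0 1).
  assert (HF : forall X, is_derive F X (RInt (fun y => f (X, y)) 0 1)).
  { intros X. apply (is_derive_RInt (V := R_NormedModule) (fun x => RInt (fun y => f (x, y)) 0 1) F 0 X).
    - apply filter_forall. intros Y. apply (RInt_correct (V := R_CompleteNormedModule)).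
      apply ex_RInt_cont, cont_inner; auto; lra.
    - apply cont_inner; auto; lra. }
  assert (HD : forall y X, is_derive (fun X => RInt (fun x => f (x, y)) 0 X) X (f (X, y))).
  { intros y X. apply (is_derive_RInt (V := R_NormedModule) (fun x => f (x, y)) _ 0 X).
    - apply filter_forall. intros Y. apply (RInt_correct (V := R_CompleteNormedModule)).
      now apply ex_RInt_s1.
    - now apply cont2_slice1. }
  assert (HG : forall X, 0 < X + 1 -> is_derive G X (RInt (fun y => f (X, y)) 0 1)).
  { intros X _.
    rewrite (RInt_ext (fun y => f (X, y)) (fun y => Derive (fun X => RInt (fun x => f (x, y)) 0 X) X)).
    2: { intros y _. symmetry. apply is_derive_unique, HD. }
    apply (is_derive_RInt_param (fun X y => RInt (fun x => f (x, y)) 0 X) 0 1 X).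
    - apply filter_forall. intros Y t _. eexists. apply HD.
    - intros t _. apply continuity_2d_pt_ext with (fun u v => f (u, v)).
      + intros u v. symmetry. apply is_derive_unique, HD.
      + now apply cont2_2d.
    - apply filter_forall. intros Y. apply ex_RInt_cont.
      intros z.
      (* [cont_inner] wants ordered bounds, so for negative [Y] the inner integral is reversed. *)
      destruct (Rle_dec 0 Y) as [HY|HY].
      + apply (cont_inner (fun p => f (swap p)) 0 Y HY (cont2_swap f Hf) z).
      + apply continuous_ext with (fun y => opp (RInt (fun x => f (x, y)) Y 0)).
        * intros y. apply (opp_RInt_swap (V := R_CompleteNormedModule)). now apply ex_RInt_s1.
        * apply (continuous_opp (V := R_NormedModule)).
          apply (cont_inner (fun p => f (swap p)) Y 0 ltac:(lra) (cont2_swap f Hf) z). }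
  change (F 1 = G 1).
  assert (E : minus (F 0) (G 0) = minus (F 1) (G 1)).
  { apply (eq_is_derive (V := R_NormedModule) (fun X => minus (F X) (G X)) 0 1); [|lra]. intros t Ht.
    evar_last.
    - apply (is_derive_minus (V := R_NormedModule) F G t _ _ (HF t) (HG t ltac:(lra))).
    - apply (minus_eq_zero (G := R_AbelianGroup)). }
  assert (F0 : F 0 = 0) by (apply (RInt_point (V := R_CompleteNormedModule))).
  assert (G0 : G 0 = 0).
  { unfold G. rewrite (RInt_ext _ (fun _ => 0)).
    - rewrite RInt_const. unfold scal; simpl; unfold mult; simpl. ring.
    - intros. apply (RInt_point (V := R_CompleteNormedModule)). }
  rewrite F0, G0 in E. unfold minus, plus, opp in E; simpl in E. lra.
Qed.

(** C^1 functions with gradient [(F1, F2)] taking equal values on opposite sides of the unit square.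
    This boundary condition is all the periodicity that integration by parts needs. *)
Record TC1 (F F1 F2 : R * R -> R) : Prop := {
  TC1_c : cont2 F; TC1_c1 : cont2 F1; TC1_c2 : cont2 F2;
  TC1_d1 : forall x y, is_derive (fun u => F (u, y)) x (F1 (x, y));
  TC1_d2 : forall x y, is_derive (fun v => F (x, v)) y (F2 (x, y));
  TC1_p1 : forall y, F (1, y) = F (0, y);
  TC1_p2 : forall x, F (x, 1) = F (x, 0) }.

Lemma TI_d2 F F1 F2 : TC1 F F1 F2 -> TI F2 = 0.
Proof.
  intros H. unfold TI. rewrite (RInt_ext _ (fun _ => 0)).
  - rewrite RInt_const. unfold scal; simpl; unfold mult; simpl. ring.
  - intros x _. apply is_RInt_unique.
    replace 0 with (minus (F (x, 1)) (F (x, 0))) at 2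
      by (rewrite (TC1_p2 _ _ _ H); unfold minus, plus, opp; simpl; ring).
    apply (is_RInt_derive (V := R_CompleteNormedModule) (fun v => F (x, v)) (fun v => F2 (x, v))).
    + intros; apply (TC1_d2 _ _ _ H).
    + intros; apply cont2_slice2, (TC1_c2 _ _ _ H).
Qed.

Lemma TC1_swap F F1 F2 : TC1 F F1 F2 ->
  TC1 (fun p => F (swap p)) (fun p => F2 (swap p)) (fun p => F1 (swap p)).
Proof.
  intros [c c1 c2 d1 d2 p1 p2]. split; try (now apply cont2_swap); unfold swap; simpl; auto.
Qed.
Lemma TI_d1 F F1 F2 : TC1 F F1 F2 -> TI F1 = 0.
Proof.
  intros H. rewrite Fubini by apply H. eapply TI_d2. eapply TC1_swap; eauto.
Qed.

Lemma TC1_const c : TC1 (fun _ => c) (fun _ => 0) (fun _ => 0).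
Proof. split; try apply cont2_const; auto; intros; exact (is_derive_const (K := R_AbsRing) (V := R_NormedModule) c _). Qed.
Lemma TC1_plus F F1 F2 G G1 G2 : TC1 F F1 F2 -> TC1 G G1 G2 ->
  TC1 (fun p => F p + G p) (fun p => F1 p + G1 p) (fun p => F2 p + G2 p).
Proof.
  intros [c c1 c2 d1 d2 p1 p2] [c' c1' c2' d1' d2' p1' p2'].
  split; try (now apply cont2_plus).
  - intros. apply (is_derive_plus (V := R_NormedModule)); auto.
  - intros. apply (is_derive_plus (V := R_NormedModule)); auto.
  - intros. rewrite p1, p1'; auto.
  - intros. rewrite p2, p2'; auto.
Qed.
Lemma TC1_mult F F1 F2 G G1 G2 : TC1 F F1 F2 -> TC1 G G1 G2 ->
  TC1 (fun p => F p * G p) (fun p => F1 p * G p + F p * G1 p) (fun p => F2 p * G p + F p * G2 p).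
Proof.
  intros [c c1 c2 d1 d2 p1 p2] [c' c1' c2' d1' d2' p1' p2'].
  split; try (now apply cont2_mult); try (apply cont2_plus; now apply cont2_mult).
  - intros. apply (is_derive_mult (K := R_AbsRing)); auto. intros; apply Rmult_comm.
  - intros. apply (is_derive_mult (K := R_AbsRing)); auto. intros; apply Rmult_comm.
  - intros. rewrite p1, p1'; auto.
  - intros. rewrite p2, p2'; auto.
Qed.
Lemma TC1_ext F F1 F2 G G1 G2 : (forall p, F p = G p) -> (forall p, F1 p = G1 p) ->
  (forall p, F2 p = G2 p) -> TC1 F F1 F2 -> TC1 G G1 G2.
Proof.
  intros E E1 E2 [c c1 c2 d1 d2 p1 p2].
  split; try (eapply cont2_ext; eassumption).
  - intros. rewrite <- E1. eapply is_derive_ext; [|apply d1]. intros; apply E.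
  - intros. rewrite <- E2. eapply is_derive_ext; [|apply d2]. intros; apply E.
  - intros. now rewrite <- !E.
  - intros. now rewrite <- !E.
Qed.
Lemma TC1_scal a F F1 F2 : TC1 F F1 F2 -> TC1 (fun p => a * F p) (fun p => a * F1 p) (fun p => a * F2 p).
Proof.
  intros H. eapply TC1_ext; [| | |apply (TC1_mult _ _ _ _ _ _ (TC1_const a) H)]; intros; cbv beta; ring.
Qed.
Lemma TC1_comp (u u' : R -> R) F F1 F2 : TC1 F F1 F2 ->
  (forall p, is_derive u (F p) (u' (F p))) -> (forall p, continuous u' (F p)) ->
  TC1 (fun p => u (F p)) (fun p => u' (F p) * F1 p) (fun p => u' (F p) * F2 p).
Proof.
  intros [c c1 c2 d1 d2 p1 p2] Hu Hu'.
  assert (cu : cont2 (fun p => u' (F p))) by now apply cont2_comp.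
  split; try (now apply cont2_mult).
  - apply cont2_comp; auto. intros p. eapply is_derive_cont, Hu.
  - intros. rewrite Rmult_comm. apply (is_derive_comp u (fun u => F (u, y))); auto.
  - intros. rewrite Rmult_comm. apply (is_derive_comp u (fun v => F (x, v))); auto.
  - intros. now rewrite p1.
  - intros. now rewrite p2.
Qed.

(** [f x] differs from any [f u] by at most the integral of the modulus of the derivative; averaging
    over [u] in [0,1] gives the bound. *)
Lemma slice_bound (f f' : R -> R) x : 0 <= x <= 1 ->
  (forall u, is_derive f u (f' u)) -> (forall u, continuous f' u) ->
  Rabs (f x) <= RInt (fun u => Rabs (f u) + Rabs (f' u)) 0 1.
Proof.
  intros Hx Hd Hc.
  assert (cf : forall u, continuous f u) by (intros u; eapply is_derive_cont, Hd).
  assert (ca : forall u, continuous (fun u => Rabs (f u)) u) by (intros; now apply continuous_Rabs_comp).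
  assert (ca' : forall u, continuous (fun u => Rabs (f' u)) u) by (intros; now apply continuous_Rabs_comp).
  set (V := RInt (fun u => Rabs (f' u)) 0 1).
  assert (HV : forall a b, 0 <= a <= b -> b <= 1 -> Rabs (f b - f a) <= V).
  { intros a b Hab Hb.
    assert (E : is_RInt f' a b (f b - f a)).
    { apply (is_RInt_derive (V := R_CompleteNormedModule) f f'); intros; auto. }
    rewrite <- (is_RInt_unique _ _ _ _ E).
    eapply Rle_trans; [apply abs_RInt_le; [lra|now apply ex_RInt_cont]|].
    unfold V.
    rewrite <- (RInt_Chasles (V := R_CompleteNormedModule) (fun u => Rabs (f' u)) 0 a 1) by now apply ex_RInt_cont.
    rewrite <- (RInt_Chasles (V := R_CompleteNormedModule) (fun u => Rabs (f' u)) a b 1) by now apply ex_RInt_cont.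
    unfold plus; simpl.
    assert (0 <= RInt (fun u => Rabs (f' u)) 0 a).
    { apply RInt_ge_0; [lra|now apply ex_RInt_cont|]. intros; apply Rabs_pos. }
    assert (0 <= RInt (fun u => Rabs (f' u)) b 1).
    { apply RInt_ge_0; [lra|now apply ex_RInt_cont|]. intros; apply Rabs_pos. }
    lra. }
  rewrite (RInt_plus (V := R_CompleteNormedModule)) by now apply ex_RInt_cont.
  unfold plus; simpl. fold V.
  assert (HH : RInt (fun _ => Rabs (f x) - V) 0 1 <= RInt (fun u => Rabs (f u)) 0 1).
  { apply RInt_le; [lra|apply ex_RInt_const|now apply ex_RInt_cont|].
    intros u Hu.
    assert (Rabs (f x - f u) <= V).
    { destruct (Rle_dec u x); [apply HV; lra|]. rewrite Rabs_minus_sym. apply HV; lra. }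
    generalize (Rabs_triang_inv (f x) (f u)). lra. }
  rewrite RInt_const in HH. unfold scal in HH; simpl in HH; unfold mult in HH; simpl in HH. lra.
Qed.

(** The Loomis--Whitney form of the embedding of W^{1,1} into L^2 in dimension two. *)
Lemma sobolev_L2 F F1 F2 : TC1 F F1 F2 ->
  TI (fun p => F p ^ 2) <= TI (fun p => Rabs (F p) + Rabs (F1 p)) * TI (fun p => Rabs (F p) + Rabs (F2 p)).
Proof.
  intros H. pose proof H as [c c1 c2 d1 d2 p1 p2].
  assert (k1 : cont2 (fun p => Rabs (F p) + Rabs (F1 p))) by (apply cont2_plus; now apply cont2_abs).
  assert (k2 : cont2 (fun p => Rabs (F p) + Rabs (F2 p))) by (apply cont2_plus; now apply cont2_abs).
  (* [b x] dominates |F| on the slice of abscissa x and [a y] on the slice of ordinate y; the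
     product dominates F^2 and its integral factorises. *)
  set (b := fun x => RInt (fun v => Rabs (F (x, v)) + Rabs (F2 (x, v))) 0 1).
  set (a := fun y => RInt (fun u => Rabs (F (u, y)) + Rabs (F1 (u, y))) 0 1).
  assert (cb : forall x, continuous b x) by (apply (cont_inner _ 0 1 ltac:(lra) k2)).
  assert (ca : forall x, continuous a x) by (apply (cont_inner _ 0 1 ltac:(lra) (cont2_swap _ k1))).
  rewrite (Fubini _ k1). change (TI (fun p => F p ^ 2) <= RInt a 0 1 * RInt b 0 1).
  rewrite Rmult_comm, <- TI_prod by auto.
  unfold TI. apply RInt_le; [lra| | |].
  - apply (ex_outer (fun p => F p ^ 2)). now apply cont2_pow.
  - apply (ex_outer (fun p => b (fst p) * a (snd p))). apply cont2_mult; [now apply cont1_fst|now apply cont1_snd].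
  - intros x Hx. apply RInt_le; [lra| | |].
    + apply (ex_RInt_s2 (fun p => F p ^ 2)). now apply cont2_pow.
    + apply (ex_RInt_s2 (fun p => b (fst p) * a (snd p))).
      apply cont2_mult; [now apply cont1_fst|now apply cont1_snd].
    + intros y Hy. simpl fst; simpl snd.
      assert (A1 : Rabs (F (x, y)) <= a y).
      { apply (slice_bound (fun u => F (u, y)) (fun u => F1 (u, y)) x); [lra|auto|].
        intros; now apply cont2_slice1. }
      assert (A2 : Rabs (F (x, y)) <= b x).
      { apply (slice_bound (fun v => F (x, v)) (fun v => F2 (x, v)) y); [lra|auto|].
        intros; now apply cont2_slice2. }
      rewrite <- pow2_abs. generalize (Rabs_pos (F (x, y))). intros. simpl. rewrite Rmult_1_r.
      apply Rmult_le_compat; auto.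
Qed.

(** * Complex-valued integrals over the torus *)

Definition ccont2 (F : R * R -> C) : Prop := cont2 (fun p => Re (F p)) /\ cont2 (fun p => Im (F p)).
Definition CTI (F : R * R -> C) : C := (TI (fun p => Re (F p)), TI (fun p => Im (F p))).

Lemma ccont2_plus F G : ccont2 F -> ccont2 G -> ccont2 (fun p => Cplus (F p) (G p)).
Proof. intros [? ?] [? ?]. split; now apply cont2_plus. Qed.
Lemma ccont2_mult F G : ccont2 F -> ccont2 G -> ccont2 (fun p => Cmult (F p) (G p)).
Proof.
  intros [? ?] [? ?]. split.
  - apply (cont2_minus (fun p => Re (F p) * Re (G p)) (fun p => Im (F p) * Im (G p))); now apply cont2_mult.
  - apply (cont2_plus (fun p => Re (F p) * Im (G p)) (fun p => Im (F p) * Re (G p))); now apply cont2_mult.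
Qed.
Lemma ccont2_const c : ccont2 (fun _ => c).
Proof. split; apply cont2_const. Qed.
Lemma ccont2_RtoC f : cont2 f -> ccont2 (fun p => RtoC (f p)).
Proof. intros; split; simpl; auto. apply cont2_const. Qed.
Lemma ccont2_conj F : ccont2 F -> ccont2 (fun p => Cconj (F p)).
Proof. intros [? ?]; split; simpl; auto. now apply cont2_opp. Qed.
Lemma ccont2_ext F G : (forall p, F p = G p) -> ccont2 F -> ccont2 G.
Proof.
  intros E [H1 H2]; split.
  - apply cont2_ext with (fun p => Re (F p)); auto. intros; now rewrite E.
  - apply cont2_ext with (fun p => Im (F p)); auto. intros; now rewrite E.
Qed.
Lemma ccont2_Csum {A} (l : list A) F : (forall a, ccont2 (F a)) -> ccont2 (fun p => Csum l (fun a => F a p)).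
Proof.
  intros H. induction l as [|a l IH]; [exact (ccont2_const (RtoC 0))|].
  apply (ccont2_plus (F a) (fun p => Csum l (fun a => F a p))); auto.
Qed.
Lemma ccont2_pow F n : ccont2 F -> ccont2 (fun p => Cpow (F p) n).
Proof. intros H. induction n; [exact (ccont2_const (RtoC 1))|]. simpl. now apply ccont2_mult. Qed.
Lemma cont2_Cmod F : ccont2 F -> cont2 (fun p => Cmod (F p)).
Proof.
  intros [? ?]. unfold Cmod. apply cont2_sqrt. apply cont2_plus; now apply cont2_pow.
Qed.

Lemma CTI_ext F G : (forall p, F p = G p) -> CTI F = CTI G.
Proof. intros E. unfold CTI. f_equal; apply TI_ext; intros; now rewrite E. Qed.
Lemma CTI_plus F G : ccont2 F -> ccont2 G -> CTI (fun p => Cplus (F p) (G p)) = Cplus (CTI F) (CTI G).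
Proof.
  intros [? ?] [? ?]. unfold CTI, Cplus; simpl. f_equal; now apply TI_plus.
Qed.
Lemma CTI_scal c F : ccont2 F -> CTI (fun p => Cmult c (F p)) = Cmult c (CTI F).
Proof.
  intros [? ?]. unfold CTI, Cmult; simpl. f_equal.
  - rewrite <- !TI_scal, <- TI_minus; auto; apply cont2_mult; auto; apply cont2_const.
  - rewrite <- !TI_scal, <- TI_plus; auto; apply cont2_mult; auto; apply cont2_const.
Qed.
Lemma CTI_0 : CTI (fun _ => RtoC 0) = RtoC 0.
Proof. unfold CTI. simpl. now rewrite !TI_const. Qed.
Lemma CTI_Csum {A} (l : list A) F : (forall a, ccont2 (F a)) ->
  CTI (fun p => Csum l (fun a => F a p)) = Csum l (fun a => CTI (F a)).
Proof.
  intros H. induction l as [|a l IH]; [exact CTI_0|].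
  rewrite Csum_cons, <- IH. apply (CTI_plus (F a) (fun p => Csum l (fun a => F a p))); auto.
  now apply ccont2_Csum.
Qed.
(** Real and imaginary parts are estimated separately; the resulting factor 2 recurs in all kernel
    bounds. *)
Lemma CTI_Cmod F : ccont2 F -> Cmod (CTI F) <= 2 * TI (fun p => Cmod (F p)).
Proof.
  intros H. pose proof (cont2_Cmod F H) as Hc. destruct H as [Hr Hi].
  assert (A : forall z : C, Cmod z <= Rabs (Re z) + Rabs (Im z)).
  { intros z. replace z with (Cplus (RtoC (Re z)) (Cmult Ci (RtoC (Im z)))) at 1.
    - eapply Rle_trans; [apply Cmod_triangle|]. rewrite Cmod_mult, Cmod_Ci, !Cmod_R. lra.
    - destruct z; unfold Cplus, Cmult, Ci, RtoC; simpl. f_equal; ring. }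
  eapply Rle_trans; [apply A|]. simpl.
  assert (Rabs (TI (fun p => Re (F p))) <= TI (fun p => Cmod (F p))).
  { eapply Rle_trans; [now apply TI_abs|]. apply TI_le; auto; [now apply cont2_abs|].
    intros; apply re_le_Cmod. }
  assert (Rabs (TI (fun p => Im (F p))) <= TI (fun p => Cmod (F p))).
  { eapply Rle_trans; [now apply TI_abs|]. apply TI_le; auto; [now apply cont2_abs|].
    intros p. eapply Rle_trans; [|apply Rmax_Cmod]. apply Rmax_r. }
  lra.
Qed.

(** * Convolution kernels of Fourier multipliers *)

Definition th (k : Z * Z) (p : R * R) : R := 2 * PI * (IZR (fst k) * fst p + IZR (snd k) * snd p).

Lemma cont2_th k : cont2 (th k).
Proof.
  unfold th. apply (cont2_mult (fun _ => 2 * PI)); [apply cont2_const|].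
  apply (cont2_plus (fun p => IZR (fst k) * fst p) (fun p => IZR (snd k) * snd p)).
  - apply (cont2_mult (fun _ => IZR (fst k)) fst); [apply cont2_const|apply cont2_fst].
  - apply (cont2_mult (fun _ => IZR (snd k)) snd); [apply cont2_const|apply cont2_snd].
Qed.
Lemma cos_IZR_period x a : cos (x + 2 * PI * IZR a) = cos x.
Proof.
  destruct a as [|p|p]; simpl.
  - f_equal. ring.
  - rewrite <- (cos_period x (Pos.to_nat p)), INR_IZR_INZ, positive_nat_Z. f_equal. ring.
  - rewrite <- (cos_period _ (Pos.to_nat p)), INR_IZR_INZ, positive_nat_Z. f_equal.
    change (Z.neg p) with (- Z.pos p)%Z. rewrite opp_IZR. ring.
Qed.
Lemma sin_IZR_period x a : sin (x + 2 * PI * IZR a) = sin x.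
Proof.
  destruct a as [|p|p]; simpl.
  - f_equal. ring.
  - rewrite <- (sin_period x (Pos.to_nat p)), INR_IZR_INZ, positive_nat_Z. f_equal. ring.
  - rewrite <- (sin_period _ (Pos.to_nat p)), INR_IZR_INZ, positive_nat_Z. f_equal.
    change (Z.neg p) with (- Z.pos p)%Z. rewrite opp_IZR. ring.
Qed.
Lemma cont2_cos_th k : cont2 (fun p => cos (th k p)).
Proof. apply (cont2_comp cos); [intros; apply continuous_cos|apply cont2_th]. Qed.
Lemma cont2_sin_th k : cont2 (fun p => sin (th k p)).
Proof. apply (cont2_comp sin); [intros; apply continuous_sin|apply cont2_th]. Qed.

Lemma TC1_cos k : TC1 (fun p => cos (th k p)) (fun p => - (2 * PI * IZR (fst k)) * sin (th k p))
  (fun p => - (2 * PI * IZR (snd k)) * sin (th k p)).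
Proof.
  split.
  - apply cont2_cos_th.
  - apply (cont2_mult (fun _ => - (2 * PI * IZR (fst k)))); [apply cont2_const|apply cont2_sin_th].
  - apply (cont2_mult (fun _ => - (2 * PI * IZR (snd k)))); [apply cont2_const|apply cont2_sin_th].
  - intros x y. unfold th; simpl. auto_derive; auto. ring.
  - intros x y. unfold th; simpl. auto_derive; auto. ring.
  - intros y. unfold th; simpl.
    rewrite <- (cos_IZR_period (2 * PI * (IZR (fst k) * 0 + IZR (snd k) * y)) (fst k)). f_equal. ring.
  - intros x. unfold th; simpl.
    rewrite <- (cos_IZR_period (2 * PI * (IZR (fst k) * x + IZR (snd k) * 0)) (snd k)). f_equal. ring.
Qed.
Lemma TC1_sin k : TC1 (fun p => sin (th k p)) (fun p => (2 * PI * IZR (fst k)) * cos (th k p))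
  (fun p => (2 * PI * IZR (snd k)) * cos (th k p)).
Proof.
  split.
  - apply cont2_sin_th.
  - apply (cont2_mult (fun _ => (2 * PI * IZR (fst k)))); [apply cont2_const|apply cont2_cos_th].
  - apply (cont2_mult (fun _ => (2 * PI * IZR (snd k)))); [apply cont2_const|apply cont2_cos_th].
  - intros x y. unfold th; simpl. auto_derive; auto. ring.
  - intros x y. unfold th; simpl. auto_derive; auto. ring.
  - intros y. unfold th; simpl.
    rewrite <- (sin_IZR_period (2 * PI * (IZR (fst k) * 0 + IZR (snd k) * y)) (fst k)). f_equal. ring.
  - intros x. unfold th; simpl.
    rewrite <- (sin_IZR_period (2 * PI * (IZR (fst k) * x + IZR (snd k) * 0)) (snd k)). f_equal. ring.
Qed.

Lemma ccont2_ek k : ccont2 (ek k).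
Proof. split; [apply cont2_cos_th|apply cont2_sin_th]. Qed.
Lemma ccont2_ev B f : ccont2 (ev B f).
Proof.
  apply ccont2_Csum. intros k. apply (ccont2_mult (fun _ => f k) (ek k)); [apply ccont2_const|apply ccont2_ek].
Qed.

(** Up to a nonzero factor 2 pi k_i, the functions cos and sin of 2 pi k.x are partial derivatives
    of periodic functions, and such derivatives integrate to 0. *)
Lemma CTI_ek k : k <> (0%Z, 0%Z) -> CTI (ek k) = RtoC 0.
Proof.
  intros Hk.
  assert (P : forall a : Z, a <> 0%Z -> 2 * PI * IZR a <> 0).
  { intros a Ha. apply Rmult_integral_contrapositive. split.
    - pose proof PI_RGT_0. lra.
    - now apply (IZR_neq a 0%Z). }
  assert (K : fst k <> 0%Z \/ snd k <> 0%Z).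
  { destruct k as [a b]; simpl. destruct (Z.eq_dec a 0); destruct (Z.eq_dec b 0); subst; auto. }
  change (CTI (ek k)) with (TI (fun p => cos (th k p)), TI (fun p => sin (th k p))).
  unfold RtoC. destruct K as [K|K]; apply P in K.
  - pose proof (TI_d1 _ _ _ (TC1_cos k)) as Hc. pose proof (TI_d1 _ _ _ (TC1_sin k)) as Hs.
    rewrite TI_scal in Hc by apply cont2_sin_th. rewrite TI_scal in Hs by apply cont2_cos_th.
    f_equal; nra.
  - pose proof (TI_d2 _ _ _ (TC1_cos k)) as Hc. pose proof (TI_d2 _ _ _ (TC1_sin k)) as Hs.
    rewrite TI_scal in Hc by apply cont2_sin_th. rewrite TI_scal in Hs by apply cont2_cos_th.
    f_equal; nra.
Qed.
Lemma CTI_ek0 : CTI (ek (0%Z, 0%Z)) = RtoC 1.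
Proof. rewrite (CTI_ext _ (fun _ => RtoC 1)) by apply ek_0. unfold CTI; simpl. now rewrite !TI_const. Qed.

Lemma CTI_ek2 k l : k <> l -> CTI (fun y => Cmult (ek k y) (ek (kopp l) y)) = RtoC 0.
Proof.
  intros H. rewrite (CTI_ext _ (ek (ksub k l))).
  - apply CTI_ek. intros E. apply H. destruct k, l; unfold ksub in E; simpl in E.
    injection E as E1 E2. f_equal; lia.
  - intros y. rewrite ek_mult. reflexivity.
Qed.
Lemma CTI_ek2_eq k : CTI (fun y => Cmult (ek k y) (ek (kopp k) y)) = RtoC 1.
Proof.
  rewrite (CTI_ext _ (ek (0%Z, 0%Z))); [apply CTI_ek0|].
  intros y. rewrite ek_mult. f_equal. destruct k; unfold kopp; simpl. f_equal; lia.
Qed.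

(** Orthogonality of the exponentials. Depending on the choice of [g] it yields the convolution
    formula behind [ev_cmul_bound] or Parseval's identity. *)
Lemma CTI_double B B' (f g : Z * Z -> C) :
  supp B f ->
  CTI (fun y => Cmult (ev B f y) (Bsum B' (fun l => Cmult (g l) (ek (kopp l) y))))
  = Bsum B' (fun l => Cmult (f l) (g l)).
Proof.
  intros S.
  assert (E1 : forall y, Cmult (ev B f y) (Bsum B' (fun l => Cmult (g l) (ek (kopp l) y))) =
     Csum (box B') (fun l => Csum (box B) (fun k => Cmult (Cmult (f k) (g l)) (Cmult (ek k y) (ek (kopp l) y))))).
  { intros y. unfold Bsum at 1. rewrite <- Csum_scal. apply Csum_ext. intros l _.
    unfold ev, Bsum. rewrite <- Csum_scal_r. apply Csum_ext. intros k _. ring. }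
  rewrite (CTI_ext _ _ E1).
  assert (cc : forall k l, ccont2 (fun y => Cmult (ek k y) (ek (kopp l) y)))
    by (intros; apply ccont2_mult; apply ccont2_ek).
  assert (cc2 : forall k l, ccont2 (fun y => Cmult (Cmult (f k) (g l)) (Cmult (ek k y) (ek (kopp l) y)))).
  { intros k l. apply (ccont2_mult (fun _ => Cmult (f k) (g l))); [apply ccont2_const|apply cc]. }
  rewrite (CTI_Csum (box B') (fun l y => Csum (box B) (fun k => Cmult (Cmult (f k) (g l)) (Cmult (ek k y) (ek (kopp l) y))))).
  2: { intros l. apply (ccont2_Csum (box B) (fun k y => Cmult (Cmult (f k) (g l)) (Cmult (ek k y) (ek (kopp l) y)))). auto. }
  apply Csum_ext. intros l _.
  rewrite (CTI_Csum (box B) (fun k y => Cmult (Cmult (f k) (g l)) (Cmult (ek k y) (ek (kopp l) y)))) by auto.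
  rewrite (Csum_ext _ _ (fun k => Cmult (Cmult (f k) (g l)) (CTI (fun y => Cmult (ek k y) (ek (kopp l) y))))).
  2: { intros k _. now rewrite CTI_scal. }
  destruct (classic (inbox B l)) as [Hl|Hl].
  - change (Bsum B (fun k => Cmult (Cmult (f k) (g l)) (CTI (fun y => Cmult (ek k y) (ek (kopp l) y)))) = Cmult (f l) (g l)).
    rewrite (Bsum_single B l); auto.
    + rewrite CTI_ek2_eq. ring.
    + intros k Hk. rewrite CTI_ek2 by auto. ring.
  - rewrite (S l Hl), Csum_0; [ring|]. intros k Hk.
    rewrite CTI_ek2; [ring|]. intros ->. apply Hl. now apply In_box.
Qed.

Definition cmul (m f : Z * Z -> C) : fdist := fun k => Cmult (m k) (f k).

Lemma ek_minus k (x y : R * R) : ek k (fst x - fst y, snd x - snd y) = Cmult (ek k x) (ek (kopp k) y).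
Proof.
  unfold ek, Cmult, kopp; simpl. rewrite !opp_IZR.
  replace (2 * PI * (IZR (fst k) * (fst x - fst y) + IZR (snd k) * (snd x - snd y)))
    with (2 * PI * (IZR (fst k) * fst x + IZR (snd k) * snd x)
        + 2 * PI * (- IZR (fst k) * fst y + - IZR (snd k) * snd y)) by ring.
  rewrite cos_plus, sin_plus. f_equal. ring.
Qed.

(** The L^1 norm of the convolution kernel with Fourier coefficients [m]. *)
Definition L1 (B : nat) (m : Z * Z -> C) : R := TI (fun y => Cmod (ev B m y)).

(** Young's inequality: applying a multiplier is convolution with its kernel. Only the symbol needs
    its support in [box B']; the coefficients [f] are simply cut to [box B]. *)
Lemma ev_cmul_bound B B' m f M x : supp B' m -> (forall y, Cmod (ev B f y) <= M) ->
  Cmod (ev B (cmul m f) x) <= 2 * (L1 B' m * M).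
Proof.
  intros S H.
  assert (E : ev B (cmul m f) x = CTI (fun y => Cmult (ev B' m y) (ev B f (fst x - fst y, snd x - snd y)))).
  { rewrite (CTI_ext _ (fun y => Cmult (ev B' m y) (Bsum B (fun l => Cmult (Cmult (f l) (ek l x)) (ek (kopp l) y))))).
    - rewrite (CTI_double B' B m (fun l => Cmult (f l) (ek l x)) S). apply Csum_ext.
      intros k _. unfold cmul. ring.
    - intros y. f_equal. apply Csum_ext. intros k _. rewrite ek_minus. ring. }
  assert (cc : ccont2 (fun y => Cmult (ev B' m y) (ev B f (fst x - fst y, snd x - snd y)))).
  { apply ccont2_ext with (fun y => Cmult (ev B' m y) (Bsum B (fun l => Cmult (Cmult (f l) (ek l x)) (ek (kopp l) y)))).
    - intros y. f_equal. apply Csum_ext. intros k _. rewrite ek_minus. ring.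
    - apply ccont2_mult; [apply ccont2_ev|]. apply ccont2_Csum. intros k.
      apply (ccont2_mult (fun _ => Cmult (f k) (ek k x)) (ek (kopp k))); [apply ccont2_const|apply ccont2_ek]. }
  rewrite E. eapply Rle_trans; [now apply CTI_Cmod|].
  apply Rmult_le_compat_l; [lra|]. unfold L1.
  rewrite (Rmult_comm _ M), <- TI_scal by (apply cont2_Cmod, ccont2_ev).
  apply TI_le; [now apply cont2_Cmod| |].
  - apply (cont2_mult (fun _ => M)); [apply cont2_const|apply cont2_Cmod, ccont2_ev].
  - intros y. rewrite Cmod_mult, Rmult_comm. apply Rmult_le_compat_r; [apply Cmod_ge_0|apply H].
Qed.

Lemma Parseval B m : supp B m ->
  TI (fun y => Cmod (ev B m y) ^ 2) = Rsum (box B) (fun k => Cmod (m k) ^ 2).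
Proof.
  intros S.
  transitivity (Re (CTI (fun y => Cmult (ev B m y) (Bsum B (fun l => Cmult (Cconj (m l)) (ek (kopp l) y)))))).
  - unfold CTI; unfold Re at 1; unfold fst at 1. apply TI_ext. intros y.
    replace (Bsum B (fun l => Cmult (Cconj (m l)) (ek (kopp l) y))) with (Cconj (ev B m y)).
    + rewrite <- Cmod2_conj. reflexivity.
    + unfold ev, Bsum. rewrite Cconj_Csum. apply Csum_ext. intros. now rewrite Cmult_conj, ek_opp.
  - rewrite (CTI_double B B m _ S). unfold Bsum. rewrite Re_Csum. apply Rsum_ext.
    intros k _. rewrite <- Cmod2_conj. reflexivity.
Qed.

(** * Kernel bounds from finite differences of the symbol *)

Definition e1 : Z * Z := (1%Z, 0%Z).
Definition e2 : Z * Z := (0%Z, 1%Z).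
Definition kadd (k l : Z * Z) : Z * Z := ((fst k + fst l)%Z, (snd k + snd l)%Z).

(** Second difference of a symbol in direction [e]. On the kernel side it is multiplication by 2 cos
    - 2 ([ev_dd]), which is how smoothness of the symbol becomes decay of the kernel. *)
Definition dd (e : Z * Z) (m : Z * Z -> C) (k : Z * Z) : C :=
  Cminus (Cplus (m (kadd k e)) (m (ksub k e))) (Cmult (RtoC 2) (m k)).

Lemma ksub_kopp k e : ksub k (kopp e) = kadd k e.
Proof. destruct k, e; unfold ksub, kadd, kopp; simpl. f_equal; lia. Qed.

Lemma supp_dd B e m : (e = e1 \/ e = e2) -> supp B m -> supp (B + 1) (dd e m).
Proof.
  intros He S k Hk.
  assert (E : forall l, (l = k \/ l = kadd k e \/ l = ksub k e) -> m l = RtoC 0).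
  { intros l Hl. apply S. intros Hb. apply Hk.
    destruct He as [->| ->]; destruct Hl as [->|[->| ->]]; unfold inbox, kadd, ksub, e1, e2 in *; simpl in *; lia. }
  unfold dd. rewrite !E by tauto. ring.
Qed.

Lemma ev_shift B m e y : supp B m -> inbox 1 e ->
  ev (B + 1) (fun k => m (ksub k e)) y = Cmult (ek e y) (ev B m y).
Proof.
  intros S He. unfold ev at 1.
  transitivity (Cmult (ek e y) (Bsum (B + 1) (fun k => Cmult (m (ksub k e)) (ek (ksub k e) y)))).
  - unfold Bsum. rewrite <- Csum_scal. apply Csum_ext. intros k _. rewrite <- (ek_sub k e y). ring.
  - f_equal. apply (Bsum_shift B (B + 1) e (fun k => Cmult (m k) (ek k y))); [now apply supp_mult|].
    intros l Hl. unfold inbox, ksub, kopp in *; simpl in *. lia.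
Qed.

Lemma ev_dd B m e y : supp B m -> (e = e1 \/ e = e2) ->
  ev (B + 1) (dd e m) y = Cmult (RtoC (- (2 - 2 * cos (th e y)))) (ev B m y).
Proof.
  intros S He.
  assert (I1 : inbox 1 e) by (destruct He as [->| ->]; unfold inbox, e1, e2; simpl; lia).
  assert (I2 : inbox 1 (kopp e)) by (destruct He as [->| ->]; unfold inbox, e1, e2; simpl; lia).
  unfold dd. rewrite ev_minus, ev_plus, ev_scal.
  rewrite (ev_shift B m e) by auto.
  rewrite (ev_ext _ (fun k => m (kadd k e)) (fun k => m (ksub k (kopp e)))) by (intros; now rewrite ksub_kopp).
  rewrite (ev_shift B m (kopp e)) by auto.
  rewrite (ev_supp (B + 1) B m y); [|apply supp_le with B; auto; lia|auto].
  rewrite ek_opp. change (ek e y) with (cos (th e y), sin (th e y)).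
  destruct (ev B m y) as [u v]. unfold Cminus, Cplus, Cmult, Copp, Cconj, RtoC; simpl. f_equal; ring.
Qed.

(** Taylor gives sin u >= u - u^3/6, and u <= pi/2 <= 2 leaves at least a third of u. *)
Lemma sin_lower u : 0 <= u <= PI / 2 -> u / 3 <= sin u.
Proof.
  intros [H0 H1]. pose proof PI_4.
  destruct (pre_sin_bound u 0 H0 ltac:(lra)) as [H2 _].
  unfold sin_approx, sin_term in H2. simpl in H2.
  nra.
Qed.

(** One factor of the majorant of w^{-2} in [L1_goodmult]: since w^2 dominates a product of two
    one-variable weights, w^{-2} can be integrated one variable at a time. *)
Definition uw (r x : R) : R := / (1 + r ^ 2 * (2 - 2 * cos (2 * PI * x))).

Lemma uw_pos r x : 0 < 1 + r ^ 2 * (2 - 2 * cos (2 * PI * x)).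
Proof. pose proof (COS_bound (2 * PI * x)). nra. Qed.

(** 2 - 2 cos(2 pi x) = 4 sin^2(pi x) is at least x^2 on [0,1/2], because sin(pi x) >= pi x/3 >= x;
    the other half follows by the symmetry x -> 1 - x. *)
Lemma uw_le r x : 0 <= x <= 1 -> uw r x <= / (1 + (r * x) ^ 2) + / (1 + (r * (1 - x)) ^ 2).
Proof.
  intros Hx.
  assert (Q : forall z, 0 < / (1 + z ^ 2)) by (intros z; apply Rinv_0_lt_compat; pose proof (pow2_ge_0 z); lra).
  assert (A : forall z, 0 <= z <= 1/2 -> uw r z <= / (1 + (r * z) ^ 2)).
  { intros z Hz. unfold uw. apply Rinv_le_contravar; [pose proof (pow2_ge_0 (r * z)); lra|].
    assert (Z1 : 2 - 2 * cos (2 * PI * z) = 4 * (sin (PI * z)) ^ 2).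
    { replace (2 * PI * z) with (2 * (PI * z)) by ring. rewrite cos_2a_sin. ring. }
    rewrite Z1.
    assert (P2 : 3 < PI) by (pose proof PI2_3_2; lra).
    assert (S : PI * z / 3 <= sin (PI * z)) by (apply sin_lower; split; nra).
    assert (z <= sin (PI * z)) by nra.
    assert (z ^ 2 <= sin (PI * z) ^ 2) by (apply pow_incr; lra).
    rewrite Rpow_mult_distr. nra. }
  destruct (Rle_dec x (1/2)).
  - specialize (A x ltac:(lra)). specialize (Q (r * (1 - x))). lra.
  - specialize (A (1 - x) ltac:(lra)). specialize (Q (r * x)).
    replace (uw r x) with (uw r (1 - x)); [lra|].
    unfold uw. do 4 f_equal. replace (2 * PI * (1 - x)) with (- (2 * PI * x) + 2 * PI * IZR 1) by (simpl; ring).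
    rewrite cos_IZR_period. now rewrite cos_neg.
Qed.

Lemma cont_uw r x : continuous (uw r) x.
Proof.
  apply is_derive_cont with (- (r ^ 2 * (2 * (2 * PI * sin (2 * PI * x)))) / (1 + r ^ 2 * (2 - 2 * cos (2 * PI * x))) ^ 2).
  unfold uw. pose proof (uw_pos r x). auto_derive.
  - lra.
  - field. lra.
Qed.

(** Each of the two majorants of [uw_le] integrates to arctan(r)/r, and arctan(r) <= pi/2 <= 2. *)
Lemma int_uw r : 1 <= r -> RInt (uw r) 0 1 <= 4 / r.
Proof.
  intros Hr.
  assert (D1 : is_RInt (fun x => / (1 + (r * x) ^ 2)) 0 1 (minus (atan (r * 1) / r) (atan (r * 0) / r))).
  { apply (is_RInt_derive (V := R_CompleteNormedModule) (fun x => atan (r * x) / r)).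
    - intros x _. evar_last; [auto_derive; auto|]. unfold Rsqr. field. split; [|lra].
      simpl in *. nra.
    - intros x _. apply is_derive_cont with (- (r * (2 * (r * x))) / (1 + (r * x) ^ 2) ^ 2).
      auto_derive; [simpl in *; nra|]. field. simpl in *; nra. }
  assert (D2 : is_RInt (fun x => / (1 + (r * (1 - x)) ^ 2)) 0 1
      (minus (- atan (r * (1 - 1)) / r) (- atan (r * (1 - 0)) / r))).
  { apply (is_RInt_derive (V := R_CompleteNormedModule) (fun x => - atan (r * (1 - x)) / r)).
    - intros x _. evar_last; [auto_derive; auto|]. unfold Rsqr. field. split; [|lra].
      pose proof (pow2_ge_0 (r * (1 - x))). simpl in *. nra.
    - intros x _. apply is_derive_cont with ((r * (2 * (r * (1 - x)))) / (1 + (r * (1 - x)) ^ 2) ^ 2).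
      pose proof (pow2_ge_0 (r * (1 - x))). auto_derive; [simpl in *; nra|]. field. simpl in *; nra. }
  pose proof (is_RInt_plus (V := R_NormedModule) _ _ _ _ _ _ D1 D2) as D.
  apply Rle_trans with (RInt (fun x => plus (/ (1 + (r * x) ^ 2)) (/ (1 + (r * (1 - x)) ^ 2))) 0 1).
  - apply RInt_le; [lra| |eexists; apply D|].
    + apply ex_RInt_cont, cont_uw.
    + intros x Hx. apply uw_le; lra.
  - erewrite is_RInt_unique; [|exact D]. unfold minus, plus, opp; simpl.
    replace (r * (1 - 1)) with 0 by ring. rewrite Rmult_0_r, atan_0.
    replace (r * (1 - 0)) with (r * 1) by ring.
    pose proof (atan_bound (r * 1)). pose proof PI_4.
    unfold Rdiv. assert (0 < / r) by (apply Rinv_0_lt_compat; lra). nra.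
Qed.

(** Discrete form of a symbol that is smooth at frequency scale 2^n: each difference gains a factor
    2^-n. Second differences feed [L1_goodmult], the centred first differences feed the product rule
    in [goodmult_kc]. *)
Record goodmult (n c : nat) (A : R) (m : Z * Z -> C) : Prop := {
  gm_supp : supp (c * 2 ^ n) m;
  gm_b : forall k, Cmod (m k) <= A;
  gm_d : forall e k, (e = e1 \/ e = e2) -> 2 ^ n * Cmod (Cminus (m (kadd k e)) (m (ksub k e))) <= A;
  gm_dd : forall e k, (e = e1 \/ e = e2) -> 4 ^ n * Cmod (dd e m k) <= A }.

Lemma INR_pow2 n : INR (2 ^ n) = 2 ^ n.
Proof. rewrite pow_INR. reflexivity. Qed.
Lemma pow2_sq n : (2 ^ n) ^ 2 = 4 ^ n.
Proof. rewrite <- pow_mult, Nat.mul_comm, pow_mult. f_equal. simpl; ring. Qed.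
Lemma pow2_ge1 n : 1 <= 2 ^ n.
Proof. apply pow_R1_Rle. lra. Qed.

(* Weighting the kernel K by w = 1 + 4^n(4 sin^2(pi x) + 4 sin^2(pi y)) amounts to taking second
   differences of the multiplier, so |K| <= (w^2|K|^2/(4^n A) + 4^n A/w^2)/2 and Parseval give the bound. *)
Lemma L1_goodmult n c A m : 0 < A -> goodmult n c A m ->
  L1 (c * 2 ^ n) m <= (9 * (2 * INR c + 3) ^ 2 + 16) * A.
Proof.
  intros HA [S Hb _ Hdd]. set (B := (c * 2 ^ n)%nat) in *. set (r := 2 ^ n).
  pose proof (pow2_ge1 n) as Hr. fold r in Hr.
  set (w := fun p => 1 + r ^ 2 * (2 - 2 * cos (th e1 p)) + r ^ 2 * (2 - 2 * cos (th e2 p))).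
  set (m' := fun k => Cminus (m k) (Cmult (RtoC (r ^ 2)) (Cplus (dd e1 m k) (dd e2 m k)))).
  assert (S' : supp (B + 1) m').
  { intros k Hk. unfold m'. rewrite (supp_dd B e1), (supp_dd B e2) by auto.
    rewrite (supp_le B (B + 1) m) by (auto; lia). ring. }
  assert (W : forall p, Cmult (RtoC (w p)) (ev B m p) = ev (B + 1) m' p).
  { intros p. unfold m'. rewrite ev_minus, ev_scal, ev_plus, !ev_dd by auto.
    rewrite (ev_supp (B + 1) B m p); [|apply supp_le with B; auto; lia|auto].
    unfold w. destruct (ev B m p) as [u v].
    unfold Cminus, Cplus, Cmult, Copp, RtoC; simpl. f_equal; ring. }
  assert (Hm' : forall k, Cmod (m' k) <= 3 * A).
  { intros k. unfold m', Cminus. eapply Rle_trans; [apply Cmod_triangle|].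
    rewrite Cmod_opp, Cmod_mult, Cmod_R, Rabs_pos_eq by (apply pow2_ge_0).
    pose proof (Cmod_triangle (dd e1 m k) (dd e2 m k)).
    pose proof (Hdd e1 k (or_introl eq_refl)). pose proof (Hdd e2 k (or_intror eq_refl)).
    pose proof (Hb k). unfold r. rewrite pow2_sq. assert (0 < 4 ^ n) by (apply pow_lt; lra). nra. }
  assert (w1 : forall p, 1 <= w p).
  { intros p. unfold w. pose proof (COS_bound (th e1 p)). pose proof (COS_bound (th e2 p)).
    nra. }
  assert (cK : cont2 (fun p => Cmod (ev B m p))) by (apply cont2_Cmod, ccont2_ev).
  assert (cu1 : cont2 (fun p => uw r (fst p))) by (apply cont1_fst, cont_uw).
  assert (cu2 : cont2 (fun p => uw r (snd p))) by (apply cont1_snd, cont_uw).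
  assert (cu : cont2 (fun p => uw r (fst p) * uw r (snd p))) by now apply cont2_mult.
  assert (cK' : cont2 (fun p => Cmod (ev (B + 1) m' p) ^ 2)) by (apply cont2_pow, cont2_Cmod, ccont2_ev).
  set (a := / (r ^ 2 * A)).
  assert (r2 : 1 <= r ^ 2) by nra.
  assert (Ha : 0 < a) by (apply Rinv_0_lt_compat; nra).
  apply Rle_trans with (TI (fun p => a * Cmod (ev (B + 1) m' p) ^ 2 + r ^ 2 * A * (uw r (fst p) * uw r (snd p)))).
  { apply TI_le; auto.
    - apply cont2_plus; apply (cont2_mult (fun _ => _)); auto; apply cont2_const.
    - intros p. rewrite <- W, Cmod_mult, Cmod_R, (Rabs_pos_eq (w p)) by (specialize (w1 p); lra).
      set (K := Cmod (ev B m p)).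
      assert (U : / w p * / w p <= uw r (fst p) * uw r (snd p)).
      { unfold uw. rewrite <- !Rinv_mult.
        pose proof (uw_pos r (fst p)). pose proof (uw_pos r (snd p)).
        apply Rinv_le_contravar; [now apply Rmult_lt_0_compat|].
        assert (E1 : th e1 p = 2 * PI * fst p) by (unfold th, e1; simpl; ring).
        assert (E2 : th e2 p = 2 * PI * snd p) by (unfold th, e2; simpl; ring).
        unfold w. rewrite E1, E2.
        pose proof (COS_bound (2 * PI * fst p)). pose proof (COS_bound (2 * PI * snd p)).
        assert (0 <= r ^ 2 * (2 - 2 * cos (2 * PI * fst p))) by nra.
        assert (0 <= r ^ 2 * (2 - 2 * cos (2 * PI * snd p))) by nra.
        set (X := r ^ 2 * (2 - 2 * cos (2 * PI * fst p))) in *.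
        set (Y := r ^ 2 * (2 - 2 * cos (2 * PI * snd p))) in *. nra. }
      apply Rle_trans with (a * (w p * K) ^ 2 + r ^ 2 * A * (/ w p * / w p)).
      + assert (E : K = (w p * K) * / w p) by (field; specialize (w1 p); lra).
        assert (Eb : r ^ 2 * A = / a) by (unfold a; now rewrite Rinv_inv).
        rewrite Eb. rewrite E at 1. set (X := w p * K). set (Y := / w p) in *.
        assert (a * (a * X ^ 2 + / a * (Y * Y) - X * Y) = (a * X) ^ 2 + Y * Y - a * X * Y) by (field; lra).
        pose proof (pow2_ge_0 (a * X - Y)).
        nra.
      + apply Rplus_le_compat_l. apply Rmult_le_compat_l; [nra|auto]. }
  rewrite TI_plus, !TI_scal; auto.
  2: apply (cont2_mult (fun _ => a)); auto; apply cont2_const.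
  2: apply (cont2_mult (fun _ => r ^ 2 * A)); auto; apply cont2_const.
  rewrite Parseval by auto. rewrite TI_prod by apply cont_uw.
  (* The 9 is the square of the 3 in [Hm'], and the box of radius c 2^n + 1 has at most ((2c+3)
     2^n)^2 points. *)
  assert (P : Rsum (box (B + 1)) (fun k => Cmod (m' k) ^ 2) <= ((2 * INR c + 3) * r) ^ 2 * (9 * A ^ 2)).
  { eapply Rle_trans; [apply Rsum_le with (g := fun _ => 9 * A ^ 2)|].
    - intros k _. pose proof (Cmod_ge_0 (m' k)).
      replace (9 * A ^ 2) with ((3 * A) ^ 2) by ring. apply pow_incr; auto.
    - rewrite Rsum_const, length_box, mult_INR, plus_INR, mult_INR, plus_INR. unfold B.
      rewrite mult_INR, INR_pow2. fold r. simpl (INR 2). simpl (INR 1).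
      apply Rmult_le_compat_r; [nra|]. pose proof (pos_INR c).
      simpl. rewrite Rmult_1_r. apply Rmult_le_compat; nra. }
  assert (I0 : 0 <= RInt (uw r) 0 1).
  { apply RInt_ge_0; [lra|apply ex_RInt_cont, cont_uw|]. intros x _. apply Rlt_le, Rinv_0_lt_compat, uw_pos. }
  pose proof (int_uw r Hr) as I1.
  assert (I2 : RInt (uw r) 0 1 * RInt (uw r) 0 1 <= 16 / r ^ 2).
  { replace (16 / r ^ 2) with (4 / r * (4 / r)) by (field; lra). apply Rmult_le_compat; auto. }
  apply Rle_trans with (a * (((2 * INR c + 3) * r) ^ 2 * (9 * A ^ 2)) + r ^ 2 * A * (16 / r ^ 2)).
  - apply Rplus_le_compat; apply Rmult_le_compat_l; auto; nra.
  - apply Req_le. unfold a. field. split; lra.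
Qed.

Lemma goodmult_ext n c A m m' : (forall k, m k = m' k) -> goodmult n c A m -> goodmult n c A m'.
Proof.
  intros E [S b d q]. split.
  - intros k Hk. rewrite <- E. auto.
  - intros k. rewrite <- E. auto.
  - intros e k He. rewrite <- !E. auto.
  - intros e k He. unfold dd. rewrite <- !E. apply (q e k He).
Qed.
Definition kc (j : bool) (k : Z * Z) : Z := if j then fst k else snd k.

(** A shift by [e] changes the coordinate by at most 1, so the discrete Leibniz rule adds at most
    two neighbouring values of [m] to the bound (c+1) A, whence c + 3. This covers symbols of
    first-order operators. *)
Lemma goodmult_kc j n c A m : goodmult n c A m ->
  goodmult n c ((INR c + 3) * A) (fun k => Cmult (RtoC (IZR (kc j k) / 2 ^ n)) (m k)).
Proof.
  intros [S b d q]. pose proof (pow2_ge1 n) as P.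
  assert (A0 : 0 <= A) by (eapply Rle_trans; [apply Cmod_ge_0|apply (b (0%Z, 0%Z))]).
  pose proof (pos_INR c) as C0.
  assert (P4 : 4 ^ n = 2 ^ n * 2 ^ n) by (rewrite <- pow2_sq; ring).
  assert (KB : forall k, inbox (c * 2 ^ n + 1) k -> Rabs (IZR (kc j k)) <= (INR c + 1) * 2 ^ n).
  { intros k Hk. rewrite <- abs_IZR.
    apply Rle_trans with (IZR (Z.of_nat (c * 2 ^ n + 1))).
    - apply IZR_le. destruct j; simpl; apply Hk.
    - rewrite <- INR_IZR_INZ, plus_INR, mult_INR, INR_pow2. simpl. nra. }
  assert (KB' : forall k (z : C), (z <> RtoC 0 -> inbox (c * 2 ^ n + 1) k) ->
     Cmod (Cmult (RtoC (IZR (kc j k))) z) <= (INR c + 1) * 2 ^ n * Cmod z).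
  { intros k z Hz. rewrite Cmod_mult, Cmod_R. destruct (classic (z = RtoC 0)) as [->|E].
    - rewrite Cmod_0. lra.
    - apply Rmult_le_compat_r; [apply Cmod_ge_0|]. apply KB; auto. }
  assert (Ke : forall e k, e = e1 \/ e = e2 ->
      (IZR (kc j (kadd k e)) = IZR (kc j k) + 1 /\ IZR (kc j (ksub k e)) = IZR (kc j k) - 1) \/
      (IZR (kc j (kadd k e)) = IZR (kc j k) /\ IZR (kc j (ksub k e)) = IZR (kc j k))).
  { intros e [k1 k2] [->| ->]; destruct j; unfold kc, kadd, ksub, e1, e2; simpl;
      rewrite ?plus_IZR, ?minus_IZR; simpl; (left; lra) || (right; lra). }
  assert (V : 0 < / 2 ^ n) by (apply Rinv_0_lt_compat; lra).
  assert (D : forall (x y : R) (z : C), Cmult (RtoC (x / y)) z = Cmult (RtoC (/ y)) (Cmult (RtoC x) z)).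
  { intros. unfold Rdiv. rewrite RtoC_mult. ring. }
  split.
  - intros k Hk. rewrite S by auto. ring.
  - intros k. rewrite D, Cmod_mult, Cmod_R, (Rabs_pos_eq (/ 2 ^ n)) by lra.
    apply (Rmult_le_reg_l (2 ^ n)); [lra|]. rewrite <- Rmult_assoc, Rinv_r, Rmult_1_l by lra.
    eapply Rle_trans; [apply KB'|].
    + intros Hz. pose proof (supp_in _ _ _ S Hz) as [? ?]. split; lia.
    + specialize (b k). assert (0 <= (INR c + 1) * 2 ^ n) by nra. nra.
  - intros e k He. specialize (d e k He). pose proof (Ke e k He) as K.
    assert (T : Cmod (Cmult (RtoC (IZR (kc j k))) (Cminus (m (kadd k e)) (m (ksub k e)))) <=
       (INR c + 1) * 2 ^ n * Cmod (Cminus (m (kadd k e)) (m (ksub k e)))).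
    { apply KB'. intros Hz. apply NNPP. intros Hk. apply Hz.
      assert (E : forall l, (l = kadd k e \/ l = ksub k e) -> m l = RtoC 0).
      { intros l Hl. apply S. intros Hb. apply Hk.
        destruct He as [->| ->]; destruct Hl as [-> | ->]; unfold inbox, kadd, ksub, e1, e2 in *; simpl in *; lia. }
      rewrite !E by tauto. ring. }
    pose proof (Cmod_triangle (m (kadd k e)) (m (ksub k e))) as T2.
    pose proof (b (kadd k e)). pose proof (b (ksub k e)).
    rewrite !D.
    replace (Cminus _ _) with (Cmult (RtoC (/ 2 ^ n)) (Cminus (Cmult (RtoC (IZR (kc j (kadd k e)))) (m (kadd k e)))
      (Cmult (RtoC (IZR (kc j (ksub k e)))) (m (ksub k e))))) by ring.
    rewrite Cmod_mult, Cmod_R, (Rabs_pos_eq (/ 2 ^ n)), <- Rmult_assoc, Rinv_r, Rmult_1_l by lra.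
    destruct K as [[-> ->]|[-> ->]].
    + replace (Cminus _ _) with (Cplus (Cmult (RtoC (IZR (kc j k))) (Cminus (m (kadd k e)) (m (ksub k e))))
         (Cplus (m (kadd k e)) (m (ksub k e)))) by (rewrite RtoC_plus, RtoC_minus; ring).
      eapply Rle_trans; [apply Cmod_triangle|]. nra.
    + replace (Cminus _ _) with (Cmult (RtoC (IZR (kc j k))) (Cminus (m (kadd k e)) (m (ksub k e)))) by ring.
      nra.
  - intros e k He. specialize (d e k He). specialize (q e k He). pose proof (Ke e k He) as K.
    assert (T : Cmod (Cmult (RtoC (IZR (kc j k))) (dd e m k)) <= (INR c + 1) * 2 ^ n * Cmod (dd e m k)).
    { apply KB'. intros Hz. apply (supp_in _ _ _ (supp_dd _ e m He S) Hz). }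
    unfold dd. rewrite !D.
    replace (Cminus _ _) with (Cmult (RtoC (/ 2 ^ n)) (Cminus (Cplus (Cmult (RtoC (IZR (kc j (kadd k e)))) (m (kadd k e)))
      (Cmult (RtoC (IZR (kc j (ksub k e)))) (m (ksub k e)))) (Cmult (RtoC 2) (Cmult (RtoC (IZR (kc j k))) (m k))))) by ring.
    rewrite Cmod_mult, Cmod_R, (Rabs_pos_eq (/ 2 ^ n)) by lra. rewrite P4.
    rewrite (Rmult_assoc (2 ^ n)), <- (Rmult_assoc (2 ^ n) (/ 2 ^ n)), Rinv_r, Rmult_1_l by lra.
    rewrite P4 in q.
    destruct K as [[-> ->]|[-> ->]].
    + replace (Cminus _ _) with (Cplus (Cmult (RtoC (IZR (kc j k))) (dd e m k))
         (Cminus (m (kadd k e)) (m (ksub k e)))) by (unfold dd; rewrite RtoC_plus, RtoC_minus; ring).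
      eapply Rle_trans; [apply Rmult_le_compat_l; [lra|apply Cmod_triangle]|].
      rewrite Rmult_plus_distr_l. nra.
    + replace (Cminus _ _) with (Cmult (RtoC (IZR (kc j k))) (dd e m k)) by (unfold dd; ring).
      nra.
Qed.

Lemma diff_bounds (g g1 g2 : R -> R) D1 D2 x :
  (forall x, is_derive g x (g1 x)) -> (forall x, is_derive g1 x (g2 x)) ->
  (forall x, Rabs (g1 x) <= D1) -> (forall x, Rabs (g2 x) <= D2) ->
  Rabs (g (x + 1) - g (x - 1)) <= 2 * D1 /\ Rabs (g (x + 1) + g (x - 1) - 2 * g x) <= 2 * D2.
Proof.
  intros H1 H2 B1 B2. split.
  - destruct (MVT_gen g (x - 1) (x + 1) g1) as (c & _ & E).
    + intros; apply H1.
    + intros. apply continuity_pt_filterlim, (is_derive_cont g _ _ (H1 _)).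
    + rewrite E, Rabs_mult. replace (x + 1 - (x - 1)) with 2 by ring.
      rewrite (Rabs_pos_eq 2) by lra. specialize (B1 c). lra.
  - destruct (MVT_gen (fun t => g (x + t) + g (x - t)) 0 1 (fun t => g1 (x + t) - g1 (x - t))) as (c & Hc & E).
    + intros t _.
      assert (Q1 := H1 (x + t)). assert (Q2 := H1 (x - t)).
      evar_last. { apply (is_derive_plus (V := R_NormedModule)).
        - apply (is_derive_comp g (fun t => x + t)); [apply Q1|]. auto_derive; auto.
        - apply (is_derive_comp g (fun t => x - t)); [apply Q2|]. auto_derive; auto. }
      unfold plus, scal; simpl; unfold mult; simpl. ring.
    + intros t _. apply continuity_pt_filterlim.
      apply (continuous_plus (K := R_AbsRing) (V := R_NormedModule) (fun t => g (x + t)) (fun t => g (x - t))).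
      * apply (continuous_comp (fun t => x + t) g); [|apply (is_derive_cont g _ _ (H1 _))].
        apply (is_derive_cont (fun t => x + t) t 1). auto_derive; [auto|ring].
      * apply (continuous_comp (fun t => x - t) g); [|apply (is_derive_cont g _ _ (H1 _))].
        apply (is_derive_cont (fun t => x - t) t (-1)). auto_derive; [auto|ring].
    + rewrite Rmin_left, Rmax_right in Hc by lra.
      destruct (MVT_gen g1 (x - c) (x + c) g2) as (d & _ & E2).
      * intros; apply H2.
      * intros. apply continuity_pt_filterlim, (is_derive_cont g1 _ _ (H2 _)).
      * rewrite Rplus_0_r, Rminus_0_r in E.
        replace (g (x + 1) + g (x - 1) - 2 * g x) with (g2 d * (x + c - (x - c)) * (1 - 0)) by lra.
        rewrite !Rabs_mult, (Rabs_pos_eq (1 - 0)) by lra.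
        rewrite (Rabs_pos_eq (x + c - (x - c))) by lra. specialize (B2 d). pose proof (Rabs_pos (g2 d)). nra.
Qed.

Lemma znorm_sq k : znorm k ^ 2 = IZR (fst k) ^ 2 + IZR (snd k) ^ 2.
Proof.
  unfold znorm. rewrite pow2_sqrt; auto.
  pose proof (pow2_ge_0 (IZR (fst k))). pose proof (pow2_ge_0 (IZR (snd k))). lra.
Qed.
Lemma znorm_ge0 k : 0 <= znorm k.
Proof. apply sqrt_pos. Qed.

(** A profile in |k|^2/4^n rather than |k|/2^n stays smooth at the origin. It vanishes for |k|^2 >=
    8 4^n, hence outside the box of radius 3 2^n. Where it does not vanish, the chain rule bounds
    its second derivative by (32 + 2) A/4^n, and passing to differences doubles this to 68 A/4^n. *)
Lemma goodmult_radial n A (G G1 G2 : R -> R) :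
  (forall s, is_derive G s (G1 s)) -> (forall s, is_derive G1 s (G2 s)) ->
  (forall s, Rabs (G s) <= A) -> (forall s, Rabs (G1 s) <= A) -> (forall s, Rabs (G2 s) <= A) ->
  (forall s, 8 <= s -> G s = 0 /\ G1 s = 0 /\ G2 s = 0) ->
  goodmult n 3 (68 * A) (fun k => RtoC (G (znorm k ^ 2 / 4 ^ n))).
Proof.
  intros H1 H2 B0 B1 B2 Z.
  assert (A0 : 0 <= A) by (eapply Rle_trans; [apply Rabs_pos|apply (B0 0)]).
  pose proof (pow2_ge1 n) as P.
  assert (P4 : 4 ^ n = 2 ^ n * 2 ^ n) by (rewrite <- pow2_sq; ring).
  assert (P4p : 0 < 4 ^ n) by (apply pow_lt; lra).
  set (g := fun b x => G ((x ^ 2 + b ^ 2) / 4 ^ n)).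
  set (g1 := fun b x => G1 ((x ^ 2 + b ^ 2) / 4 ^ n) * (2 * x / 4 ^ n)).
  set (g2 := fun b x => G2 ((x ^ 2 + b ^ 2) / 4 ^ n) * (2 * x / 4 ^ n) * (2 * x / 4 ^ n)
       + G1 ((x ^ 2 + b ^ 2) / 4 ^ n) * (2 / 4 ^ n)).
  assert (K1 : forall b x, is_derive (g b) x (g1 b x)).
  { intros b x. unfold g, g1. evar_last.
    - apply (is_derive_comp G (fun x => (x ^ 2 + b ^ 2) / 4 ^ n)); [apply H1|].
      auto_derive; auto.
    - unfold scal; simpl; unfold mult; simpl. field. lra. }
  assert (K2 : forall b x, is_derive (g1 b) x (g2 b x)).
  { intros b x. unfold g1, g2. evar_last.
    - apply (is_derive_mult (K := R_AbsRing) (fun x => G1 ((x ^ 2 + b ^ 2) / 4 ^ n)) (fun x => 2 * x / 4 ^ n)).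
      + apply (is_derive_comp G1 (fun x => (x ^ 2 + b ^ 2) / 4 ^ n)); [apply H2|].
        auto_derive; auto.
      + auto_derive; auto.
      + intros; apply Rmult_comm.
    - unfold scal, plus; simpl; unfold mult; simpl. field. lra. }
  assert (X : forall b x, 8 <= (x ^ 2 + b ^ 2) / 4 ^ n \/ (x ^ 2 <= 8 * 4 ^ n /\ Rabs x <= 3 * 2 ^ n)).
  { intros b x. destruct (Rle_dec 8 ((x ^ 2 + b ^ 2) / 4 ^ n)) as [|Hn]; [left; auto|right].
    apply Rnot_le_lt in Hn. apply (Rmult_lt_compat_r (4 ^ n)) in Hn; auto.
    unfold Rdiv in Hn. rewrite Rmult_assoc, Rinv_l, Rmult_1_r in Hn by lra.
    pose proof (pow2_ge_0 b). split; [lra|].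
    apply Rabs_le. rewrite P4 in Hn. split; nra. }
  assert (Bg1 : forall b x, Rabs (g1 b x) <= 6 * A / 2 ^ n).
  { intros b x. unfold g1. assert (0 <= 6 * A / 2 ^ n) by (apply Rmult_le_pos; [lra|apply Rlt_le, Rinv_0_lt_compat; lra]).
    destruct (X b x) as [Hz|[_ Hx]].
    - destruct (Z _ Hz) as (_ & -> & _). rewrite Rmult_0_l, Rabs_R0. auto.
    - rewrite Rabs_mult. unfold Rdiv. rewrite !Rabs_mult, (Rabs_pos_eq 2), (Rabs_pos_eq (/ 4 ^ n)) by
        (try lra; apply Rlt_le, Rinv_0_lt_compat; lra).
      set (Y := Rabs (G1 _)). assert (Y <= A) by apply B1. assert (0 <= Y) by apply Rabs_pos.
      apply (Rmult_le_reg_r (4 ^ n)); auto.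
      replace (Y * (2 * Rabs x * / 4 ^ n) * 4 ^ n) with (Y * (2 * Rabs x)) by (field; lra).
      replace (6 * A * / 2 ^ n * 4 ^ n) with (A * (6 * 2 ^ n)) by (rewrite P4; field; lra).
      pose proof (Rabs_pos x). apply Rmult_le_compat; lra. }
  assert (Bg2 : forall b x, Rabs (g2 b x) <= 34 * A / 4 ^ n).
  { intros b x. unfold g2. assert (0 <= 34 * A / 4 ^ n) by (apply Rmult_le_pos; [lra|apply Rlt_le, Rinv_0_lt_compat; lra]).
    destruct (X b x) as [Hz|[Hx _]].
    - destruct (Z _ Hz) as (_ & -> & ->). rewrite !Rmult_0_l, Rplus_0_l, Rabs_R0. auto.
    - eapply Rle_trans; [apply Rabs_triang|].
      set (u := (x ^ 2 + b ^ 2) / 4 ^ n).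
      replace (G2 u * (2 * x / 4 ^ n) * (2 * x / 4 ^ n)) with (G2 u * (4 * x ^ 2 / (4 ^ n * 4 ^ n))) by (field; lra).
      rewrite !Rabs_mult.
      assert (q1 : 0 <= 4 * x ^ 2 / (4 ^ n * 4 ^ n)).
      { apply Rmult_le_pos; [pose proof (pow2_ge_0 x); lra|]. apply Rlt_le, Rinv_0_lt_compat. nra. }
      assert (q2 : 0 <= 2 / 4 ^ n) by (apply Rmult_le_pos; [lra|apply Rlt_le, Rinv_0_lt_compat; lra]).
      rewrite (Rabs_pos_eq (4 * x ^ 2 / (4 ^ n * 4 ^ n))), (Rabs_pos_eq (2 / 4 ^ n)) by auto.
      assert (q3 : 4 * x ^ 2 / (4 ^ n * 4 ^ n) <= 32 / 4 ^ n).
      { apply (Rmult_le_reg_r (4 ^ n * 4 ^ n)); [nra|].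
        replace (4 * x ^ 2 / (4 ^ n * 4 ^ n) * (4 ^ n * 4 ^ n)) with (4 * x ^ 2) by (field; lra).
        replace (32 / 4 ^ n * (4 ^ n * 4 ^ n)) with (32 * 4 ^ n) by (field; lra). lra. }
      pose proof (Rabs_pos (G1 u)). pose proof (Rabs_pos (G2 u)).
      assert (Rabs (G2 u) * (4 * x ^ 2 / (4 ^ n * 4 ^ n)) <= A * (32 / 4 ^ n)) by (apply Rmult_le_compat; auto).
      assert (Rabs (G1 u) * (2 / 4 ^ n) <= A * (2 / 4 ^ n)) by (apply Rmult_le_compat; auto; lra).
      unfold Rdiv in *. lra. }
  assert (Eg : forall e k, e = e1 \/ e = e2 -> exists b x,
     G (znorm (kadd k e) ^ 2 / 4 ^ n) = g b (x + 1) /\ G (znorm (ksub k e) ^ 2 / 4 ^ n) = g b (x - 1)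
     /\ G (znorm k ^ 2 / 4 ^ n) = g b x).
  { intros e [a b] [->| ->]; rewrite !znorm_sq; unfold kadd, ksub, e1, e2, g; simpl fst; simpl snd;
      rewrite !plus_IZR, !minus_IZR; simpl.
    - exists (IZR b), (IZR a). rewrite Rplus_0_r, Rminus_0_r. auto.
    - exists (IZR a), (IZR b). rewrite Rplus_0_r, Rminus_0_r. repeat split; apply (f_equal G); unfold Rdiv; ring. }
  split.
  - intros k Hk. cut (8 <= znorm k ^ 2 / 4 ^ n); [intros Hz8; now rewrite (proj1 (Z _ Hz8))|]. rewrite znorm_sq.
    apply (Rmult_le_reg_r (4 ^ n)); auto. unfold Rdiv. rewrite Rmult_assoc, Rinv_l, Rmult_1_r by lra.
    assert (Q : forall a, (Z.of_nat (3 * 2 ^ n) < Z.abs a)%Z -> 8 * 4 ^ n <= IZR a ^ 2).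
    { intros a Ha. apply IZR_lt in Ha. rewrite <- INR_IZR_INZ, mult_INR, INR_pow2, abs_IZR in Ha.
      simpl INR in Ha. rewrite <- pow2_abs, P4. nra. }
    pose proof (pow2_ge_0 (IZR (fst k))). pose proof (pow2_ge_0 (IZR (snd k))).
    destruct (Z_le_gt_dec (Z.abs (fst k)) (Z.of_nat (3 * 2 ^ n))) as [Ha|Ha].
    + destruct (Z_le_gt_dec (Z.abs (snd k)) (Z.of_nat (3 * 2 ^ n))) as [Hb|Hb].
      * exfalso. apply Hk. split; auto.
      * pose proof (Q (snd k) ltac:(lia)). lra.
    + pose proof (Q (fst k) ltac:(lia)). lra.
  - intros k. rewrite Cmod_R. specialize (B0 (znorm k ^ 2 / 4 ^ n)). lra.
  - intros e k He. destruct (Eg e k He) as (b & x & E1 & E2 & _). rewrite E1, E2, <- RtoC_minus, Cmod_R.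
    destruct (diff_bounds (g b) (g1 b) (g2 b) _ _ x (K1 b) (K2 b) (Bg1 b) (Bg2 b)) as [Q _].
    apply (Rmult_le_compat_l (2 ^ n)) in Q; [|lra].
    replace (2 ^ n * (2 * (6 * A / 2 ^ n))) with (12 * A) in Q by (field; lra). lra.
  - intros e k He. unfold dd. destruct (Eg e k He) as (b & x & E1 & E2 & E3).
    rewrite E1, E2, E3, <- RtoC_mult, <- RtoC_plus, <- RtoC_minus, Cmod_R.
    destruct (diff_bounds (g b) (g1 b) (g2 b) _ _ x (K1 b) (K2 b) (Bg1 b) (Bg2 b)) as [_ Q].
    apply (Rmult_le_compat_l (4 ^ n)) in Q; [|lra].
    replace (4 ^ n * (2 * (34 * A / 4 ^ n))) with (68 * A) in Q by (field; lra). lra.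
Qed.

Lemma bounded_compact (f : R -> R) a b : a <= b -> (forall x, continuous f x) ->
  exists M, 0 < M /\ forall x, a <= x <= b -> Rabs (f x) <= M.
Proof.
  intros Hab Hc.
  destruct (continuity_ab_maj (fun x => Rabs (f x)) a b Hab) as (c & H & _).
  { intros x _. apply continuity_pt_filterlim. apply continuous_Rabs_comp, Hc. }
  exists (Rabs (f c) + 1). split.
  - pose proof (Rabs_pos (f c)). lra.
  - intros x Hx. specialize (H x Hx). lra.
Qed.

(** [rho] lives on 3/4 <= r <= 8/3, that is 9/16 <= s <= 64/9 for s = r^2. The square root is
    therefore harmless, and the extra profile [e] need only be controlled for 1/2 < s <= 8, which
    admits profiles singular at 0 such as 1/s. *)
Lemma rho_mult (rho : R -> R) : smooth rho ->
  (forall r, (Rabs r <= 3/4 \/ 8/3 <= Rabs r) -> rho r = 0) ->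
  exists C, 0 < C /\ forall n A (e e' e'' : R -> R),
    (forall s, 1/2 < s -> is_derive e s (e' s)) -> (forall s, 1/2 < s -> is_derive e' s (e'' s)) ->
    (forall s, 1/2 < s <= 8 -> Rabs (e s) <= A /\ Rabs (e' s) <= A /\ Rabs (e'' s) <= A) ->
    goodmult n 3 (C * A) (fun k => RtoC (rho (znorm k / 2 ^ n) * e (znorm k ^ 2 / 4 ^ n))).
Proof.
  intros Sm Z.
  set (d1 := Derive rho). set (d2 := Derive d1).
  assert (D1 : forall x, is_derive rho x (d1 x)) by (intros x; apply Derive_correct, (Sm 1%nat x)).
  assert (D2 : forall x, is_derive d1 x (d2 x)) by (intros x; apply Derive_correct, (Sm 2%nat x)).
  assert (D3 : forall x, continuous d2 x).
  { intros x. apply (ex_derive_continuous (K := R_AbsRing) (V := R_NormedModule)). apply (Sm 3%nat x). }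
  destruct (bounded_compact rho 0 3 ltac:(lra) (fun x => is_derive_cont _ _ _ (D1 x))) as (M0 & P0 & B0).
  destruct (bounded_compact d1 0 3 ltac:(lra) (fun x => is_derive_cont _ _ _ (D2 x))) as (M1 & P1 & B1).
  destruct (bounded_compact d2 0 3 ltac:(lra) D3) as (M2 & P2 & B2).
  set (M := M0 + M1 + M2).
  assert (L0 : forall r, (Rabs r < 3/4 \/ 8/3 < Rabs r) -> locally r (fun x => rho x = 0)).
  { intros r [Hr|Hr].
    - exists (mkposreal (3/4 - Rabs r) ltac:(lra)). intros y Hy. apply Z. left.
      change (Rabs (y - r) < 3/4 - Rabs r) in Hy.
      pose proof (Rabs_triang_inv y r). lra.
    - exists (mkposreal (Rabs r - 8/3) ltac:(lra)). intros y Hy. apply Z. right.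
      change (Rabs (y - r) < Rabs r - 8/3) in Hy.
      pose proof (Rabs_triang_inv r y). rewrite Rabs_minus_sym in Hy. lra. }
  assert (Z1 : forall r, (Rabs r < 3/4 \/ 8/3 < Rabs r) -> d1 r = 0).
  { intros r Hr. unfold d1. rewrite (Derive_ext_loc rho (fun _ => 0)) by auto. apply Derive_const. }
  assert (L1 : forall r, (Rabs r < 3/4 \/ 8/3 < Rabs r) -> locally r (fun x => d1 x = 0)).
  { intros r Hr. pose proof (locally_locally _ _ (L0 r Hr)) as LL. revert LL. apply filter_imp.
    intros y Hy. unfold d1. rewrite (Derive_ext_loc rho (fun _ => 0)) by auto. apply Derive_const. }
  assert (Z2 : forall r, (Rabs r < 3/4 \/ 8/3 < Rabs r) -> d2 r = 0).
  { intros r Hr. unfold d2. rewrite (Derive_ext_loc d1 (fun _ => 0)) by auto. apply Derive_const. }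
  exists (68 * (8 * M)). split; [unfold M; lra|]. intros n A e e' e'' He He' Hb.
  set (f := fun s => rho (sqrt s)). set (f1 := fun s => d1 (sqrt s) * / (2 * sqrt s)).
  set (f2 := fun s => d2 (sqrt s) * / (2 * sqrt s) * / (2 * sqrt s) - d1 (sqrt s) * / (4 * s * sqrt s)).
  assert (sq : forall s, 1/2 < s -> 2/3 < sqrt s).
  { intros s Hs. apply Rsqr_incrst_0; [|lra|apply sqrt_pos]. rewrite Rsqr_sqrt by lra. unfold Rsqr. lra. }
  assert (Df : forall s, 1/2 < s -> is_derive f s (f1 s)).
  { intros s Hs. pose proof (sq s Hs). unfold f, f1. evar_last.
    - apply (is_derive_comp rho sqrt); [apply D1|]. apply is_derive_sqrt; [apply is_derive_id|lra].
    - unfold scal; simpl; unfold mult, one; simpl. field. lra. }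
  assert (Df1 : forall s, 1/2 < s -> is_derive f1 s (f2 s)).
  { intros s Hs. pose proof (sq s Hs) as Hq. unfold f1, f2. evar_last.
    - apply (is_derive_mult (K := R_AbsRing) (fun s => d1 (sqrt s)) (fun s => / (2 * sqrt s))).
      + apply (is_derive_comp d1 sqrt); [apply D2|]. apply is_derive_sqrt; [apply is_derive_id|lra].
      + instantiate (1 := - / (4 * s * sqrt s)). auto_derive.
        * split; [lra|]. split; auto. apply Rgt_not_eq. lra.
        * assert (E : s = sqrt s * sqrt s) by (rewrite sqrt_sqrt; lra).
          set (q := sqrt s) in *. rewrite E. field. lra.
      + intros; apply Rmult_comm.
    - unfold scal, plus; simpl; unfold mult, one; simpl. field. repeat split; lra. }
  assert (zf : forall s, (1/2 < s < 9/16 \/ 8 <= s) -> f s = 0 /\ f1 s = 0 /\ f2 s = 0).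
  { intros s Hs. assert (H : Rabs (sqrt s) < 3/4 \/ 8/3 < Rabs (sqrt s)).
    { rewrite Rabs_pos_eq by apply sqrt_pos. destruct Hs as [Hs|Hs]; [left|right];
        (apply Rsqr_incrst_0; [|try apply sqrt_pos; lra|try apply sqrt_pos; lra]);
        rewrite Rsqr_sqrt by lra; unfold Rsqr; lra. }
    unfold f, f1, f2. rewrite (Z1 _ H), (Z2 _ H), (Z (sqrt s)) by (destruct H; [left|right]; lra).
    repeat split; ring. }
  assert (bf : forall s, 1/2 < s <= 8 -> Rabs (f s) <= M /\ Rabs (f1 s) <= M /\ Rabs (f2 s) <= 2 * M).
  { intros s Hs. pose proof (sq s (proj1 Hs)) as Hq.
    assert (Hq3 : sqrt s <= 3).
    { apply Rsqr_incr_0; [|apply sqrt_pos|lra]. rewrite Rsqr_sqrt by lra. unfold Rsqr. lra. }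
    specialize (B0 (sqrt s) ltac:(lra)). specialize (B1 (sqrt s) ltac:(lra)). specialize (B2 (sqrt s) ltac:(lra)).
    unfold f, f1, f2. set (q := sqrt s) in *.
    assert (i1 : 0 < / (2 * q) <= 1).
    { split; [apply Rinv_0_lt_compat; lra|]. rewrite <- Rinv_1. apply Rinv_le_contravar; lra. }
    assert (i2 : 0 < / (4 * s * q) <= 1).
    { split; [apply Rinv_0_lt_compat; nra|]. rewrite <- Rinv_1. apply Rinv_le_contravar; nra. }
    assert (ab : forall x i K, Rabs x <= K -> 0 < i <= 1 -> Rabs (x * i) <= K).
    { intros x i K Hx Hi. rewrite Rabs_mult, (Rabs_pos_eq i) by lra. pose proof (Rabs_pos x). nra. }
    unfold M. repeat split; [lra|generalize (ab _ _ _ B1 i1); lra|].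
    unfold Rminus. eapply Rle_trans; [apply Rabs_triang|]. rewrite Rabs_Ropp.
    generalize (ab _ _ _ (ab _ _ _ B2 i1) i1) (ab _ _ _ B1 i2). lra. }
  assert (A0 : 0 <= A) by (eapply Rle_trans; [apply Rabs_pos|apply (Hb 1); lra]).
  assert (M0' : 0 <= M) by (unfold M; lra).
  (* The product vanishes on (1/2, 9/16), so its extension by 0 to s <= 1/2 is still twice
     differentiable. *)
  set (cut := fun (h : R -> R) s => if Rle_dec s (1/2) then 0 else h s).
  assert (cutE : forall h s, 1/2 < s -> cut h s = h s).
  { intros h s Hs. unfold cut. destruct (Rle_dec s (1/2)); auto. lra. }
  assert (cutD : forall h h', (forall s, 1/2 < s -> is_derive h s (h' s)) ->
     (forall s, 1/2 < s < 9/16 -> h s = 0 /\ h' s = 0) -> forall s, is_derive (cut h) s (cut h' s)).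
  { intros h h' Dh Zh s. destruct (Rlt_dec (1/2) s) as [Hs|Hs].
    - rewrite cutE by auto. apply is_derive_ext_loc with h; [|apply Dh; auto].
      exists (mkposreal (s - 1/2) ltac:(lra)). intros y Hy. change (Rabs (y - s) < s - 1/2) in Hy.
      symmetry; apply cutE. apply Rabs_def2 in Hy. lra.
    - replace (cut h' s) with 0 by (unfold cut; destruct (Rle_dec s (1/2)); lra).
      apply is_derive_ext_loc with (fun _ => 0); [|apply (is_derive_const (K := R_AbsRing) (V := R_NormedModule) 0 s)].
      exists (mkposreal (1/16) ltac:(lra)). intros y Hy. change (Rabs (y - s) < 1/16) in Hy.
      apply Rabs_def2 in Hy. unfold cut. destruct (Rle_dec y (1/2)); auto. symmetry. apply Zh. lra. }
  set (g := fun s => f s * e s). set (g1 := fun s => f1 s * e s + f s * e' s).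
  set (g2 := fun s => (f2 s * e s + f1 s * e' s) + (f1 s * e' s + f s * e'' s)).
  assert (Dg : forall s, 1/2 < s -> is_derive g s (g1 s)).
  { intros s Hs. apply (is_derive_mult (K := R_AbsRing) f e); auto. intros; apply Rmult_comm. }
  assert (Dg1 : forall s, 1/2 < s -> is_derive g1 s (g2 s)).
  { intros s Hs. apply (is_derive_plus (V := R_NormedModule) (fun s => f1 s * e s) (fun s => f s * e' s)).
    - apply (is_derive_mult (K := R_AbsRing) f1 e); auto. intros; apply Rmult_comm.
    - apply (is_derive_mult (K := R_AbsRing) f e'); auto. intros; apply Rmult_comm. }
  assert (zg : forall s, (1/2 < s < 9/16 \/ 8 <= s) -> g s = 0 /\ g1 s = 0 /\ g2 s = 0).
  { intros s Hs. destruct (zf s Hs) as (z0 & z1 & z2). unfold g, g1, g2. rewrite z0, z1, z2. repeat split; ring. }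
  assert (ab : forall x y K, Rabs x <= K -> Rabs y <= A -> Rabs (x * y) <= K * A).
  { intros x y K Hx Hy. rewrite Rabs_mult. apply Rmult_le_compat; auto using Rabs_pos. }
  assert (bg : forall s, 1/2 < s <= 8 -> Rabs (g s) <= 8 * M * A /\ Rabs (g1 s) <= 8 * M * A /\ Rabs (g2 s) <= 8 * M * A).
  { intros s Hs. destruct (bf s Hs) as (b0 & b1 & b2). destruct (Hb s Hs) as (h0 & h1 & h2).
    unfold g, g1, g2. assert (0 <= M * A) by now apply Rmult_le_pos.
    repeat split.
    - generalize (ab _ _ _ b0 h0). lra.
    - eapply Rle_trans; [apply Rabs_triang|]. generalize (ab _ _ _ b1 h0) (ab _ _ _ b0 h1). lra.
    - eapply Rle_trans; [apply Rabs_triang|].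
      pose proof (Rabs_triang (f2 s * e s) (f1 s * e' s)). pose proof (Rabs_triang (f1 s * e' s) (f s * e'' s)).
      generalize (ab _ _ _ b2 h0) (ab _ _ _ b1 h1) (ab _ _ _ b0 h2). lra. }
  assert (bc : forall h, (forall s, 8 <= s -> h s = 0) -> (forall s, 1/2 < s <= 8 -> Rabs (h s) <= 8 * M * A) ->
     forall s, Rabs (cut h s) <= 8 * M * A).
  { intros h Hz Hh s. unfold cut. assert (0 <= M * A) by now apply Rmult_le_pos.
    destruct (Rle_dec s (1/2)) as [Hs|Hs]; [rewrite Rabs_R0; lra|].
    destruct (Rle_dec s 8) as [Hs'|Hs']; [apply Hh; lra|]. rewrite Hz by lra. rewrite Rabs_R0; lra. }
  replace (68 * (8 * M) * A) with (68 * (8 * M * A)) by ring.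
  apply goodmult_ext with (fun k => RtoC (cut g (znorm k ^ 2 / 4 ^ n))).
  - intros k. f_equal. pose proof (pow2_ge1 n).
    assert (E : sqrt (znorm k ^ 2 / 4 ^ n) = znorm k / 2 ^ n).
    { replace (znorm k ^ 2 / 4 ^ n) with ((znorm k / 2 ^ n) ^ 2) by (rewrite <- pow2_sq; field; lra).
      apply sqrt_pow2. apply Rmult_le_pos; [apply znorm_ge0|apply Rlt_le, Rinv_0_lt_compat; lra]. }
    unfold cut. destruct (Rle_dec _ (1/2)) as [Hs|Hs].
    + rewrite Z; [ring|]. left. rewrite <- E. rewrite Rabs_pos_eq by apply sqrt_pos.
      apply Rle_trans with (sqrt (9/16)); [apply sqrt_le_1_alt; lra|].
      replace (9/16) with ((3/4)^2) by lra. rewrite sqrt_pow2; lra.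
    + unfold g, f. now rewrite E.
  - apply goodmult_radial with (cut g1) (cut g2).
    + apply cutD; auto. intros s Hs. destruct (zg s (or_introl Hs)) as (? & ? & ?). auto.
    + apply cutD; auto. intros s Hs. destruct (zg s (or_introl Hs)) as (? & ? & ?). auto.
    + apply bc; [intros; apply zg; auto|intros; apply bg; auto].
    + apply bc; [intros; apply zg; auto|intros; apply bg; auto].
    + apply bc; [intros; apply zg; auto|intros; apply bg; auto].
    + intros s Hs. rewrite !cutE by lra. apply zg; auto.
Qed.

(** * Littlewood--Paley blocks and Besov balls *)

(** The dyadic weight 2^{(n-1)a} of [besov_le]. *)
Definition wt (a : R) (n : nat) : R := Rpower 2 ((INR n - 1) * a).

Lemma wt_pos a n : 0 < wt a n.
Proof. apply exp_pos. Qed.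
Lemma wt_plus a b n : wt (a + b) n = wt a n * wt b n.
Proof. unfold wt. rewrite <- Rpower_plus. f_equal. ring. Qed.
Lemma wt_opp a n : wt (- a) n * wt a n = 1.
Proof. rewrite <- wt_plus. unfold wt. rewrite Rplus_opp_l, Rmult_0_r. apply Rpower_O. lra. Qed.
Lemma Rpower2_le x y : x <= y -> Rpower 2 x <= Rpower 2 y.
Proof. intros H. apply Rle_Rpower; lra. Qed.
Lemma wt_near a n i : (i <= n + 1)%nat -> (n <= i + 1)%nat -> wt a n <= Rpower 2 (Rabs a) * wt a i.
Proof.
  intros H1 H2. unfold wt. rewrite <- Rpower_plus. apply Rpower2_le.
  apply le_INR in H1, H2. rewrite plus_INR in H1, H2. simpl in H1, H2.
  set (x := INR n - INR i). assert (Hx : -1 <= x <= 1) by (unfold x; lra).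
  assert (x * a <= Rabs a).
  { pose proof (Rle_abs (- a)). rewrite Rabs_Ropp in *.
    destruct (Rle_dec 0 a); [rewrite Rabs_pos_eq in * by lra|rewrite Rabs_left in * by lra]; nra. }
  replace ((INR n - 1) * a) with ((INR i - 1) * a + x * a) by (unfold x; ring). lra.
Qed.
Lemma wt_mono a n i : 0 <= a -> (n <= i)%nat -> wt (- a) i <= wt (- a) n.
Proof. intros Ha H. apply Rpower2_le. apply le_INR in H. nra. Qed.
Lemma wt_neg_le a n : 0 <= a -> wt (- a) n <= Rpower 2 a.
Proof. intros Ha. apply Rpower2_le. pose proof (pos_INR n). nra. Qed.
Lemma wt2 n : wt 2 n = 4 ^ n / 4.
Proof.
  unfold wt. replace ((INR n - 1) * 2) with (INR n * 2 + (-2)) by ring.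
  rewrite Rpower_plus. replace (INR n * 2) with (INR (n * 2)) by (rewrite mult_INR; simpl; ring).
  rewrite Rpower_pow by lra. rewrite Nat.mul_comm, pow_mult.
  replace (Rpower 2 (-2)) with (/ 4); [unfold Rdiv; f_equal; f_equal; simpl; ring|].
  replace (-2) with (- INR 2) by (simpl; ring). rewrite Rpower_Ropp, Rpower_pow by lra. f_equal. simpl; ring.
Qed.

Lemma ev_close B f g eps x : (forall k, inbox B k -> Cmod (Cminus (f k) (g k)) <= eps) ->
  Cmod (Cminus (ev B f x) (ev B g x)) <= (2 * INR B + 1) ^ 2 * eps.
Proof.
  intros H. rewrite <- ev_minus. now apply (Cmod_ev B (fun k => Cminus (f k) (g k))).
Qed.

(** Extracting the mode [k] is a multiplier whose kernel is the exponential itself, of L^1 norm 1;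
    the 2 is that of [ev_cmul_bound]. *)
Lemma coef_bound B f M k : inbox B k -> (forall x, Cmod (ev B f x) <= M) -> Cmod (f k) <= 2 * M.
Proof.
  intros Hk H.
  set (d := fun l : Z * Z => if Z.eqb (fst l) (fst k) then if Z.eqb (snd l) (snd k) then RtoC 1 else RtoC 0 else RtoC 0).
  assert (dk : d k = RtoC 1) by (unfold d; now rewrite !Z.eqb_refl).
  assert (dn : forall l, l <> k -> d l = RtoC 0).
  { intros l Hl. unfold d. destruct (Z.eqb_spec (fst l) (fst k)); auto.
    destruct (Z.eqb_spec (snd l) (snd k)); auto. exfalso. apply Hl. destruct l, k; simpl in *; congruence. }
  assert (S : supp B d) by (intros l Hl; apply dn; congruence).
  assert (E : forall y, ev B d y = ek k y).
  { intros y. unfold ev. rewrite (Bsum_single B k); auto.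
    - rewrite dk. ring.
    - intros l Hl. rewrite dn by auto. ring. }
  assert (L : L1 B d = 1).
  { unfold L1. rewrite (TI_ext _ (fun _ => 1)); [apply TI_const|]. intros. now rewrite E, Cmod_ek. }
  pose proof (ev_cmul_bound B B d f M (0, 0) S H) as Q. rewrite L, Rmult_1_l in Q.
  replace (ev B (cmul d f) (0, 0)) with (Cmult (f k) (ek k (0, 0))) in Q.
  - now rewrite Cmod_mult, Cmod_ek, Rmult_1_r in Q.
  - unfold ev. rewrite (Bsum_single B k); auto.
    + unfold cmul. rewrite dk. ring.
    + intros l Hl. unfold cmul. rewrite dn by auto. ring.
Qed.

(** Indices of the blocks that can meet block n; [blk_overlap] shows that there are no others. *)
Definition nearl (n : nat) : list nat := match n with O => 0 :: 1 :: nil | S m => m :: S m :: S (S m) :: nil end%nat.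
Lemma nearl_spec n i : In i (nearl n) <-> (i <= n + 1 /\ n <= i + 1)%nat.
Proof. destruct n; simpl; lia. Qed.
Lemma NoDup_nearl n : NoDup (nearl n).
Proof. destruct n; simpl; repeat constructor; simpl; lia. Qed.
Lemma length_nearl n : (length (nearl n) <= 3)%nat.
Proof. destruct n; simpl; lia. Qed.

Lemma RtoC_Rsum {A} (l : list A) f : RtoC (Rsum l f) = Csum l (fun a => RtoC (f a)).
Proof.
  induction l as [|a l IH]; [reflexivity|]. rewrite Rsum_cons, Csum_cons, <- IH. apply RtoC_plus.
Qed.
Lemma Rsum_support {A} (l l' : list A) (f : A -> R) :
  NoDup l -> NoDup l' -> (forall a, f a <> 0 -> (In a l <-> In a l')) -> Rsum l f = Rsum l' f.
Proof.
  intros N N' H. apply RtoC_inj. rewrite !RtoC_Rsum. apply Csum_support; auto.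
  intros a Ha. apply H. intros E. apply Ha. now rewrite E.
Qed.

Lemma ev_bound_list {A} B (l : list A) (g : A -> fdist) x c :
  (forall a, In a l -> Cmod (ev B (g a) x) <= c) ->
  Cmod (ev B (fun k => Csum l (fun a => g a k)) x) <= INR (length l) * c.
Proof. intros H. rewrite ev_Csum. now apply Cmod_Csum_le. Qed.

Section LP.
Variables chi rho : R -> R.
Hypothesis HD : dyadic_partition chi rho.

Notation b := (blk chi rho).
Notation bl := (LPblock chi rho).

Lemma blk_bounds n k : 0 <= b n k <= 1.
Proof. destruct HD as (_ & _ & H1 & H2 & _). destruct n; simpl; auto. Qed.

Lemma blk_hi n k : b n k <> 0 -> znorm k < 4/3 * 2 ^ n.
Proof.
  destruct HD as (_ & _ & _ & _ & H1 & H2 & _). intros H. apply Rnot_le_lt. intros Hz. apply H.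
  pose proof (znorm_ge0 k). destruct n as [|n]; simpl.
  - apply H1. rewrite Rabs_pos_eq by auto. simpl in Hz. lra.
  - apply H2. right. pose proof (pow2_ge1 n). rewrite Rabs_pos_eq.
    + apply (Rmult_le_reg_r (2 ^ n)); [lra|]. unfold Rdiv. rewrite (Rmult_assoc (znorm k)), Rinv_l, Rmult_1_r by lra.
      simpl in Hz. lra.
    + apply Rmult_le_pos; auto. apply Rlt_le, Rinv_0_lt_compat. lra.
Qed.
Lemma blk_lo n k : (1 <= n)%nat -> b n k <> 0 -> 3/8 * 2 ^ n < znorm k.
Proof.
  destruct HD as (_ & _ & _ & _ & H1 & H2 & _). intros Hn H. apply Rnot_le_lt. intros Hz. apply H.
  pose proof (znorm_ge0 k). destruct n as [|n]; [lia|]. simpl.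
  apply H2. left. pose proof (pow2_ge1 n). rewrite Rabs_pos_eq.
  - apply (Rmult_le_reg_r (2 ^ n)); [lra|]. unfold Rdiv. rewrite (Rmult_assoc (znorm k)), Rinv_l, Rmult_1_r by lra.
    simpl in Hz. lra.
  - apply Rmult_le_pos; auto. apply Rlt_le, Rinv_0_lt_compat. lra.
Qed.

Lemma znorm_comp k : Rabs (IZR (fst k)) <= znorm k /\ Rabs (IZR (snd k)) <= znorm k.
Proof.
  unfold znorm. split; rewrite <- sqrt_Rsqr_abs; apply sqrt_le_1_alt; unfold Rsqr; simpl in *; nra.
Qed.
Lemma inbox_znorm B k : znorm k < INR B + 1 -> inbox B k.
Proof.
  intros H. destruct (znorm_comp k) as [H1 H2].
  assert (Q : forall a, Rabs (IZR a) <= znorm k -> (Z.abs a <= Z.of_nat B)%Z).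
  { intros a Ha. apply Z.lt_succ_r. apply lt_IZR. rewrite abs_IZR, succ_IZR, <- INR_IZR_INZ. lra. }
  split; auto.
Qed.
Lemma blk_inbox n k : b n k <> 0 -> inbox (3 * 2 ^ n) k.
Proof.
  intros H. apply inbox_znorm. apply blk_hi in H. rewrite mult_INR, INR_pow2.
  pose proof (pow2_ge1 n). simpl INR. lra.
Qed.
Lemma blk_out n k : ~ inbox (3 * 2 ^ n) k -> b n k = 0.
Proof. intros H. apply NNPP. intros E. apply H. now apply blk_inbox. Qed.

Lemma znorm_opp k : znorm (kopp k) = znorm k.
Proof. unfold znorm, kopp; simpl. rewrite !opp_IZR. f_equal. ring. Qed.
Lemma blk_opp n k : b n (kopp k) = b n k.
Proof. destruct n; simpl; now rewrite znorm_opp. Qed.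

(** Block n stays below 4/3 2^n, while block n+2 starts above 3/8 2^(n+2) = 3/2 2^n. *)
Lemma blk_overlap n i k : b n k <> 0 -> b i k <> 0 -> (i <= n + 1)%nat.
Proof.
  intros H1 H2. apply Nat.nlt_ge. intros Hi. apply blk_hi in H1. apply blk_lo in H2; [|lia].
  assert (2 ^ (n + 2) <= 2 ^ i) by (apply Rle_pow; [lra|lia]).
  rewrite pow_add in H. simpl in H. pose proof (pow2_ge1 n). lra.
Qed.

Lemma sN_Rsum N k : sN chi rho N k = Rsum (seq 0 (S N)) (fun n => b n k).
Proof. reflexivity. Qed.

Lemma sN_sum_n N k : sN chi rho (S N) k = chi (znorm k) + sum_n (fun j => rho (znorm k / 2 ^ j)) N.
Proof.
  induction N as [|N IH].
  - unfold sN; simpl. rewrite sum_O. simpl. lra.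
  - rewrite sum_Sn. unfold plus; simpl. rewrite <- Rplus_assoc, <- IH.
    rewrite !sN_Rsum. rewrite (seq_S (S (S N))). rewrite Rsum_app. unfold Rsum at 2. simpl. lra.
Qed.

(** For |k| <= 3/4 2^N every later block vanishes at k, so the partial sums are stationary from N on
    and must equal the sum 1 of the series. *)
Lemma sN_one N k : znorm k <= 3/4 * 2 ^ N -> sN chi rho N k = 1.
Proof.
  destruct HD as (_ & _ & _ & _ & _ & H2 & HS). intros Hz.
  pose proof (HS (znorm k) (znorm_ge0 k)) as Hs.
  assert (Zj : forall j, (N <= j)%nat -> rho (znorm k / 2 ^ j) = 0).
  { intros j Hj. apply H2. left. pose proof (pow2_ge1 j). pose proof (znorm_ge0 k).
    rewrite Rabs_pos_eq by (apply Rmult_le_pos; auto; apply Rlt_le, Rinv_0_lt_compat; lra).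
    apply (Rmult_le_reg_r (2 ^ j)); [lra|]. unfold Rdiv. rewrite (Rmult_assoc (znorm k)), Rinv_l, Rmult_1_r by lra.
    assert (2 ^ N <= 2 ^ j) by (apply Rle_pow; [lra|lia]). lra. }
  assert (C : forall j, sN chi rho (N + j) k = sN chi rho N k).
  { induction j as [|j IH]; [f_equal; lia|]. rewrite <- IH, !sN_Rsum.
    replace (N + S j)%nat with (S (N + j)) by lia. rewrite (seq_S (S (N + j))), Rsum_app.
    unfold Rsum at 2. simpl. rewrite Zj by lia. lra. }
  assert (L : is_lim_seq (sum_n (fun j => rho (znorm k / 2 ^ j))) (sN chi rho N k - chi (znorm k))).
  { apply is_lim_seq_incr_n with N. apply is_lim_seq_ext with (fun _ => sN chi rho N k - chi (znorm k)).
    - intros n. rewrite <- (C (S n)). replace (N + S n)%nat with (S (n + N)) by lia. rewrite sN_sum_n. lra.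
    - apply is_lim_seq_const. }
  assert (E : Finite (sN chi rho N k - chi (znorm k)) = Finite (1 - chi (znorm k))).
  { rewrite <- (is_lim_seq_unique _ _ L). apply is_lim_seq_unique. apply Hs. }
  injection E. lra.
Qed.

Lemma sN_out N k : ~ inbox (3 * 2 ^ N) k -> sN chi rho N k = 0.
Proof.
  intros H. rewrite sN_Rsum. transitivity (Rsum (seq 0 (S N)) (fun _ => 0)).
  - apply Rsum_ext. intros n Hn. apply in_seq in Hn. apply blk_out. intros Hb. apply H.
    assert (2 ^ n <= 2 ^ N)%nat by (apply Nat.pow_le_mono_r; lia).
    destruct Hb. split; lia.
  - rewrite Rsum_const. ring.
Qed.
Lemma pow2_unbounded x : exists N, x <= 2 ^ N.
Proof.
  destruct (Pow_x_infinity 2 ltac:(rewrite Rabs_pos_eq; lra) x) as [N HN].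
  exists N. specialize (HN N (le_n N)). rewrite Rabs_pos_eq in HN by (apply pow_le; lra). lra.
Qed.
Lemma sN_eventually k : exists N0, forall N, (N0 <= N)%nat -> sN chi rho N k = 1.
Proof.
  destruct (pow2_unbounded (4/3 * znorm k)) as [N0 H]. exists N0. intros N HN. apply sN_one.
  assert (2 ^ N0 <= 2 ^ N) by (apply Rle_pow; [lra|lia]). lra.
Qed.

Lemma blk_fat n k : b n k * Rsum (nearl n) (fun i => b i k) = b n k.
Proof.
  destruct (classic (b n k = 0)) as [->|Hn]; [ring|].
  destruct (sN_eventually k) as [N0 HN].
  rewrite (Rsum_support (nearl n) (seq 0 (S (Nat.max N0 (n + 1))))).
  - rewrite <- sN_Rsum, HN by lia. ring.
  - apply NoDup_nearl.
  - apply seq_NoDup.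
  - intros i Hi. pose proof (blk_overlap _ _ _ Hn Hi). pose proof (blk_overlap _ _ _ Hi Hn).
    rewrite nearl_spec, in_seq. lia.
Qed.

Lemma bl_ev n B f x : (3 * 2 ^ n <= B)%nat -> bl n f x = ev B (mul (b n) f) x.
Proof.
  intros H. rewrite LPblock_ev.
  assert (S : supp (3 * 2 ^ n) (mul (b n) f)) by (apply supp_mul_l, blk_out).
  apply ev_supp; auto. apply supp_le with (3 * 2 ^ n)%nat; auto.
Qed.

Lemma bl_plus n f g x : bl n (fun k => Cplus (f k) (g k)) x = Cplus (bl n f x) (bl n g x).
Proof. rewrite !LPblock_ev, <- ev_plus. apply ev_ext. intros; unfold mul; ring. Qed.
Lemma bl_minus n f g x : bl n (fun k => Cminus (f k) (g k)) x = Cminus (bl n f x) (bl n g x).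
Proof. rewrite !LPblock_ev, <- ev_minus. apply ev_ext. intros; unfold mul; ring. Qed.
Lemma bl_scal n c f x : bl n (fun k => Cmult c (f k)) x = Cmult c (bl n f x).
Proof. rewrite !LPblock_ev, <- ev_scal. apply ev_ext. intros; unfold mul; ring. Qed.
Lemma bl_ext n f g x : (forall k, f k = g k) -> bl n f x = bl n g x.
Proof. intros H. rewrite !LPblock_ev. apply ev_ext. intros; unfold mul; now rewrite H. Qed.

Notation bes := (besov_le chi rho).

Lemma bes_iff a f M : bes a f M <-> forall n x, Cmod (bl n f x) <= M * wt (- a) n.
Proof.
  split; intros H n x; specialize (H n x); fold (wt a n) in *; pose proof (wt_opp a n) as E;
    pose proof (wt_pos a n); pose proof (wt_pos (- a) n).
  - apply (Rmult_le_reg_l (wt a n)); auto.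
    replace (wt a n * (M * wt (- a) n)) with (M * (wt (- a) n * wt a n)) by ring. rewrite E. lra.
  - apply (Rmult_le_reg_l (wt (- a) n)); auto.
    rewrite <- Rmult_assoc, E. lra.
Qed.
Lemma bes_nonneg a f M : bes a f M -> 0 <= M.
Proof.
  intros H. specialize (H 0%nat (0, 0)). eapply Rle_trans; [|apply H].
  apply Rmult_le_pos; [apply Rlt_le, exp_pos|apply Cmod_ge_0].
Qed.
Lemma bes_le a f M M' : M <= M' -> bes a f M -> bes a f M'.
Proof. intros H H1 n x. eapply Rle_trans; [apply H1|auto]. Qed.
Lemma bes_ext a f g M : (forall k, f k = g k) -> bes a f M -> bes a g M.
Proof. intros E H n x. rewrite <- (bl_ext n f g x) by auto. apply H. Qed.
Lemma bes_plus a f g M M' : bes a f M -> bes a g M' -> bes a (fun k => Cplus (f k) (g k)) (M + M').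
Proof.
  rewrite !bes_iff. intros H H' n x. rewrite bl_plus. eapply Rle_trans; [apply Cmod_triangle|].
  specialize (H n x). specialize (H' n x). lra.
Qed.
Lemma bes_minus a f g M M' : bes a f M -> bes a g M' -> bes a (fun k => Cminus (f k) (g k)) (M + M').
Proof.
  rewrite !bes_iff. intros H H' n x. rewrite bl_minus. unfold Cminus. eapply Rle_trans; [apply Cmod_triangle|].
  rewrite Cmod_opp. specialize (H n x). specialize (H' n x). lra.
Qed.
Lemma bes_scal a f M c : bes a f M -> bes a (fun k => Cmult c (f k)) (Cmod c * M).
Proof.
  rewrite !bes_iff. intros H n x. rewrite bl_scal, Cmod_mult, Rmult_assoc.
  apply Rmult_le_compat_l; [apply Cmod_ge_0|auto].
Qed.
Lemma bes_0 a f M : 0 <= M -> (forall k, f k = RtoC 0) -> bes a f M.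
Proof.
  intros HM H. apply bes_iff. intros n x. rewrite LPblock_ev.
  replace (ev _ _ x) with (RtoC 0).
  - rewrite Cmod_0. apply Rmult_le_pos; auto. apply Rlt_le, wt_pos.
  - symmetry. apply Csum_0. intros k _. unfold mul. rewrite H. ring.
Qed.
Lemma bes_Csum {A} a (l : list A) (f : A -> fdist) M : (forall i, In i l -> bes a (f i) M) ->
  bes a (fun k => Csum l (fun i => f i k)) (INR (length l) * M).
Proof.
  induction l as [|i l IH]; intros H.
  - apply bes_0; [simpl; lra|reflexivity].
  - replace (INR (length (i :: l)) * M) with (M + INR (length l) * M) by (simpl length; rewrite S_INR; ring).
    apply (bes_plus a (f i) (fun k => Csum l (fun i => f i k))); auto with datatypes.
Qed.
Lemma bes_weaken a a' f M : a' <= a -> bes a f M -> bes a' f (Rpower 2 (a - a') * M).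
Proof.
  intros Ha H. pose proof (bes_nonneg _ _ _ H) as M0. rewrite bes_iff in *. intros n x. specialize (H n x).
  eapply Rle_trans; [apply H|]. replace (- a) with (- (a - a') + - a') by ring. rewrite wt_plus.
  pose proof (wt_neg_le (a - a') n ltac:(lra)). pose proof (wt_pos (- a') n).
  replace (Rpower 2 (a - a') * M * wt (- a') n) with (M * (Rpower 2 (a - a') * wt (- a') n)) by ring.
  apply Rmult_le_compat_l; auto. apply Rmult_le_compat_r; lra.
Qed.

(** A block involves finitely many modes, so a strict violation at one pair (n, x) would persist for
    a close enough approximant. This Fatou property passes uniform bounds to coefficientwise limits,
    in the product and in the Picard iteration. *)
Lemma bes_closed a f M :
  (forall B eps, 0 < eps -> exists g, bes a g M /\ forall k, inbox B k -> Cmod (Cminus (f k) (g k)) <= eps) ->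
  bes a f M.
Proof.
  intros H. apply bes_iff. intros n x. apply Rnot_lt_le. intros Hlt.
  set (B := (3 * 2 ^ n)%nat). set (c := (2 * INR B + 1) ^ 2).
  assert (c0 : 0 < c) by (unfold c; pose proof (pos_INR B); nra).
  set (d := Cmod (bl n f x) - M * wt (- a) n). assert (d0 : 0 < d) by (unfold d; lra).
  destruct (H B (d / (2 * c))) as (g & Hg & Hk).
  { apply Rdiv_lt_0_compat; lra. }
  rewrite bes_iff in Hg. specialize (Hg n x).
  assert (Q : Cmod (Cminus (bl n f x) (bl n g x)) <= c * (d / (2 * c))).
  { rewrite !LPblock_ev. apply ev_close. intros k Hb. unfold mul.
    replace (Cminus _ _) with (Cmult (RtoC (b n k)) (Cminus (f k) (g k))) by ring.
    rewrite Cmod_mult, Cmod_R, Rabs_pos_eq by apply blk_bounds.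
    pose proof (blk_bounds n k). pose proof (Hk k Hb). pose proof (Cmod_ge_0 (Cminus (f k) (g k))). nra. }
  replace (c * (d / (2 * c))) with (d / 2) in Q by (field; lra).
  assert (Cmod (bl n f x) <= Cmod (bl n g x) + Cmod (Cminus (bl n f x) (bl n g x))).
  { replace (bl n f x) with (Cplus (bl n g x) (Cminus (bl n f x) (bl n g x))) at 1 by ring. apply Cmod_triangle. }
  unfold d in *. lra.
Qed.

(** A mode is seen by finitely many blocks, whose symbols add up to 1 there. Besov convergence thus
    implies convergence of every coefficient. *)
Lemma bes_coef a k : exists C, 0 < C /\ forall f M, bes a f M -> Cmod (f k) <= C * M.
Proof.
  destruct (sN_eventually k) as [N HN]. specialize (HN N (le_n N)).
  exists (2 * Rsum (seq 0 (S N)) (fun n => wt (- a) n)). split.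
  { apply Rmult_lt_0_compat; [lra|]. simpl seq. rewrite Rsum_cons. pose proof (wt_pos (- a) 0).
    assert (0 <= Rsum (seq 1 N) (fun n => wt (- a) n)) by (apply Rsum_ge0; intros; apply Rlt_le, wt_pos). lra. }
  intros f M H. rewrite bes_iff in H.
  replace (f k) with (Csum (seq 0 (S N)) (fun n => Cmult (RtoC (b n k)) (f k))).
  2: { rewrite Csum_scal_r, <- RtoC_Rsum, <- sN_Rsum, HN. ring. }
  eapply Rle_trans; [apply Cmod_Csum|].
  rewrite Rmult_assoc, (Rmult_comm _ M), <- Rmult_assoc, <- Rsum_scal. apply Rsum_le.
  intros n _. rewrite Rmult_assoc.
  destruct (classic (inbox (3 * 2 ^ n) k)) as [Hk|Hk].
  - apply (coef_bound (3 * 2 ^ n) (mul (b n) f)); [auto|intros y; apply H].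
  - cbv beta. rewrite (blk_out n k Hk). rewrite Cmult_0_l, Cmod_0.
    specialize (H n (0, 0)). pose proof (Cmod_ge_0 (bl n f (0, 0))). lra.
Qed.

Lemma bl_dconj n f x : bl n (dconj f) x = Cconj (bl n f x).
Proof.
  rewrite !LPblock_ev, <- ev_dconj. apply ev_ext. intros k _. unfold mul, dconj.
  change ((- fst k)%Z, (- snd k)%Z) with (kopp k).
  rewrite Cmult_conj, blk_opp. f_equal. unfold Cconj, RtoC; simpl. f_equal. ring.
Qed.
Lemma bes_dconj a f M : bes a f M -> bes a (dconj f) M.
Proof. intros H n x. rewrite bl_dconj, Cmod_conj. apply H. Qed.

Lemma rho_data : smooth rho /\ forall r, (Rabs r <= 3/4 \/ 8/3 <= Rabs r) -> rho r = 0.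
Proof. destruct HD as (_ & H1 & _ & _ & _ & H2 & _). auto. Qed.

Lemma L1_small m B A : 0 <= A -> supp B m -> (forall k, Cmod (m k) <= A) -> L1 B m <= (2 * INR B + 1) ^ 2 * A.
Proof.
  intros HA S H. unfold L1. rewrite <- (TI_const ((2 * INR B + 1) ^ 2 * A)). apply TI_le.
  - apply cont2_Cmod, ccont2_ev.
  - apply cont2_const.
  - intros p. apply Cmod_ev. auto.
Qed.

(* The kernels of these multipliers are bounded in L^1 uniformly in n. *)
Lemma radial_L1 : exists C, 0 < C /\ forall n A (e e' e'' : R -> R), 0 < A ->
    (forall s, 1/2 < s -> is_derive e s (e' s)) -> (forall s, 1/2 < s -> is_derive e' s (e'' s)) ->
    (forall s, 1/2 < s <= 8 -> Rabs (e s) <= A /\ Rabs (e' s) <= A /\ Rabs (e'' s) <= A) ->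
    forall B f M, (forall y, Cmod (ev B f y) <= M) -> forall x,
    Cmod (ev B (mul (fun k => b (S n) k * e (znorm k ^ 2 / 4 ^ n)) f) x) <= C * A * M /\
    forall j, Cmod (ev B (mul (fun k => IZR (kc j k) / 2 ^ n * (b (S n) k * e (znorm k ^ 2 / 4 ^ n))) f) x) <= C * A * M.
Proof.
  destruct rho_data as [Sm Z]. destruct (rho_mult rho Sm Z) as (C & C0 & H).
  set (c := 9 * (2 * INR 3 + 3) ^ 2 + 16).
  assert (c0 : 0 < c) by (unfold c; simpl; lra).
  exists (2 * (c * (6 * C))). split; [nra|].
  intros n A e e' e'' A0 H1 H2 H3 B f M Hf x.
  assert (M0 : 0 <= M) by (eapply Rle_trans; [apply Cmod_ge_0|apply (Hf x)]).
  pose proof (H n A e e' e'' H1 H2 H3) as G. assert (CA : 0 < C * A) by now apply Rmult_lt_0_compat.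
  split.
  - eapply Rle_trans.
    { apply (ev_cmul_bound B (3 * 2 ^ n) (fun k => RtoC (b (S n) k * e (znorm k ^ 2 / 4 ^ n)))); [apply G|apply Hf]. }
    pose proof (L1_goodmult n 3 (C * A) _ CA G) as Q. fold c in Q.
    change (L1 (3 * 2 ^ n) (fun k => RtoC (b (S n) k * e (znorm k ^ 2 / 4 ^ n))) <= c * (C * A)) in Q.
    apply Rle_trans with (2 * (c * (C * A) * M)); [apply Rmult_le_compat_l; [lra|now apply Rmult_le_compat_r]|].
    assert (0 <= c * (C * A) * M) by (apply Rmult_le_pos; auto; nra). lra.
  - intros j. pose proof (goodmult_kc j n 3 (C * A) _ G) as G'.
    assert (E : (INR 3 + 3) * (C * A) = 6 * C * A) by (simpl; ring). rewrite E in G'.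
    assert (CA' : 0 < 6 * C * A) by nra.
    assert (G2 : goodmult n 3 (6 * C * A) (fun k => RtoC (IZR (kc j k) / 2 ^ n * (b (S n) k * e (znorm k ^ 2 / 4 ^ n))))).
    { eapply goodmult_ext; [|apply G']. intros k. simpl b. now rewrite RtoC_mult. }
    eapply Rle_trans.
    { apply (ev_cmul_bound B (3 * 2 ^ n) (fun k => RtoC (IZR (kc j k) / 2 ^ n * (b (S n) k * e (znorm k ^ 2 / 4 ^ n))))); [apply G2|apply Hf]. }
    pose proof (L1_goodmult n 3 (6 * C * A) _ CA' G2) as Q. fold c in Q.
    replace (2 * (c * (6 * C)) * A * M) with (2 * (c * (6 * C * A) * M)) by ring.
    apply Rmult_le_compat_l; [lra|now apply Rmult_le_compat_r].
Qed.

Lemma blk_kernel : exists C, 1 <= C /\ forall n, L1 (3 * 2 ^ n) (fun k => RtoC (b n k)) <= C.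
Proof.
  destruct (rho_data) as [Sm Z]. destruct (rho_mult rho Sm Z) as (C & C0 & H).
  set (c := 9 * (2 * INR 3 + 3) ^ 2 + 16).
  assert (c0 : 0 < c) by (unfold c; simpl; lra).
  exists (49 + c * C). split; [nra|]. intros [|n].
  (* Block 0 has no ring shape; its symbol is at most 1 on the 49 points of the box of radius 3, and
     counting is enough. *)
  - apply Rle_trans with 49; [|nra]. eapply Rle_trans; [apply L1_small with (A := 1)|simpl; lra]; [lra| |].
    + intros k Hk. rewrite blk_out; auto.
    + intros k. rewrite Cmod_R. pose proof (blk_bounds 0 k). rewrite Rabs_pos_eq; lra.
  - assert (G : goodmult n 3 (C * 1) (fun k => RtoC (b (S n) k))).
    { apply goodmult_ext with (fun k => RtoC (b (S n) k * 1)); [|apply (H n 1 (fun _ => 1) (fun _ => 0) (fun _ => 0))].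
      - intros k. now rewrite Rmult_1_r.
      - intros; apply (is_derive_const (K := R_AbsRing) (V := R_NormedModule)).
      - intros; apply (is_derive_const (K := R_AbsRing) (V := R_NormedModule)).
      - intros. rewrite Rabs_R0, Rabs_R1. lra. }
    pose proof (L1_goodmult n 3 (C * 1) _ ltac:(lra) G) as Q. fold c in Q.
    unfold L1 in *. erewrite TI_ext; [|intros y; erewrite (ev_supp _ (3 * 2 ^ n)); [reflexivity| |apply G]].
    2: { intros k Hk. rewrite blk_out; auto. }
    lra.
Qed.

Lemma blk_L1 : exists C, 1 <= C /\ forall n B f M, (forall y, Cmod (ev B f y) <= M) ->
  forall x, Cmod (ev B (mul (b n) f) x) <= C * M.
Proof.
  destruct blk_kernel as (C & C1 & H). exists (2 * C). split; [lra|].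
  intros n B f M Hf x. assert (M0 : 0 <= M) by (eapply Rle_trans; [apply Cmod_ge_0|apply (Hf x)]).
  eapply Rle_trans.
  { apply (ev_cmul_bound B (3 * 2 ^ n) (fun k => RtoC (b n k))); [|apply Hf].
    intros k Hk. rewrite blk_out; auto. }
  rewrite Rmult_assoc. apply Rmult_le_compat_l; [lra|]. apply Rmult_le_compat_r; auto.
Qed.

(** [S_N f] in the notation of the paper. *)
Definition SN (N : nat) (f : fdist) : fdist := mul (sN chi rho N) f.
Lemma supp_SN N f : supp (3 * 2 ^ N) (SN N f).
Proof. apply supp_mul_l, sN_out. Qed.

Lemma bl_SN_low n N f x : (n + 1 <= N)%nat -> bl n (SN N f) x = bl n f x.
Proof.
  intros Hn. rewrite !LPblock_ev. apply ev_ext. intros k _. unfold SN, mul.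
  destruct (classic (b n k = 0)) as [->|Hb]; [ring|].
  rewrite sN_one; [ring|]. apply blk_hi in Hb.
  assert (2 ^ (n + 1) <= 2 ^ N) by (apply Rle_pow; [lra|lia]). rewrite pow_add in H. simpl in H.
  pose proof (pow2_ge1 n). lra.
Qed.

(** Within block n the symbol of S_N reduces to the sum of at most three neighbouring blocks of
    index <= N, so the kernel of S_N itself never has to be estimated. *)
Lemma bl_SN : exists C, 1 <= C /\ forall n N f M, (forall x, Cmod (bl n f x) <= M) ->
  forall x, Cmod (bl n (SN N f) x) <= C * M.
Proof.
  destruct blk_L1 as (C & C1 & H). exists (3 * C). split; [lra|]. intros n N f M Hf x.
  set (l := filter (fun i => Nat.leb i N) (nearl n)).
  assert (E : forall k, mul (b n) (SN N f) k = Csum l (fun i => mul (b i) (mul (b n) f) k)).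
  { intros k. unfold mul, SN, mul. rewrite Csum_scal_r, <- RtoC_Rsum.
    destruct (classic (b n k = 0)) as [->|Hb]; [ring|].
    rewrite (Rsum_support l (seq 0 (S N))).
    - rewrite <- sN_Rsum. ring.
    - apply NoDup_filter, NoDup_nearl.
    - apply seq_NoDup.
    - intros i Hi. pose proof (blk_overlap _ _ _ Hb Hi). pose proof (blk_overlap _ _ _ Hi Hb).
      unfold l. rewrite filter_In, nearl_spec, in_seq, Nat.leb_le. lia. }
  rewrite LPblock_ev, (ev_ext _ _ _ _ (fun k _ => E k)).
  assert (M0 : 0 <= M) by (eapply Rle_trans; [apply Cmod_ge_0|apply (Hf x)]).
  eapply Rle_trans; [apply (ev_bound_list _ l (fun i => mul (b i) (mul (b n) f))) with (c := C * M)|].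
  - intros i _. apply H. intros y. rewrite <- LPblock_ev. apply Hf.
  - rewrite <- Rmult_assoc. apply Rmult_le_compat_r; auto. apply Rmult_le_compat_r; [lra|].
    apply Rle_trans with (INR 3); [|simpl; lra]. apply le_INR. unfold l.
    pose proof (length_nearl n). pose proof (filter_length_le (fun i => Nat.leb i N) (nearl n)). lia.
Qed.

Lemma bes_SN : exists C, 1 <= C /\ forall a f M N, bes a f M -> bes a (SN N f) (C * M).
Proof.
  destruct bl_SN as (C & C1 & H). exists C. split; auto. intros a f M N Hf.
  rewrite bes_iff in *. intros n x. rewrite Rmult_assoc. apply H. auto.
Qed.

(** Blocks n < N are untouched by S_N, and on the others giving up eps of regularity gains 2^{-eps
    N}. This rate makes the approximations of a product Cauchy and the truncation error of the
    energy argument vanish. *)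
Lemma bes_SN_tail : exists C, 1 <= C /\ forall a eps f M N, 0 <= eps -> bes a f M ->
  bes (a - eps) (fun k => Cminus (f k) (SN N f k)) (C * wt (- eps) N * M).
Proof.
  destruct bl_SN as (C & C1 & H). exists (1 + C). split; [lra|]. intros a eps f M N He Hf.
  pose proof (bes_nonneg _ _ _ Hf) as M0.
  rewrite bes_iff in *. intros n x. rewrite bl_minus.
  pose proof (wt_pos (- eps) N). pose proof (wt_pos (- (a - eps)) n).
  destruct (le_lt_dec (n + 1) N) as [Hn|Hn].
  - rewrite bl_SN_low by auto. replace (Cminus _ _) with (RtoC 0) by ring. rewrite Cmod_0.
    repeat apply Rmult_le_pos; lra.
  - unfold Cminus. eapply Rle_trans; [apply Cmod_triangle|]. rewrite Cmod_opp.
    specialize (H n N f _ (Hf n) x). specialize (Hf n x).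
    apply Rle_trans with ((1 + C) * (M * wt (- a) n)); [lra|].
    replace (- a) with (- (a - eps) + - eps) by ring. rewrite wt_plus.
    pose proof (wt_mono eps N n He ltac:(lia)).
    replace ((1 + C) * (M * (wt (- (a - eps)) n * wt (- eps) n))) with ((1 + C) * wt (- eps) n * M * wt (- (a - eps)) n) by ring.
    apply Rmult_le_compat_r; [lra|]. apply Rmult_le_compat_r; auto. apply Rmult_le_compat_l; lra.
Qed.

(* A function of the blocks n-1, n, n+1 suffices to compute any multiplier supported in block n. *)
Lemma fat_bound a n f M B x : (3 * 2 ^ (n + 1) <= B)%nat -> bes a f M ->
  Cmod (ev B (fun k => Csum (nearl n) (fun i => mul (b i) f k)) x) <= 3 * (Rpower 2 (Rabs a) * M * wt (- a) n).
Proof.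
  intros HB H. pose proof (bes_nonneg _ _ _ H) as M0. rewrite bes_iff in H.
  eapply Rle_trans; [apply (ev_bound_list _ (nearl n) (fun i => mul (b i) f)) with (c := Rpower 2 (Rabs a) * M * wt (- a) n)|].
  - intros i Hi. apply nearl_spec in Hi. rewrite <- bl_ev.
    + eapply Rle_trans; [apply H|]. pose proof (wt_near (- a) i n ltac:(lia) ltac:(lia)) as W.
      rewrite Rabs_Ropp in W. rewrite (Rmult_comm (Rpower 2 _)), Rmult_assoc. now apply Rmult_le_compat_l.
    + assert (2 ^ i <= 2 ^ (n + 1))%nat by (apply Nat.pow_le_mono_r; lia). lia.
  - apply Rmult_le_compat_r.
    + pose proof (wt_pos (- a) n). pose proof (Rpower_pos 2 (Rabs a)).
      repeat apply Rmult_le_pos; lra.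
    + apply Rle_trans with (INR 3); [apply le_INR, length_nearl|simpl; lra].
Qed.

(** * Smoothing by the semigroup *)

Variable mu : R.
Hypothesis mu_pos : 0 < mu.

(** exp(x) >= (1 + x/3)^3, as the cube of exp(x/3) >= 1 + x/3. Of the three powers, two pay for two
    derivatives and one is left as the factor 1/(1+l). *)
Lemma exp_cubic c l : 0 < c <= 1 -> 0 <= l -> (1 + l) ^ 2 * exp (- (c * l)) <= 27 / c ^ 3 / (1 + l).
Proof.
  intros Hc Hl.
  assert (E : exp (c * l) >= (1 + c * l / 3) ^ 3).
  { replace (exp (c * l)) with (exp (c * l / 3) ^ 3).
    - apply Rle_ge, pow_incr. split; [|apply exp_ineq1_le]. assert (0 <= c * l) by nra. lra.
    - simpl. rewrite Rmult_1_r, <- !exp_plus. f_equal. field. }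
  assert (E2 : (c / 3 * (1 + l)) ^ 3 <= (1 + c * l / 3) ^ 3) by (apply pow_incr; split; nra).
  rewrite exp_Ropp.
  apply (Rmult_le_reg_r (exp (c * l))); [apply exp_pos|].
  rewrite Rmult_assoc, Rinv_l, Rmult_1_r by (apply Rgt_not_eq, exp_pos).
  apply Rle_trans with (27 / c ^ 3 / (1 + l) * (c / 3 * (1 + l)) ^ 3).
  - apply Req_le. field. split; lra.
  - apply Rmult_le_compat_l; [|lra]. apply Rmult_le_pos; [apply Rmult_le_pos; [lra|]|].
    + apply Rlt_le, Rinv_0_lt_compat, pow_lt; lra.
    + apply Rlt_le, Rinv_0_lt_compat; lra.
Qed.

(** With l = 4 pi^2 t 4^n and s = |k|^2/4^n the symbol of P_t is exp(-t) E(s) (cos(ls) - i sin(ls)).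
    The six bounds are those of the cosine and sine profiles and of their first two derivatives:
    each derivative costs a factor of order l, which exp(-mu l s) with s > 1/2 repays, with a decay
    1/(1+l) to spare. *)
Lemma heat_profile : exists C, 0 < C /\ forall l, 0 <= l -> forall s, 1/2 < s ->
  let E := fun s => exp (- (l * mu * s)) in
  Rabs (E s * cos (l * s)) <= C / (1 + l) /\ Rabs (E s * sin (l * s)) <= C / (1 + l) /\
  Rabs (- l * mu * (E s * cos (l * s)) - l * (E s * sin (l * s))) <= C / (1 + l) /\
  Rabs (- l * mu * (E s * sin (l * s)) + l * (E s * cos (l * s))) <= C / (1 + l) /\
  Rabs (l ^ 2 * (mu ^ 2 - 1) * (E s * cos (l * s)) + 2 * l ^ 2 * mu * (E s * sin (l * s))) <= C / (1 + l) /\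
  Rabs (l ^ 2 * (mu ^ 2 - 1) * (E s * sin (l * s)) - 2 * l ^ 2 * mu * (E s * cos (l * s))) <= C / (1 + l).
Proof.
  set (c := Rmin 1 (mu / 2)).
  assert (Hc : 0 < c <= 1) by (unfold c; split; [apply Rmin_glb_lt; lra|apply Rmin_l]).
  assert (Hc2 : c <= mu / 2) by apply Rmin_r.
  set (K := 27 / c ^ 3). assert (K0 : 0 < K) by (unfold K; apply Rdiv_lt_0_compat; [lra|apply pow_lt; lra]).
  exists ((1 + mu) ^ 2 * K). split; [nra|]. intros l Hl s Hs E.
  assert (HE : 0 < E s) by apply exp_pos.
  assert (B : (1 + l) ^ 2 * E s <= K / (1 + l)).
  { eapply Rle_trans; [|apply (exp_cubic c l Hc Hl)]. apply Rmult_le_compat_l; [apply pow2_ge_0|].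
    unfold E. assert (HH : - (l * mu * s) <= - (c * l)).
    { assert (c * l <= mu / 2 * l) by (apply Rmult_le_compat_r; lra).
      assert (0 <= l * mu) by nra. assert (l * mu * (1/2) <= l * mu * s) by (apply Rmult_le_compat_l; lra). lra. }
    destruct HH as [HH| ->]; [apply Rlt_le, exp_increasing; auto|lra]. }
  assert (G : forall p q, Rabs p <= (1 + mu) ^ 2 * (1 + l) ^ 2 * Rabs q -> Rabs q <= 1 -> Rabs (p * E s) <= (1 + mu) ^ 2 * K / (1 + l)).
  { intros p q Hp Hq. rewrite Rabs_mult, (Rabs_pos_eq (E s)) by lra.
    apply Rle_trans with ((1 + mu) ^ 2 * ((1 + l) ^ 2 * E s)).
    - rewrite <- Rmult_assoc. apply Rmult_le_compat_r; [lra|]. eapply Rle_trans; [apply Hp|].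
      rewrite <- (Rmult_1_r ((1 + mu) ^ 2 * (1 + l) ^ 2)) at 2. apply Rmult_le_compat_l; auto.
      apply Rmult_le_pos; apply pow2_ge_0.
    - unfold Rdiv in *. rewrite Rmult_assoc. apply Rmult_le_compat_l; [apply pow2_ge_0|auto]. }
  set (x := l * s).
  assert (ab : forall z, Rabs (cos z) <= 1 /\ Rabs (sin z) <= 1).
  { intros z. pose proof (COS_bound z). pose proof (SIN_bound z). split; apply Rabs_le; lra. }
  assert (G2 : forall p, Rabs p <= (1 + mu) ^ 2 * (1 + l) ^ 2 -> Rabs (p * E s) <= (1 + mu) ^ 2 * K / (1 + l)).
  { intros p Hp. apply (G p 1); rewrite Rabs_R1; lra. }
  assert (tri : forall u v w z X Y, Rabs w <= 1 -> Rabs z <= 1 -> Rabs u <= X -> Rabs v <= Y -> Rabs (u * w + v * z) <= X + Y).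
  { intros u v w z X Y Hw Hz Hu Hv. eapply Rle_trans; [apply Rabs_triang|]. rewrite !Rabs_mult.
    pose proof (Rabs_pos u). pose proof (Rabs_pos v). nra. }
  assert (one : 1 <= (1 + mu) ^ 2 * (1 + l) ^ 2) by nra.
  assert (lin : l * mu + l <= (1 + mu) ^ 2 * (1 + l) ^ 2).
  { apply Rle_trans with ((1 + mu) * (1 + l)); [nra|]. replace ((1 + mu) ^ 2 * (1 + l) ^ 2) with (((1 + mu) * (1 + l)) ^ 2) by ring. nra. }
  assert (quad : l ^ 2 * (mu ^ 2 + 1) + 2 * l ^ 2 * mu <= (1 + mu) ^ 2 * (1 + l) ^ 2).
  { replace (l ^ 2 * (mu ^ 2 + 1) + 2 * l ^ 2 * mu) with ((1 + mu) ^ 2 * l ^ 2) by ring.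
    apply Rmult_le_compat_l; [apply pow2_ge_0|]. apply pow_incr. lra. }
  assert (q1 : Rabs (l ^ 2 * (mu ^ 2 - 1)) <= l ^ 2 * (mu ^ 2 + 1)).
  { rewrite Rabs_mult, (Rabs_pos_eq (l ^ 2)) by apply pow2_ge_0. apply Rmult_le_compat_l; [apply pow2_ge_0|].
    pose proof (pow2_ge_0 mu). apply Rabs_le. lra. }
  assert (q2 : Rabs (2 * l ^ 2 * mu) <= 2 * l ^ 2 * mu) by (rewrite Rabs_pos_eq; [lra|]; pose proof (pow2_ge_0 l); nra).
  assert (q2' : Rabs (- (2 * l ^ 2 * mu)) <= 2 * l ^ 2 * mu) by (now rewrite Rabs_Ropp).
  assert (q3 : Rabs (- l * mu) <= l * mu) by (replace (- l * mu) with (- (l * mu)) by ring; rewrite Rabs_Ropp, Rabs_pos_eq; nra).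
  assert (q4 : Rabs l <= l) by (rewrite Rabs_pos_eq; lra).
  assert (q4' : Rabs (- l) <= l) by (rewrite Rabs_Ropp; auto).
  destruct (ab x) as [ac as_].
  repeat split.
  - rewrite Rmult_comm. apply G2. eapply Rle_trans; [apply ac|lra].
  - rewrite Rmult_comm. apply G2. eapply Rle_trans; [apply as_|lra].
  - replace (- l * mu * (E s * cos x) - l * (E s * sin x)) with ((- l * mu * cos x + - l * sin x) * E s) by ring.
    apply G2. eapply Rle_trans; [apply tri; eassumption|auto].
  - replace (- l * mu * (E s * sin x) + l * (E s * cos x)) with ((- l * mu * sin x + l * cos x) * E s) by ring.
    apply G2. eapply Rle_trans; [apply tri; eassumption|auto].
  - replace (l ^ 2 * (mu ^ 2 - 1) * (E s * cos x) + 2 * l ^ 2 * mu * (E s * sin x)) with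
      ((l ^ 2 * (mu ^ 2 - 1) * cos x + 2 * l ^ 2 * mu * sin x) * E s) by ring.
    apply G2. eapply Rle_trans; [apply tri; eassumption|auto].
  - replace (l ^ 2 * (mu ^ 2 - 1) * (E s * sin x) - 2 * l ^ 2 * mu * (E s * cos x)) with
      ((l ^ 2 * (mu ^ 2 - 1) * sin x + - (2 * l ^ 2 * mu) * cos x) * E s) by ring.
    apply G2. eapply Rle_trans; [apply tri; eassumption|auto].
Qed.

Lemma heat_L1 : exists C, 0 < C /\ forall n t, 0 <= t -> forall B f M, (forall y, Cmod (ev B f y) <= M) ->
  forall x, Cmod (ev B (cmul (fun k => Cmult (Pmult mu t k) (RtoC (b (S n) k))) f) x) <= C / (1 + t * 4 ^ n) * M.
Proof.
  destruct radial_L1 as (C & C0 & H). destruct heat_profile as (D & D0 & HP).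
  exists (2 * (C * D)). split; [nra|]. intros n t Ht B f M Hf x.
  assert (M0 : 0 <= M) by (eapply Rle_trans; [apply Cmod_ge_0|apply (Hf x)]).
  assert (P4 : 0 < 4 ^ n) by (apply pow_lt; lra).
  assert (PI2 : 9 <= PI ^ 2) by (pose proof PI2_3_2; nra).
  set (l := 4 * PI ^ 2 * t * 4 ^ n).
  assert (tn : 0 <= t * 4 ^ n) by (apply Rmult_le_pos; lra).
  assert (Hl : 0 <= l).
  { unfold l. replace (4 * PI ^ 2 * t * 4 ^ n) with (4 * PI ^ 2 * (t * 4 ^ n)) by ring. nra. }
  assert (Hl2 : t * 4 ^ n <= l).
  { unfold l.
    replace (4 * PI ^ 2 * t * 4 ^ n) with (4 * PI ^ 2 * (t * 4 ^ n)) by ring. nra. }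
  assert (A0 : 0 < D / (1 + l)) by (apply Rdiv_lt_0_compat; lra).
  specialize (HP l Hl). cbv zeta in HP.
  set (E := fun s => exp (- (l * mu * s))) in *.
  destruct (H n (D / (1 + l)) (fun s => E s * cos (l * s))
     (fun s => - l * mu * (E s * cos (l * s)) - l * (E s * sin (l * s)))
     (fun s => l ^ 2 * (mu ^ 2 - 1) * (E s * cos (l * s)) + 2 * l ^ 2 * mu * (E s * sin (l * s))) A0)
     with (B := B) (f := f) (M := M) (x := x) as [Qc _]; auto.
  { intros s _. unfold E. auto_derive; auto. ring. }
  { intros s _. unfold E. auto_derive; auto. ring. }
  { intros s [Hs _]. specialize (HP s Hs). change (exp (- (l * mu * s))) with (E s) in HP. tauto. }
  destruct (H n (D / (1 + l)) (fun s => E s * sin (l * s))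
     (fun s => - l * mu * (E s * sin (l * s)) + l * (E s * cos (l * s)))
     (fun s => l ^ 2 * (mu ^ 2 - 1) * (E s * sin (l * s)) - 2 * l ^ 2 * mu * (E s * cos (l * s))) A0)
     with (B := B) (f := f) (M := M) (x := x) as [Qs _]; auto.
  { intros s _. unfold E. auto_derive; auto. ring. }
  { intros s _. unfold E. auto_derive; auto. ring. }
  { intros s [Hs _]. specialize (HP s Hs). change (exp (- (l * mu * s))) with (E s) in HP. tauto. }
  set (mc := fun k => b (S n) k * (E (znorm k ^ 2 / 4 ^ n) * cos (l * (znorm k ^ 2 / 4 ^ n)))) in *.
  set (ms := fun k => b (S n) k * (E (znorm k ^ 2 / 4 ^ n) * sin (l * (znorm k ^ 2 / 4 ^ n)))) in *.
  assert (EQ : forall k, cmul (fun k => Cmult (Pmult mu t k) (RtoC (b (S n) k))) f k =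
     Cmult (RtoC (exp (- t))) (Cminus (mul mc f k) (Cmult Ci (mul ms f k)))).
  { intros k. unfold cmul, mul, Pmult.
    replace (t * (4 * PI ^ 2 * znorm k ^ 2)) with (l * (znorm k ^ 2 / 4 ^ n)) by (unfold l; field; lra).
    replace (exp (- t * (1 + mu * (4 * PI ^ 2 * znorm k ^ 2)))) with (exp (- t) * E (znorm k ^ 2 / 4 ^ n)).
    2: { unfold E. rewrite <- exp_plus. f_equal. unfold l. field. lra. }
    unfold mc, ms. destruct (f k) as [u v].
    unfold Cminus, Cplus, Copp, Cmult, Ci, RtoC; cbn [fst snd]. f_equal; ring. }
  rewrite (ev_ext B _ _ x (fun k _ => EQ k)), ev_scal, ev_minus, ev_scal, Cmod_mult, Cmod_R.
  rewrite Rabs_pos_eq by (apply Rlt_le, exp_pos).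
  assert (Et : exp (- t) <= 1) by (rewrite <- exp_0; destruct Ht as [Ht| <-]; [apply Rlt_le, exp_increasing; lra|rewrite Ropp_0; lra]).
  assert (T : Cmod (Cminus (ev B (mul mc f) x) (Cmult Ci (ev B (mul ms f) x))) <= 2 * (C * (D / (1 + l)) * M)).
  { unfold Cminus. eapply Rle_trans; [apply Cmod_triangle|]. rewrite Cmod_opp, Cmod_mult, Cmod_Ci. lra. }
  apply Rle_trans with (1 * (2 * (C * (D / (1 + l)) * M))).
  { apply Rmult_le_compat; auto using Cmod_ge_0. apply Rlt_le, exp_pos. }
  rewrite Rmult_1_l. replace (2 * (C * (D / (1 + l)) * M)) with (2 * (C * D) * / (1 + l) * M) by (unfold Rdiv; ring).
  apply Rmult_le_compat_r; auto. unfold Rdiv. apply Rmult_le_compat_l; [nra|].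
  apply Rinv_le_contravar; [|lra]. lra.
Qed.

Lemma Cmod_Pmult t k : 0 <= t -> Cmod (Pmult mu t k) <= 1.
Proof.
  intros Ht. unfold Pmult. set (L := 4 * PI ^ 2 * znorm k ^ 2).
  assert (HL : 0 <= L) by (unfold L; pose proof (pow2_ge_0 PI); pose proof (pow2_ge_0 (znorm k)); nra).
  unfold Cmod; cbn [fst snd].
  replace ((exp (- t * (1 + mu * L)) * cos (t * L)) ^ 2 + (- (exp (- t * (1 + mu * L)) * sin (t * L))) ^ 2)
    with (exp (- t * (1 + mu * L)) ^ 2).
  - rewrite sqrt_pow2 by (apply Rlt_le, exp_pos). apply Rle_trans with (exp 0); [|rewrite exp_0; lra].
    assert (- t * (1 + mu * L) <= 0) as [H| ->]; [|apply Rlt_le, exp_increasing; auto|lra].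
    assert (0 <= t * (1 + mu * L)) by (apply Rmult_le_pos; nra). lra.
  - pose proof (sin2_cos2 (t * L)) as E. unfold Rsqr in E.
    transitivity (exp (- t * (1 + mu * L)) ^ 2 * (sin (t * L) * sin (t * L) + cos (t * L) * cos (t * L))); [rewrite E; ring|ring].
Qed.

Lemma heat_block a T : 0 <= T -> exists C, 0 < C /\ forall f M t n x, 0 <= t <= T -> bes a f M ->
  Cmod (bl n (cmul (Pmult mu t) f) x) <= C / (1 + t * 4 ^ n) * (M * wt (- a) n).
Proof.
  intros HT. destruct heat_L1 as (C & C0 & H).
  set (R0 := Rpower 2 (Rabs a)). assert (R0p : 0 < R0) by apply exp_pos.
  exists (12 * C * R0 + 294 * (1 + T) * R0). split; [nra|]. intros f M t n x Ht Hf.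
  pose proof (bes_nonneg _ _ _ Hf) as M0.
  assert (W := wt_pos (- a) n).
  assert (MW : 0 <= M * wt (- a) n) by (apply Rmult_le_pos; lra).
  assert (R0C : 0 < C * R0) by nra.
  set (B := (3 * 2 ^ (n + 1))%nat).
  set (g := fun k => Csum (nearl n) (fun i => mul (b i) f k)).
  assert (Hg : forall y, Cmod (ev B g y) <= 3 * (R0 * M * wt (- a) n)) by (intros; apply fat_bound; auto).
  assert (EQ : forall k, mul (b n) (cmul (Pmult mu t) f) k = cmul (fun k => Cmult (Pmult mu t k) (RtoC (b n k))) g k).
  { intros k. unfold mul, cmul, g, mul. rewrite Csum_scal_r, <- RtoC_Rsum.
    rewrite <- (blk_fat n k) at 1. rewrite RtoC_mult. ring. }
  assert (HB : (3 * 2 ^ n <= B)%nat).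
  { unfold B. assert (2 ^ n <= 2 ^ (n + 1))%nat by (apply Nat.pow_le_mono_r; lia). lia. }
  rewrite (bl_ev n B) by auto. rewrite (ev_ext B _ _ x (fun k _ => EQ k)).
  (* Block 0 contains the zero mode, so only |P_t| <= 1 is used there and the factor 1/(1+t) is paid
     for by the constant 1 + T. *)
  destruct n as [|n].
  - eapply Rle_trans.
    { apply (ev_cmul_bound B 3 (fun k => Cmult (Pmult mu t k) (RtoC (b 0 k)))); [|apply Hg].
      intros k Hk. rewrite blk_out by auto. ring. }
    assert (HL : L1 3 (fun k => Cmult (Pmult mu t k) (RtoC (b 0 k))) <= 49).
    { eapply Rle_trans; [apply L1_small with (A := 1)|simpl; lra]; [lra| |].
      - intros k Hk. rewrite blk_out by auto. ring.
      - intros k. rewrite Cmod_mult, Cmod_R. pose proof (blk_bounds 0 k). rewrite Rabs_pos_eq by lra.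
        pose proof (Cmod_Pmult t k (proj1 Ht)). nra. }
    apply Rle_trans with (294 * R0 * (M * wt (- a) 0)).
    + assert (0 <= R0 * M * wt (- a) 0) by (repeat apply Rmult_le_pos; lra).
      apply Rle_trans with (2 * (49 * (3 * (R0 * M * wt (- a) 0)))); [|lra].
      apply Rmult_le_compat_l; [lra|]. apply Rmult_le_compat_r; lra.
    + apply Rmult_le_compat_r; auto. simpl (4 ^ 0). rewrite Rmult_1_r.
      apply (Rmult_le_reg_r (1 + t)); [lra|]. unfold Rdiv. rewrite Rmult_assoc, (Rmult_assoc _ (/ (1 + t))), Rinv_l, Rmult_1_r by lra.
      assert (R0 * (1 + t) <= R0 * (1 + T)) by (apply Rmult_le_compat_l; lra). lra.
  - eapply Rle_trans; [apply (H n t (proj1 Ht) B g _ Hg)|].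
    replace (C / (1 + t * 4 ^ n) * (3 * (R0 * M * wt (- a) (S n)))) with (3 * (C * R0) / (1 + t * 4 ^ n) * (M * wt (- a) (S n)))
      by (unfold Rdiv; ring).
    apply Rmult_le_compat_r; auto.
    assert (P4 : 0 < 4 ^ n) by (apply pow_lt; lra). assert (0 <= t * 4 ^ n) by (apply Rmult_le_pos; lra).
    simpl (4 ^ S n).
    apply Rle_trans with (12 * C * R0 / (1 + t * (4 * 4 ^ n))).
    + apply (Rmult_le_reg_r ((1 + t * 4 ^ n) * (1 + t * (4 * 4 ^ n)))); [nra|].
      replace (3 * (C * R0) / (1 + t * 4 ^ n) * ((1 + t * 4 ^ n) * (1 + t * (4 * 4 ^ n)))) with (3 * (C * R0) * (1 + t * (4 * 4 ^ n)))
        by (field; lra).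
      replace (12 * C * R0 / (1 + t * (4 * 4 ^ n)) * ((1 + t * 4 ^ n) * (1 + t * (4 * 4 ^ n)))) with (3 * (C * R0) * (4 * (1 + t * 4 ^ n)))
        by (field; lra).
      apply Rmult_le_compat_l; lra.
    + unfold Rdiv. apply Rmult_le_compat_r; [apply Rlt_le, Rinv_0_lt_compat; lra|]. nra.
Qed.

Lemma inv_pow_theta u th : 0 <= u -> 0 <= th <= 1 -> / (1 + u) <= Rpower (1 + u) (- th).
Proof.
  intros Hu Hth. rewrite <- (Rpower_1 (1 + u)) at 1 by lra. rewrite <- Rpower_Ropp.
  apply Rle_Rpower; lra.
Qed.

(** Schauder estimate: 1/(1+u) <= u^{-th} with u of order t 4^n exchanges a singularity t^{-th} in
    time for 2 th derivatives. *)
Lemma Pmult_bes a th T : 0 <= T -> 0 <= th <= 1 -> exists C, 0 < C /\ forall f M t, 0 < t <= T -> bes a f M ->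
  bes (a + 2 * th) (cmul (Pmult mu t) f) (C * Rpower t (- th) * M).
Proof.
  intros HT Hth. destruct (heat_block a T HT) as (C & C0 & H).
  exists C. split; auto. intros f M t Ht Hf. pose proof (bes_nonneg _ _ _ Hf) as M0.
  apply bes_iff. intros n x. eapply Rle_trans; [apply H; eauto; lra|].
  assert (P4 : 1 <= 4 ^ n) by (apply pow_R1_Rle; lra).
  assert (tp : 0 < t * 4 ^ n) by (apply Rmult_lt_0_compat; lra).
  replace (C * Rpower t (- th) * M * wt (- (a + 2 * th)) n) with (C * (Rpower t (- th) * wt (- (2 * th)) n) * (M * wt (- a) n)).
  2: { replace (- (a + 2 * th)) with (- a + - (2 * th)) by ring. rewrite wt_plus. ring. }
  apply Rmult_le_compat_r; [apply Rmult_le_pos; auto; apply Rlt_le, wt_pos|].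
  unfold Rdiv. apply Rmult_le_compat_l; [lra|].
  eapply Rle_trans; [apply (inv_pow_theta _ th); lra|].
  apply Rle_trans with (Rpower (t * (4 ^ n / 4)) (- th)).
  - rewrite !Rpower_Ropp. apply Rinv_le_contravar; [apply exp_pos|].
    apply Rle_Rpower_l; [lra|]. split; [|lra]. apply Rmult_lt_0_compat; lra.
  - rewrite <- wt2, <- Rpower_mult_distr by (try apply wt_pos; lra). apply Rmult_le_compat_l; [apply Rlt_le, exp_pos|].
    apply Req_le. unfold wt. rewrite Rpower_mult. f_equal. ring.
Qed.

End LP.

(** * Products *)

Lemma geom_sum q N : 0 < q < 1 -> Rsum (seq 0 N) (fun i => q ^ i) <= / (1 - q).
Proof.
  intros Hq. assert (H : Rsum (seq 0 N) (fun i => q ^ i) = (1 - q ^ N) / (1 - q)).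
  { induction N as [|N IH]; [unfold Rsum; simpl; field; lra|].
    rewrite seq_S, Rsum_app, IH. unfold Rsum; simpl. field. lra. }
  rewrite H. unfold Rdiv. rewrite <- (Rmult_1_l (/ (1 - q))) at 2. apply Rmult_le_compat_r.
  - apply Rlt_le, Rinv_0_lt_compat. lra.
  - pose proof (pow_le q N). lra.
Qed.
(** Truncated subtraction makes [(i - n) + (n - i)] the distance |i - n|; the two geometric tails on
    either side of n give the factor 2. *)
Lemma geom_sum_near q n N : 0 < q < 1 -> Rsum (seq 0 N) (fun i => q ^ ((i - n) + (n - i))) <= 2 / (1 - q).
Proof.
  intros Hq. set (U := fun N => Rsum (seq 0 N) (fun i => q ^ ((i - n) + (n - i)))).
  assert (US : forall N, U (S N) = U N + q ^ ((N - n) + (n - N))).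
  { intros M. unfold U. rewrite seq_S, Rsum_app. unfold Rsum at 2. simpl. lra. }
  assert (I : 0 < / (1 - q)) by (apply Rinv_0_lt_compat; lra).
  assert (H1 : forall N, (N <= n + 1)%nat -> U N <= q ^ (n + 1 - N) * / (1 - q)).
  { induction N0 as [|M IH]; intros HM.
    - unfold U, Rsum; simpl. apply Rmult_le_pos; [apply pow_le|]; lra.
    - rewrite US. specialize (IH ltac:(lia)). replace (n + 1 - M)%nat with (S (n - M)) in IH by lia.
      replace (n + 1 - S M)%nat with (n - M)%nat by lia. replace ((M - n) + (n - M))%nat with (n - M)%nat by lia.
      simpl in IH. replace (q ^ (n - M) * / (1 - q)) with (q * q ^ (n - M) * / (1 - q) + q ^ (n - M)) by (field; lra). lra. }
  assert (H2 : forall j, U (n + 1 + j)%nat <= (2 - q ^ (j + 1)) * / (1 - q)).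
  { induction j as [|j IH].
    - rewrite Nat.add_0_r. specialize (H1 (n + 1)%nat (le_n _)). rewrite Nat.sub_diag in H1. simpl in *. nra.
    - replace (n + 1 + S j)%nat with (S (n + 1 + j)) by lia. rewrite US.
      replace ((n + 1 + j - n) + (n - (n + 1 + j)))%nat with (j + 1)%nat by lia.
      replace ((2 - q ^ (S j + 1)) * / (1 - q)) with ((2 - q ^ (j + 1)) * / (1 - q) + q ^ (j + 1)); [lra|].
      rewrite !pow_add. simpl. field. lra. }
  change (U N <= 2 / (1 - q)). destruct (le_lt_dec N (n + 1)) as [H|H].
  - eapply Rle_trans; [apply H1; auto|]. unfold Rdiv. apply Rmult_le_compat_r; [lra|].
    assert (q ^ (n + 1 - N) <= 1); [|lra]. rewrite <- (pow1 (n + 1 - N)). apply pow_incr. lra.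
  - specialize (H2 (N - (n + 1))%nat). replace (n + 1 + (N - (n + 1)))%nat with N in H2 by lia.
    eapply Rle_trans; [apply H2|]. unfold Rdiv. apply Rmult_le_compat_r; [lra|].
    assert (0 <= q ^ (N - (n + 1) + 1)) by (apply pow_le; lra). lra.
Qed.

(* The resonant, low-high and high-low interactions of dyadic blocks i and j contributing to block n. *)
Definition adm (n i j : nat) : Prop :=
  (n <= Nat.max i j + 2)%nat /\ (j + 3 <= i -> i <= n + 2)%nat /\ (i + 3 <= j -> j <= n + 2)%nat.

(** In each of the three regimes the regularity to spare is converted into decay at rate d in both
    indices, each index decaying away either from 0 or from n. The double sum over blocks then
    converges uniformly in n. *)
Lemma exps_bound be s d (n i j : R) :
  0 < d -> d <= be -> d <= Rabs s -> 2 * d <= be + s -> s <= be -> 0 <= n -> 0 <= i -> 0 <= j ->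
  ((j + 3 <= i /\ n - 2 <= i <= n + 2) \/ (i + 3 <= j /\ n - 2 <= j <= n + 2) \/ (i - 2 <= j <= i + 2 /\ n <= i + 4)) ->
  exists x y, (x = i \/ x = Rabs (i - n)) /\ (y = j \/ y = Rabs (j - n)) /\
    - i * be - j * s <= - n * s + (12 * (be + Rabs s)) - d * x - d * y.
Proof.
  intros Hd Hb Hs Hbs Hsb Hn Hi Hj C.
  assert (Ab : forall x, Rabs x <= 4 -> d * Rabs x <= 4 * d) by (intros; nra).
  assert (As : Rabs s = s \/ Rabs s = - s) by (unfold Rabs; destruct (Rcase_abs s); auto).
  destruct C as [[C1 C2]|[[C1 C2]|[C1 C2]]].
  - pose proof (Ab (i - n) ltac:(apply Rabs_le; lra)) as A1.
    destruct As as [As|As]; rewrite As in *.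
    + exists (Rabs (i - n)), j. split; [auto|split; [auto|]].
      nra.
    + exists (Rabs (i - n)), (Rabs (j - n)). split; [auto|split; [auto|]].
      rewrite (Rabs_left1 (j - n)) by lra.
      nra.
  - pose proof (Ab (j - n) ltac:(apply Rabs_le; lra)) as A1.
    exists i, (Rabs (j - n)). split; [auto|split; [auto|]].
    nra.
  - exists (Rabs (i - n)), (Rabs (j - n)). split; [auto|split; [auto|]].
    assert (A1 : Rabs (i - n) <= (i - n) + 8) by (apply Rabs_le; lra).
    assert (A2 : Rabs (j - n) <= (i - n) + 14) by (apply Rabs_le; lra).
    nra.
Qed.

(** [- be < s] makes the resonant sum converge. [s <> 0] keeps the sum over low frequencies of the
    second factor geometric: it is carried by j near n when s < 0 and by j near 0 when s > 0. The
    two possible kinds of decay are simply added, so that the right side is a product of sums in i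
    and in j. *)
Lemma adm_weight be s : 0 < be -> - be < s <= be -> s <> 0 -> exists d C, 0 < d /\ 0 < C /\ forall n i j, adm n i j ->
  wt (- be) i * wt (- s) j <= C * wt (- s) n *
   ((Rpower 2 (- d) ^ i + Rpower 2 (- d) ^ ((i - n) + (n - i))) * (Rpower 2 (- d) ^ j + Rpower 2 (- d) ^ ((j - n) + (n - j)))).
Proof.
  intros Hb Hs Hs0. set (d := Rmin (Rabs s) ((be + s) / 2)).
  assert (Pa : 0 < Rabs s) by now apply Rabs_pos_lt.
  assert (Hd : 0 < d) by (unfold d; apply Rmin_glb_lt; lra).
  assert (d1 : d <= Rabs s) by apply Rmin_l. assert (d2 : d <= (be + s) / 2) by apply Rmin_r.
  exists d, (Rpower 2 (12 * (be + Rabs s) + be)). split; [auto|split; [apply exp_pos|]].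
  intros n i j (A1 & A2 & A3).
  pose proof (pos_INR n). pose proof (pos_INR i). pose proof (pos_INR j).
  destruct (exps_bound be s d (INR n) (INR i) (INR j)) as (x & y & Hx & Hy & Hxy); try lra.
  { destruct (le_lt_dec (j + 3) i) as [H3|H3]; [left|destruct (le_lt_dec (i + 3) j) as [H4|H4]; right; [left|right]].
    - specialize (A2 H3). assert (n <= i + 2)%nat by lia. apply le_INR in H3, A2, H2. rewrite plus_INR in *. simpl in *. lra.
    - specialize (A3 H4). assert (n <= j + 2)%nat by lia. apply le_INR in H4, A3, H2. rewrite plus_INR in *. simpl in *. lra.
    - assert (n <= i + 4)%nat by lia. assert (i <= j + 2)%nat by lia. assert (j <= i + 2)%nat by lia.
      apply le_INR in H2, H5, H6. rewrite plus_INR in *. simpl in *. lra. }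
  assert (ab : forall a : nat, INR ((a - n) + (n - a)) = Rabs (INR a - INR n)).
  { intros a. destruct (le_lt_dec n a) as [Ha|Ha].
    - replace ((a - n) + (n - a))%nat with (a - n)%nat by lia. rewrite minus_INR by auto.
      rewrite Rabs_pos_eq; auto. apply le_INR in Ha. lra.
    - replace ((a - n) + (n - a))%nat with (n - a)%nat by lia. rewrite minus_INR by lia.
      rewrite Rabs_left; [ring|]. apply lt_INR in Ha. lra. }
  assert (pw : forall a : nat, Rpower 2 (- d) ^ a = Rpower 2 (- d * INR a)).
  { intros a. rewrite <- Rpower_mult, Rpower_pow; auto. apply exp_pos. }
  assert (Q : forall (a : nat) z, (z = INR a \/ z = Rabs (INR a - INR n)) ->
     Rpower 2 (- d * z) <= Rpower 2 (- d) ^ a + Rpower 2 (- d) ^ ((a - n) + (n - a))).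
  { intros a z Hz. rewrite !pw, ab. pose proof (Rpower_pos 2 (- d * INR a)). pose proof (Rpower_pos 2 (- d * Rabs (INR a - INR n))).
    destruct Hz as [->| ->]; lra. }
  apply Rle_trans with (Rpower 2 (12 * (be + Rabs s) + be) * wt (- s) n * (Rpower 2 (- d * x) * Rpower 2 (- d * y))).
  - unfold wt. rewrite <- !Rpower_plus. apply Rpower2_le. lra.
  - apply Rmult_le_compat_l.
    + apply Rmult_le_pos; apply Rlt_le; [apply exp_pos|apply wt_pos].
    + apply Rmult_le_compat; auto; apply Rlt_le, exp_pos.
Qed.

Definition Ccv (u : nat -> C) (l : C) : Prop :=
  forall eps, 0 < eps -> exists N0, forall N, (N0 <= N)%nat -> Cmod (Cminus (u N) l) <= eps.

Lemma Cmod_comp z : Rabs (fst z) <= Cmod z /\ Rabs (snd z) <= Cmod z.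
Proof. pose proof (Rmax_Cmod z). pose proof (Rmax_l (Rabs (fst z)) (Rabs (snd z))). pose proof (Rmax_r (Rabs (fst z)) (Rabs (snd z))). lra. Qed.
Lemma Cmod_le_comp z : Cmod z <= Rabs (fst z) + Rabs (snd z).
Proof.
  replace z with (Cplus (RtoC (fst z)) (Cmult Ci (RtoC (snd z)))) at 1.
  - eapply Rle_trans; [apply Cmod_triangle|]. rewrite Cmod_mult, Cmod_Ci, !Cmod_R. lra.
  - destruct z; unfold Cplus, Cmult, Ci, RtoC; simpl. f_equal; ring.
Qed.

(** Bridges to [dmul], which takes the limits of the two components separately and has a junk value
    where they do not converge. *)
Lemma Ccv_Lim u l : Ccv u l -> (real (Lim_seq (fun N => fst (u N))), real (Lim_seq (fun N => snd (u N)))) = l.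
Proof.
  intros H.
  assert (Q : forall p : C -> R, (forall z w, Rabs (p z - p w) <= Cmod (Cminus z w)) -> real (Lim_seq (fun N => p (u N))) = p l).
  { intros p Hp. erewrite is_lim_seq_unique with (l := p l); [reflexivity|].
    apply is_lim_seq_spec. intros eps. destruct (H (eps / 2)) as [N0 HN]; [pose proof (cond_pos eps); lra|].
    exists N0. intros N Hn. specialize (HN N Hn). specialize (Hp (u N) l). pose proof (cond_pos eps). lra. }
  rewrite (Q fst), (Q snd); [now destruct l| |].
  - intros [a1 b1] [a2 b2]. apply (Cmod_comp (Cminus (a1, b1) (a2, b2))).
  - intros [a1 b1] [a2 b2]. apply (Cmod_comp (Cminus (a1, b1) (a2, b2))).
Qed.
Lemma Ccv_cauchy u : (forall eps, 0 < eps -> exists N0, forall N M, (N0 <= N <= M)%nat -> Cmod (Cminus (u M) (u N)) <= eps) ->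
  exists l, Ccv u l.
Proof.
  intros H.
  assert (Q : forall p : C -> R, (forall z w, Rabs (p z - p w) <= Cmod (Cminus z w)) -> ex_finite_lim_seq (fun N => p (u N))).
  { intros p Hp. apply ex_lim_seq_cauchy_corr. intros eps.
    destruct (H (eps / 2)) as [N0 HN]; [pose proof (cond_pos eps); lra|]. pose proof (cond_pos eps).
    exists N0. intros n m Hn Hm. destruct (le_lt_dec n m) as [Hnm|Hnm].
    - specialize (HN n m ltac:(lia)). specialize (Hp (u m) (u n)). rewrite Rabs_minus_sym. lra.
    - specialize (HN m n ltac:(lia)). specialize (Hp (u n) (u m)). lra. }
  destruct (Q fst) as [a Ha]; [intros [a1 b1] [a2 b2]; apply (Cmod_comp (Cminus (a1, b1) (a2, b2)))|].
  destruct (Q snd) as [b Hb]; [intros [a1 b1] [a2 b2]; apply (Cmod_comp (Cminus (a1, b1) (a2, b2)))|].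
  exists (a, b). intros eps He. apply is_lim_seq_spec in Ha, Hb. assert (He2 : 0 < eps / 2) by lra.
  destruct (Ha (mkposreal _ He2)) as [N1 H1]. destruct (Hb (mkposreal _ He2)) as [N2 H2]. simpl in *.
  exists (Nat.max N1 N2). intros N HN. eapply Rle_trans; [apply Cmod_le_comp|].
  specialize (H1 N ltac:(lia)). specialize (H2 N ltac:(lia)).
  unfold Cminus, Cplus, Copp; simpl. unfold Rminus in *. lra.
Qed.
Lemma Ccv_unique u l l' : Ccv u l -> Ccv u l' -> l = l'.
Proof. intros H H'. now rewrite <- (Ccv_Lim _ _ H), <- (Ccv_Lim _ _ H'). Qed.
Lemma Ccv_minus u v l l' : Ccv u l -> Ccv v l' -> Ccv (fun N => Cminus (u N) (v N)) (Cminus l l').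
Proof.
  intros H H' eps He. destruct (H (eps / 2)) as [N1 H1]; [lra|]. destruct (H' (eps / 2)) as [N2 H2]; [lra|].
  exists (Nat.max N1 N2). intros N HN. specialize (H1 N ltac:(lia)). specialize (H2 N ltac:(lia)).
  replace (Cminus _ _) with (Cminus (Cminus (u N) l) (Cminus (v N) l')) by ring.
  unfold Cminus at 1. eapply Rle_trans; [apply Cmod_triangle|]. rewrite Cmod_opp. lra.
Qed.
Lemma Ccv_const u l N0 : (forall N, (N0 <= N)%nat -> u N = l) -> Ccv u l.
Proof.
  intros H eps He. exists N0. intros N HN. rewrite H by auto. replace (Cminus l l) with (RtoC 0) by ring.
  rewrite Cmod_0. lra.
Qed.

Lemma conv_box B B' f g k : supp B f -> supp B' f -> conv B f g k = conv B' f g k.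
Proof. intros. apply Bsum_supp; now apply supp_mult. Qed.
Lemma conv_minus_l B f f' g k : conv B (fun k => Cminus (f k) (f' k)) g k = Cminus (conv B f g k) (conv B f' g k).
Proof. unfold conv, Bsum. rewrite <- Csum_minus. apply Csum_ext. intros; ring. Qed.
Lemma conv_minus_r B f g g' k : conv B f (fun k => Cminus (g k) (g' k)) k = Cminus (conv B f g k) (conv B f g' k).
Proof. unfold conv, Bsum. rewrite <- Csum_minus. apply Csum_ext. intros; ring. Qed.
Lemma conv_ext B f f' g g' k : (forall l, f l = f' l) -> (forall l, g l = g' l) -> conv B f g k = conv B f' g' k.
Proof. intros H H'. apply Csum_ext. intros l _. now rewrite H, H'. Qed.

Section Prod.
Variables chi rho : R -> R.
Hypothesis HD : dyadic_partition chi rho.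
Notation b := (blk chi rho).
Notation bl := (LPblock chi rho).
Notation bes := (besov_le chi rho).

Lemma znorm_tri k l : znorm (kadd k l) <= znorm k + znorm l.
Proof.
  change (znorm (kadd k l)) with (Cmod (IZR (fst k + fst l), IZR (snd k + snd l))). rewrite !plus_IZR.
  apply (Cmod_triangle (IZR (fst k), IZR (snd k)) (IZR (fst l), IZR (snd l))).
Qed.

(** A mode k of the product arises from l and k - l, and none of the three norms exceeds the sum of
    the other two. With the annuli of the blocks, this forbids any of the three indices to exceed
    both others by 3 or more. *)
Lemma blk_adm n i j k l : b n k <> 0 -> b i l <> 0 -> b j (ksub k l) <> 0 -> adm n i j.
Proof.
  intros Hn Hi Hj.
  pose proof (blk_hi _ _ HD _ _ Hn) as hn. pose proof (blk_hi _ _ HD _ _ Hi) as hi. pose proof (blk_hi _ _ HD _ _ Hj) as hj.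
  assert (T1 : znorm k <= znorm l + znorm (ksub k l)).
  { replace k with (kadd l (ksub k l)) at 1 by (destruct k, l; unfold kadd, ksub; simpl; f_equal; lia). apply znorm_tri. }
  assert (T2 : znorm l <= znorm k + znorm (ksub k l)).
  { rewrite <- (znorm_opp (ksub k l)).
    replace l with (kadd k (kopp (ksub k l))) at 1 by (destruct k, l; unfold kadd, ksub, kopp; simpl; f_equal; lia). apply znorm_tri. }
  assert (T3 : znorm (ksub k l) <= znorm k + znorm l).
  { rewrite <- (znorm_opp l).
    replace (ksub k l) with (kadd k (kopp l)) at 1 by (destruct k, l; unfold kadd, ksub, kopp; simpl; f_equal; lia). apply znorm_tri. }
  assert (pw : forall a c d, (a + d <= c)%nat -> 2 ^ a * 2 ^ d <= 2 ^ c).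
  { intros a c d H. rewrite <- pow_add. apply Rle_pow; [lra|auto]. }
  split; [|split].
  - apply Nat.nlt_ge. intros H. pose proof (blk_lo _ _ HD n k ltac:(lia) Hn) as L.
    pose proof (pw i n 3%nat ltac:(lia)). pose proof (pw j n 3%nat ltac:(lia)). simpl in *. lra.
  - intros H. apply Nat.nlt_ge. intros H'. pose proof (blk_lo _ _ HD i l ltac:(lia) Hi) as L.
    pose proof (pw n i 3%nat ltac:(lia)). pose proof (pw j i 3%nat ltac:(lia)). simpl in *. lra.
  - intros H. apply Nat.nlt_ge. intros H'. pose proof (blk_lo _ _ HD j _ ltac:(lia) Hj) as L.
    pose proof (pw n j 3%nat ltac:(lia)). pose proof (pw i j 3%nat ltac:(lia)). simpl in *. lra.
Qed.

Lemma sN_box B : exists J, forall N, (J <= N)%nat -> forall k, inbox B k -> sN chi rho N k = 1.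
Proof.
  destruct (pow2_unbounded (4 * INR B)) as [J HJ]. exists J. intros N HN k [H1 H2]. apply (sN_one _ _ HD).
  assert (2 ^ J <= 2 ^ N) by (apply Rle_pow; [lra|auto]).
  pose proof (pos_INR B). assert (znorm k <= 2 * INR B); [|lra].
  change (znorm k) with (Cmod (IZR (fst k), IZR (snd k))). eapply Rle_trans; [apply Cmod_le_comp|]. simpl.
  apply IZR_le in H1, H2. rewrite abs_IZR, <- INR_IZR_INZ in H1, H2. lra.
Qed.

Lemma SN_id B f : supp B f -> exists J, forall N, (J <= N)%nat -> forall k, SN chi rho N f k = f k.
Proof.
  intros S. destruct (sN_box B) as [J HJ]. exists J. intros N HN k. unfold SN, mul.
  destruct (classic (inbox B k)) as [Hk|Hk]; [rewrite HJ by auto; ring|rewrite S by auto; ring].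
Qed.

(** The paraproduct estimate, with a constant independent of the number of modes. The three kinds of
    interaction are not separated: only admissible triples contribute, and [adm_weight] sums them
    all at once. *)
Lemma prod_trig be s : 0 < be -> - be < s <= be -> s <> 0 -> exists C, 0 < C /\
  forall B f g F G, supp B f -> supp B g -> bes be f F -> bes s g G -> bes s (conv B f g) (C * F * G).
Proof.
  intros Hb Hs Hs0. destruct (adm_weight be s Hb Hs Hs0) as (d & C0 & Hd & HC & HW).
  destruct (blk_L1 _ _ HD) as (CK & CK1 & HK).
  set (q := Rpower 2 (- d)). fold q in HW.
  assert (Hq : 0 < q < 1).
  { split; [apply exp_pos|]. unfold q. rewrite <- (Rpower_O 2) by lra. apply Rpower_lt; lra. }
  assert (I : 0 < / (1 - q)) by (apply Rinv_0_lt_compat; lra).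
  exists (CK * C0 * (3 / (1 - q)) ^ 2).
  split; [apply Rmult_lt_0_compat; auto; apply Rmult_lt_0_compat; lra|].
  intros B f g F G Sf Sg Hf Hg.
  pose proof (bes_nonneg _ _ _ _ _ Hf) as F0. pose proof (bes_nonneg _ _ _ _ _ Hg) as G0.
  rewrite bes_iff in Hf, Hg. rewrite bes_iff. intros n x.
  destruct (sN_box B) as [J HJ]. set (l := seq 0 (S J)).
  assert (DEC : forall h, supp B h -> forall k, h k = Csum l (fun i => mul (b i) h k)).
  { intros h Sh k. unfold mul. rewrite Csum_scal_r, <- RtoC_Rsum. unfold l. rewrite <- sN_Rsum.
    destruct (classic (inbox B k)) as [Hk|Hk]; [rewrite (HJ J (le_n _) k Hk); ring|rewrite Sh by auto; ring]. }
  set (B2 := (B + B + 3 * 2 ^ n)%nat).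
  rewrite (bl_ev _ _ HD n B2) by (unfold B2; lia).
  assert (E : forall k, mul (b n) (conv B f g) k =
     Csum l (fun i => Csum l (fun j => mul (b n) (conv B (mul (b i) f) (mul (b j) g)) k))).
  { intros k. unfold mul at 1.
    transitivity (Cmult (RtoC (b n k)) (Csum l (fun i => Csum l (fun j => conv B (mul (b i) f) (mul (b j) g) k)))).
    - f_equal. unfold conv, Bsum.
      rewrite (Csum_ext (box B) _ (fun l0 => Csum l (fun i => Csum l (fun j => Cmult (mul (b i) f l0) (mul (b j) g (ksub k l0)))))).
      + rewrite Csum_exch. apply Csum_ext. intros i _. now rewrite Csum_exch.
      + intros l0 _. rewrite (DEC f Sf l0) at 1. rewrite (DEC g Sg (ksub k l0)) at 1.
        rewrite <- Csum_scal_r. apply Csum_ext. intros i _. now rewrite <- Csum_scal.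
    - rewrite <- Csum_scal. apply Csum_ext. intros i _. now rewrite <- Csum_scal. }
  rewrite (ev_ext B2 _ _ x (fun k _ => E k)), ev_Csum.
  set (p := fun i => q ^ i + q ^ ((i - n) + (n - i))).
  assert (TERM : forall i j, Cmod (ev B2 (mul (b n) (conv B (mul (b i) f) (mul (b j) g))) x) <=
     CK * (C0 * F * G * wt (- s) n) * (p i * p j)).
  { intros i j.
    assert (P0 : 0 <= p i * p j).
    { unfold p. apply Rmult_le_pos; apply Rplus_le_le_0_compat; apply pow_le; lra. }
    assert (K0 : 0 <= CK * (C0 * F * G * wt (- s) n)).
    { pose proof (wt_pos (- s) n). repeat apply Rmult_le_pos; lra. }
    destruct (classic (adm n i j)) as [Ha|Ha].
    - apply Rle_trans with (CK * ((F * wt (- be) i) * (G * wt (- s) j))).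
      + apply HK. intros y.
        assert (S1 : supp B (mul (b i) f)) by now apply supp_mul.
        assert (S2 : supp B (mul (b j) g)) by now apply supp_mul.
        rewrite (ev_supp B2 (B + B) (conv B (mul (b i) f) (mul (b j) g)));
          [|apply supp_le with (B + B)%nat; [unfold B2; lia|]; now apply supp_conv|now apply supp_conv].
        rewrite (ev_conv B B) by auto. rewrite Cmod_mult.
        rewrite (ev_supp B (3 * 2 ^ i) (mul (b i) f)) by (auto; apply supp_mul_l, (blk_out _ _ HD)).
        rewrite (ev_supp B (3 * 2 ^ j) (mul (b j) g)) by (auto; apply supp_mul_l, (blk_out _ _ HD)).
        apply Rmult_le_compat; try apply Cmod_ge_0; [apply Hf|apply Hg].
      + specialize (HW n i j Ha). fold (p i) in HW. fold (p j) in HW.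
        rewrite (Rmult_assoc CK). apply Rmult_le_compat_l; [lra|].
        replace (F * wt (- be) i * (G * wt (- s) j)) with (F * G * (wt (- be) i * wt (- s) j)) by ring.
        replace (C0 * F * G * wt (- s) n * (p i * p j)) with (F * G * (C0 * wt (- s) n * (p i * p j))) by ring.
        apply Rmult_le_compat_l; auto. now apply Rmult_le_pos.
    - rewrite (ev_ext B2 _ (fun _ => RtoC 0)).
      + unfold ev, Bsum. rewrite Csum_0 by (intros; ring). rewrite Cmod_0. now apply Rmult_le_pos.
      + intros k _. unfold mul at 1. destruct (classic (b n k = 0)) as [->|Hn]; [ring|].
        unfold conv, Bsum. rewrite Csum_0; [ring|]. intros l0 _. unfold mul.
        destruct (classic (b i l0 = 0)) as [->|Hi]; [ring|].
        destruct (classic (b j (ksub k l0) = 0)) as [->|Hj]; [ring|].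
        exfalso. apply Ha. eapply blk_adm; eauto. }
  eapply Rle_trans; [apply Cmod_Csum|].
  apply Rle_trans with (Rsum l (fun i => CK * (C0 * F * G * wt (- s) n) * Rsum l p * p i)).
  { apply Rsum_le. intros i _. rewrite ev_Csum. eapply Rle_trans; [apply Cmod_Csum|].
    eapply Rle_trans; [apply Rsum_le; intros j _; apply TERM|]. rewrite Rsum_scal, Rsum_scal. apply Req_le. ring. }
  rewrite Rsum_scal.
  assert (SP : 0 <= Rsum l p <= 3 / (1 - q)).
  { split.
    - apply Rsum_ge0. intros i _. unfold p. apply Rplus_le_le_0_compat; apply pow_le; lra.
    - unfold p, l. rewrite Rsum_plus. pose proof (geom_sum q (S J) Hq). pose proof (geom_sum_near q n (S J) Hq).
      unfold Rdiv in *. change (Rsum (seq 0 (S J)) (pow q)) with (Rsum (seq 0 (S J)) (fun i => q ^ i)). lra. }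
  replace (CK * C0 * (3 / (1 - q)) ^ 2 * F * G * wt (- s) n) with (CK * (C0 * F * G * wt (- s) n) * (3 / (1 - q) * (3 / (1 - q)))) by ring.
  rewrite Rmult_assoc. apply Rmult_le_compat_l.
  - pose proof (wt_pos (- s) n). repeat apply Rmult_le_pos; lra.
  - apply Rmult_le_compat; lra.
Qed.

Notation TN := (dmul_approx chi rho).
Notation SNf := (SN chi rho).
Lemma TN_conv N f g k : TN N f g k = conv (3 * 2 ^ N) (SNf N f) (SNf N g) k.
Proof. reflexivity. Qed.

Lemma wt_to_0 eps c : 0 < eps -> 0 < c -> exists N0, forall N, (N0 <= N)%nat -> wt (- eps) N <= c.
Proof.
  intros He Hc.
  assert (H2 : 0 < ln 2) by (rewrite <- ln_1; apply ln_increasing; lra).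
  destruct (nfloor_ex (Rmax 0 (1 - ln c / (eps * ln 2)))) as [N0 [_ HN]]; [apply Rmax_l|].
  exists (N0 + 1)%nat. intros N HN'. unfold wt, Rpower. rewrite <- (exp_ln c) by auto.
  assert (L : (INR N - 1) * - eps * ln 2 <= ln c).
  { apply le_INR in HN'. rewrite plus_INR in HN'. simpl in HN'.
    pose proof (Rmax_r 0 (1 - ln c / (eps * ln 2))).
    assert (X : - (ln c / (eps * ln 2)) <= INR N - 1) by lra.
    apply (Rmult_le_compat_r (eps * ln 2)) in X; [|nra].
    replace (- (ln c / (eps * ln 2)) * (eps * ln 2)) with (- ln c) in X by (field; split; lra). lra. }
  destruct L as [L| ->]; [apply Rlt_le, exp_increasing; auto|lra].
Qed.

(** With a little regularity [e] given up in both factors, the truncated products are Cauchy by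
    [bes_SN_tail], so the limits in [dmul] exist. The bound without loss is then recovered from the
    uniform bound on the truncations through [bes_closed]. *)
Lemma dmul_bes be s : 0 < be -> - be < s <= be -> s <> 0 -> exists C, 0 < C /\
  forall f g F G, bes be f F -> bes s g G ->
  (forall k, Ccv (fun N => TN N f g k) (dmul chi rho f g k)) /\ bes s (dmul chi rho f g) (C * F * G).
Proof.
  intros Hb Hs Hs0.
  (* Small enough for [(be - e, s - e)] to satisfy the hypotheses of [prod_trig] again; in
     particular [s - e] keeps the sign of [s]. *)
  set (e := Rmin (be / 2) (Rmin ((be + s) / 4) (Rabs s / 2))).
  assert (Pa : 0 < Rabs s) by now apply Rabs_pos_lt.
  assert (He : 0 < e) by (unfold e; repeat apply Rmin_glb_lt; lra).
  assert (e2 : e <= (be + s) / 4) by (unfold e; eapply Rle_trans; [apply Rmin_r|apply Rmin_l]).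
  assert (e3 : e <= Rabs s / 2) by (unfold e; eapply Rle_trans; [apply Rmin_r|apply Rmin_r]).
  assert (As : (0 < s /\ Rabs s = s) \/ (s < 0 /\ Rabs s = - s)).
  { unfold Rabs; destruct (Rcase_abs s); [right|left]; split; lra. }
  destruct (prod_trig be s Hb Hs Hs0) as (C1 & C1p & P1).
  destruct (prod_trig (be - e) (s - e)) as (C2 & C2p & P2); [lra|lra|destruct As; lra|].
  destruct (bes_SN _ _ HD) as (C3 & C3p & P3). destruct (bes_SN_tail _ _ HD) as (C4 & C4p & P4).
  exists (C1 * C3 * C3). split; [repeat apply Rmult_lt_0_compat; lra|].
  intros f g F G Hf Hg. pose proof (bes_nonneg _ _ _ _ _ Hf) as F0. pose proof (bes_nonneg _ _ _ _ _ Hg) as G0.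
  assert (box_le : forall N M, (N <= M)%nat -> (3 * 2 ^ N <= 3 * 2 ^ M)%nat).
  { intros N M H. assert (2 ^ N <= 2 ^ M)%nat by (apply Nat.pow_le_mono_r; lia). lia. }
  assert (SS : forall N M h, (N <= M)%nat -> supp (3 * 2 ^ M) (SNf N h)).
  { intros N M h H. apply supp_le with (3 * 2 ^ N)%nat; auto. apply (supp_SN _ _ HD). }
  assert (SM : forall N M h, (N <= M)%nat -> supp (3 * 2 ^ M) (fun k => Cminus (SNf M h k) (SNf N h k))).
  { intros N M h H k Hk. rewrite (SS M M), (SS N M) by auto. ring. }
  set (K := C3 * F * (2 * C4 * G) + 2 * C4 * F * (C3 * G)).
  assert (Hw : forall a h H N, bes a h H -> bes (a - e) (SNf N h) (Rpower 2 e * (C3 * H))).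
  { intros a h H N Hh. eapply bes_le; [|apply (bes_weaken _ _ a (a - e)); [lra|apply P3, Hh]].
    apply Req_le. do 2 f_equal. ring. }
  assert (Hd : forall a h H N M, (N <= M)%nat -> bes a h H ->
     bes (a - e) (fun k => Cminus (SNf M h k) (SNf N h k)) (2 * C4 * wt (- e) N * H)).
  { intros a h H N M HNM Hh. pose proof (bes_nonneg _ _ _ _ _ Hh) as H0.
    apply bes_ext with (fun k => Cminus (Cminus (h k) (SNf N h k)) (Cminus (h k) (SNf M h k))); [intros; ring|].
    eapply bes_le; [|apply bes_minus; apply P4; [lra|eassumption|lra|eassumption]].
    pose proof (wt_mono e N M ltac:(lra) HNM).
    assert (C4 * wt (- e) M * H <= C4 * wt (- e) N * H) by (apply Rmult_le_compat_r; auto; apply Rmult_le_compat_l; lra). lra. }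
  assert (DIFF : forall N M, (N <= M)%nat ->
     bes (s - e) (fun k => Cminus (TN M f g k) (TN N f g k)) (C2 * Rpower 2 e * K * wt (- e) N)).
  { intros N M HNM. set (B := (3 * 2 ^ M)%nat).
    apply bes_ext with (fun k => Cplus (conv B (fun k => Cminus (SNf M f k) (SNf N f k)) (SNf M g) k)
       (conv B (SNf N f) (fun k => Cminus (SNf M g k) (SNf N g k)) k)).
    - intros k. rewrite !TN_conv, conv_minus_l, conv_minus_r.
      rewrite (conv_box (3 * 2 ^ N) B (SNf N f)) by (apply (supp_SN _ _ HD) || now apply SS). fold B. ring.
    - eapply bes_le; [|apply bes_plus; apply P2].
      2: now apply SM. 2: now apply SS. 2: apply (Hd be f F N M HNM Hf). 2: apply (Hw s g G M Hg).
      2: now apply SS. 2: now apply SM. 2: apply (Hw be f F N Hf). 2: apply (Hd s g G N M HNM Hg).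
      apply Req_le. unfold K. ring. }
  assert (R0 : 0 < Rpower 2 e) by apply exp_pos.
  assert (K0 : 0 <= K) by (unfold K; apply Rplus_le_le_0_compat; repeat apply Rmult_le_pos; lra).
  assert (CV : forall k, exists l, Ccv (fun N => TN N f g k) l).
  { intros k. apply Ccv_cauchy. intros eps Heps.
    destruct (bes_coef _ _ HD (s - e) k) as (Ck & Ck0 & Hk).
    set (c := Ck * (C2 * Rpower 2 e * K) + 1).
    assert (c0 : 0 < c) by (unfold c; assert (0 <= Ck * (C2 * Rpower 2 e * K)); [repeat apply Rmult_le_pos; lra|lra]).
    destruct (wt_to_0 e (eps / c) He) as [N0 HN]; [now apply Rdiv_lt_0_compat|].
    exists N0. intros N M HNM. specialize (HN N ltac:(lia)).
    eapply Rle_trans; [apply (Hk _ _ (DIFF N M ltac:(lia)))|].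
    pose proof (wt_pos (- e) N).
    apply Rle_trans with (c * wt (- e) N).
    - unfold c. rewrite <- Rmult_assoc. apply Rmult_le_compat_r; lra.
    - apply (Rmult_le_compat_l c) in HN; [|lra]. replace (c * (eps / c)) with eps in HN by (field; lra). auto. }
  assert (CV' : forall k, Ccv (fun N => TN N f g k) (dmul chi rho f g k)).
  { intros k. destruct (CV k) as [l Hl]. unfold dmul. now rewrite (Ccv_Lim _ _ Hl). }
  split; auto.
  apply (bes_closed _ _ HD). intros B eps Heps.
  assert (UN : exists N, forall k, In k (box B) -> Cmod (Cminus (dmul chi rho f g k) (TN N f g k)) <= eps).
  { assert (UN' : exists N0, forall N, (N0 <= N)%nat -> forall k, In k (box B) -> Cmod (Cminus (TN N f g k) (dmul chi rho f g k)) <= eps).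
    { induction (box B) as [|k l IH]; [exists 0%nat; intros N _ k []|].
      destruct IH as [N1 H1]. destruct (CV' k eps Heps) as [N2 H2]. exists (Nat.max N1 N2).
      intros N HN k' [<-|Hk]; [apply H2; lia|apply H1; auto; lia]. }
    destruct UN' as [N H]. exists N. intros k Hk. rewrite <- Cmod_opp.
    replace (Copp _) with (Cminus (TN N f g k) (dmul chi rho f g k)) by ring. auto. }
  destruct UN as [N HN]. exists (fun k => TN N f g k). split.
  - replace (C1 * C3 * C3 * F * G) with (C1 * (C3 * F) * (C3 * G)) by ring.
    apply bes_ext with (conv (3 * 2 ^ N) (SNf N f) (SNf N g)); [intros k; symmetry; apply TN_conv|].
    exact (P1 _ _ _ _ _ (supp_SN _ _ HD N f) (supp_SN _ _ HD N g) (P3 _ _ _ N Hf) (P3 _ _ _ N Hg)).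
  - intros k Hk. apply HN. now apply In_box.
Qed.

(** For trigonometric polynomials S_N is eventually the identity, so the defining limit is
    stationary and the abstract product is the ordinary one. *)
Lemma dmul_trig B f g k : supp B f -> supp B g -> dmul chi rho f g k = conv B f g k.
Proof.
  intros Sf Sg. destruct (SN_id B f Sf) as [J1 H1]. destruct (SN_id B g Sg) as [J2 H2].
  symmetry. apply Ccv_unique with (fun N => TN N f g k).
  - apply Ccv_const with (Nat.max (Nat.max J1 J2) B). intros N HN.
    rewrite TN_conv.
    rewrite (conv_ext _ _ f _ g) by (intros; (apply H1 || apply H2); lia).
    apply conv_box; auto. apply supp_le with B; auto. pose proof (Nat.pow_gt_lin_r 2 N). lia.
  - unfold dmul. set (u := fun N => TN N f g k).
    assert (Ccv u (conv B f g k)).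
    { apply Ccv_const with (Nat.max (Nat.max J1 J2) B). intros N HN. unfold u.
      rewrite TN_conv.
      rewrite (conv_ext _ _ f _ g) by (intros; (apply H1 || apply H2); lia).
      apply conv_box; auto. apply supp_le with B; auto. pose proof (Nat.pow_gt_lin_r 2 N). lia. }
    change (Ccv u (real (Lim_seq (fun N => fst (u N))), real (Lim_seq (fun N => snd (u N))))).
    now rewrite (Ccv_Lim _ _ H).
Qed.

Lemma supp_dmul B f g : supp B f -> supp B g -> supp (B + B) (dmul chi rho f g).
Proof. intros Sf Sg k Hk. rewrite (dmul_trig B) by auto. now apply supp_conv with (B1 := B) (B2 := B). Qed.
Lemma ev_dmul B f g x : supp B f -> supp B g -> ev (B + B) (dmul chi rho f g) x = Cmult (ev B f x) (ev B g x).
Proof.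
  intros Sf Sg. rewrite (ev_ext _ _ (conv B f g)) by (intros; now apply dmul_trig). now apply ev_conv.
Qed.

(** [dmul] is bilinear only where its limits exist, so bilinearity is checked mode by mode through
    uniqueness of limits; [dmul_bes] then applies to (f - f')g + f'(g - g'). *)
Lemma dmul_lip be s : 0 < be -> - be < s <= be -> s <> 0 -> exists C, 0 < C /\
  forall f f' g g' F G d e, bes be f F -> bes be f' F -> bes s g G -> bes s g' G ->
   bes be (dsub f f') d -> bes s (dsub g g') e ->
   bes s (dsub (dmul chi rho f g) (dmul chi rho f' g')) (C * (d * G + F * e)).
Proof.
  intros Hb Hs Hs0. destruct (dmul_bes be s Hb Hs Hs0) as (C & C0 & H). exists C. split; auto.
  intros f f' g g' F G d e Hf Hf' Hg Hg' Hd He.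
  destruct (H _ _ _ _ Hf Hg) as [c1 _]. destruct (H _ _ _ _ Hf' Hg) as [c2 _]. destruct (H _ _ _ _ Hf' Hg') as [c3 _].
  destruct (H _ _ _ _ Hd Hg) as [c4 b4]. destruct (H _ _ _ _ Hf' He) as [c5 b5].
  replace (C * (d * G + F * e)) with (C * d * G + C * F * e) by ring.
  eapply bes_ext; [|apply (bes_plus _ _ _ _ _ _ _ b4 b5)]. intros k. cbv beta.
  assert (A1 : dmul chi rho (dsub f f') g k = Cminus (dmul chi rho f g k) (dmul chi rho f' g k)).
  { apply Ccv_unique with (fun N => TN N (dsub f f') g k); auto.
    pose proof (Ccv_minus _ _ _ _ (c1 k) (c2 k)) as Q. intros eps Heps. destruct (Q eps Heps) as [N0 HN]. exists N0.
    intros N Hn. specialize (HN N Hn). cbv beta in HN. rewrite !TN_conv, <- conv_minus_l in HN.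
    rewrite TN_conv. erewrite conv_ext; [apply HN| |reflexivity]. intros. unfold SN, mul, dsub. ring. }
  assert (A2 : dmul chi rho f' (dsub g g') k = Cminus (dmul chi rho f' g k) (dmul chi rho f' g' k)).
  { apply Ccv_unique with (fun N => TN N f' (dsub g g') k); auto.
    pose proof (Ccv_minus _ _ _ _ (c2 k) (c3 k)) as Q. intros eps Heps. destruct (Q eps Heps) as [N0 HN]. exists N0.
    intros N Hn. specialize (HN N Hn). cbv beta in HN. rewrite !TN_conv, <- conv_minus_r in HN.
    rewrite TN_conv. erewrite conv_ext; [apply HN|reflexivity|]. intros. unfold SN, mul, dsub. ring. }
  rewrite A1, A2. unfold dsub. ring.
Qed.

End Prod.

(** * The polynomial nonlinearity as a locally Lipschitz map *)

Lemma uniform_const (P : nat -> R -> Prop) : (forall n C C', C <= C' -> P n C -> P n C') ->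
  (forall n, exists C, 0 < C /\ P n C) -> forall N, exists C, 0 < C /\ forall n, (n <= N)%nat -> P n C.
Proof.
  intros M H N. induction N as [|N (C & C0 & IH)].
  - destruct (H 0%nat) as (C & C0 & HC). exists C. split; auto. intros n Hn. now replace n with 0%nat by lia.
  - destruct (H (S N)) as (C' & C0' & HC'). exists (C + C'). split; [lra|]. intros n Hn.
    destruct (le_lt_dec n N) as [H1|H1].
    + apply M with C; [lra|auto].
    + replace n with (S N) by lia. apply M with C'; [lra|auto].
Qed.

(** [Psi] for an arbitrary family [z i j] in place of the Wick powers. *)
Definition PsiG (chi rho : R -> R) (m : nat) (nu tau : C) (z : nat -> nat -> fdist) (v : fdist) : fdist := fun k =>
  Cplus (Cmult (Copp nu) (Csum (seq 0 (m + 2)) (fun i => Csum (seq 0 (S m)) (fun j =>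
        Cmult (RtoC (INR (binom (m + 1) i) * INR (binom m j)))
          (dmul chi rho (dmul chi rho (dpow chi rho v i) (dpow chi rho (dconj v) j)) (z (m + 1 - i) (m - j))%nat k)))))
   (Cmult (Cplus tau (RtoC 1)) (Cplus (v k) (z 1%nat 0%nat k))).

(** Every colon power is 1, Z, a member of the family, or a conjugate of one of these, so bounds and
    continuity are checked in five cases. *)
Lemma Zcolon_cases m a b : (a <= m + 1)%nat -> (b <= m)%nat ->
  (forall Zt Zft, Zcolon Zt Zft a b = done) \/ (forall Zt Zft, Zcolon Zt Zft a b = Zt) \/
  (forall Zt Zft, Zcolon Zt Zft a b = dconj Zt) \/
  (exists i j, inL m i j /\ forall Zt Zft, Zcolon Zt Zft a b = Zft i j) \/
  (exists i j, inL m i j /\ forall Zt Zft, Zcolon Zt Zft a b = dconj (Zft i j)).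
Proof.
  intros Ha Hb.
  destruct (Nat.eq_dec (a + b) 0); [left; replace a with 0%nat by lia; now replace b with 0%nat by lia|].
  destruct (Nat.eq_dec (a + b) 1).
  { destruct a as [|a]; right; [right; left|left].
    - now replace b with 1%nat by lia.
    - replace a with 0%nat by lia. now replace b with 0%nat by lia. }
  right; right; right.
  assert (E : forall Zt Zft, Zcolon Zt Zft a b = if Nat.leb b a then Zft a b else dconj (Zft b a)).
  { intros. destruct a as [|[|a]]; destruct b as [|[|b]]; try lia; reflexivity. }
  destruct (Nat.leb_spec b a).
  - left. exists a, b. split; [unfold inL; lia|]. auto.
  - right. exists b, a. split; [unfold inL; lia|]. auto.
Qed.

Section PsiSec.
Variables chi rho : R -> R.
Hypothesis HD : dyadic_partition chi rho.
Notation bes := (besov_le chi rho).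
Notation "f ** g" := (dmul chi rho f g) (at level 40).

Lemma bes_sub_sym a f g d : bes a (dsub f g) d -> bes a (dsub g f) d.
Proof.
  intros H n x. replace (LPblock chi rho n (dsub g f) x) with (Copp (LPblock chi rho n (dsub f g) x)).
  - rewrite Cmod_opp. apply H.
  - unfold dsub. rewrite !bl_minus. ring.
Qed.

Lemma blk_0 n : blk chi rho n (0%Z, 0%Z) = if Nat.eqb n 0 then 1 else 0.
Proof.
  assert (Z : znorm (0%Z, 0%Z) = 0).
  { unfold znorm; simpl. replace (0 * (0 * 1) + 0 * (0 * 1)) with 0 by ring. apply sqrt_0. }
  destruct n as [|n].
  - pose proof (sN_one _ _ HD 0 (0%Z, 0%Z)) as H. rewrite Z in H. specialize (H ltac:(simpl; lra)).
    unfold sN in H. simpl in *. rewrite Z in *. lra.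
  - simpl. rewrite Z. unfold Rdiv. rewrite Rmult_0_l. apply (rho_data _ _ HD). left. rewrite Rabs_R0. lra.
Qed.
Lemma done_k k : k <> (0%Z, 0%Z) -> done k = RtoC 0.
Proof.
  intros H. unfold done. destruct (Z.eqb_spec (fst k) 0); auto. destruct (Z.eqb_spec (snd k) 0); auto.
  exfalso. apply H. destruct k; simpl in *; congruence.
Qed.
Lemma supp_done B : supp B done.
Proof. intros k Hk. apply done_k. intros ->. apply Hk. unfold inbox; simpl; lia. Qed.
Lemma ev_done B x : ev B done x = RtoC 1.
Proof.
  unfold ev. rewrite (Bsum_single B (0%Z, 0%Z)).
  - rewrite ek_0. unfold done; simpl. ring.
  - unfold inbox; simpl; lia.
  - intros k Hk. rewrite done_k by auto. ring.
Qed.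
Lemma bes_done a : bes a done (wt a 0).
Proof.
  apply bes_iff. intros n x. rewrite LPblock_ev. unfold ev.
  rewrite (Bsum_single _ (0%Z, 0%Z)).
  - unfold mul. rewrite blk_0, ek_0. unfold done; simpl. pose proof (wt_opp a 0). pose proof (wt_pos a 0). pose proof (wt_pos (- a) n).
    destruct n; simpl.
    + rewrite !Cmult_1_r, Cmod_1. lra.
    + rewrite !Cmult_1_r, Cmod_0. apply Rmult_le_pos; lra.
  - unfold inbox; simpl; lia.
  - intros k Hk. unfold mul. rewrite done_k by auto. ring.
Qed.

(** The Lipschitz factor is that of x^n on a ball of radius A. For n = 0 the truncated exponent
    [n - 1] is 0 and the factor [INR n] annihilates the term. *)
Lemma dpow_bes be : 0 < be -> forall n, exists C, 0 < C /\
  forall v w A d, bes be v A -> bes be w A -> bes be (dsub v w) d ->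
   bes be (dpow chi rho v n) (C * A ^ n) /\
   bes be (dsub (dpow chi rho v n) (dpow chi rho w n)) (C * (INR n * A ^ (n - 1) * d)).
Proof.
  intros Hb n. destruct (dmul_bes _ _ HD be be Hb ltac:(lra) ltac:(lra)) as (C1 & C1p & P1).
  destruct (dmul_lip _ _ HD be be Hb ltac:(lra) ltac:(lra)) as (C2 & C2p & P2).
  induction n as [|n (C & C0 & IH)].
  - exists (wt be 0). split; [apply wt_pos|]. intros v w A d _ _ _. split.
    + rewrite Rmult_1_r. apply bes_done.
    + apply bes_0; [simpl; lra|]. intros k. unfold dsub; simpl. ring.
  - exists (C1 * C + C2 * C). split; [nra|]. intros v w A d Hv Hw Hd.
    pose proof (bes_nonneg _ _ _ _ _ Hv) as A0. pose proof (bes_nonneg _ _ _ _ _ Hd) as d0.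
    destruct (IH v w A d Hv Hw Hd) as [b1 l1]. destruct (IH w v A d Hw Hv (bes_sub_sym _ _ _ _ Hd)) as [b2 _].
    pose proof (pow_le A n A0) as An. pose proof (pos_INR n) as n0.
    split.
    + eapply bes_le; [|apply (P1 _ _ _ _ b1 Hv)]. simpl. assert (0 <= A * A ^ n) by nra. assert (0 <= C2 * C) by nra. nra.
    + simpl dpow. eapply bes_le; [|apply (P2 _ _ _ _ _ _ _ _ b1 b2 Hv Hw l1 Hd)].
      replace (S n - 1)%nat with n by lia. rewrite S_INR.
      assert (E : INR n * A ^ (n - 1) * A = INR n * A ^ n).
      { destruct n; [simpl; ring|]. replace (S n - 1)%nat with n by lia. simpl; ring. }
      replace (C2 * (C * (INR n * A ^ (n - 1) * d) * A + C * A ^ n * d)) with (C2 * C * d * (INR n * A ^ (n - 1) * A + A ^ n)) by ring.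
      rewrite E. assert (0 <= d * (INR n * A ^ n + A ^ n)) by (apply Rmult_le_pos; nra).
      assert (0 <= C1 * C) by nra. nra.
Qed.

(** [1 <= A] lets all monomials of degree at most p + 1 share the bounds of the top degree, A^(p+1)
    for the size and A^p for the Lipschitz constant. *)
Lemma mono_bes be al : 0 < al < be -> forall i j p, (i + j <= S p)%nat -> exists C, 0 < C /\
  forall v w z z' A B d e, 1 <= A -> bes be v A -> bes be w A -> bes be (dsub v w) d ->
   bes (- al) z B -> bes (- al) z' B -> bes (- al) (dsub z z') e ->
   bes (- al) ((dpow chi rho v i ** dpow chi rho (dconj v) j) ** z) (C * (A ^ S p * B)) /\
   bes (- al) (dsub ((dpow chi rho v i ** dpow chi rho (dconj v) j) ** z) ((dpow chi rho w i ** dpow chi rho (dconj w) j) ** z'))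
     (C * (A ^ p * d * B + A ^ S p * e)).
Proof.
  intros Hab i j p Hp.
  destruct (dpow_bes be ltac:(lra) i) as (Ci & Ci0 & Hi). destruct (dpow_bes be ltac:(lra) j) as (Cj & Cj0 & Hj).
  destruct (dmul_bes _ _ HD be be ltac:(lra) ltac:(lra) ltac:(lra)) as (C1 & C1p & P1).
  destruct (dmul_lip _ _ HD be be ltac:(lra) ltac:(lra) ltac:(lra)) as (C2 & C2p & P2).
  destruct (dmul_bes _ _ HD be (- al) ltac:(lra) ltac:(lra) ltac:(lra)) as (C3 & C3p & P3).
  destruct (dmul_lip _ _ HD be (- al) ltac:(lra) ltac:(lra) ltac:(lra)) as (C4 & C4p & P4).
  set (X := C1 * Ci * Cj). set (Y := C2 * Ci * Cj * (INR i + INR j)).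
  pose proof (pos_INR i) as i0. pose proof (pos_INR j) as j0.
  assert (X0 : 0 < X) by (unfold X; repeat apply Rmult_lt_0_compat; lra).
  assert (Y0 : 0 <= Y) by (unfold Y; repeat apply Rmult_le_pos; lra).
  exists (C3 * X + C4 * (X + Y)). split; [nra|].
  intros v w z z' A B d e HA Hv Hw Hd Hz Hz' He.
  pose proof (bes_nonneg _ _ _ _ _ Hz) as B0. pose proof (bes_nonneg _ _ _ _ _ Hd) as d0. pose proof (bes_nonneg _ _ _ _ _ He) as e0.
  destruct (Hi v w A d Hv Hw Hd) as [bi li]. destruct (Hi w v A d Hw Hv (bes_sub_sym _ _ _ _ Hd)) as [bi' _].
  pose proof (bes_dconj _ _ _ _ _ Hv) as Hcv. pose proof (bes_dconj _ _ _ _ _ Hw) as Hcw.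
  assert (Hcd : bes be (dsub (dconj v) (dconj w)) d).
  { eapply bes_ext; [|apply (bes_dconj _ _ _ _ _ Hd)]. intros k. unfold dconj, dsub. now rewrite Cminus_conj. }
  destruct (Hj _ _ A d Hcv Hcw Hcd) as [bj lj]. destruct (Hj _ _ A d Hcw Hcv (bes_sub_sym _ _ _ _ Hcd)) as [bj' _].
  destruct (P1 _ _ _ _ bi bj) as [_ b1]. destruct (P1 _ _ _ _ bi' bj') as [_ b2].
  assert (pw : forall a, (a <= S p)%nat -> A ^ a <= A ^ S p) by (intros; now apply Rle_pow).
  assert (pw' : forall a, (a <= p)%nat -> A ^ a <= A ^ p) by (intros; now apply Rle_pow).
  assert (Ap0 : forall a, 0 <= A ^ a) by (intros; apply pow_le; lra).
  assert (b1' : forall f, bes be f (C1 * (Ci * A ^ i) * (Cj * A ^ j)) -> bes be f (X * A ^ S p)).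
  { intros f. apply bes_le. replace (C1 * (Ci * A ^ i) * (Cj * A ^ j)) with (X * A ^ (i + j)) by (unfold X; rewrite pow_add; ring).
    apply Rmult_le_compat_l; [lra|auto]. }
  apply b1' in b1, b2.
  assert (l1 : bes be (dsub (dpow chi rho v i ** dpow chi rho (dconj v) j) (dpow chi rho w i ** dpow chi rho (dconj w) j)) (Y * (A ^ p * d))).
  { eapply bes_le; [|apply (P2 _ _ _ _ _ _ _ _ bi bi' bj bj' li lj)].
    assert (T : forall a c, (a + c <= S p)%nat -> INR a * A ^ (a - 1) * A ^ c <= INR a * A ^ p).
    { intros a c H. destruct a as [|a]; [simpl; lra|]. rewrite Rmult_assoc, <- pow_add. apply Rmult_le_compat_l; [apply pos_INR|apply pw'; lia]. }
    pose proof (T i j Hp). pose proof (T j i ltac:(lia)).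
    replace (C2 * (Ci * (INR i * A ^ (i - 1) * d) * (Cj * A ^ j) + Ci * A ^ i * (Cj * (INR j * A ^ (j - 1) * d)))) with
      (C2 * Ci * Cj * d * (INR i * A ^ (i - 1) * A ^ j + INR j * A ^ (j - 1) * A ^ i)) by ring.
    replace (Y * (A ^ p * d)) with (C2 * Ci * Cj * d * (INR i * A ^ p + INR j * A ^ p)) by (unfold Y; ring).
    apply Rmult_le_compat_l; [repeat apply Rmult_le_pos; lra|lra]. }
  assert (U1 : 0 <= A ^ S p * B) by (apply Rmult_le_pos; auto).
  assert (U2 : 0 <= A ^ p * d * B) by (repeat apply Rmult_le_pos; auto).
  assert (U3 : 0 <= A ^ S p * e) by (apply Rmult_le_pos; auto).
  split.
  - destruct (P3 _ _ _ _ b1 Hz) as [_ b3]. eapply bes_le; [|apply b3].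
    assert (0 <= C4 * (X + Y)) by nra. nra.
  - eapply bes_le; [|apply (P4 _ _ _ _ _ _ _ _ b1 b2 Hz Hz' l1 He)].
    apply Rle_trans with (C4 * (X + Y) * (A ^ p * d * B + A ^ S p * e)).
    + rewrite (Rmult_assoc C4). apply Rmult_le_compat_l; [lra|]. nra.
    + apply Rmult_le_compat_r; [lra|]. assert (0 <= C3 * X) by nra. lra.
Qed.

Variables (m : nat) (nu tau : C).
Notation PG := (PsiG chi rho m nu tau).

(** Allowing two families [z] and [z'] serves three purposes: Lipschitz dependence on v, continuity
    in time of the nonlinearity, and the error made when the Wick powers are truncated. *)
Lemma PsiG_bes be al : 0 < al < be -> exists C, 0 < C /\
  forall v w z z' A B d e, 1 <= A -> 1 <= B -> bes be v A -> bes be w A -> bes be (dsub v w) d ->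
   (forall i j, (i <= m + 1)%nat -> (j <= m)%nat -> bes (- al) (z i j) B /\ bes (- al) (z' i j) B /\ bes (- al) (dsub (z i j) (z' i j)) e) ->
   bes (- al) (PG z v) (C * (A ^ (2 * m + 1) * B)) /\
   bes (- al) (dsub (PG z v) (PG z' w)) (C * (A ^ (2 * m) * d * B + A ^ (2 * m + 1) * e)).
Proof.
  intros Hab.
  set (P := fun i j C => forall v w z z' A B d e, 1 <= A -> bes be v A -> bes be w A -> bes be (dsub v w) d ->
   bes (- al) z B -> bes (- al) z' B -> bes (- al) (dsub z z') e ->
   bes (- al) ((dpow chi rho v i ** dpow chi rho (dconj v) j) ** z) (C * (A ^ S (2 * m) * B)) /\
   bes (- al) (dsub ((dpow chi rho v i ** dpow chi rho (dconj v) j) ** z) ((dpow chi rho w i ** dpow chi rho (dconj w) j) ** z'))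
     (C * (A ^ (2 * m) * d * B + A ^ S (2 * m) * e))).
  assert (Pm : forall i j C C', C <= C' -> P i j C -> P i j C').
  { intros i j C C' HC HP v w z z' A B d e HA Hv Hw Hd Hz Hz' He. destruct (HP v w z z' A B d e HA Hv Hw Hd Hz Hz' He) as [H1 H2].
    pose proof (bes_nonneg _ _ _ _ _ Hz) as B0. pose proof (bes_nonneg _ _ _ _ _ Hd) as d0. pose proof (bes_nonneg _ _ _ _ _ He) as e0.
    pose proof (pow_le A (2 * m) ltac:(lra)). assert (0 <= A) by lra.
    split; [eapply bes_le; [|apply H1]|eapply bes_le; [|apply H2]]; apply Rmult_le_compat_r; auto; repeat apply Rplus_le_le_0_compat; repeat apply Rmult_le_pos; auto. }
  assert (EC : exists C, 0 < C /\ forall i j, (i <= m + 1)%nat -> (j <= m)%nat -> P i j C).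
  { destruct (uniform_const (fun i C => forall j, (j <= m)%nat -> (i <= m + 1)%nat -> P i j C)) with (N := (m + 1)%nat) as (C & C0 & HC).
    - intros i C C' H HP j Hj Hi. apply Pm with C; auto.
    - intros i. destruct (uniform_const (fun j C => (j <= m)%nat -> (i <= m + 1)%nat -> P i j C)) with (N := m) as (C & C0 & HC).
      + intros j C C' H HP Hj Hi. apply Pm with C; auto.
      + intros j. destruct (le_lt_dec j m) as [Hj|Hj]; [destruct (le_lt_dec i (m + 1)) as [Hi|Hi]|]; try (exists 1; split; [lra|intros; lia]).
        destruct (mono_bes be al Hab i j (2 * m) ltac:(lia)) as (C & C0 & HC). exists C. split; [auto|intros; exact HC].
      + exists C. split; [auto|]. intros; auto.
    - exists C. split; [auto|]. intros; auto. }
  destruct EC as (C & C0 & HC).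
  set (b0 := INR (length (seq 0 (m + 2)))). set (b1 := INR (length (seq 0 (S m)))).
  destruct (uniform_const (fun i c => INR (binom (m + 1) i) <= c) ltac:(intros; lra)
     ltac:(intros n; exists (INR (binom (m + 1) n) + 1); pose proof (pos_INR (binom (m + 1) n)); lra) (m + 1)%nat) as (c1 & c10 & Hc1).
  destruct (uniform_const (fun i c => INR (binom m i) <= c) ltac:(intros; lra)
     ltac:(intros n; exists (INR (binom m n) + 1); pose proof (pos_INR (binom m n)); lra) m) as (c2 & c20 & Hc2).
  set (t1 := Cmod (Cplus tau (RtoC 1))). set (R1 := Rpower 2 (be + al)).
  assert (t10 : 0 <= t1) by apply Cmod_ge_0. assert (R10 : 0 < R1) by apply exp_pos.
  assert (b00 : 0 <= b0) by apply pos_INR. assert (b10 : 0 <= b1) by apply pos_INR.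
  assert (n0 : 0 <= Cmod nu) by apply Cmod_ge_0.
  set (D1 := Cmod nu * (b0 * (b1 * (c1 * c2 * C)))). set (D2 := t1 * (R1 + 1)).
  assert (D10 : 0 <= D1) by (unfold D1; repeat apply Rmult_le_pos; lra).
  assert (D20 : 0 <= D2) by (unfold D2; apply Rmult_le_pos; lra).
  exists (D1 + D2 + 1). split; [lra|].
  intros v w z z' A B d e HA HB Hv Hw Hd Hz.
  pose proof (bes_nonneg _ _ _ _ _ Hd) as d0.
  destruct (Hz 1%nat 0%nat ltac:(lia) ltac:(lia)) as (Hz1 & Hz1' & Hze1). pose proof (bes_nonneg _ _ _ _ _ Hze1) as e0.
  set (X := A ^ (2 * m + 1) * B). set (Y := A ^ (2 * m) * d * B + A ^ (2 * m + 1) * e).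
  assert (Apos : forall n, 1 <= A ^ n) by (intros; now apply pow_R1_Rle).
  assert (X0 : 0 <= X) by (unfold X; apply Rmult_le_pos; [pose proof (Apos (2 * m + 1)%nat); lra|lra]).
  assert (Y0 : 0 <= Y).
  { unfold Y. pose proof (Apos (2 * m + 1)%nat). pose proof (Apos (2 * m)%nat).
    apply Rplus_le_le_0_compat; repeat apply Rmult_le_pos; lra. }
  assert (bin : forall i j, In i (seq 0 (m + 2)) -> In j (seq 0 (S m)) ->
      (i <= m + 1)%nat /\ (j <= m)%nat /\ 0 <= INR (binom (m + 1) i) * INR (binom m j) <= c1 * c2).
  { intros i j Hi Hj. apply in_seq in Hi, Hj. split; [lia|split; [lia|]].
    specialize (Hc1 i ltac:(lia)). specialize (Hc2 j ltac:(lia)). pose proof (pos_INR (binom (m + 1) i)). pose proof (pos_INR (binom m j)).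
    split; [nra|]. apply Rmult_le_compat; auto. }
  assert (E1 : A ^ S (2 * m) * B = X) by (unfold X; do 2 f_equal; lia).
  assert (E2 : A ^ (2 * m) * d * B + A ^ S (2 * m) * e = Y) by (unfold Y; do 3 f_equal; lia).
  assert (scal_c : forall f c K, 0 <= c <= c1 * c2 -> 0 <= K -> bes (- al) f (C * K) -> bes (- al) (fun k => Cmult (RtoC c) (f k)) (c1 * c2 * C * K)).
  { intros f c K Hc HK Hf. eapply bes_le; [|apply (bes_scal _ _ _ _ _ (RtoC c) Hf)].
    rewrite Cmod_R, Rabs_pos_eq by lra. rewrite (Rmult_assoc (c1 * c2)). apply Rmult_le_compat_r; [nra|lra]. }
  assert (WK : forall f K, 0 <= K -> bes be f K -> bes (- al) f (R1 * K)).
  { intros f K HK Hf. eapply bes_le; [|apply (bes_weaken _ _ be (- al) _ _ ltac:(lra) Hf)].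
    apply Req_le. unfold R1. do 2 f_equal. ring. }
  split.
  - unfold PsiG.
    eapply bes_le; [|apply bes_plus; [apply bes_scal; apply bes_Csum; intros i Hi; apply bes_Csum; intros j Hj|
       apply bes_scal; apply bes_plus; [apply WK; [|apply Hv]; lra|apply Hz1]]].
    2: { destruct (bin i j Hi Hj) as (Hi' & Hj' & Hbin). apply scal_c; [auto| |rewrite <- E1]; [exact X0|].
      destruct (Hz (m + 1 - i)%nat (m - j)%nat ltac:(lia) ltac:(lia)) as (z1 & z2 & z3).
      apply (HC i j Hi' Hj' v w _ _ A B d e HA Hv Hw Hd z1 z2 z3). }
    fold b0 b1 t1. rewrite Cmod_opp.
    replace (Cmod nu * (b0 * (b1 * (c1 * c2 * C * X)))) with (D1 * X) by (unfold D1; ring).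
    assert (R1 * A + B <= (R1 + 1) * X).
    { assert (A <= X). { unfold X. pose proof (Apos (2 * m)%nat). rewrite pow_add. simpl (A ^ 1). assert (A <= A ^ (2 * m) * (A * 1)) by nra. nra. }
      assert (B <= X). { unfold X. pose proof (Apos (2 * m + 1)%nat). nra. } nra. }
    assert (t1 * (R1 * A + B) <= D2 * X) by (unfold D2; rewrite Rmult_assoc; apply Rmult_le_compat_l; auto).
    lra.
  - apply bes_ext with (fun k => Cplus
      (Cmult (Copp nu) (Csum (seq 0 (m + 2)) (fun i => Csum (seq 0 (S m)) (fun j =>
        Cmult (RtoC (INR (binom (m + 1) i) * INR (binom m j)))
          (dsub ((dpow chi rho v i ** dpow chi rho (dconj v) j) ** (z (m + 1 - i) (m - j))%nat)
             ((dpow chi rho w i ** dpow chi rho (dconj w) j) ** (z' (m + 1 - i) (m - j))%nat) k)))))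
      (Cmult (Cplus tau (RtoC 1)) (Cplus (dsub v w k) (dsub (z 1%nat 0%nat) (z' 1%nat 0%nat) k)))).
    { intros k. unfold dsub at 4. unfold PsiG.
      rewrite (Csum_ext (seq 0 (m + 2)) _ (fun i => Cminus (Csum (seq 0 (S m)) (fun j => Cmult (RtoC (INR (binom (m + 1) i) * INR (binom m j)))
          (((dpow chi rho v i ** dpow chi rho (dconj v) j) ** (z (m + 1 - i) (m - j))%nat) k)))
          (Csum (seq 0 (S m)) (fun j => Cmult (RtoC (INR (binom (m + 1) i) * INR (binom m j)))
          (((dpow chi rho w i ** dpow chi rho (dconj w) j) ** (z' (m + 1 - i) (m - j))%nat) k))))).
      - rewrite Csum_minus. unfold dsub. ring.
      - intros i _. rewrite <- Csum_minus. apply Csum_ext. intros j _. unfold dsub. ring. }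
    eapply bes_le; [|apply bes_plus; [apply bes_scal; apply bes_Csum; intros i Hi; apply bes_Csum; intros j Hj|
       apply bes_scal; apply bes_plus; [apply WK; [|apply Hd]; lra|apply Hze1]]].
    2: { destruct (bin i j Hi Hj) as (Hi' & Hj' & Hbin). apply scal_c; [auto| |rewrite <- E2]; [exact Y0|].
      destruct (Hz (m + 1 - i)%nat (m - j)%nat ltac:(lia) ltac:(lia)) as (z1 & z2 & z3).
      apply (HC i j Hi' Hj' v w _ _ A B d e HA Hv Hw Hd z1 z2 z3). }
    fold b0 b1 t1. rewrite Cmod_opp.
    replace (Cmod nu * (b0 * (b1 * (c1 * c2 * C * Y)))) with (D1 * Y) by (unfold D1; ring).
    assert (R1 * d + e <= (R1 + 1) * Y).
    { assert (d <= Y /\ e <= Y).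
      { unfold Y. pose proof (Apos (2 * m)%nat). pose proof (Apos (2 * m + 1)%nat).
        assert (d <= A ^ (2 * m) * d) by nra.
        split; nra. }
      nra. }
    assert (t1 * (R1 * d + e) <= D2 * Y) by (unfold D2; rewrite Rmult_assoc; apply Rmult_le_compat_l; auto).
    lra.
Qed.

Variables (Z0 : R -> fdist) (Zf : nat -> nat -> R -> fdist).
Definition zfam (t : R) : nat -> nat -> fdist := Zcolon (Z0 t) (fun i j => Zf i j t).
Hypothesis HL : in_calL chi rho m Z0 Zf.
Hypothesis Hm : (1 <= m)%nat.

Lemma dconj_sub f g k : dsub (dconj f) (dconj g) k = dconj (dsub f g) k.
Proof. unfold dconj, dsub. now rewrite Cminus_conj. Qed.

Lemma zfam_cont al i j : 0 < al < 1 -> (i <= m + 1)%nat -> (j <= m)%nat ->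
  cont_on chi rho (fun t => 0 < t) (- al) (fun t => zfam t i j).
Proof.
  intros Hal Hi Hj.
  assert (CJ : forall v : R -> fdist, cont_on chi rho (fun t => 0 < t) (- al) v -> cont_on chi rho (fun t => 0 < t) (- al) (fun t => dconj (v t))).
  { intros v [H1 H2]. split.
    - intros t Ht. destruct (H1 t Ht) as [M HM]. exists M. now apply bes_dconj.
    - intros t Ht eps He. destruct (H2 t Ht eps He) as (dl & d0 & Hd). exists dl. split; auto. intros s Hs Hst.
      eapply bes_ext; [intros k; symmetry; apply dconj_sub|]. apply bes_dconj. auto. }
  assert (LOC : forall v : R -> fdist, (forall T, 0 < T -> cont_on chi rho (fun t => 0 < t <= T) (- al) v) -> cont_on chi rho (fun t => 0 < t) (- al) v).
  { intros v H. split.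
    - intros t Ht. apply (proj1 (H t Ht)). lra.
    - intros t Ht eps He. destruct (proj2 (H (t + 1) ltac:(lra)) t ltac:(lra) eps He) as (dl & d0 & Hd).
      exists (Rmin dl 1). split; [apply Rmin_glb_lt; lra|]. intros s Hs Hst.
      rmin dl 1. apply Hd; [|lra]. apply Rabs_def2 in Hst. lra. }
  assert (CZ : cont_on chi rho (fun t => 0 < t) (- al) Z0).
  { apply LOC. intros T HT. destruct (HL al al T Hal Hal HT) as [[H1 H2] _]. split.
    - intros t Ht. apply H1. lra.
    - intros t Ht eps He. destruct (H2 t ltac:(lra) eps He) as (dl & d0 & Hd). exists dl. split; auto.
      intros s Hs. apply Hd. lra. }
  assert (CF : forall a b, inL m a b -> cont_on chi rho (fun t => 0 < t) (- al) (Zf a b)).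
  { intros a b Hab. apply LOC. intros T HT. destruct (HL al al T Hal Hal HT) as (_ & H & _). auto. }
  assert (EQ : forall u v : R -> fdist, (forall t, u t = v t) -> cont_on chi rho (fun t => 0 < t) (- al) v -> cont_on chi rho (fun t => 0 < t) (- al) u).
  { intros u v E [H1 H2]. split.
    - intros t Ht. rewrite E. auto.
    - intros t Ht eps He. destruct (H2 t Ht eps He) as (dl & d0 & Hd). exists dl. split; auto. intros s Hs Hst. rewrite !E. auto. }
  destruct (Zcolon_cases m i j Hi Hj) as [H|[H|[H|[(a & b & Hab & H)|(a & b & Hab & H)]]]].
  - apply EQ with (fun _ => done); [intros; apply H|]. split.
    + intros. exists (wt (- al) 0). apply bes_done.
    + intros t Ht eps He. exists 1. split; [lra|]. intros s _ _. apply bes_0; [lra|]. intros k. unfold dsub. ring.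
  - apply EQ with Z0; auto. intros; apply H.
  - apply EQ with (fun t => dconj (Z0 t)); auto. intros; apply H.
  - apply EQ with (Zf a b); auto. intros t. apply (H (Z0 t) (fun i j => Zf i j t)).
  - apply EQ with (fun t => dconj (Zf a b t)); auto. intros t. apply (H (Z0 t) (fun i j => Zf i j t)).
Qed.

(** The exponents (i+j-1) a' never exceed 2m a', since i + j <= 2m + 1. With a' = eta/(2m) all Wick
    powers share one singularity t^{-eta}, as weak as desired. *)
Lemma zfam_bound al eta T : 0 < al < 1 -> 0 < eta < 1 -> 0 < T -> exists B, 1 <= B /\
  forall t i j, 0 < t <= T -> (i <= m + 1)%nat -> (j <= m)%nat -> bes (- al) (zfam t i j) (B * Rpower t (- eta)).
Proof.
  intros Hal Het HT.
  assert (Hm1 : 1 <= INR m) by (apply (le_INR 1); auto).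
  set (a' := eta / (2 * INR m)).
  assert (Ha' : 0 < a' < 1).
  { unfold a'. split; [apply Rdiv_lt_0_compat; lra|]. apply (Rmult_lt_reg_r (2 * INR m)); [lra|].
    unfold Rdiv. rewrite Rmult_assoc, Rinv_l by lra. lra. }
  destruct (HL al a' T Hal Ha' HT) as (_ & _ & M & HM0 & HM).
  assert (M0 : 0 <= M) by (eapply bes_nonneg; apply (HM0 T); lra).
  set (R := Rpower (1 + T) eta). assert (R0 : 0 < R) by apply exp_pos.
  set (w0 := wt (- al) 0). assert (w00 : 0 < w0) by apply wt_pos.
  exists ((w0 + M) * R + 1). split; [nra|].
  assert (UP : forall t e, 0 < t <= T -> 0 <= e <= eta -> Rpower t (- e) <= R * Rpower t (- eta)).
  { intros t e Ht He. replace (- e) with ((eta - e) + - eta) by ring. rewrite Rpower_plus.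
    apply Rmult_le_compat_r; [apply Rlt_le, exp_pos|].
    apply Rle_trans with (Rpower (1 + T) (eta - e)).
    - apply Rle_Rpower_l; lra.
    - unfold R. apply Rle_Rpower; lra. }
  assert (B0 : forall t K, 0 < t <= T -> 0 <= K <= w0 + M -> K <= ((w0 + M) * R + 1) * Rpower t (- eta)).
  { intros t K Ht HK. pose proof (UP t 0 Ht ltac:(lra)) as H. rewrite Ropp_0, Rpower_O in H by lra.
    pose proof (Rpower_pos t (- eta)). nra. }
  assert (BF : forall t a b, 0 < t <= T -> inL m a b -> bes (- al) (Zf a b t) (((w0 + M) * R + 1) * Rpower t (- eta))).
  { intros t a b Ht Hab n x. specialize (HM a b t Hab Ht n x).
    set (e := (INR (a + b) - 1) * a') in *.
    assert (He : 0 <= e <= eta).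
    { unfold e. destruct Hab as (h1 & h2 & h3 & h4). assert (H5 : (a + b <= 2 * m + 1)%nat) by lia.
      apply le_INR in H5. apply lt_INR in h4. rewrite (plus_INR (2 * m)), mult_INR in H5. simpl in H5, h4.
      split; [nra|]. apply Rle_trans with (2 * INR m * a'); [apply Rmult_le_compat_r; lra|].
      unfold a'. apply Req_le. field. lra. }
    set (Q := _ * Cmod _) in *.
    assert (EQ : Q = Rpower t (- e) * (Rpower t e * Q)).
    { rewrite <- Rmult_assoc, <- Rpower_plus, Rplus_opp_l, Rpower_O by lra. ring. }
    rewrite EQ. pose proof (UP t e Ht He). pose proof (Rpower_pos t (- e)). pose proof (Rpower_pos t (- eta)).
    apply Rle_trans with (Rpower t (- e) * M); [apply Rmult_le_compat_l; lra|].
    apply Rle_trans with (R * Rpower t (- eta) * M); [apply Rmult_le_compat_r; lra|].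
    nra. }
  intros t i j Ht Hi Hj. unfold zfam.
  destruct (Zcolon_cases m i j Hi Hj) as [H|[H|[H|[(a & b & Hab & H)|(a & b & Hab & H)]]]]; rewrite H.
  - eapply bes_le; [|apply bes_done]. apply B0; auto. fold w0. lra.
  - eapply bes_le; [|apply HM0]; [apply B0; auto|]; lra.
  - apply bes_dconj. eapply bes_le; [|apply HM0]; [apply B0; auto|]; lra.
  - auto.
  - apply bes_dconj. auto.
Qed.

Lemma zfam_00 t : zfam t 0 0 = done.
Proof. reflexivity. Qed.

End PsiSec.

(** * The linear equation *)

Definition Cder (f : R -> C) (t : R) (l : C) : Prop :=
  is_derive (fun s => Re (f s)) t (Re l) /\ is_derive (fun s => Im (f s)) t (Im l).

Lemma Cder_plus f g t l m : Cder f t l -> Cder g t m -> Cder (fun s => Cplus (f s) (g s)) t (Cplus l m).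
Proof.
  intros [a b] [c d]. split.
  - apply (is_derive_plus (V := R_NormedModule) (fun s => Re (f s)) (fun s => Re (g s))); auto.
  - apply (is_derive_plus (V := R_NormedModule) (fun s => Im (f s)) (fun s => Im (g s))); auto.
Qed.
Lemma Cder_const c t : Cder (fun _ => c) t (RtoC 0).
Proof. split; simpl; apply (is_derive_const (K := R_AbsRing) (V := R_NormedModule)). Qed.
Lemma Cder_mult f g t l m : Cder f t l -> Cder g t m ->
  Cder (fun s => Cmult (f s) (g s)) t (Cplus (Cmult l (g t)) (Cmult (f t) m)).
Proof.
  intros [a b] [c d].
  assert (M : forall u v u' v', is_derive u t u' -> is_derive v t v' -> is_derive (fun s => u s * v s) t (u' * v t + u t * v')).
  { intros u v u' v' Hu Hv. apply (is_derive_mult (K := R_AbsRing) u v); auto. intros; apply Rmult_comm. }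
  split.
  - evar_last.
    + apply (is_derive_minus (V := R_NormedModule) (fun s => Re (f s) * Re (g s)) (fun s => Im (f s) * Im (g s))); apply M; eassumption.
    + unfold minus, plus, opp, Re, Im, Cmult, Cplus; simpl. ring.
  - evar_last.
    + apply (is_derive_plus (V := R_NormedModule) (fun s => Re (f s) * Im (g s)) (fun s => Im (f s) * Re (g s))); apply M; eassumption.
    + unfold plus, Re, Im, Cmult, Cplus; simpl. ring.
Qed.
Lemma Cder_eq f t l l' : l = l' -> Cder f t l -> Cder f t l'.
Proof. now intros ->. Qed.
Lemma Cder_ext_loc f g t l : (exists d, 0 < d /\ forall s, Rabs (s - t) < d -> f s = g s) -> Cder f t l -> Cder g t l.
Proof.
  intros (d & Hd & E) [a b]. split; (eapply is_derive_ext_loc; [|eassumption]);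
    exists (mkposreal d Hd); intros y Hy; cbv beta; rewrite (E y Hy); reflexivity.
Qed.
Lemma Cder_minus f g t l m : Cder f t l -> Cder g t m -> Cder (fun s => Cminus (f s) (g s)) t (Cminus l m).
Proof.
  intros [a b] [c d]. split.
  - apply (is_derive_minus (V := R_NormedModule) (fun s => Re (f s)) (fun s => Re (g s))); auto.
  - apply (is_derive_minus (V := R_NormedModule) (fun s => Im (f s)) (fun s => Im (g s))); auto.
Qed.
Lemma Cder_scal c f t l : Cder f t l -> Cder (fun s => Cmult c (f s)) t (Cmult c l).
Proof.
  intros H. eapply Cder_eq; [|apply Cder_mult; [apply Cder_const|apply H]]. cbv beta. ring.
Qed.
Lemma Cder_Csum {A} (ls : list A) f l t : (forall a, Cder (f a) t (l a)) ->
  Cder (fun s => Csum ls (fun a => f a s)) t (Csum ls l).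
Proof.
  intros H. induction ls as [|a ls IH]; [apply (Cder_const (RtoC 0))|].
  apply (Cder_plus (f a) (fun s => Csum ls (fun a => f a s))); auto.
Qed.
Lemma Cder_ev B (f : R -> fdist) l t x : (forall k, Cder (fun s => f s k) t (l k)) ->
  Cder (fun s => ev B (f s) x) t (ev B l x).
Proof.
  intros H. apply (Cder_Csum (box B) (fun k s => Cmult (f s k) (ek k x))).
  intros k. eapply Cder_eq; [|apply Cder_mult; [apply H|apply Cder_const]]. cbv beta. ring.
Qed.
Lemma Cder_shift f t0 t l : Cder f (t0 + t) l -> Cder (fun s => f (t0 + s)) t l.
Proof.
  intros [a b]. split.
  - evar_last; [apply (is_derive_comp (fun s => Re (f s)) (fun s => t0 + s)); [apply a|]|].
    + auto_derive; auto.
    + unfold scal; simpl; unfold mult, one; simpl; ring.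
  - evar_last; [apply (is_derive_comp (fun s => Im (f s)) (fun s => t0 + s)); [apply b|]|].
    + auto_derive; auto.
    + unfold scal; simpl; unfold mult, one; simpl; ring.
Qed.

Definition Ccont (f : R -> C) (t : R) : Prop :=
  forall eps, 0 < eps -> exists d, 0 < d /\ forall s, Rabs (s - t) < d -> Cmod (Cminus (f s) (f t)) <= eps.

Lemma continuous_eps (u : R -> R) t : continuous u t <->
  forall eps, 0 < eps -> exists d, 0 < d /\ forall s, Rabs (s - t) < d -> Rabs (u s - u t) < eps.
Proof.
  split.
  - intros H eps He. apply filterlim_locally with (eps := mkposreal eps He) in H.
    destruct H as [d Hd]. exists d. split; [apply cond_pos|]. intros s Hs. apply (Hd s Hs).
  - intros H. apply filterlim_locally. intros eps. destruct (H eps (cond_pos eps)) as (d & Hd & Hs).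
    exists (mkposreal d Hd). intros s Hs'. apply (Hs s Hs').
Qed.
Lemma Ccont_comp f t : Ccont f t <-> continuous (fun s => Re (f s)) t /\ continuous (fun s => Im (f s)) t.
Proof.
  rewrite !continuous_eps. split.
  - intros H. split; intros eps He; destruct (H (eps / 2) ltac:(lra)) as (d & Hd & Hs); exists d; split; auto;
      intros s Hst; specialize (Hs s Hst); pose proof (Cmod_comp (Cminus (f s) (f t))) as [h1 h2].
    + change (Rabs (Re (f s) - Re (f t)) <= Cmod (Cminus (f s) (f t))) in h1. lra.
    + change (Rabs (Im (f s) - Im (f t)) <= Cmod (Cminus (f s) (f t))) in h2. lra.
  - intros [H1 H2] eps He. destruct (H1 (eps / 2) ltac:(lra)) as (d1 & Hd1 & Hs1). destruct (H2 (eps / 2) ltac:(lra)) as (d2 & Hd2 & Hs2).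
    exists (Rmin d1 d2). split; [now apply Rmin_glb_lt|]. intros s Hs.
    rmin d1 d2. specialize (Hs1 s ltac:(lra)). specialize (Hs2 s ltac:(lra)).
    eapply Rle_trans; [apply Cmod_le_comp|].
    change (Rabs (Re (f s) - Re (f t)) + Rabs (Im (f s) - Im (f t)) <= eps). lra.
Qed.
Lemma Cder_cont f t l : Cder f t l -> Ccont f t.
Proof. intros [a b]. apply Ccont_comp. split; eapply is_derive_cont; eassumption. Qed.

Lemma is_derive_Rpow e s : 0 < s -> is_derive (fun s => Rpower s e) s (e * Rpower s (e - 1)).
Proof.
  intros Hs. unfold Rpower. auto_derive; auto.
  replace ((e - 1) * ln s) with (e * ln s + - ln s) by ring. rewrite exp_plus, exp_Ropp, exp_ln by auto. field. lra.
Qed.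

(** Integral bounds are obtained by comparison with a majorant [ph] of known primitive [Ph], so that
    no integrability of f' has to be established. *)
Lemma mvt_bound (f f' Ph ph : R -> R) a b : a <= b ->
  (forall s, a <= s <= b -> is_derive f s (f' s)) -> (forall s, a <= s <= b -> is_derive Ph s (ph s)) ->
  (forall s, a <= s <= b -> Rabs (f' s) <= ph s) -> Rabs (f b - f a) <= Ph b - Ph a.
Proof.
  intros Hab Hf HP H.
  assert (G : forall sg, (sg = 1 \/ sg = -1) -> sg * (f b - f a) <= Ph b - Ph a).
  { intros sg Hsg.
    assert (D : forall s, a <= s <= b -> is_derive (fun s => Ph s - sg * f s) s (ph s - sg * f' s)).
    { intros s Hs. apply (is_derive_minus (V := R_NormedModule) Ph (fun s => sg * f s)); [auto|].
      apply (is_derive_scal f). auto. }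
    destruct (MVT_gen (fun s => Ph s - sg * f s) a b (fun s => ph s - sg * f' s)) as (c & Hc & E).
    - intros s Hs. rewrite Rmin_left, Rmax_right in Hs by lra. apply D. lra.
    - intros s Hs. rewrite Rmin_left, Rmax_right in Hs by lra. apply continuity_pt_filterlim. exact (is_derive_cont _ _ _ (D s Hs)).
    - rewrite Rmin_left, Rmax_right in Hc by lra. specialize (H c Hc). pose proof (Rle_abs (f' c)). pose proof (Rle_abs (- f' c)) as h2. rewrite Rabs_Ropp in h2.
      nra. }
  apply Rabs_le. pose proof (G 1 (or_introl eq_refl)). pose proof (G (-1) (or_intror eq_refl)). lra.
Qed.
Lemma Cmvt g g' (Ph ph : R -> R) a b : a <= b ->
  (forall s, a <= s <= b -> Cder g s (g' s)) -> (forall s, a <= s <= b -> is_derive Ph s (ph s)) ->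
  (forall s, a <= s <= b -> Cmod (g' s) <= ph s) -> Cmod (Cminus (g b) (g a)) <= 2 * (Ph b - Ph a).
Proof.
  intros Hab Hg HP H. eapply Rle_trans; [apply Cmod_le_comp|].
  assert (Rabs (Re (g b) - Re (g a)) <= Ph b - Ph a).
  { apply (mvt_bound (fun s => Re (g s)) (fun s => Re (g' s)) Ph ph); auto; intros s Hs; [apply (Hg s Hs)|].
    eapply Rle_trans; [apply (Cmod_comp (g' s))|auto]. }
  assert (Rabs (Im (g b) - Im (g a)) <= Ph b - Ph a).
  { apply (mvt_bound (fun s => Im (g s)) (fun s => Im (g' s)) Ph ph); auto; intros s Hs; [apply (Hg s Hs)|].
    eapply Rle_trans; [apply (Cmod_comp (g' s))|auto]. }
  change (Rabs (Re (g b) - Re (g a)) + Rabs (Im (g b) - Im (g a)) <= 2 * (Ph b - Ph a)). lra.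
Qed.

Lemma Rpower_small e c : 0 < e -> 0 < c -> exists d, 0 < d /\ forall t, 0 < t < d -> Rpower t e <= c.
Proof.
  intros He Hc. exists (Rpower c (/ e)). split; [apply exp_pos|]. intros t Ht.
  rewrite <- (Rpower_1 c) by auto. replace 1 with (/ e * e) by (field; lra). rewrite <- Rpower_mult.
  apply Rle_Rpower_l; lra.
Qed.

(** Primitive vanishing at 0 of a function with an integrable singularity there. *)
Definition prim (T : R) (f : R -> R) (t : R) : R :=
  RInt f (T / 2) t - real (Lim_seq (fun n => RInt f (T / 2) (T / 2 / (INR n + 1)))).

Lemma prim_spec T f K ka : 0 < T -> 0 <= K -> ka < 1 ->
  (forall s, 0 < s < T -> continuous f s) -> (forall s, 0 < s < T -> Rabs (f s) <= K * Rpower s (- ka)) ->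
  forall t, 0 < t < T -> is_derive (prim T f) t (f t) /\ Rabs (prim T f t) <= K / (1 - ka) * Rpower t (1 - ka).
Proof.
  intros HT HK Hka Hc Hb.
  set (F := RInt f (T / 2)).
  assert (HF : forall t, 0 < t < T -> is_derive F t (f t)).
  { intros t Ht. apply (is_derive_RInt (V := R_NormedModule) f F (T / 2) t); [|auto].
    exists (mkposreal (Rmin t (T - t)) ltac:(apply Rmin_glb_lt; lra)). intros y Hy.
    change (Rabs (y - t) < Rmin t (T - t)) in Hy. rmin t (T - t).
    apply Rabs_def2 in Hy. apply (RInt_correct (V := R_CompleteNormedModule)).
    apply (ex_RInt_continuous (V := R_CompleteNormedModule)). intros z Hz. apply Hc.
    unfold Rmin, Rmax in Hz. destruct (Rle_dec (T / 2) y); lra. }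
  set (G := fun t => K / (1 - ka) * Rpower t (1 - ka)).
  assert (Gpos : forall t, 0 <= G t).
  { intros t. unfold G. apply Rmult_le_pos; [apply Rmult_le_pos; [auto|apply Rlt_le, Rinv_0_lt_compat; lra]|apply Rlt_le, exp_pos]. }
  assert (D : forall a b, 0 < a <= b -> b < T -> Rabs (F b - F a) <= G b).
  { intros a b Ha Hb'. apply Rle_trans with (G b - G a); [|specialize (Gpos a); lra].
    apply (mvt_bound F f G (fun s => K * Rpower s (- ka))); [lra| | |].
    - intros s Hs. apply HF. lra.
    - intros s Hs. unfold G. evar_last; [apply is_derive_scal; apply is_derive_Rpow; lra|].
      replace (1 - ka - 1) with (- ka) by ring. field. lra.
    - intros s Hs. apply Hb. lra. }
  set (sq := fun n => T / 2 / (INR n + 1)).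
  assert (sqp : forall n, 0 < sq n <= T / 2).
  { intros n. unfold sq. pose proof (pos_INR n). split; [apply Rdiv_lt_0_compat; lra|].
    unfold Rdiv. rewrite <- (Rmult_1_r (T * / 2)) at 2. apply Rmult_le_compat_l; [lra|].
    rewrite <- Rinv_1. apply Rinv_le_contravar; lra. }
  assert (sq0 : forall c, 0 < c -> exists N, forall n, (N <= n)%nat -> sq n < c).
  { intros c Hc0. destruct (nfloor_ex (T / c)) as [N [_ HN]]; [apply Rmult_le_pos; [lra|apply Rlt_le, Rinv_0_lt_compat; auto]|].
    exists N. intros n Hn. apply le_INR in Hn. unfold sq. pose proof (pos_INR n).
    apply (Rmult_lt_reg_r (INR n + 1)); [lra|]. unfold Rdiv at 1. rewrite Rmult_assoc, Rinv_l, Rmult_1_r by lra.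
    assert (T < c * (INR n + 1)); [|lra]. apply (Rmult_lt_compat_r c) in HN; auto.
    unfold Rdiv in HN. rewrite Rmult_assoc, Rinv_l, Rmult_1_r in HN by lra. nra. }
  (* The majorant [G] tends to 0 at 0 because ka < 1; this makes F Cauchy along the sequence [sq]
     and later identifies the limit. *)
  assert (L : ex_finite_lim_seq (fun n => F (sq n))).
  { apply ex_lim_seq_cauchy_corr. intros eps.
    destruct (Rpower_small (1 - ka) (eps / 2 / (K / (1 - ka) + 1))) as (d & Hd & Hsm); [lra| |].
    { assert (0 <= K / (1 - ka)) by (apply Rmult_le_pos; [auto|apply Rlt_le, Rinv_0_lt_compat; lra]).
      apply Rdiv_lt_0_compat; [pose proof (cond_pos eps)|]; lra. }
    destruct (sq0 d Hd) as [N HN].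
    assert (GS : forall n, (N <= n)%nat -> G (sq n) < eps).
    { intros n Hn. specialize (HN n Hn). specialize (Hsm (sq n) ltac:(split; [apply sqp|auto])). unfold G.
      assert (K1 : 0 <= K / (1 - ka)) by (apply Rmult_le_pos; [auto|apply Rlt_le, Rinv_0_lt_compat; lra]).
      apply Rle_lt_trans with ((K / (1 - ka) + 1) * (eps / 2 / (K / (1 - ka) + 1))).
      - apply Rmult_le_compat; try lra. apply Rlt_le, exp_pos.
      - set (X := K / (1 - ka)) in *. replace ((X + 1) * (eps / 2 / (X + 1))) with (eps / 2) by (field; lra). pose proof (cond_pos eps); lra. }
    exists N. intros n m Hn Hm.
    destruct (Rle_dec (sq n) (sq m)) as [H|H].
    - rewrite Rabs_minus_sym. eapply Rle_lt_trans; [apply D; [split; [apply sqp|auto]|]|apply GS; auto]. specialize (sqp m). lra.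
    - eapply Rle_lt_trans; [apply D; [split; [apply sqp|lra]|]|apply GS; auto]. specialize (sqp n). lra. }
  destruct L as [l Hl].
  assert (El : real (Lim_seq (fun n => F (sq n))) = l) by (now rewrite (is_lim_seq_unique _ _ Hl)).
  intros t Ht. split.
  - change (prim T f) with (fun t => F t - real (Lim_seq (fun n => F (sq n)))). rewrite El.
    evar_last; [apply (is_derive_minus (V := R_NormedModule) F (fun _ => l)); [apply HF; auto|apply (is_derive_const (K := R_AbsRing) (V := R_NormedModule))]|].
    unfold minus, plus, opp, zero; simpl. ring.
  - change (prim T f t) with (F t - real (Lim_seq (fun n => F (sq n)))). rewrite El. fold (G t).
    apply Rnot_lt_le. intros Hlt. apply is_lim_seq_spec in Hl.
    destruct (Hl (mkposreal (Rabs (F t - l) - G t) ltac:(lra))) as [N1 H1]. destruct (sq0 t (proj1 Ht)) as [N2 H2].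
    specialize (H1 (Nat.max N1 N2) ltac:(lia)). specialize (H2 (Nat.max N1 N2) ltac:(lia)). simpl in H1.
    set (s := sq (Nat.max N1 N2)) in *. assert (0 < s) by apply sqp. pose proof (D s t ltac:(lra) ltac:(lra)).
    assert (Rabs (F t - l) <= Rabs (F t - F s) + Rabs (F s - l)); [|lra].
    replace (F t - l) with ((F t - F s) + (F s - l)) by ring. apply Rabs_triang.
Qed.

(** * The modewise linear equation and Duhamel's formula *)

Section Heat.
Variable mu : R.
Hypothesis mu_pos : 0 < mu.
Notation P := (Pmult mu).

(** The symbol of A = (i+mu) Delta - 1. *)
Definition Asym (k : Z * Z) : C := let L := 4 * PI ^ 2 * znorm k ^ 2 in (- (1 + mu * L), - L).

Lemma Pmult_plus s t k : P (s + t) k = Cmult (P s k) (P t k).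
Proof.
  unfold Pmult. set (L := 4 * PI ^ 2 * znorm k ^ 2).
  replace (- (s + t) * (1 + mu * L)) with (- s * (1 + mu * L) + - t * (1 + mu * L)) by ring.
  replace ((s + t) * L) with (s * L + t * L) by ring.
  rewrite exp_plus, cos_plus, sin_plus. unfold Cmult; simpl. f_equal; ring.
Qed.
Lemma Pmult_0 k : P 0 k = RtoC 1.
Proof.
  unfold Pmult, RtoC. rewrite Ropp_0, !Rmult_0_l, exp_0, cos_0, sin_0. f_equal; ring.
Qed.
Lemma Pmult_der k t : Cder (fun s => P s k) t (Cmult (Asym k) (P t k)).
Proof.
  unfold Cder, Pmult, Asym, Cmult, Copp, Re, Im. cbv zeta. set (L := 4 * PI ^ 2 * znorm k ^ 2). cbn [fst snd].
  split; auto_derive; auto; unfold Rminus; ring.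
Qed.
Lemma Pmult_der_back k t s : Cder (fun s => P (t - s) k) s (Copp (Cmult (Asym k) (P (t - s) k))).
Proof.
  unfold Cder, Pmult, Asym, Cmult, Copp, Re, Im. cbv zeta. set (L := 4 * PI ^ 2 * znorm k ^ 2). cbn [fst snd].
  split; auto_derive; auto; unfold Rminus; ring.
Qed.
Lemma Pmult_inv k t : Cmult (P t k) (P (- t) k) = RtoC 1.
Proof. rewrite <- Pmult_plus, Rplus_opp_r. apply Pmult_0. Qed.

Lemma Pmult_back_bound k T : 0 < T -> exists K, 0 < K /\ forall s, 0 < s < T -> Cmod (P (- s) k) <= K.
Proof.
  intros HT. set (L := 4 * PI ^ 2 * znorm k ^ 2).
  assert (HL : 0 <= L) by (unfold L; pose proof (pow2_ge_0 PI); pose proof (pow2_ge_0 (znorm k)); nra).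
  exists (2 * exp (T * (1 + mu * L))). split; [pose proof (exp_pos (T * (1 + mu * L))); lra|]. intros s Hs.
  eapply Rle_trans; [apply Cmod_le_comp|]. unfold Pmult; cbn [fst snd]. fold L.
  rewrite Rabs_Ropp, !Rabs_mult, (Rabs_pos_eq (exp _)) by apply Rlt_le, exp_pos.
  assert (E : exp (- - s * (1 + mu * L)) <= exp (T * (1 + mu * L))).
  { apply Rlt_le, exp_increasing. assert (0 <= mu * L) by nra. nra. }
  assert (Rabs (cos (- s * L)) <= 1) by (apply Rabs_le; pose proof (COS_bound (- s * L)); lra).
  assert (Rabs (sin (- s * L)) <= 1) by (apply Rabs_le; pose proof (SIN_bound (- s * L)); lra).
  pose proof (exp_pos (- - s * (1 + mu * L))). nra.
Qed.

(** The Duhamel integral int_0^t P_{t-s} psi_s ds, mode by mode. *)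
Definition Duh (T : R) (psi : R -> fdist) (t : R) : fdist := fun k =>
  let g := fun s => Cmult (P (- s) k) (psi s k) in
  Cmult (P t k) (prim T (fun s => Re (g s)) t, prim T (fun s => Im (g s)) t).

(** Together with [init], this replaces the mild formulation: an ordinary differential equation for
    each Fourier coefficient on the open interval, and convergence of each coefficient at time 0.
    [ode_int_to] and [int_to_ode] translate to and from the integral equation. *)
Definition modeODE (T : R) (psi y : R -> fdist) : Prop :=
  forall k t, 0 < t < T -> Cder (fun s => y s k) t (Cplus (Cmult (Asym k) (y t k)) (psi t k)).
Definition init (y : R -> fdist) (u0 : fdist) : Prop :=
  forall k eps, 0 < eps -> exists d, 0 < d /\ forall t, 0 < t < d -> Cmod (Cminus (y t k) (u0 k)) <= eps.

Lemma Ccont_mult f g t : Ccont f t -> Ccont g t -> Ccont (fun s => Cmult (f s) (g s)) t.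
Proof.
  rewrite !Ccont_comp. intros [a b] [c d]. split.
  - apply (continuous_minus (K := R_AbsRing) (V := R_NormedModule) (fun s => Re (f s) * Re (g s)) (fun s => Im (f s) * Im (g s)));
      apply (continuous_mult (K := R_AbsRing)); auto.
  - apply (continuous_plus (K := R_AbsRing) (V := R_NormedModule) (fun s => Re (f s) * Im (g s)) (fun s => Im (f s) * Re (g s)));
      apply (continuous_mult (K := R_AbsRing)); auto.
Qed.
Lemma Pmult_back_cont k s : Ccont (fun s => P (- s) k) s.
Proof.
  apply Cder_cont with (Copp (Cmult (Asym k) (P (0 - s) k))).
  apply Cder_ext_loc with (fun s => P (0 - s) k); [|apply Pmult_der_back].
  exists 1. split; [lra|]. intros. f_equal. ring.
Qed.

(** On a single mode the semigroup is invertible, so conjugation by P_{-t} reduces the equation to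
    taking a primitive; the backward factor is bounded on (0,T), though not uniformly in the
    mode. *)
Lemma Duh_spec T psi ka : 0 < T -> ka < 1 ->
  (forall k s, 0 < s < T -> Ccont (fun s => psi s k) s) ->
  (forall k, exists K, forall s, 0 < s < T -> Cmod (psi s k) <= K * Rpower s (- ka)) ->
  modeODE T psi (Duh T psi) /\ init (Duh T psi) (fun _ => RtoC 0).
Proof.
  intros HT Hka Hc Hb.
  assert (Q : forall k, exists K, 0 <= K /\ forall t, 0 < t < T ->
    let g := fun s => Cmult (P (- s) k) (psi s k) in
    is_derive (prim T (fun s => Re (g s))) t (Re (g t)) /\ is_derive (prim T (fun s => Im (g s))) t (Im (g t)) /\
    Rabs (prim T (fun s => Re (g s)) t) <= K * Rpower t (1 - ka) /\ Rabs (prim T (fun s => Im (g s)) t) <= K * Rpower t (1 - ka)).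
  { intros k. destruct (Hb k) as [K HK]. destruct (Pmult_back_bound k T HT) as (K1 & K10 & HK1).
    assert (K0 : 0 <= K).
    { specialize (HK (T / 2) ltac:(lra)). pose proof (Cmod_ge_0 (psi (T / 2) k)). pose proof (Rpower_pos (T / 2) (- ka)).
      nra. }
    assert (G : forall s, 0 < s < T -> Cmod (Cmult (P (- s) k) (psi s k)) <= K1 * K * Rpower s (- ka)).
    { intros s Hs. rewrite Cmod_mult, Rmult_assoc. apply Rmult_le_compat; auto using Cmod_ge_0. }
    assert (cg : forall s, 0 < s < T -> Ccont (fun s => Cmult (P (- s) k) (psi s k)) s).
    { intros s Hs. apply Ccont_mult; [apply Pmult_back_cont|auto]. }
    exists (K1 * K / (1 - ka)). split.
    { apply Rmult_le_pos; [nra|apply Rlt_le, Rinv_0_lt_compat; lra]. }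
    intros t Ht g.
    destruct (prim_spec T (fun s => Re (g s)) (K1 * K) ka) with (t := t) as [r1 r2]; auto; [nra| | |].
    { intros s Hs. apply (proj1 (Ccont_comp _ _) (cg s Hs)). }
    { intros s Hs. eapply Rle_trans; [apply (Cmod_comp (g s))|apply G; auto]. }
    destruct (prim_spec T (fun s => Im (g s)) (K1 * K) ka) with (t := t) as [r3 r4]; auto; [nra| |].
    { intros s Hs. apply (proj1 (Ccont_comp _ _) (cg s Hs)). }
    { intros s Hs. eapply Rle_trans; [apply (Cmod_comp (g s))|apply G; auto]. } }
  split.
  - intros k t Ht. destruct (Q k) as (K & K0 & HQ). destruct (HQ t Ht) as (r1 & r2 & _ & _).
    set (F := fun t => (prim T (fun s => Re (Cmult (P (- s) k) (psi s k))) t, prim T (fun s => Im (Cmult (P (- s) k) (psi s k))) t) : C).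
    assert (DF : Cder F t (Cmult (P (- t) k) (psi t k))) by (split; [exact r1|exact r2]).
    apply Cder_eq with (Cplus (Cmult (Cmult (Asym k) (P t k)) (F t)) (Cmult (P t k) (Cmult (P (- t) k) (psi t k)))).
    + replace (Cmult (P t k) (Cmult (P (- t) k) (psi t k))) with (Cmult (Cmult (P t k) (P (- t) k)) (psi t k)) by ring.
      rewrite Pmult_inv. change (Duh T psi t k) with (Cmult (P t k) (F t)). ring.
    + apply (Cder_mult (fun t => P t k) F); [apply Pmult_der|exact DF].
  - intros k eps He. destruct (Q k) as (K & K0 & HQ).
    destruct (Rpower_small (1 - ka) (eps / (2 * (K + 1)))) as (d & Hd & Hs); [lra|apply Rdiv_lt_0_compat; lra|].
    exists (Rmin d T). split; [now apply Rmin_glb_lt|]. intros t Ht. rmin d T.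
    destruct (HQ t ltac:(lra)) as (_ & _ & r3 & r4). specialize (Hs t ltac:(lra)).
    unfold Cminus. rewrite <- RtoC_opp, Ropp_0, Cplus_0_r. unfold Duh. rewrite Cmod_mult.
    pose proof (Cmod_Pmult mu mu_pos t k ltac:(lra)) as hP.
    assert (hF : Cmod (prim T (fun s => Re (Cmult (P (- s) k) (psi s k))) t, prim T (fun s => Im (Cmult (P (- s) k) (psi s k))) t) <= eps).
    { eapply Rle_trans; [apply Cmod_le_comp|]. cbn [fst snd].
      assert (K * Rpower t (1 - ka) <= (K + 1) * (eps / (2 * (K + 1)))).
      { apply Rmult_le_compat; auto; [apply Rlt_le, exp_pos|lra]. }
      replace ((K + 1) * (eps / (2 * (K + 1)))) with (eps / 2) in * by (field; lra). lra. }
    match type of hF with Cmod ?z <= _ => pose proof (Cmod_ge_0 z) end. nra.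
Qed.

Variables chi rho : R -> R.
Hypothesis HD : dyadic_partition chi rho.
Notation bes := (besov_le chi rho).

(** An elementary substitute for the Beta integral: one of s and t - s is at least t/2, so the
    product of singular weights is at most (t/2)^{-th} s^{-ka} + (t/2)^{-ka} (t-s)^{-th}, and [Ph]
    is a primitive of this sum. *)
Lemma kernel_primitive th ka t : 0 <= th < 1 -> 0 <= ka < 1 -> 0 < t ->
  let Ph := fun s => Rpower (t / 2) (- th) / (1 - ka) * Rpower s (1 - ka) - Rpower (t / 2) (- ka) / (1 - th) * Rpower (t - s) (1 - th) in
  let c := Rpower (/ 2) (- th) / (1 - ka) + Rpower (/ 2) (- ka) / (1 - th) in
  (forall s, 0 < s < t -> exists p, is_derive Ph s p /\ Rpower (t - s) (- th) * Rpower s (- ka) <= p) /\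
  (forall a b, 0 < a < t -> 0 < b < t -> Ph b - Ph a <= c * Rpower t (1 - th - ka)).
Proof.
  intros Hth Hka Ht Ph c.
  assert (RP : forall x e, 0 < Rpower x e) by (intros; apply exp_pos).
  assert (I1 : 0 < / (1 - ka)) by (apply Rinv_0_lt_compat; lra).
  assert (I2 : 0 < / (1 - th)) by (apply Rinv_0_lt_compat; lra).
  split.
  - intros s Hs. exists (Rpower (t / 2) (- th) * Rpower s (- ka) + Rpower (t / 2) (- ka) * Rpower (t - s) (- th)). split.
    + unfold Ph. evar_last.
      * apply (is_derive_minus (V := R_NormedModule) (fun s => _ * Rpower s (1 - ka)) (fun s => _ * Rpower (t - s) (1 - th))).
        { apply is_derive_scal. apply is_derive_Rpow. lra. }
        { apply is_derive_scal. apply (is_derive_comp (fun s => Rpower s (1 - th)) (fun s => t - s)).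
          - apply is_derive_Rpow. lra.
          - instantiate (1 := -1). auto_derive; auto. }
      * unfold minus, plus, opp, scal; simpl; unfold mult; simpl.
        replace (1 - ka - 1) with (- ka) by ring. replace (1 - th - 1) with (- th) by ring. field. lra.
    + pose proof (RP s (- ka)). pose proof (RP (t - s) (- th)). pose proof (RP (t / 2) (- th)). pose proof (RP (t / 2) (- ka)).
      assert (M : forall x e, t / 2 <= x -> 0 <= e -> Rpower x (- e) <= Rpower (t / 2) (- e)).
      { intros x e Hx He. rewrite !Rpower_Ropp. apply Rinv_le_contravar; [apply RP|]. apply Rle_Rpower_l; lra. }
      destruct (Rle_dec s (t / 2)) as [Hs2|Hs2].
      * pose proof (M (t - s) th ltac:(lra) ltac:(lra)). nra.
      * pose proof (M s ka ltac:(lra) ltac:(lra)). nra.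
  - intros a b Ha Hb. unfold Ph, c.
    assert (E : forall x y, Rpower (t / 2) (- x) * Rpower t (1 - y) = Rpower (/ 2) (- x) * Rpower t (1 - x - y)).
    { intros x y. unfold Rdiv. rewrite (Rmult_comm t), <- Rpower_mult_distr by lra. rewrite Rmult_assoc, <- Rpower_plus. do 2 f_equal. ring. }
    assert (b1 : Rpower b (1 - ka) <= Rpower t (1 - ka)) by (apply Rle_Rpower_l; lra).
    assert (a1 : Rpower (t - a) (1 - th) <= Rpower t (1 - th)) by (apply Rle_Rpower_l; lra).
    pose proof (RP a (1 - ka)). pose proof (RP (t - b) (1 - th)).
    set (U := Rpower (t / 2) (- th) / (1 - ka)). set (V := Rpower (t / 2) (- ka) / (1 - th)).
    assert (U0 : 0 < U) by (unfold U, Rdiv; apply Rmult_lt_0_compat; auto).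
    assert (V0 : 0 < V) by (unfold V, Rdiv; apply Rmult_lt_0_compat; auto).
    apply Rle_trans with (U * Rpower t (1 - ka) + V * Rpower t (1 - th)).
    + assert (U * Rpower b (1 - ka) <= U * Rpower t (1 - ka)) by (apply Rmult_le_compat_l; lra).
      assert (V * Rpower (t - a) (1 - th) <= V * Rpower t (1 - th)) by (apply Rmult_le_compat_l; lra).
      assert (0 <= U * Rpower a (1 - ka)) by (apply Rmult_le_pos; lra).
      assert (0 <= V * Rpower (t - b) (1 - th)) by (apply Rmult_le_pos; lra). lra.
    + apply Req_le. unfold U, V.
      replace (Rpower (t / 2) (- th) / (1 - ka) * Rpower t (1 - ka)) with (Rpower (t / 2) (- th) * Rpower t (1 - ka) / (1 - ka)) by (unfold Rdiv; ring).
      replace (Rpower (t / 2) (- ka) / (1 - th) * Rpower t (1 - th)) with (Rpower (t / 2) (- ka) * Rpower t (1 - th) / (1 - th)) by (unfold Rdiv; ring).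
      rewrite !E. replace (1 - ka - th) with (1 - th - ka) by ring. unfold Rdiv. ring.
Qed.

(* With g(s) = Delta_n P_{t-s} y_s (x) one has g' = Delta_n P_{t-s} psi_s (x), g(0) = 0 and g(t) = Delta_n y_t (x). *)
Lemma Duhamel_bound al bt ka Tm : 0 < al + bt < 2 -> 0 <= ka < 1 -> 0 < Tm -> exists C, 0 < C /\
  forall T psi y K, 0 < T <= Tm -> modeODE T psi y -> init y (fun _ => RtoC 0) ->
   (forall s, 0 < s < T -> bes (- al) (psi s) (K * Rpower s (- ka))) ->
   forall t, 0 < t < T -> bes bt (y t) (C * K * Rpower t (1 - (al + bt) / 2 - ka)).
Proof.
  intros Hab Hka HTm. set (th := (al + bt) / 2).
  destruct (Pmult_bes _ _ HD mu mu_pos (- al) th Tm) as (C & C0 & HP); [lra|unfold th; lra|].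
  replace (- al + 2 * th) with bt in HP by (unfold th; field).
  set (c := Rpower (/ 2) (- th) / (1 - ka) + Rpower (/ 2) (- ka) / (1 - th)).
  assert (c0 : 0 < c).
  { unfold c. apply Rplus_lt_0_compat; apply Rdiv_lt_0_compat; try apply exp_pos; unfold th; lra. }
  exists (2 * (C * c)). split; [nra|]. intros T psi y K HT Hode Hin Hpsi t Ht.
  apply bes_iff. intros n x.
  destruct (kernel_primitive th ka t ltac:(unfold th; lra) Hka ltac:(lra)) as [Hd Hv]. fold c in Hv.
  set (Ph := fun s => Rpower (t / 2) (- th) / (1 - ka) * Rpower s (1 - ka) - Rpower (t / 2) (- ka) / (1 - th) * Rpower (t - s) (1 - th)) in *.
  assert (K0 : 0 <= K).
  { specialize (Hpsi t Ht). apply bes_nonneg in Hpsi. pose proof (Rpower_pos t (- ka)). nra. }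
  set (W := C * K * wt (- bt) n). assert (W0 : 0 <= W) by (unfold W; pose proof (wt_pos (- bt) n); repeat apply Rmult_le_pos; lra).
  set (B := (3 * 2 ^ n)%nat).
  set (g := fun s => ev B (mul (blk chi rho n) (cmul (P (t - s)) (y s))) x).
  assert (Dg : forall s, 0 < s < T -> Cder g s (LPblock chi rho n (cmul (P (t - s)) (psi s)) x)).
  { intros s Hs. unfold g. rewrite LPblock_ev. apply Cder_ev. intros k. unfold mul, cmul.
    apply Cder_scal. eapply Cder_eq; [|apply Cder_mult; [apply Pmult_der_back|apply Hode; auto]]. cbv beta. ring. }
  assert (GB : forall a b, 0 < a <= b -> b < t -> Cmod (Cminus (g b) (g a)) <= 2 * (W * (c * Rpower t (1 - th - ka)))).
  { intros a b Ha Hb. apply Rle_trans with (2 * (W * Ph b - W * Ph a)).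
    - apply Cmvt with (g' := fun s => LPblock chi rho n (cmul (P (t - s)) (psi s)) x) (Ph := fun s => W * Ph s) (ph := fun s => W * Derive Ph s); [lra| | |].
      + intros s Hs. apply Dg. lra.
      + intros s Hs. apply is_derive_scal. destruct (Hd s ltac:(lra)) as (p & Hp & _). apply Derive_correct. now exists p.
      + intros s Hs. destruct (Hd s ltac:(lra)) as (p & Hp & Hle).
        replace (Derive Ph s) with p by (symmetry; now apply is_derive_unique).
        pose proof (HP (psi s) _ (t - s) ltac:(lra) (Hpsi s ltac:(lra))) as HQ. rewrite bes_iff in HQ. eapply Rle_trans; [apply HQ|].
        replace (C * Rpower (t - s) (- th) * (K * Rpower s (- ka)) * wt (- bt) n) with (W * (Rpower (t - s) (- th) * Rpower s (- ka))) by (unfold W; ring).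
        apply Rmult_le_compat_l; auto.
    - apply Rmult_le_compat_l; [lra|]. rewrite <- Rmult_minus_distr_l. apply Rmult_le_compat_l; auto. apply Hv; lra. }
  set (Q := 2 * (W * (c * Rpower t (1 - th - ka)))) in *.
  replace (2 * (C * c) * K * Rpower t (1 - th - ka) * wt (- bt) n) with Q by (unfold Q, W; ring).
  assert (gt : g t = LPblock chi rho n (y t) x).
  { unfold g. rewrite LPblock_ev. apply ev_ext. intros k _. unfold mul, cmul. rewrite Rminus_eq_0, Pmult_0. ring. }
  (* The majorant is singular at both ends, so [GB] holds only for 0 < a <= b < t. An excess of 4
     eps over Q is contradicted by choosing a near 0 (initial condition) and b near t (continuity of
     g), each at a cost of eps. *)
  rewrite <- gt. apply Rnot_lt_le. intros Hlt. set (eps := (Cmod (g t) - Q) / 4). assert (He : 0 < eps) by (unfold eps; lra).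
  destruct (Cder_cont _ _ _ (Dg t ltac:(lra)) eps He) as (d1 & Hd1 & H1).
  assert (H2 : exists d, 0 < d /\ forall s, 0 < s < d -> s < t -> Cmod (g s) <= eps).
  { set (e2 := eps / (2 * INR B + 1) ^ 2). assert (BB : 0 < (2 * INR B + 1) ^ 2) by (pose proof (pos_INR B); nra).
    assert (He2 : 0 < e2) by (apply Rdiv_lt_0_compat; auto).
    assert (U : exists d, 0 < d /\ forall s, 0 < s < d -> forall k, In k (box B) -> Cmod (y s k) <= e2).
    { induction (box B) as [|k l IH]; [exists 1; split; [lra|]; intros s _ k []|].
      destruct IH as (d & Hd0 & IH). destruct (Hin k e2 He2) as (d' & Hd' & IH'). exists (Rmin d d'). split; [now apply Rmin_glb_lt|].
      intros s Hs k' [<-|Hk]; pose proof (Rmin_l d d'); pose proof (Rmin_r d d').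
      - specialize (IH' s ltac:(lra)). unfold Cminus in IH'. now rewrite <- RtoC_opp, Ropp_0, Cplus_0_r in IH'.
      - apply IH; auto; lra. }
    destruct U as (d & Hd0 & U). exists d. split; auto. intros s Hs Hst.
    replace eps with ((2 * INR B + 1) ^ 2 * e2) by (unfold e2; field; pose proof (pos_INR B); lra). apply Cmod_ev. intros k Hk.
    unfold mul, cmul. rewrite !Cmod_mult, Cmod_R. pose proof (blk_bounds _ _ HD n k). rewrite Rabs_pos_eq by lra.
    pose proof (Cmod_Pmult mu mu_pos (t - s) k ltac:(lra)). specialize (U s Hs k ltac:(now apply In_box)).
    pose proof (Cmod_ge_0 (P (t - s) k)).
    assert (Cmod (P (t - s) k) * Cmod (y s k) <= e2) by nra. nra. }
  destruct H2 as (d2 & Hd2 & H2).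
  set (a := Rmin (d2 / 2) (t / 2)). set (b := Rmax (t - d1 / 2) (t / 2)).
  assert (Ha : 0 < a <= t / 2 /\ a <= d2 / 2) by (unfold a; split; [split; [apply Rmin_glb_lt; lra|apply Rmin_r]|apply Rmin_l]).
  assert (Hb : t / 2 <= b < t /\ t - d1 / 2 <= b) by (unfold b; split; [split; [apply Rmax_r|apply Rmax_lub_lt; lra]|apply Rmax_l]).
  specialize (H1 b ltac:(apply Rabs_def1; lra)). specialize (H2 a ltac:(lra) ltac:(lra)).
  pose proof (GB a b ltac:(lra) ltac:(lra)) as H3.
  assert (Cmod (g t) <= Cmod (Cminus (g b) (g t)) + Cmod (Cminus (g b) (g a)) + Cmod (g a)).
  { replace (g t) with (Cplus (Copp (Cminus (g b) (g t))) (Cplus (Cminus (g b) (g a)) (g a))) at 1 by ring.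
    eapply Rle_trans; [apply Cmod_triangle|]. rewrite Cmod_opp.
    pose proof (Cmod_triangle (Cminus (g b) (g a)) (g a)). lra. }
  unfold eps in *. lra.
Qed.

(** High blocks are uniformly small thanks to the surplus regularity bt - be; the remaining blocks
    involve finitely many modes, each continuous in time. *)
Lemma cont_on_interp be bt (D : R -> Prop) (y : R -> fdist) : be < bt ->
  (forall t, D t -> exists d M, 0 < d /\ forall s, D s -> Rabs (s - t) < d -> bes bt (y s) M) ->
  (forall t k, D t -> Ccont (fun s => y s k) t) -> cont_on chi rho D be y.
Proof.
  intros Hb HB HC. split.
  - intros t Ht. destruct (HB t Ht) as (d & M & Hd & HM). exists (Rpower 2 (bt - be) * M).
    apply bes_weaken; [lra|]. apply HM; auto. rewrite Rminus_eq_0, Rabs_R0. auto.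
  - intros t Ht eps He. destruct (HB t Ht) as (d & M & Hd & HM).
    assert (Ht' : bes bt (y t) M) by (apply HM; auto; rewrite Rminus_eq_0, Rabs_R0; auto).
    pose proof (bes_nonneg _ _ _ _ _ Ht') as M0.
    destruct (wt_to_0 (bt - be) (eps / (2 * M + 1))) as [N HN]; [lra|apply Rdiv_lt_0_compat; lra|].
    set (B := (3 * 2 ^ N)%nat). assert (BB : 0 < (2 * INR B + 1) ^ 2) by (pose proof (pos_INR B); nra).
    assert (Wm : exists w, 0 < w /\ forall n, (n <= N)%nat -> w <= wt (- be) n).
    { clear -N. induction N as [|N (w & w0 & IH)].
      - exists (wt (- be) 0). split; [apply wt_pos|]. intros n Hn. replace n with 0%nat by lia. lra.
      - exists (Rmin w (wt (- be) (S N))). split; [apply Rmin_glb_lt; auto; apply wt_pos|]. intros n Hn.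
        destruct (le_lt_dec n N); [eapply Rle_trans; [apply Rmin_l|auto]|]. replace n with (S N) by lia. apply Rmin_r. }
    destruct Wm as (w & w0 & Hw).
    set (e2 := eps * w / (2 * INR B + 1) ^ 2). assert (He2 : 0 < e2) by (apply Rdiv_lt_0_compat; auto; now apply Rmult_lt_0_compat).
    assert (U : exists d, 0 < d /\ forall s, Rabs (s - t) < d -> forall k, In k (box B) -> Cmod (Cminus (y s k) (y t k)) <= e2).
    { induction (box B) as [|k l IH]; [exists 1; split; [lra|]; intros s _ k []|].
      destruct IH as (d' & Hd0 & IH). destruct (HC t k Ht e2 He2) as (d'' & Hd' & IH'). exists (Rmin d' d''). split; [now apply Rmin_glb_lt|].
      intros s Hs k' [<-|Hk]; pose proof (Rmin_l d' d''); pose proof (Rmin_r d' d'').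
      - apply IH'. lra.
      - apply IH; auto; lra. }
    destruct U as (d' & Hd0 & U). exists (Rmin d d'). split; [now apply Rmin_glb_lt|]. intros s Hs Hst.
    rmin d d'.
    specialize (HM s Hs ltac:(lra)). specialize (U s ltac:(lra)).
    apply bes_iff. intros n x. destruct (le_lt_dec n N) as [Hn|Hn].
    + rewrite (bl_ev _ _ HD n B) by (unfold B; assert (2 ^ n <= 2 ^ N)%nat by (apply Nat.pow_le_mono_r; lia); lia).
      eapply Rle_trans; [apply Cmod_ev with (c := e2)|].
      * intros k Hk. unfold mul, dsub. rewrite Cmod_mult, Cmod_R. pose proof (blk_bounds _ _ HD n k). rewrite Rabs_pos_eq by lra.
        specialize (U k ltac:(now apply In_box)). nra.
      * unfold e2. replace ((2 * INR B + 1) ^ 2 * (eps * w / (2 * INR B + 1) ^ 2)) with (eps * w) by (field; pose proof (pos_INR B); lra).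
        apply Rmult_le_compat_l; [lra|auto].
    + pose proof (bes_minus _ _ _ _ _ _ _ HM Ht') as Q. rewrite bes_iff in Q. eapply Rle_trans; [apply Q|].
      replace (- bt) with (- (bt - be) + - be) by ring. rewrite wt_plus, <- Rmult_assoc.
      apply Rmult_le_compat_r; [apply Rlt_le, wt_pos|]. specialize (HN n ltac:(lia)).
      apply Rle_trans with ((2 * M + 1) * (eps / (2 * M + 1))); [|apply Req_le; field; lra].
      apply Rmult_le_compat; try lra. apply Rlt_le, wt_pos.
Qed.

End Heat.

(** * Local theory *)

Lemma Rpower_pow_mult s e n : Rpower s e ^ n = Rpower s (INR n * e).
Proof. rewrite <- Rpower_pow by apply exp_pos. rewrite Rpower_mult. f_equal. ring. Qed.
Lemma Rpower_ge1 s e : 0 < s <= 1 -> 0 <= e -> 1 <= Rpower s (- e).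
Proof.
  intros Hs He. rewrite Rpower_Ropp, <- Rinv_1. apply Rinv_le_contravar; [apply exp_pos|].
  rewrite <- (Rpower_O s) by lra. destruct (Rle_lt_or_eq_dec 0 e He) as [He'|<-]; [|lra].
  rewrite Rpower_O by lra. replace 1 with (Rpower 1 e) by (unfold Rpower; now rewrite ln_1, Rmult_0_r, exp_0).
  apply Rle_Rpower_l; lra.
Qed.

Section Local.
Variables chi rho : R -> R.
Hypothesis HD : dyadic_partition chi rho.
Variable mu : R.
Hypothesis mu_pos : 0 < mu.
Variables be al bt ga et al1 : R.
Variable p : nat.
Notation bes := (besov_le chi rho).
Notation P := (Pmult mu).
Notation ode := (modeODE mu).
Hypothesis Hal : 0 < al < be.
Hypothesis Hbt : be < bt.
Hypothesis Habt : al + bt < 2.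
Hypothesis Het : 0 < et.
Hypothesis Hga : 0 < ga.
(** Order of the singularity at time 0 of the nonlinearity: t^{-et} from the Wick powers and t^{-ga}
    from each of the p + 1 factors of the solution. *)
Definition kap : R := et + (INR p + 1) * ga.
(** Power of T gained by the Duhamel term in the norm sup t^ga |v_t| of C^be; its positivity makes
    the Picard map a contraction for short times. *)
Definition omg : R := ga + 1 - (al + bt) / 2 - kap.
Hypothesis Hka : kap < 1.
Hypothesis Hom : 0 < omg.
Hypothesis Hal1 : 0 < al1.
Hypothesis Hini : (al1 + bt) / 2 < ga.

(** Local Lipschitz nonlinearities with a singularity of order [et] at time 0. *)
Definition good (T K : R) (Ps : R -> fdist -> fdist) : Prop :=
  (forall s v A, 0 < s < T -> 1 <= A -> bes be v A -> bes (- al) (Ps s v) (K * Rpower s (- et) * A ^ S p)) /\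
  (forall s v w A d, 0 < s < T -> 1 <= A -> bes be v A -> bes be w A -> bes be (dsub v w) d ->
     bes (- al) (dsub (Ps s v) (Ps s w)) (K * Rpower s (- et) * A ^ p * d)) /\
  (forall v a b, 0 <= a -> b <= T -> cont_on chi rho (fun t => a < t < b) be v ->
     forall k t, a < t < b -> Ccont (fun s => Ps s (v s) k) t).

Definition wbound (T A : R) (v : R -> fdist) : Prop := forall t, 0 < t < T -> bes be (v t) (A * Rpower t (- ga)).

(** Solutions on the open interval (0,T). The weighted bound is asked only on (0,T'] for each T' <
    T, so nothing is presupposed at the end of the interval; it is the class in which uniqueness is
    proved. *)
Record Sol (T : R) (u0 : fdist) (Ps : R -> fdist -> fdist) (v : R -> fdist) : Prop := {
  Sol_cont : cont_on chi rho (fun t => 0 < t < T) be v;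
  Sol_ode : ode T (fun s => Ps s (v s)) v;
  Sol_init : init v u0;
  Sol_bound : forall T', T' < T -> exists M, forall t, 0 < t <= T' -> bes be (v t) (M * Rpower t (- ga)) }.

Lemma ga_lt1 : ga < 1.
Proof. unfold kap in Hka. pose proof (pos_INR p). nra. Qed.
Lemma kap_pos : 0 <= kap.
Proof. unfold kap. pose proof (pos_INR p). nra. Qed.

Lemma good_bound T K Ps v A : 0 < T <= 1 -> 1 <= A -> good T K Ps -> wbound T A v ->
  forall s, 0 < s < T -> bes (- al) (Ps s (v s)) (K * A ^ S p * Rpower s (- kap)).
Proof.
  intros HT HA (G & _ & _) Hv s Hs.
  assert (H1 : 1 <= A * Rpower s (- ga)) by (pose proof (Rpower_ge1 s ga ltac:(lra) ltac:(lra)); nra).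
  eapply bes_le; [|apply (G s (v s) _ Hs H1 (Hv s Hs))].
  rewrite Rpow_mult_distr, Rpower_pow_mult. apply Req_le.
  replace (- kap) with (- et + INR (S p) * - ga) by (unfold kap; rewrite S_INR; ring). rewrite Rpower_plus. ring.
Qed.
Lemma good_lip T K Ps v w A D : 0 < T <= 1 -> 1 <= A -> good T K Ps -> wbound T A v -> wbound T A w ->
  wbound T D (fun t => dsub (v t) (w t)) ->
  forall s, 0 < s < T -> bes (- al) (dsub (Ps s (v s)) (Ps s (w s))) (K * A ^ p * D * Rpower s (- kap)).
Proof.
  intros HT HA (_ & G & _) Hv Hw Hd s Hs.
  assert (H1 : 1 <= A * Rpower s (- ga)) by (pose proof (Rpower_ge1 s ga ltac:(lra) ltac:(lra)); nra).
  eapply bes_le; [|apply (G s (v s) (w s) _ _ Hs H1 (Hv s Hs) (Hw s Hs) (Hd s Hs))].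
  rewrite Rpow_mult_distr, Rpower_pow_mult. apply Req_le.
  replace (- kap) with (- et + INR p * - ga + - ga) by (unfold kap; ring). rewrite !Rpower_plus. ring.
Qed.

(** The bound in the better space C^bt is kept because [cont_on_interp] turns it into continuity
    with values in C^be. *)
Lemma Duh_be : exists C, 0 < C /\ forall T psi y Q, 0 < T <= 1 -> ode T psi y -> init y (fun _ => RtoC 0) ->
   (forall s, 0 < s < T -> bes (- al) (psi s) (Q * Rpower s (- kap))) ->
   (forall t, 0 < t < T -> bes bt (y t) (C * Q * Rpower t (1 - (al + bt) / 2 - kap))) /\
   wbound T (C * Q * Rpower T omg) y.
Proof.
  destruct (Duhamel_bound mu mu_pos chi rho HD al bt kap 1) as (C & C0 & H); [lra|split; [apply kap_pos|auto]|lra|].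
  set (R1 := Rpower 2 (bt - be)). assert (R10 : 0 < R1) by apply exp_pos.
  exists (C * (R1 + 1)). split; [nra|]. intros T psi y Q HT Ho Hi Hp.
  assert (Q0 : 0 <= Q).
  { specialize (Hp (T / 2) ltac:(lra)). apply bes_nonneg in Hp. pose proof (Rpower_pos (T / 2) (- kap)). nra. }
  assert (B : forall t, 0 < t < T -> bes bt (y t) (C * Q * Rpower t (1 - (al + bt) / 2 - kap))) by (intros; now apply (H T psi y Q)).
  assert (CQ : 0 <= C * Q) by nra.
  split; intros t Ht; specialize (B t Ht); pose proof (Rpower_pos t (1 - (al + bt) / 2 - kap)) as E.
  - eapply bes_le; [|apply B]. apply Rmult_le_compat_r; [lra|]. assert (0 <= C * Q * R1) by nra. lra.
  - eapply bes_le; [|apply (bes_weaken _ _ bt be); [lra|apply B]]. fold R1.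
    replace (1 - (al + bt) / 2 - kap) with (omg + - ga) by (unfold omg; ring). rewrite Rpower_plus.
    pose proof (Rpower_pos t (- ga)) as E1.
    assert (E2 : Rpower t omg <= Rpower T omg) by (apply Rle_Rpower_l; lra).
    pose proof (Rpower_pos t omg) as E3.
    apply Rle_trans with (R1 * (C * Q * (Rpower T omg * Rpower t (- ga)))).
    + apply Rmult_le_compat_l; [lra|]. apply Rmult_le_compat_l; auto. apply Rmult_le_compat_r; lra.
    + assert (0 <= C * Q * (Rpower T omg * Rpower t (- ga))) by (apply Rmult_le_pos; nra). nra.
Qed.

Lemma small_zero (z : C) c q : 0 <= c -> (forall n, Cmod z <= c * (/ 2) ^ n * q) -> z = RtoC 0.
Proof.
  intros Hc H. apply Cmod_eq_0. apply Rle_antisym; [|apply Cmod_ge_0].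
  assert (q0 : 0 <= c * q) by (specialize (H 0%nat); simpl in H; pose proof (Cmod_ge_0 z); lra).
  apply Rnot_lt_le. intros Hlt.
  destruct (pow_lt_1_zero (/ 2) ltac:(rewrite Rabs_pos_eq; lra) (Cmod z / (c * q + 1))) as [N HN]; [apply Rdiv_lt_0_compat; lra|].
  specialize (HN N (le_n N)). specialize (H N). rewrite Rabs_pos_eq in HN by (apply pow_le; lra).
  apply (Rmult_lt_compat_r (c * q + 1)) in HN; [|lra]. unfold Rdiv in HN. rewrite Rmult_assoc, Rinv_l, Rmult_1_r in HN by lra.
  nra.
Qed.

Lemma ode_diff T psi psi' y y' : ode T psi y -> ode T psi' y' -> ode T (fun s => dsub (psi s) (psi' s)) (fun s => dsub (y s) (y' s)).
Proof.
  intros H H' k t Ht. unfold dsub. eapply Cder_eq; [|apply Cder_minus; [apply H|apply H']; auto]. ring.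
Qed.
Lemma init_diff y y' u : init y u -> init y' u -> init (fun s => dsub (y s) (y' s)) (fun _ => RtoC 0).
Proof.
  intros H H' k eps He. destruct (H k (eps / 2) ltac:(lra)) as (d & Hd & h). destruct (H' k (eps / 2) ltac:(lra)) as (d' & Hd' & h').
  exists (Rmin d d'). split; [now apply Rmin_glb_lt|]. intros t Ht. rmin d d'.
  specialize (h t ltac:(lra)). specialize (h' t ltac:(lra)). unfold dsub.
  replace (Cminus _ _) with (Cplus (Cminus (y t k) (u k)) (Copp (Cminus (y' t k) (u k)))) by ring.
  eapply Rle_trans; [apply Cmod_triangle|]. rewrite Cmod_opp. lra.
Qed.

(** Both parts rest on the same smallness condition, the Lipschitz constant on a ball times T^omg
    being at most 1/2. In the existence part it involves only K and the C^{-al1} bound [Rr] of the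
    data, which is what later allows restarts with a uniform step. *)
Lemma local_theory : exists CC C0, 0 < CC /\ 0 < C0 /\
  (forall T K A Ps u0 v w, 0 < T <= 1 -> 0 <= K -> 1 <= A -> good T K Ps -> CC * K * A ^ p * Rpower T omg <= / 2 ->
    Sol T u0 Ps v -> Sol T u0 Ps w -> wbound T A v -> wbound T A w -> forall t k, 0 < t < T -> v t k = w t k) /\
  (forall T K Rr Ps u0, 0 < T <= 1 -> 0 <= K -> 0 <= Rr -> good T K Ps -> bes (- al1) u0 Rr ->
    CC * K * (C0 * Rr + 1) ^ S p * Rpower T omg <= / 2 -> exists v, Sol T u0 Ps v).
Proof.
  destruct Duh_be as (CC & CC0 & HDu).
  pose proof ga_lt1 as g1.
  destruct (Pmult_bes _ _ HD mu mu_pos (- al1) ((al1 + be) / 2) 1) as (C1 & C10 & HP1); [lra|lra|].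
  destruct (Pmult_bes _ _ HD mu mu_pos (- al1) ((al1 + bt) / 2) 1) as (C2 & C20 & HP2); [lra|lra|].
  replace (- al1 + 2 * ((al1 + be) / 2)) with be in HP1 by field.
  replace (- al1 + 2 * ((al1 + bt) / 2)) with bt in HP2 by field.
  exists CC, C1. split; [auto|split; [auto|split]].
  - intros T K A Ps u0 v w HT HK HA HG Hc Hv Hw Bv Bw t k Ht.
    (* Each use of the Duhamel bound halves the weighted distance between the two solutions, which
       must therefore vanish. *)
    assert (IT : forall n, wbound T (2 * A * (/ 2) ^ n) (fun t => dsub (v t) (w t))).
    { induction n as [|n IH].
      - intros s Hs. simpl. rewrite Rmult_1_r. eapply bes_le; [|apply bes_minus; [apply Bv|apply Bw]; auto]. lra.
      - destruct (HDu T _ _ (K * A ^ p * (2 * A * (/ 2) ^ n)) HT (ode_diff _ _ _ _ _ (Sol_ode _ _ _ _ Hv) (Sol_ode _ _ _ _ Hw))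
          (init_diff _ _ _ (Sol_init _ _ _ _ Hv) (Sol_init _ _ _ _ Hw))) as [_ Q].
        { apply (good_lip T K Ps v w A); auto. }
        intros s Hs. eapply bes_le; [|apply Q; auto]. apply Rmult_le_compat_r; [apply Rlt_le, exp_pos|].
        simpl. replace (CC * (K * A ^ p * (2 * A * (/ 2) ^ n)) * Rpower T omg) with (CC * K * A ^ p * Rpower T omg * (2 * A * (/ 2) ^ n)) by ring.
        pose proof (pow_lt (/ 2) n ltac:(lra)). assert (0 <= 2 * A * (/ 2) ^ n) by nra. nra. }
    destruct (bes_coef _ _ HD be k) as (Ck & Ck0 & Hk).
    assert (Z : dsub (v t) (w t) k = RtoC 0).
    { apply (small_zero _ (Ck * (2 * A)) (Rpower t (- ga))); [nra|]. intros n.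
      eapply Rle_trans; [apply (Hk _ _ (IT n t Ht))|]. apply Req_le. ring. }
    unfold dsub in Z. replace (v t k) with (Cplus (Cminus (v t k) (w t k)) (w t k)) by ring. rewrite Z. ring.
  (* [A] is the radius of an invariant ball: [C1 * Rr] accounts for the free evolution and 1 for the
     Duhamel term. *)
  - intros T K Rr Ps u0 HT HK HR HG Hu Hc. set (A := C1 * Rr + 1) in *.
    assert (HA : 1 <= A) by (unfold A; nra).
    assert (RT : 0 < Rpower T omg) by apply exp_pos.
    assert (Ap : 1 <= A ^ p) by now apply pow_R1_Rle.
    assert (Hc' : CC * K * A ^ p * Rpower T omg <= / 2).
    { eapply Rle_trans; [|apply Hc]. apply Rmult_le_compat_r; [lra|]. apply Rmult_le_compat_l; [nra|]. apply Rle_pow; [auto|lia]. }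
    set (Phi := fun (v : R -> fdist) t k => Cplus (Cmult (P t k) (u0 k)) (Duh mu T (fun s => Ps s (v s)) t k)).
    set (ok := fun v => cont_on chi rho (fun t => 0 < t < T) be v /\ wbound T A v).
    assert (PHI : forall v, ok v -> ok (Phi v) /\ ode T (fun s => Ps s (v s)) (Phi v) /\ init (Phi v) u0 /\
       ode T (fun s => Ps s (v s)) (Duh mu T (fun s => Ps s (v s))) /\ init (Duh mu T (fun s => Ps s (v s))) (fun _ => RtoC 0)).
    { intros v [cv bv]. pose proof (good_bound T K Ps v A HT HA HG bv) as PB.
      destruct (Duh_spec mu mu_pos T (fun s => Ps s (v s)) kap) as [D1 D2]; [lra|auto| | |].
      { intros k s Hs. destruct HG as (_ & _ & G3). apply (G3 v 0 T); auto; lra. }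
      { intros k. destruct (bes_coef _ _ HD (- al) k) as (Ck & Ck0 & Hk). exists (Ck * (K * A ^ S p)).
        intros s Hs. eapply Rle_trans; [apply (Hk _ _ (PB s Hs))|]. apply Req_le. ring. }
      destruct (HDu T _ _ (K * A ^ S p) HT D1 D2 PB) as [B1 B2].
      assert (OD : ode T (fun s => Ps s (v s)) (Phi v)).
      { intros k t Ht. unfold Phi. eapply Cder_eq; [|apply Cder_plus; [apply Cder_mult; [apply Pmult_der|apply Cder_const]|apply D1; auto]].
        cbv beta. ring. }
      split; [|split; [auto|split; [|auto]]].
      - split.
        + apply (cont_on_interp chi rho HD be bt); [auto| |].
          * intros t Ht. exists (t / 2), (C2 * Rpower (t / 2) (- ((al1 + bt) / 2)) * Rr
              + CC * (K * A ^ S p) * (Rpower (t / 2) (- ga) )). split; [lra|].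
            intros s Hs Hst. apply Rabs_def2 in Hst.
            assert (mono : forall e, 0 <= e -> Rpower s (- e) <= Rpower (t / 2) (- e)).
            { intros e He. rewrite !Rpower_Ropp. apply Rinv_le_contravar; [apply exp_pos|]. apply Rle_Rpower_l; lra. }
            apply (bes_plus _ _ bt (cmul (P s) u0) (Duh mu T (fun s => Ps s (v s)) s)).
            -- eapply bes_le; [|apply (HP2 u0 Rr s); [lra|apply Hu]]. apply Rmult_le_compat_r; [auto|]. apply Rmult_le_compat_l; [lra|]. apply mono. lra.
            -- eapply bes_le; [|apply B1; auto]. pose proof (pow_lt A (S p) ltac:(lra)).
               apply Rmult_le_compat_l; [apply Rmult_le_pos; nra|].
               replace (1 - (al + bt) / 2 - kap) with (omg + - ga) by (unfold omg; ring). rewrite Rpower_plus.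
               specialize (mono ga ltac:(lra)). assert (Rpower s omg <= 1).
               { replace 1 with (Rpower 1 omg) by (unfold Rpower; now rewrite ln_1, Rmult_0_r, exp_0). apply Rle_Rpower_l; lra. }
               pose proof (Rpower_pos s (- ga)). nra.
          * intros t k Ht. eapply Cder_cont, OD; auto.
        + intros t Ht. eapply bes_le; [|apply (bes_plus _ _ be (cmul (P t) u0) (Duh mu T (fun s => Ps s (v s)) t));
            [apply (HP1 u0 Rr t); [lra|apply Hu]|apply B2; auto]].
          assert (M : Rpower t (- ((al1 + be) / 2)) <= Rpower t (- ga)).
          { replace (- ((al1 + be) / 2)) with (- ga + (ga - (al1 + be) / 2)) by ring. rewrite Rpower_plus.
            assert (Rpower t (ga - (al1 + be) / 2) <= 1).
            { replace 1 with (Rpower 1 (ga - (al1 + be) / 2)) by (unfold Rpower; now rewrite ln_1, Rmult_0_r, exp_0). apply Rle_Rpower_l; lra. }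
            pose proof (Rpower_pos t (- ga)). nra. }
          pose proof (Rpower_pos t (- ga)).
          assert (C1 * Rpower t (- ((al1 + be) / 2)) * Rr <= C1 * Rr * Rpower t (- ga)).
          { replace (C1 * Rpower t (- ((al1 + be) / 2)) * Rr) with (C1 * Rr * Rpower t (- ((al1 + be) / 2))) by ring.
            apply Rmult_le_compat_l; [nra|auto]. }
          assert (CC * (K * A ^ S p) * Rpower T omg * Rpower t (- ga) <= 1 * Rpower t (- ga)).
          { apply Rmult_le_compat_r; [lra|]. replace (CC * (K * A ^ S p) * Rpower T omg) with (CC * K * A ^ S p * Rpower T omg) by ring. lra. }
          apply Rle_trans with (C1 * Rr * Rpower t (- ga) + 1 * Rpower t (- ga)); [lra|unfold A; lra].
      - intros k eps He. set (c := Cmod (u0 k) + 1). assert (c0 : 0 < c) by (unfold c; pose proof (Cmod_ge_0 (u0 k)); lra).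
        destruct (Cder_cont _ _ _ (Pmult_der mu k 0) (eps / 2 / c)) as (d & Hd & h); [apply Rdiv_lt_0_compat; lra|].
        destruct (D2 k (eps / 2) ltac:(lra)) as (d' & Hd' & h'). exists (Rmin d d'). split; [now apply Rmin_glb_lt|].
        intros t Ht. rmin d d'. specialize (h t ltac:(apply Rabs_def1; lra)). specialize (h' t ltac:(lra)).
        rewrite Pmult_0 in h. unfold Phi.
        replace (Cminus _ (u0 k)) with (Cplus (Cmult (Cminus (P t k) (RtoC 1)) (u0 k)) (Cminus (Duh mu T (fun s => Ps s (v s)) t k) (RtoC 0))) by ring.
        eapply Rle_trans; [apply Cmod_triangle|]. rewrite Cmod_mult.
        assert (Cmod (Cminus (P t k) (RtoC 1)) * Cmod (u0 k) <= eps / 2 / c * c).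
        { apply Rmult_le_compat; try apply Cmod_ge_0; auto. unfold c. lra. }
        replace (eps / 2 / c * c) with (eps / 2) in * by (field; lra). lra. }
    set (v := nat_rect (fun _ => R -> fdist) (fun _ _ => RtoC 0) (fun _ => Phi)).
    assert (OK : forall n, ok (v n)).
    { induction n as [|n IH]; [|apply PHI; auto]. split.
      - split; [intros; exists 0; apply bes_0; [lra|reflexivity]|]. intros t Ht eps He. exists 1. split; [lra|].
        intros s _ _. apply bes_0; [lra|]. intros k. unfold dsub, v; simpl. ring.
      - intros t Ht. apply bes_0; [|reflexivity]. apply Rmult_le_pos; [lra|apply Rlt_le, exp_pos]. }
    assert (CTR : forall a b D, ok a -> ok b -> wbound T D (fun t => dsub (a t) (b t)) -> wbound T (D * / 2) (fun t => dsub (Phi a t) (Phi b t))).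
    { intros a b D Ha Hb HDd. destruct (PHI a Ha) as (_ & o1 & i1 & _). destruct (PHI b Hb) as (_ & o2 & i2 & _).
      destruct (HDu T _ _ (K * A ^ p * D) HT (ode_diff _ _ _ _ _ o1 o2) (init_diff _ _ _ i1 i2)) as [_ Q].
      { apply (good_lip T K Ps a b A); auto; [apply Ha|apply Hb]. }
      intros s Hs. eapply bes_le; [|apply Q; auto]. apply Rmult_le_compat_r; [apply Rlt_le, exp_pos|].
      assert (D0 : 0 <= D).
      { specialize (HDd s Hs). apply bes_nonneg in HDd. pose proof (Rpower_pos s (- ga)). nra. }
      replace (CC * (K * A ^ p * D) * Rpower T omg) with (CC * K * A ^ p * Rpower T omg * D) by ring. nra. }
    assert (DN : forall n, wbound T (A * (/ 2) ^ n) (fun t => dsub (v (S n) t) (v n t))).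
    { induction n as [|n IH].
      - intros t Ht. simpl pow. rewrite Rmult_1_r. apply bes_ext with (v 1%nat t); [intros k; unfold dsub, v; simpl; ring|]. apply (OK 1%nat); auto.
      - replace (A * (/ 2) ^ S n) with (A * (/ 2) ^ n * / 2) by (simpl; ring). apply (CTR (v (S n)) (v n)); auto. }
    (* Summation of the geometric increments; the induction on j closes with the sharper constant
       2^{-n} - 2^{-(n+j)}. *)
    assert (DM : forall n j, wbound T (2 * A * (/ 2) ^ n) (fun t => dsub (v (n + j)%nat t) (v n t))).
    { intros n j. assert (Q : wbound T (2 * A * ((/ 2) ^ n - (/ 2) ^ (n + j))) (fun t => dsub (v (n + j)%nat t) (v n t))).
      { induction j as [|j IH].
        - intros t Ht. rewrite Nat.add_0_r. apply bes_0; [|intros k; unfold dsub; ring]. rewrite Rminus_eq_0, Rmult_0_r, Rmult_0_l. lra.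
        - intros t Ht. rewrite Nat.add_succ_r. apply bes_ext with (fun k => Cplus (dsub (v (S (n + j)) t) (v (n + j)%nat t) k) (dsub (v (n + j)%nat t) (v n t) k)).
          + intros k. unfold dsub. ring.
          + eapply bes_le; [|apply bes_plus; [apply DN; auto|apply IH; auto]].
            apply Req_le. simpl. field. }
      intros t Ht. eapply bes_le; [|apply Q; auto]. apply Rmult_le_compat_r; [apply Rlt_le, exp_pos|].
      apply Rmult_le_compat_l; [lra|]. pose proof (pow_lt (/ 2) (n + j) ltac:(lra)). lra. }
    assert (half0 : forall c, 0 < c -> exists N, forall n, (N <= n)%nat -> (/ 2) ^ n <= c).
    { intros c Hc0. destruct (pow_lt_1_zero (/ 2) ltac:(rewrite Rabs_pos_eq; lra) c Hc0) as [N HN]. exists N. intros n Hn.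
      specialize (HN n Hn). rewrite Rabs_pos_eq in HN by (apply pow_le; lra). lra. }
    set (V := fun t k => (real (Lim_seq (fun n => fst (v n t k))), real (Lim_seq (fun n => snd (v n t k)))) : C).
    assert (CV : forall t k, 0 < t < T -> Ccv (fun n => v n t k) (V t k)).
    { intros t k Ht. assert (E : exists l, Ccv (fun n => v n t k) l).
      { apply Ccv_cauchy. intros eps He. destruct (bes_coef _ _ HD be k) as (Ck & Ck0 & Hk).
        set (c := Ck * (2 * A * Rpower t (- ga))). assert (c0 : 0 < c).
        { unfold c. pose proof (Rpower_pos t (- ga)). repeat apply Rmult_lt_0_compat; lra. }
        destruct (half0 (eps / c)) as [N HN]; [now apply Rdiv_lt_0_compat|]. exists N. intros n M [Hn HM].
        replace M with (n + (M - n))%nat by lia. eapply Rle_trans; [apply (Hk _ _ (DM n (M - n)%nat t Ht))|].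
        specialize (HN n Hn). replace (Ck * (2 * A * (/ 2) ^ n * Rpower t (- ga))) with (c * (/ 2) ^ n) by (unfold c; ring).
        apply Rle_trans with (c * (eps / c)); [apply Rmult_le_compat_l; lra|apply Req_le; field; lra]. }
      destruct E as [l Hl]. unfold V. now rewrite (Ccv_Lim _ _ Hl). }
    assert (VN : forall n, wbound T (2 * A * (/ 2) ^ n) (fun t => dsub (V t) (v n t))).
    { intros n t Ht. apply (bes_closed _ _ HD). intros B eps He.
      assert (U : exists N0, forall N, (N0 <= N)%nat -> forall k, In k (box B) -> Cmod (Cminus (v N t k) (V t k)) <= eps).
      { induction (box B) as [|k l IH]; [exists 0%nat; intros N _ k []|]. destruct IH as [N1 H1]. destruct (CV t k Ht eps He) as [N2 H2].
        exists (Nat.max N1 N2). intros N HN k' [<-|Hk]; [apply H2; lia|apply H1; auto; lia]. }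
      destruct U as [N0 HN]. exists (dsub (v (n + N0)%nat t) (v n t)). split; [apply DM; auto|].
      intros k Hk. specialize (HN (n + N0)%nat ltac:(lia) k ltac:(now apply In_box)). unfold dsub.
      rewrite <- Cmod_opp. replace (Copp _) with (Cminus (v (n + N0)%nat t k) (V t k)) by ring. auto. }
    assert (OKV : ok V).
    { split.
      - split.
        + intros t Ht. exists (2 * A * (/ 2) ^ 0 * Rpower t (- ga)). apply bes_ext with (dsub (V t) (v 0%nat t)); [intros k; unfold dsub, v; simpl; ring|]. apply VN; auto.
        + intros t Ht eps He. set (c := 2 * A * Rpower (t / 2) (- ga)). assert (c0 : 0 < c) by (unfold c; pose proof (Rpower_pos (t / 2) (- ga)); nra).
          destruct (half0 (eps / 3 / c)) as [N HN]; [apply Rdiv_lt_0_compat; lra|]. specialize (HN N (le_n N)).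
          destruct (proj2 (proj1 (OK N)) t Ht (eps / 3) ltac:(lra)) as (d & Hd & h).
          exists (Rmin d (t / 2)). split; [apply Rmin_glb_lt; lra|]. intros s Hs Hst. rmin d (t / 2).
          specialize (h s Hs ltac:(lra)).
          assert (Q : forall r, 0 < r < T -> t / 2 <= r -> bes be (dsub (V r) (v N r)) (eps / 3)).
          { intros r Hr Hr2. eapply bes_le; [|apply VN; auto].
            assert (Rpower r (- ga) <= Rpower (t / 2) (- ga)).
            { rewrite !Rpower_Ropp. apply Rinv_le_contravar; [apply exp_pos|]. apply Rle_Rpower_l; lra. }
            pose proof (pow_lt (/ 2) N ltac:(lra)).
            apply Rle_trans with (c * (/ 2) ^ N).
            - unfold c. replace (2 * A * Rpower (t / 2) (- ga) * (/ 2) ^ N) with (2 * A * (/ 2) ^ N * Rpower (t / 2) (- ga)) by ring.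
              apply Rmult_le_compat_l; [nra|auto].
            - apply Rle_trans with (c * (eps / 3 / c)); [apply Rmult_le_compat_l; lra|apply Req_le; field; lra]. }
          apply Rabs_def2 in Hst.
          apply bes_ext with (fun k => Cminus (Cplus (dsub (V s) (v N s) k) (dsub (v N s) (v N t) k)) (dsub (V t) (v N t) k)); [intros k; unfold dsub; ring|].
          eapply bes_le; [|apply bes_minus; [apply bes_plus; [apply (Q s); lra|apply h]|apply (Q t); lra]]. lra.
      - intros t Ht. apply (bes_closed _ _ HD). intros B eps He.
        assert (U : exists N0, forall N, (N0 <= N)%nat -> forall k, In k (box B) -> Cmod (Cminus (v N t k) (V t k)) <= eps).
        { induction (box B) as [|k l IH]; [exists 0%nat; intros N _ k []|]. destruct IH as [N1 H1]. destruct (CV t k Ht eps He) as [N2 H2].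
          exists (Nat.max N1 N2). intros N HN k' [<-|Hk]; [apply H2; lia|apply H1; auto; lia]. }
        destruct U as [N0 HN]. exists (v N0 t). split; [apply OK; auto|].
        intros k Hk. specialize (HN N0 (le_n _) k ltac:(now apply In_box)). rewrite <- Cmod_opp.
        replace (Copp _) with (Cminus (v N0 t k) (V t k)) by ring. auto. }
    assert (FIX : forall t k, 0 < t < T -> V t k = Phi V t k).
    { intros t k Ht. apply Ccv_unique with (fun n => v (S n) t k).
      - intros eps He. destruct (CV t k Ht eps He) as [N HN]. exists N. intros n Hn. apply HN. lia.
      - intros eps He. destruct (bes_coef _ _ HD be k) as (Ck & Ck0 & Hk).
        set (c := Ck * (2 * A * / 2 * Rpower t (- ga))). assert (c0 : 0 < c).
        { unfold c. pose proof (Rpower_pos t (- ga)). repeat apply Rmult_lt_0_compat; lra. }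
        destruct (half0 (eps / c)) as [N HN]; [now apply Rdiv_lt_0_compat|]. exists N. intros n Hn. specialize (HN n Hn).
        rewrite <- Cmod_opp. replace (Copp _) with (dsub (Phi V t) (Phi (v n) t) k) by (unfold dsub; simpl; ring).
        eapply Rle_trans; [apply (Hk _ _ (CTR V (v n) _ OKV (OK n) (VN n) t Ht))|].
        replace (Ck * (2 * A * (/ 2) ^ n * / 2 * Rpower t (- ga))) with (c * (/ 2) ^ n) by (unfold c; ring).
        apply Rle_trans with (c * (eps / c)); [apply Rmult_le_compat_l; lra|apply Req_le; field; lra]. }
    exists V. destruct (PHI V OKV) as (_ & o & i & _). split.
    + apply OKV.
    + intros k t Ht. apply Cder_ext_loc with (fun s => Phi V s k).
      * exists (Rmin t (T - t)). split; [apply Rmin_glb_lt; lra|]. intros s Hs. rmin t (T - t).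
        apply Rabs_def2 in Hs. symmetry. apply FIX. lra.
      * rewrite FIX by auto. apply o; auto.
    + intros k eps He. destruct (i k eps He) as (d & Hd & h). exists (Rmin d T). split; [apply Rmin_glb_lt; lra|]. intros t Ht.
      rmin d T. rewrite FIX by lra. apply h. lra.
    + intros T' HT'. exists A. intros t Ht. apply OKV. lra.
Qed.

(** * Time shifts, uniqueness and gluing *)

Lemma good_le T T' K Ps : T' <= T -> good T K Ps -> good T' K Ps.
Proof.
  intros H (G1 & G2 & G3). split; [|split].
  - intros; apply G1; auto; lra.
  - intros; apply G2; auto; lra.
  - intros v a b Ha Hb. apply G3; lra.
Qed.

Lemma cont_on_shift (D D' : R -> Prop) t0 v : (forall t, D t -> D' (t0 + t)) -> cont_on chi rho D' be v -> cont_on chi rho D be (fun t => v (t0 + t)).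
Proof.
  intros HDD [c1 c2]. split.
  - intros t Ht. auto.
  - intros t Ht eps He. destruct (c2 _ (HDD t Ht) eps He) as (d & Hd & h). exists d. split; auto. intros s Hs Hst.
    apply h; auto. replace (t0 + s - (t0 + t)) with (s - t) by ring. auto.
Qed.
Lemma cont_on_sub (D D' : R -> Prop) v : (forall t, D t -> D' t) -> cont_on chi rho D' be v -> cont_on chi rho D be v.
Proof.
  intros HDD [c1 c2]. split; [auto|]. intros t Ht eps He. destruct (c2 t (HDD t Ht) eps He) as (d & Hd & h). exists d. split; auto.
Qed.

(** Restarting at t0 only improves the singularity, (t0+s)^{-et} <= s^{-et}, so K and with it the
    local lifespan are unaffected. *)
Lemma good_shift T K Ps t0 : 0 <= K -> 0 <= t0 -> good T K Ps -> good (T - t0) K (fun s => Ps (t0 + s)).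
Proof.
  intros HK Ht (G1 & G2 & G3).
  assert (M : forall s, 0 < s -> Rpower (t0 + s) (- et) <= Rpower s (- et)).
  { intros s Hs. rewrite !Rpower_Ropp. apply Rinv_le_contravar; [apply exp_pos|]. apply Rle_Rpower_l; lra. }
  split; [|split].
  - intros s v A Hs HA Hv. eapply bes_le; [|apply (G1 (t0 + s) v A); auto; lra].
    pose proof (pow_le A (S p) ltac:(lra)). apply Rmult_le_compat_r; [auto|]. apply Rmult_le_compat_l; auto. apply M. lra.
  - intros s v w A d Hs HA Hv Hw Hd. eapply bes_le; [|apply (G2 (t0 + s) v w A d); auto; lra].
    pose proof (bes_nonneg _ _ _ _ _ Hd). pose proof (pow_le A p ltac:(lra)). apply Rmult_le_compat_r; [auto|]. apply Rmult_le_compat_r; [auto|].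
    apply Rmult_le_compat_l; auto. apply M. lra.
  - intros v a b Ha Hb Hv k t Htab eps He.
    assert (C' : cont_on chi rho (fun t => t0 + a < t < t0 + b) be (fun r => v (- t0 + r))).
    { apply cont_on_shift with (D' := fun t => a < t < b); auto. intros; lra. }
    destruct (G3 _ (t0 + a) (t0 + b) ltac:(lra) ltac:(lra) C' k (t0 + t) ltac:(lra) eps He) as (d & Hd & h).
    exists d. split; auto. intros s Hs. specialize (h (t0 + s)). cbv beta in h.
    replace (- t0 + (t0 + s)) with s in h by ring. replace (- t0 + (t0 + t)) with t in h by ring. apply h.
    replace (t0 + s - (t0 + t)) with (s - t) by ring. auto.
Qed.

Lemma Sol_le T T' u0 Ps v : T' <= T -> Sol T u0 Ps v -> Sol T' u0 Ps v.
Proof.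
  intros H [c o i b]. split; auto.
  - eapply cont_on_sub; [|apply c]. intros; simpl in *; lra.
  - intros k t Ht. apply o. lra.
  - intros T1 HT1. apply b. lra.
Qed.
Lemma Sol_shift T u0 Ps v t0 : 0 < t0 < T -> Sol T u0 Ps v -> Sol (T - t0) (v t0) (fun s => Ps (t0 + s)) (fun s => v (t0 + s)).
Proof.
  intros Ht [c o i b]. split.
  - apply cont_on_shift with (D' := fun t => 0 < t < T); auto. intros; lra.
  - intros k t Htt. apply (Cder_shift (fun s => v s k)). apply o. lra.
  - intros k eps He. destruct (Cder_cont _ _ _ (o k t0 Ht) eps He) as (d & Hd & h). exists d. split; auto. intros s Hs.
    apply h. apply Rabs_def1; lra.
  - intros T' HT'. destruct (b (t0 + T') ltac:(lra)) as [M HM]. exists M. intros t Htt.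
    eapply bes_le; [|apply HM; lra].
    assert (0 <= M).
    { specialize (HM t0 ltac:(lra)). apply bes_nonneg in HM. pose proof (Rpower_pos t0 (- ga)). nra. }
    apply Rmult_le_compat_l; auto. rewrite !Rpower_Ropp. apply Rinv_le_contravar; [apply exp_pos|]. apply Rle_Rpower_l; lra.
Qed.

Lemma step_size c : 0 <= c -> exists h, 0 < h <= 1 /\ forall h', 0 < h' <= h -> c * Rpower h' omg <= / 2.
Proof.
  intros Hc. destruct (Rpower_small omg (/ (2 * (c + 1))) Hom) as (d & Hd & H); [apply Rinv_0_lt_compat; lra|].
  exists (Rmin 1 (d / 2)). split; [split; [apply Rmin_glb_lt; lra|apply Rmin_l]|]. intros h' Hh. pose proof (Rmin_r 1 (d / 2)).
  specialize (H h' ltac:(lra)). apply Rle_trans with (c * / (2 * (c + 1))); [apply Rmult_le_compat_l; auto|].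
  apply (Rmult_le_reg_r (2 * (c + 1))); [lra|]. rewrite Rmult_assoc, Rinv_l by lra. lra.
Qed.

(** Up to T' < T both solutions obey one weighted bound A, so local uniqueness holds on steps of a
    fixed length h. Progress is made by h/2 at a time, so that each restart happens at a time where
    equality is already known. *)
Lemma uniqueness T K Ps u0 v w : 0 <= K -> good T K Ps -> Sol T u0 Ps v -> Sol T u0 Ps w ->
  forall t k, 0 < t < T -> v t k = w t k.
Proof.
  intros HK HG Hv Hw t k Ht.
  destruct local_theory as (CC & C0 & CC0 & _ & UL & _).
  set (T' := (t + T) / 2).
  destruct (Sol_bound _ _ _ _ Hv T' ltac:(unfold T'; lra)) as [M1 H1]. destruct (Sol_bound _ _ _ _ Hw T' ltac:(unfold T'; lra)) as [M2 H2].
  set (A := Rmax 1 (Rmax M1 M2)).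
  assert (HA : 1 <= A) by apply Rmax_l.
  assert (A1 : M1 <= A) by (eapply Rle_trans; [apply Rmax_l|apply Rmax_r]). assert (A2 : M2 <= A) by (eapply Rle_trans; [apply (Rmax_r M1 M2)|apply Rmax_r]).
  assert (Bv : wbound T' A v).
  { intros s Hs. eapply bes_le; [|apply H1; lra]. apply Rmult_le_compat_r; [apply Rlt_le, exp_pos|auto]. }
  assert (Bw : wbound T' A w).
  { intros s Hs. eapply bes_le; [|apply H2; lra]. apply Rmult_le_compat_r; [apply Rlt_le, exp_pos|auto]. }
  assert (Ap := pow_le A p ltac:(lra)).
  destruct (step_size (CC * K * A ^ p)) as (h & Hh & Hst); [repeat apply Rmult_le_pos; lra|].
  assert (HT' : T' <= T) by (unfold T'; lra).
  pose proof (Sol_le _ _ _ _ _ HT' Hv) as Hv'. pose proof (Sol_le _ _ _ _ _ HT' Hw) as Hw'. pose proof (good_le _ _ _ _ HT' HG) as HG'.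
  assert (BASE : forall s, 0 < s < T' -> s < h -> forall k, v s k = w s k).
  { intros s Hs Hsh k'. set (T1 := Rmin h T'). rmin h T'.
    assert (0 < T1) by (apply Rmin_glb_lt; lra). fold T1 in H, H0.
    apply (UL T1 K A Ps u0 v w); try assumption; try lra.
    - eapply good_le; [|apply HG']. auto.
    - apply Hst. lra.
    - eapply Sol_le; [|apply Hv']. auto.
    - eapply Sol_le; [|apply Hw']. auto.
    - intros r Hr. apply Bv. lra.
    - intros r Hr. apply Bw. lra.
    - split; [lra|]. apply Rmin_glb_lt; lra. }
  assert (STEP : forall t0, 0 < t0 < T' -> (forall k, v t0 k = w t0 k) -> forall s, t0 < s < T' -> s < t0 + h -> forall k, v s k = w s k).
  { intros t0 Ht0 Heq s Hs Hsh k'. set (T1 := Rmin h (T' - t0)). rmin h (T' - t0).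
    assert (0 < T1) by (apply Rmin_glb_lt; lra). fold T1 in H, H0.
    assert (E0 : v t0 = w t0) by (apply functional_extensionality; auto).
    pose proof (Sol_shift _ _ _ _ _ Ht0 Hv') as S1. pose proof (Sol_shift _ _ _ _ _ Ht0 Hw') as S2. rewrite <- E0 in S2.
    replace s with (t0 + (s - t0)) by ring.
    assert (sh : forall u, wbound T' A u -> wbound T1 A (fun s => u (t0 + s))).
    { intros u Hu r Hr. eapply bes_le; [|apply Hu; lra]. apply Rmult_le_compat_l; [lra|].
      rewrite !Rpower_Ropp. apply Rinv_le_contravar; [apply exp_pos|]. apply Rle_Rpower_l; lra. }
    apply (UL T1 K A (fun s => Ps (t0 + s)) (v t0) (fun s => v (t0 + s)) (fun s => w (t0 + s))); try assumption; try lra.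
    - eapply good_le; [|apply good_shift; [auto| |apply HG']]; [auto|lra].
    - apply Hst. lra.
    - eapply Sol_le; [|apply S1]. auto.
    - eapply Sol_le; [|apply S2]. auto.
    - now apply sh.
    - now apply sh.
    - split; [lra|]. apply Rmin_glb_lt; lra. }
  assert (IND : forall n s, 0 < s < T' -> s < (INR n + 1) * (h / 2) -> forall k, v s k = w s k).
  { induction n as [|n IH]; intros s Hs Hn k'.
    - apply BASE; auto. simpl in Hn. lra.
    - rewrite S_INR in Hn. destruct n as [|n].
      + apply BASE; auto. simpl in Hn. lra.
      + destruct (Rlt_dec s ((INR (S n) + 1) * (h / 2))) as [Hlt|Hge]; [apply IH; auto|].
        assert (0 < INR (S n)) by (apply lt_0_INR; lia).
        assert (t0p : 0 < INR (S n) * (h / 2)) by nra.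
        apply (STEP (INR (S n) * (h / 2))); try nra.
        apply IH; nra. }
  destruct (nfloor_ex (t / (h / 2))) as [n [_ Hn]]; [apply Rmult_le_pos; [lra|apply Rlt_le, Rinv_0_lt_compat; lra]|].
  apply (IND n); [unfold T'; lra|]. apply (Rmult_lt_compat_r (h / 2)) in Hn; [|lra].
  unfold Rdiv in Hn at 1. rewrite Rmult_assoc, Rinv_l, Rmult_1_r in Hn by lra. lra.
Qed.

(** The restart takes place at t0 < T, before the first solution ends. Uniqueness makes the two
    pieces agree on the overlap, so continuity and the equation at each time are inherited from one
    of the pieces. *)
Lemma glue T K Ps u0 v t0 h w : 0 <= K -> 0 < t0 < T -> T <= t0 + h -> good (t0 + h) K Ps ->
  Sol T u0 Ps v -> Sol h (v t0) (fun s => Ps (t0 + s)) w ->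
  exists u, Sol (t0 + h) u0 Ps u /\ forall t, t < T -> u t = v t.
Proof.
  intros HK Ht0 HT HG Hv Hw.
  assert (AG : forall s, 0 < s < T - t0 -> v (t0 + s) = w s).
  { intros s Hs. apply functional_extensionality. intros k.
    apply (uniqueness (T - t0) K (fun s => Ps (t0 + s)) (v t0) (fun s => v (t0 + s)) w); auto.
    - apply good_shift; auto; [lra|]. eapply good_le; [|apply HG]. auto.
    - exact (Sol_shift T u0 Ps v t0 Ht0 Hv).
    - eapply Sol_le; [|apply Hw]. lra. }
  set (u := fun t => if Rlt_dec t T then v t else w (t - t0)).
  assert (uv : forall t, t < T -> u t = v t) by (intros t Ht; unfold u; destruct (Rlt_dec t T); [auto|lra]).
  assert (uw : forall t, t0 < t -> u t = w (t - t0)).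
  { intros t Ht. unfold u. destruct (Rlt_dec t T); auto. rewrite <- AG by lra. f_equal. ring. }
  destruct Hv as [c o i b]. destruct Hw as [c' o' i' b'].
  exists u. split; auto. split.
  - split.
    + intros t Ht. destruct (Rlt_dec t T); [rewrite uv by auto; apply c; lra|rewrite uw by lra; apply c'; lra].
    + intros t Ht eps He. destruct (Rlt_dec t T) as [Htl|Htl].
      * destruct (proj2 c t ltac:(lra) eps He) as (d & Hd & hh). exists (Rmin d (T - t)). split; [apply Rmin_glb_lt; lra|].
        intros s Hs Hst. rmin d (T - t).
        assert (s < T) by (apply Rabs_def2 in Hst; lra). rewrite !uv by auto. apply hh; lra.
      * destruct (proj2 c' (t - t0) ltac:(lra) eps He) as (d & Hd & hh). exists (Rmin d (t - t0)). split; [apply Rmin_glb_lt; lra|].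
        intros s Hs Hst. rmin d (t - t0).
        assert (t0 < s) by (apply Rabs_def2 in Hst; lra). rewrite !uw by lra. apply hh; [lra|].
        replace (s - t0 - (t - t0)) with (s - t) by ring. lra.
  - intros k t Ht. destruct (Rlt_dec t T) as [Htl|Htl].
    + rewrite uv by auto. apply Cder_ext_loc with (fun s => v s k); [|apply o; lra].
      exists (T - t). split; [lra|]. intros s Hs. rewrite uv; auto. apply Rabs_def2 in Hs. lra.
    + rewrite uw by lra. apply Cder_ext_loc with (fun s => w (- t0 + s) k).
      * exists (t - t0). split; [lra|]. intros s Hs. rewrite uw by (apply Rabs_def2 in Hs; lra). replace (s - t0) with (- t0 + s) by ring. reflexivity.
      * apply (Cder_shift (fun s => w s k)). pose proof (o' k (t - t0) ltac:(lra)) as D. cbv beta in D.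
        replace (t0 + (t - t0)) with t in D by ring. replace (- t0 + t) with (t - t0) by ring. exact D.
  - intros k eps He. destruct (i k eps He) as (d & Hd & hh). exists (Rmin d T). split; [apply Rmin_glb_lt; lra|].
    intros t Ht. rmin d T. rewrite uv by lra. apply hh. lra.
  (* The bound on [w] carries the weight (t - t0)^{-ga}, singular at t0, and is used only past the
     midpoint [T2] of the overlap; [Q] converts it to the weight t^{-ga}. *)
  - intros T' HT'. destruct (b ((t0 + T) / 2) ltac:(lra)) as [M HM]. destruct (b' (T' - t0) ltac:(lra)) as [M' HM'].
    set (T2 := (t0 + T) / 2) in *. set (s1 := T2 - t0).
    set (Q := Rpower s1 (- ga) * Rpower (t0 + h) ga).
    exists (Rabs M + Rabs M' * Q). intros t Ht.
    assert (Q0 : 0 < Q) by (unfold Q; apply Rmult_lt_0_compat; apply exp_pos).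
    pose proof (Rpower_pos t (- ga)) as E.
    pose proof (Rle_abs M). pose proof (Rle_abs M'). pose proof (Rabs_pos M). pose proof (Rabs_pos M').
    destruct (Rle_dec t T2) as [Htl|Htl].
    + rewrite uv by (unfold T2 in *; lra). eapply bes_le; [|apply HM; lra]. apply Rmult_le_compat_r; [lra|].
      assert (0 <= Rabs M' * Q) by nra. lra.
    + rewrite uw by (unfold T2 in *; lra). eapply bes_le; [|apply HM'; unfold T2 in *; lra].
      apply Rle_trans with (Rabs M' * (Q * Rpower t (- ga))).
      * assert (Rpower (t - t0) (- ga) <= Q * Rpower t (- ga)).
        { apply Rle_trans with (Rpower s1 (- ga)).
          - rewrite !Rpower_Ropp. apply Rinv_le_contravar; [apply exp_pos|]. apply Rle_Rpower_l; [lra|]. unfold s1, T2 in *; lra.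
          - unfold Q. rewrite Rmult_assoc. rewrite <- (Rmult_1_r (Rpower s1 (- ga))) at 1. apply Rmult_le_compat_l; [apply Rlt_le, exp_pos|].
            rewrite Rpower_Ropp. apply (Rmult_le_reg_r (Rpower t ga)); [apply exp_pos|]. rewrite Rmult_1_l, Rmult_assoc, Rinv_l, Rmult_1_r by (apply Rgt_not_eq, exp_pos).
            apply Rle_Rpower_l; lra. }
        pose proof (Rpower_pos (t - t0) (- ga)).
        apply Rle_trans with (Rabs M' * Rpower (t - t0) (- ga)); [apply Rmult_le_compat_r; lra|apply Rmult_le_compat_l; lra].
      * nra.
Qed.

End Local.

(** * Energy estimate at a fixed time *)

Definition CTC1 (F F1 F2 : R * R -> C) : Prop :=
  TC1 (fun p => Re (F p)) (fun p => Re (F1 p)) (fun p => Re (F2 p)) /\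
  TC1 (fun p => Im (F p)) (fun p => Im (F1 p)) (fun p => Im (F2 p)).

Lemma CTC1_const c : CTC1 (fun _ => c) (fun _ => RtoC 0) (fun _ => RtoC 0).
Proof. split; apply TC1_const. Qed.
Lemma CTC1_plus F F1 F2 G G1 G2 : CTC1 F F1 F2 -> CTC1 G G1 G2 ->
  CTC1 (fun p => Cplus (F p) (G p)) (fun p => Cplus (F1 p) (G1 p)) (fun p => Cplus (F2 p) (G2 p)).
Proof.
  intros [a b] [c d]. split.
  - exact (TC1_plus _ _ _ _ _ _ a c).
  - exact (TC1_plus _ _ _ _ _ _ b d).
Qed.
Lemma CTC1_mult F F1 F2 G G1 G2 : CTC1 F F1 F2 -> CTC1 G G1 G2 ->
  CTC1 (fun p => Cmult (F p) (G p)) (fun p => Cplus (Cmult (F1 p) (G p)) (Cmult (F p) (G1 p)))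
    (fun p => Cplus (Cmult (F2 p) (G p)) (Cmult (F p) (G2 p))).
Proof.
  intros [a b] [c d]. split.
  - eapply TC1_ext; [| | |exact (TC1_plus _ _ _ _ _ _ (TC1_mult _ _ _ _ _ _ a c) (TC1_scal (-1) _ _ _ (TC1_mult _ _ _ _ _ _ b d)))];
      intros p; unfold Re, Im, Cplus, Cmult; simpl; ring.
  - eapply TC1_ext; [| | |exact (TC1_plus _ _ _ _ _ _ (TC1_mult _ _ _ _ _ _ a d) (TC1_mult _ _ _ _ _ _ b c))];
      intros p; unfold Re, Im, Cplus, Cmult; simpl; ring.
Qed.
Lemma CTC1_RtoC F F1 F2 : TC1 F F1 F2 -> CTC1 (fun p => RtoC (F p)) (fun p => RtoC (F1 p)) (fun p => RtoC (F2 p)).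
Proof. intros H. split; [exact H|exact (TC1_const 0)]. Qed.
Lemma CTC1_conj F F1 F2 : CTC1 F F1 F2 -> CTC1 (fun p => Cconj (F p)) (fun p => Cconj (F1 p)) (fun p => Cconj (F2 p)).
Proof.
  intros [a b]. split; [exact a|].
  eapply TC1_ext; [| | |exact (TC1_scal (-1) _ _ _ b)]; intros p; unfold Im, Cconj; simpl; ring.
Qed.
Lemma CTC1_ext F F1 F2 G G1 G2 : (forall p, F p = G p) -> (forall p, F1 p = G1 p) ->
  (forall p, F2 p = G2 p) -> CTC1 F F1 F2 -> CTC1 G G1 G2.
Proof.
  intros E E1 E2 [a b]. split.
  - eapply TC1_ext; [| | |exact a]; intros p; cbv beta; now rewrite ?E, ?E1, ?E2.
  - eapply TC1_ext; [| | |exact b]; intros p; cbv beta; now rewrite ?E, ?E1, ?E2.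
Qed.
Lemma CTC1_Csum {A} (l : list A) F F1 F2 : (forall a, CTC1 (F a) (F1 a) (F2 a)) ->
  CTC1 (fun p => Csum l (fun a => F a p)) (fun p => Csum l (fun a => F1 a p)) (fun p => Csum l (fun a => F2 a p)).
Proof.
  intros H. induction l as [|a l IH]; [exact (CTC1_const (RtoC 0))|].
  exact (CTC1_plus _ _ _ _ _ _ (H a) IH).
Qed.
Lemma CTC1_cont F F1 F2 : CTC1 F F1 F2 -> ccont2 F /\ ccont2 F1 /\ ccont2 F2.
Proof. intros [[c c1 c2 _ _ _ _] [d d1 d2 _ _ _ _]]. repeat split; auto. Qed.

(** Partial derivatives on the Fourier side. *)
Definition Dk (j : bool) (f : fdist) : fdist := fun k => Cmult (0, 2 * PI * IZR (kc j k)) (f k).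

Lemma CTC1_ev B f : CTC1 (ev B f) (ev B (Dk true f)) (ev B (Dk false f)).
Proof.
  apply (CTC1_Csum (box B) (fun k p => Cmult (f k) (ek k p)) (fun k p => Cmult (Dk true f k) (ek k p)) (fun k p => Cmult (Dk false f k) (ek k p))).
  intros k. assert (E : CTC1 (ek k) (fun p => Cmult (0, 2 * PI * IZR (fst k)) (ek k p)) (fun p => Cmult (0, 2 * PI * IZR (snd k)) (ek k p))).
  { split.
    - eapply TC1_ext; [| | |exact (TC1_cos k)]; intros p; unfold Re, Cmult, ek, th; cbn [fst snd]; ring.
    - eapply TC1_ext; [| | |exact (TC1_sin k)]; intros p; unfold Im, Cmult, ek, th; cbn [fst snd]; ring. }
  eapply CTC1_ext; [| | |exact (CTC1_mult _ _ _ _ _ _ (CTC1_const (f k)) E)]; intros p; unfold Dk, kc; ring.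
Qed.

(** Selects the partial derivative in direction [j], so that both directions are treated by one
    argument. *)
Definition pd {A : Type} (j : bool) (x y : A) : A := if j then x else y.
Lemma TI_pd j F F1 F2 : TC1 F F1 F2 -> TI (pd j F1 F2) = 0.
Proof. intros H. destruct j; simpl; [eapply TI_d1|eapply TI_d2]; eassumption. Qed.

Lemma CTI_parts j F F1 F2 G G1 G2 : CTC1 F F1 F2 -> CTC1 G G1 G2 ->
  CTI (fun p => Cmult (F p) (pd j G1 G2 p)) = Copp (CTI (fun p => Cmult (pd j F1 F2 p) (G p))).
Proof.
  intros HF HG. pose proof (CTC1_cont _ _ _ HF) as (cF & cF1 & cF2). pose proof (CTC1_cont _ _ _ HG) as (cG & cG1 & cG2).
  assert (cj : ccont2 (pd j F1 F2) /\ ccont2 (pd j G1 G2)) by (destruct j; simpl; auto). destruct cj as [cjF cjG].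
  assert (Z : CTI (fun p => Cplus (Cmult (pd j F1 F2 p) (G p)) (Cmult (F p) (pd j G1 G2 p))) = RtoC 0).
  { pose proof (CTC1_mult _ _ _ _ _ _ HF HG) as [a b]. pose proof (TI_pd j _ _ _ a) as Za. pose proof (TI_pd j _ _ _ b) as Zb.
    unfold CTI, RtoC. f_equal; [rewrite <- Za|rewrite <- Zb]; apply TI_ext; intros p; destruct j; reflexivity. }
  rewrite CTI_plus in Z by now apply ccont2_mult.
  set (X := CTI (fun p => Cmult (pd j F1 F2 p) (G p))) in *. set (Y := CTI (fun p => Cmult (F p) (pd j G1 G2 p))) in *.
  replace Y with (Cminus (Cplus X Y) X) by ring. rewrite Z. ring.
Qed.

Lemma Re_CTI F : Re (CTI F) = TI (fun p => Re (F p)).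
Proof. reflexivity. Qed.

(** * Powers of 1 + |v|^2: dissipation, Sobolev bound and interpolation *)

Definition hh (v : R * R -> C) (p : R * R) : R := 1 + (Re (v p) * Re (v p) + Im (v p) * Im (v p)).
Definition hp (v : R * R -> C) (s : R) (p : R * R) : R := Rpower (hh v p) s.

Lemma hh_Cmod v p : hh v p = 1 + Cmod (v p) ^ 2.
Proof. unfold hh. rewrite Cmod2_alt. ring. Qed.
Lemma hh_ge1 v p : 1 <= hh v p.
Proof. rewrite hh_Cmod. pose proof (pow2_ge_0 (Cmod (v p))). lra. Qed.
Lemma hp_pos v s p : 0 < hp v s p.
Proof. apply exp_pos. Qed.
Lemma hp_plus v s s' p : hp v (s + s') p = hp v s p * hp v s' p.
Proof. apply Rpower_plus. Qed.
Lemma hp_0 v p : hp v 0 p = 1.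
Proof. apply Rpower_O. pose proof (hh_ge1 v p). lra. Qed.
Lemma hp_1 v p : hp v 1 p = hh v p.
Proof. apply Rpower_1. pose proof (hh_ge1 v p). lra. Qed.
Lemma hp_mono v s s' p : s <= s' -> hp v s p <= hp v s' p.
Proof.
  intros [H| ->]; [|lra]. pose proof (hh_ge1 v p) as [h|h]; [left; now apply Rpower_lt|].
  unfold hp. rewrite <- h. unfold Rpower. rewrite ln_1, !Rmult_0_r. lra.
Qed.
Lemma hp_half v p : Cmod (v p) <= hp v (1/2) p.
Proof.
  unfold hp. replace (1/2) with (/2) by field. rewrite Rpower_sqrt by (pose proof (hh_ge1 v p); lra).
  rewrite <- (sqrt_pow2 (Cmod (v p))) by apply Cmod_ge_0. apply sqrt_le_1_alt. rewrite hh_Cmod. lra.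
Qed.

Section Calc.
Variables (v V1 V2 : R * R -> C).
Hypothesis Hv : CTC1 v V1 V2.
Notation h := (hh v).
Notation hs := (hp v).

Definition dh (j : bool) (p : R * R) : R := 2 * (Re (v p) * Re (pd j V1 V2 p) + Im (v p) * Im (pd j V1 V2 p)).

Lemma TC1_hh : TC1 h (dh true) (dh false).
Proof.
  destruct Hv as [a b].
  eapply TC1_ext; [| | |exact (TC1_plus _ _ _ _ _ _ (TC1_const 1) (TC1_plus _ _ _ _ _ _ (TC1_mult _ _ _ _ _ _ a a) (TC1_mult _ _ _ _ _ _ b b)))];
    intros p; unfold hh, dh, pd; ring.
Qed.
Lemma TC1_hp s : TC1 (hs s) (fun p => s * hs (s - 1) p * dh true p) (fun p => s * hs (s - 1) p * dh false p).
Proof.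
  assert (D : forall x, 0 < x -> is_derive (fun x => Rpower x s) x (s * Rpower x (s - 1))) by (intros; now apply is_derive_Rpow).
  apply (TC1_comp (fun x => Rpower x s) (fun x => s * Rpower x (s - 1)) h (dh true) (dh false) TC1_hh).
  - intros p. apply D. pose proof (hh_ge1 v p). lra.
  - intros p. apply is_derive_cont with (s * ((s - 1) * Rpower (h p) (s - 1 - 1))). apply is_derive_scal. apply is_derive_Rpow.
    pose proof (hh_ge1 v p). lra.
Qed.
Lemma cont2_hp s : cont2 (hs s).
Proof. apply (TC1_hp s). Qed.

Definition dvn (j : bool) (p : R * R) : R := Cmod (pd j V1 V2 p).

Lemma dh_bound j p : Rabs (dh j p) <= 2 * hs (1/2) p * dvn j p.
Proof.
  unfold dh, dvn. set (w := pd j V1 V2 p).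
  replace (2 * (Re (v p) * Re w + Im (v p) * Im w)) with (2 * Re (Cmult (Cconj (v p)) w)) by (unfold Re, Im, Cmult, Cconj; simpl; ring).
  rewrite Rabs_mult, Rabs_pos_eq by lra. rewrite Rmult_assoc. apply Rmult_le_compat_l; [lra|].
  eapply Rle_trans; [apply re_le_Cmod|]. rewrite Cmod_mult, Cmod_conj. apply Rmult_le_compat_r; [apply Cmod_ge_0|apply hp_half].
Qed.

Lemma cont2_dvn j : cont2 (dvn j).
Proof. apply cont2_Cmod. pose proof (CTC1_cont _ _ _ Hv) as (_ & c1 & c2). destruct j; simpl; auto. Qed.

(** [F] is of size h^e with gradient of size h^{e-1/2} |grad v|. *)
Definition PB (e c : R) (F : R * R -> C) : Prop := exists F1 F2, CTC1 F F1 F2 /\ forall p,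
  Cmod (F p) <= c * hs e p /\ forall j, Cmod (pd j F1 F2 p) <= c * hs (e - 1/2) p * dvn j p.

Lemma PB_const : PB 0 1 (fun _ => RtoC 1).
Proof.
  exists (fun _ => RtoC 0), (fun _ => RtoC 0). split; [apply CTC1_const|]. intros p. split.
  - rewrite hp_0, Cmod_1. lra.
  - intros j. replace (pd j _ _ p) with (RtoC 0) by (now destruct j). rewrite Cmod_0.
    pose proof (hp_pos v (0 - 1/2) p). pose proof (Cmod_ge_0 (pd j V1 V2 p)). unfold dvn. nra.
Qed.
Lemma PB_v : PB (1/2) 1 v.
Proof.
  exists V1, V2. split; auto. intros p. split.
  - rewrite Rmult_1_l. apply hp_half.
  - intros j. replace (1/2 - 1/2) with 0 by ring. rewrite hp_0. unfold dvn. lra.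
Qed.
Lemma PB_conj e c F : PB e c F -> PB e c (fun p => Cconj (F p)).
Proof.
  intros (F1 & F2 & H & B). exists (fun p => Cconj (F1 p)), (fun p => Cconj (F2 p)). split; [now apply CTC1_conj|].
  intros p. destruct (B p) as [b1 b2]. split; [rewrite Cmod_conj; auto|]. intros j. specialize (b2 j).
  destruct j; simpl in *; rewrite Cmod_conj; auto.
Qed.
Lemma PB_hp s : PB s (1 + 2 * Rabs s) (fun p => RtoC (hs s p)).
Proof.
  pose proof (Rabs_pos s) as As.
  exists (fun p => RtoC (s * hs (s - 1) p * dh true p)), (fun p => RtoC (s * hs (s - 1) p * dh false p)).
  split; [apply CTC1_RtoC, TC1_hp|]. intros p. pose proof (hp_pos v s p). split.
  - rewrite Cmod_R, Rabs_pos_eq by lra. nra.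
  - intros j. replace (pd j _ _ p) with (RtoC (s * hs (s - 1) p * dh j p)) by (now destruct j).
    rewrite Cmod_R, !Rabs_mult, (Rabs_pos_eq (hs (s - 1) p)) by (apply Rlt_le, hp_pos).
    pose proof (dh_bound j p) as Hd. pose proof (hp_pos v (s - 1) p).
    assert (0 <= dvn j p) by apply Cmod_ge_0.
    apply Rle_trans with (Rabs s * hs (s - 1) p * (2 * hs (1/2) p * dvn j p)).
    + apply Rmult_le_compat_l; [nra|auto].
    + replace (s - 1/2) with ((s - 1) + 1/2) by field. rewrite hp_plus.
      replace (Rabs s * hs (s - 1) p * (2 * hs (1 / 2) p * dvn j p)) with (2 * Rabs s * (hs (s - 1) p * hs (1/2) p * dvn j p)) by ring.
      replace ((1 + 2 * Rabs s) * (hs (s - 1) p * hs (1 / 2) p) * dvn j p) with ((1 + 2 * Rabs s) * (hs (s - 1) p * hs (1/2) p * dvn j p)) by ring.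
      apply Rmult_le_compat_r; [|lra]. pose proof (hp_pos v (1/2) p). apply Rmult_le_pos; [nra|auto].
Qed.
Lemma PB_mult e c F e' c' F' : PB e c F -> PB e' c' F' -> PB (e + e') (2 * c * c') (fun p => Cmult (F p) (F' p)).
Proof.
  intros (F1 & F2 & H & B) (G1 & G2 & H' & B').
  exists (fun p => Cplus (Cmult (F1 p) (F' p)) (Cmult (F p) (G1 p))), (fun p => Cplus (Cmult (F2 p) (F' p)) (Cmult (F p) (G2 p))).
  split; [now apply CTC1_mult|]. intros p. destruct (B p) as [b1 b2]. destruct (B' p) as [b1' b2'].
  pose proof (Cmod_ge_0 (F p)). pose proof (Cmod_ge_0 (F' p)). split.
  - rewrite Cmod_mult, hp_plus. assert (Cmod (F p) * Cmod (F' p) <= (c * hs e p) * (c' * hs e' p)) by (apply Rmult_le_compat; auto).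
    assert (0 <= c * hs e p * (c' * hs e' p)) by (apply Rmult_le_pos; lra). lra.
  - intros j. specialize (b2 j). specialize (b2' j).
    replace (pd j _ _ p) with (Cplus (Cmult (pd j F1 F2 p) (F' p)) (Cmult (F p) (pd j G1 G2 p))) by (now destruct j).
    eapply Rle_trans; [apply Cmod_triangle|]. rewrite !Cmod_mult.
    pose proof (Cmod_ge_0 (pd j F1 F2 p)). pose proof (Cmod_ge_0 (pd j G1 G2 p)).
    assert (Cmod (pd j F1 F2 p) * Cmod (F' p) <= (c * hs (e - 1/2) p * dvn j p) * (c' * hs e' p)) by (apply Rmult_le_compat; auto).
    assert (Cmod (F p) * Cmod (pd j G1 G2 p) <= (c * hs e p) * (c' * hs (e' - 1/2) p * dvn j p)) by (apply Rmult_le_compat; auto).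
    assert (E1 : hs (e + e' - 1/2) p = hs (e - 1/2) p * hs e' p) by (rewrite <- hp_plus; f_equal; ring).
    assert (E2 : hs (e + e' - 1/2) p = hs e p * hs (e' - 1/2) p) by (rewrite <- hp_plus; f_equal; ring).
    replace (c * hs (e - 1/2) p * dvn j p * (c' * hs e' p)) with (c * c' * (hs (e - 1/2) p * hs e' p) * dvn j p) in * by ring.
    replace (c * hs e p * (c' * hs (e' - 1/2) p * dvn j p)) with (c * c' * (hs e p * hs (e' - 1/2) p) * dvn j p) in * by ring.
    rewrite <- E1 in *. rewrite <- E2 in *. lra.
Qed.
Lemma PB_pow n e c F : PB e c F -> PB (INR n * e) ((2 * c) ^ n) (fun p => Cpow (F p) n).
Proof.
  intros H. induction n as [|n IH].
  - simpl. rewrite Rmult_0_l. apply PB_const.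
  - rewrite S_INR. replace ((INR n + 1) * e) with (e + INR n * e) by ring. simpl. now apply PB_mult.
Qed.

Variables (q : R) (m : nat).
Hypothesis Hq : INR m + 1/2 < q.
Hypothesis Hm : (1 <= m)%nat.

(** [Dis] is the dissipation produced by the linear part and [Xn] the leading part of the nonlinear
    term. All other terms of the energy balance are measured by [KK], whose summand 1 makes its
    powers monotone in the exponent. *)
Definition Dis : R := TI (fun p => hs (q - 1) p * (dvn true p ^ 2 + dvn false p ^ 2)).
Definition Xn : R := TI (hs (q + INR m)).
Definition KK : R := 1 + Dis + Xn.

Lemma cont2_dis : cont2 (fun p => hs (q - 1) p * (dvn true p ^ 2 + dvn false p ^ 2)).
Proof. apply cont2_mult; [apply cont2_hp|]. apply cont2_plus; apply cont2_pow, cont2_dvn. Qed.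
Lemma Dis_ge0 : 0 <= Dis.
Proof.
  apply TI_ge0; [apply cont2_dis|]. intros p. apply Rmult_le_pos; [apply Rlt_le, hp_pos|].
  pose proof (pow2_ge_0 (dvn true p)). pose proof (pow2_ge_0 (dvn false p)). lra.
Qed.
Lemma Xn_ge0 : 0 <= Xn.
Proof. apply TI_ge0; [apply cont2_hp|]. intros p. apply Rlt_le, hp_pos. Qed.
Lemma KK_ge1 : 1 <= KK.
Proof. pose proof Dis_ge0. pose proof Xn_ge0. unfold KK. lra. Qed.

(** Young's inequality for the factors h^((q-1)/2) |grad v| and h^(a-(q-1)/2) of the integrand. *)
Lemma grad_young a j : TI (fun p => hs a p * dvn j p) <= / 2 * (Dis + TI (hs (2 * a - q + 1))).
Proof.
  unfold Dis. rewrite <- TI_plus by (apply cont2_dis || apply cont2_hp).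
  rewrite <- TI_scal by (apply cont2_plus; [apply cont2_dis|apply cont2_hp]).
  apply TI_le.
  - apply cont2_mult; [apply cont2_hp|apply cont2_dvn].
  - apply (cont2_mult (fun _ => / 2)); [apply cont2_const|]. apply cont2_plus; [apply cont2_dis|apply cont2_hp].
  - intros p. set (x := hs ((q - 1) / 2) p). set (y := hs (a - (q - 1) / 2) p). set (d := dvn j p).
    assert (E1 : hs a p = x * y) by (unfold x, y; rewrite <- hp_plus; f_equal; field).
    assert (E2 : hs (q - 1) p = x * x) by (unfold x; rewrite <- hp_plus; f_equal; field).
    assert (E3 : hs (2 * a - q + 1) p = y * y) by (unfold y; rewrite <- hp_plus; f_equal; field).
    rewrite E1, E2, E3.
    assert (d ^ 2 <= dvn true p ^ 2 + dvn false p ^ 2).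
    { unfold d. pose proof (pow2_ge_0 (dvn true p)). pose proof (pow2_ge_0 (dvn false p)). destruct j; lra. }
    pose proof (pow2_ge_0 (x * d - y)).
    nra.
Qed.

Lemma TI_hp_mono s s' : s <= s' -> TI (hs s) <= TI (hs s').
Proof. intros H. apply TI_le; try apply cont2_hp. intros p. now apply hp_mono. Qed.

(** [sobolev_L2] applied to h^s with s = q + m/2: its gradient is of size h^(s-1/2) |grad v|, and
    Young's inequality then returns exactly the exponent q + m of [Xn]. *)
Lemma sobolev_K : TI (hs (2 * q + INR m)) <= (1 + q + INR m) ^ 2 * KK ^ 2.
Proof.
  set (s := q + INR m / 2). assert (m1 : 1 <= INR m) by (now apply (le_INR 1)).
  assert (F : forall j, TI (fun p => Rabs (hs s p) + Rabs (s * hs (s - 1) p * dh j p)) <= (1 + q + INR m) * KK).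
  { intros j. apply Rle_trans with (TI (fun p => hs s p + 2 * s * (hs (s - 1/2) p * dvn j p))).
    - apply TI_le.
      + apply cont2_plus; apply cont2_abs; [apply cont2_hp|]. destruct j; apply (TC1_hp s).
      + apply cont2_plus; [apply cont2_hp|]. apply (cont2_mult (fun _ => 2 * s)); [apply cont2_const|]. apply cont2_mult; [apply cont2_hp|apply cont2_dvn].
      + intros p. rewrite Rabs_pos_eq by apply Rlt_le, hp_pos. apply Rplus_le_compat_l.
        rewrite !Rabs_mult, (Rabs_pos_eq s), (Rabs_pos_eq (hs (s - 1) p)) by (try apply Rlt_le, hp_pos; unfold s; lra).
        pose proof (dh_bound j p). replace (s - 1/2) with ((s - 1) + 1/2) by field. rewrite hp_plus.
        pose proof (hp_pos v (s - 1) p).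
        apply Rle_trans with (s * hs (s - 1) p * (2 * hs (1/2) p * dvn j p)); [apply Rmult_le_compat_l; [apply Rmult_le_pos; [unfold s; lra|lra]|auto]|].
        apply Req_le. ring.
    - rewrite TI_plus; [|apply cont2_hp|apply (cont2_mult (fun _ => 2 * s)); [apply cont2_const|apply cont2_mult; [apply cont2_hp|apply cont2_dvn]]].
      rewrite TI_scal by (apply cont2_mult; [apply cont2_hp|apply cont2_dvn]).
      pose proof (grad_young (s - 1/2) j) as Y. replace (2 * (s - 1/2) - q + 1) with (q + INR m) in Y by (unfold s; field). fold Xn in Y.
      pose proof (TI_hp_mono s (q + INR m) ltac:(unfold s; lra)) as M. fold Xn in M.
      pose proof Dis_ge0. pose proof Xn_ge0. unfold KK.
      assert (2 * s * TI (fun p => hs (s - 1/2) p * dvn j p) <= 2 * s * (/ 2 * (Dis + Xn))) by (apply Rmult_le_compat_l; [unfold s; lra|auto]).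
      assert (s * (Dis + Xn) <= (q + INR m) * (Dis + Xn)) by (apply Rmult_le_compat_r; [lra|unfold s; lra]).
      nra. }
  eapply Rle_trans; [|eapply Rle_trans; [apply (sobolev_L2 _ _ _ (TC1_hp s))|]].
  - apply Req_le. apply TI_ext. intros p. simpl. rewrite Rmult_1_r, <- hp_plus. f_equal. unfold s. field.
  -
    replace ((1 + q + INR m) ^ 2 * KK ^ 2) with (((1 + q + INR m) * KK) * ((1 + q + INR m) * KK)) by ring.
    apply Rmult_le_compat; auto; (apply TI_ge0; [apply cont2_plus; apply cont2_abs; [apply cont2_hp|apply (TC1_hp s)]|]);
      intros p; apply Rplus_le_le_0_compat; apply Rabs_pos.
Qed.

Definition rr : R := q + INR m.

(** Splitting at the level h = KK^(1/rr): below it h^(rr-1/2) is bounded by a constant, above it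
    half a power of h is traded for KK^(-1/(2 rr)). An exponent of [KK] strictly below 1 is what
    makes absorption possible. *)
Lemma TI_low e : e <= rr - 1/2 -> TI (hs e) <= 2 * Rpower KK (1 - / (2 * rr)).
Proof.
  intros He. assert (m1 : 1 <= INR m) by (now apply (le_INR 1)). assert (r1 : 1 < rr) by (unfold rr; lra).
  pose proof KK_ge1 as K1. set (Y := Rpower KK (/ rr)).
  assert (Y0 : 0 < Y) by apply exp_pos.
  eapply Rle_trans; [apply (TI_hp_mono e (rr - 1/2)); auto|].
  apply Rle_trans with (TI (fun p => Rpower Y (- (1/2)) * hs rr p + Rpower Y (rr - 1/2))).
  - apply TI_le; [apply cont2_hp| |].
    + apply cont2_plus; [apply (cont2_mult (fun _ => Rpower Y (- (1/2)))); [apply cont2_const|apply cont2_hp]|apply cont2_const].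
    + intros p. pose proof (hh_ge1 v p). pose proof (Rpower_pos Y (rr - 1/2)) as e1. pose proof (Rpower_pos Y (- (1/2))) as e2.
      pose proof (hp_pos v rr p).
      destruct (Rle_dec (h p) Y) as [Hh|Hh].
      * assert (hs (rr - 1/2) p <= Rpower Y (rr - 1/2)) by (unfold hp; apply Rle_Rpower_l; lra). nra.
      * replace (rr - 1/2) with (- (1/2) + rr) at 1 by ring. rewrite hp_plus.
        assert (hs (- (1/2)) p <= Rpower Y (- (1/2))).
        { unfold hp. rewrite !Rpower_Ropp. apply Rinv_le_contravar; [apply exp_pos|]. apply Rle_Rpower_l; lra. }
        nra.
  - rewrite TI_plus; [|apply (cont2_mult (fun _ => Rpower Y (- (1/2)))); [apply cont2_const|apply cont2_hp]|apply cont2_const].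
    rewrite TI_scal, TI_const by apply cont2_hp. fold rr in *. change (TI (hs rr)) with Xn.
    assert (XK : Xn <= KK) by (unfold KK; pose proof Dis_ge0; lra).
    assert (E1 : Rpower Y (- (1/2)) * KK = Rpower KK (1 - / (2 * rr))).
    { rewrite <- (Rpower_1 KK) at 1 by lra. unfold Y. rewrite Rpower_mult, <- Rpower_plus. f_equal. field. lra. }
    assert (E2 : Rpower Y (rr - 1/2) = Rpower KK (1 - / (2 * rr))).
    { unfold Y. rewrite Rpower_mult. f_equal. field. lra. }
    rewrite E2. assert (Rpower Y (- (1/2)) * Xn <= Rpower Y (- (1/2)) * KK) by (apply Rmult_le_compat_l; [apply Rlt_le, exp_pos|auto]). lra.
Qed.

(** A bound quadratic in [KK] is enough, because gradients enter the duality estimate with a factor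
    that the choice of cut-off turns into a negative power of [KK]. *)
Lemma TI_grad e j : e <= rr - 1/2 -> TI (fun p => hs (e - 1/2) p * dvn j p) <= (1 + q + INR m) ^ 2 * KK ^ 2.
Proof.
  intros He. assert (m1 : 1 <= INR m) by (now apply (le_INR 1)).
  eapply Rle_trans; [apply grad_young|]. pose proof KK_ge1 as K1. pose proof Xn_ge0.
  assert (TI (hs (2 * (e - 1/2) - q + 1)) <= (1 + q + INR m) ^ 2 * KK ^ 2).
  { eapply Rle_trans; [apply (TI_hp_mono _ (2 * q + INR m)); unfold rr in He; lra|apply sobolev_K]. }
  assert (Dis <= (1 + q + INR m) ^ 2 * KK ^ 2).
  { apply Rle_trans with (KK ^ 2); [unfold KK in *; nra|]. assert (1 <= (1 + q + INR m) ^ 2) by nra. nra. }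
  lra.
Qed.

End Calc.

(** This is where the admissible range of q enters. *)
Lemma coercive mu q : 0 < mu -> 1 < q -> (q - 1) ^ 2 < mu ^ 2 * (2 * q - 1) -> exists dl, 0 < dl /\
  forall v V1 V2 V11 V12 V21 V22, CTC1 v V1 V2 -> CTC1 V1 V11 V12 -> CTC1 V2 V21 V22 ->
  TI (fun p => hp v (q - 1) p * Re (Cmult (Cconj (v p)) (Cmult (mu, 1) (Cplus (V11 p) (V22 p))))) <= - dl * Dis v V1 V2 q.
Proof.
  (* [d0] is the amount of coercivity for which the strict inequality on q survives as [QF], the
     discriminant condition for the quadratic form in [QP]. *)
  intros Hmu Hq Hc. set (d0 := (mu ^ 2 * (2 * q - 1) - (q - 1) ^ 2) / (2 * q * mu)). set (dl := Rmin (mu / 2) d0).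
  assert (qm : 0 < 2 * q * mu) by nra.
  assert (Hd0 : 0 < d0) by (unfold d0; apply Rdiv_lt_0_compat; lra).
  assert (Hdl : 0 < dl) by (unfold dl; apply Rmin_glb_lt; lra).
  assert (dl1 : dl <= mu / 2) by apply Rmin_l. assert (dl2 : dl <= d0) by apply Rmin_r.
  assert (QF : (q - 1) ^ 2 <= (mu - dl) * ((2 * q - 1) * mu - dl)).
  { assert (dl * (2 * q * mu) <= mu ^ 2 * (2 * q - 1) - (q - 1) ^ 2).
    { apply Rle_trans with (d0 * (2 * q * mu)); [apply Rmult_le_compat_r; lra|]. unfold d0. apply Req_le. field. split; lra. }
    nra. }
  assert (QP : forall A B, 0 <= (mu - dl) * (A * A + B * B) + 2 * (q - 1) * (mu * (A * A) - A * B)).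
  { intros A B. set (al := (2 * q - 1) * mu - dl). assert (al0 : 0 < al) by (unfold al; nra).
    assert (E : al * ((mu - dl) * (A * A + B * B) + 2 * (q - 1) * (mu * (A * A) - A * B)) =
       (al * A - (q - 1) * B) ^ 2 + (al * (mu - dl) - (q - 1) ^ 2) * (B * B)) by (unfold al; ring).
    apply (Rmult_le_reg_l al); auto. rewrite Rmult_0_r, E. pose proof (pow2_ge_0 (al * A - (q - 1) * B)).
    assert (0 <= (al * (mu - dl) - (q - 1) ^ 2) * (B * B)) by (apply Rmult_le_pos; [unfold al; lra|nra]). lra. }
  exists dl. split; auto. intros v V1 V2 V11 V12 V21 V22 Hv H1 H2.
  set (g := hp v (q - 1)).
  assert (cg : cont2 g) by (eapply cont2_hp; eauto).
  assert (DIR : forall j W W1 W2, W = pd j V1 V2 -> CTC1 W W1 W2 ->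
    TI (fun p => g p * Re (Cmult (Cconj (v p)) (Cmult (mu, 1) (pd j W1 W2 p)))) <= - dl * TI (fun p => g p * Cmod (W p) ^ 2)).
  { intros j W W1 W2 EW HW. pose proof Hv as [ha hb]. pose proof HW as [ka kb].
    pose proof (CTC1_cont _ _ _ Hv) as (cv & cV1 & cV2). pose proof (CTC1_cont _ _ _ HW) as (cW & cW1 & cW2).
    (* The function differentiated is h^(q-1) Re((mu+i) conj(v) W). Its derivative integrates to 0,
       which moves one derivative from W onto h^(q-1) conj(v). *)
    pose proof (TC1_mult _ _ _ _ _ _ (TC1_hp v V1 V2 Hv (q - 1)) (TC1_plus _ _ _ _ _ _
      (TC1_scal mu _ _ _ (TC1_plus _ _ _ _ _ _ (TC1_mult _ _ _ _ _ _ ha ka) (TC1_mult _ _ _ _ _ _ hb kb)))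
      (TC1_scal (-1) _ _ _ (TC1_plus _ _ _ _ _ _ (TC1_mult _ _ _ _ _ _ ha kb) (TC1_scal (-1) _ _ _ (TC1_mult _ _ _ _ _ _ hb ka)))))) as HM.
    apply (TI_pd j) in HM.
    (* [A] and [Bb] are the real and imaginary parts of conj(v) W; their squares add up to (h-1)
       |W|^2, which lets [QP] be compared with the dissipation. *)
    set (A := fun p => Re (v p) * Re (W p) + Im (v p) * Im (W p)).
    set (Bb := fun p => Re (v p) * Im (W p) - Im (v p) * Re (W p)).
    set (T1 := fun p => g p * Re (Cmult (Cconj (v p)) (Cmult (mu, 1) (pd j W1 W2 p)))).
    set (T2 := fun p => g p * (mu * (Re (W p) * Re (W p) + Im (W p) * Im (W p))) + 2 * (q - 1) * (hp v (q - 2) p * (mu * (A p * A p) - A p * Bb p))).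
    assert (cRv : cont2 (fun p => Re (v p))) by apply cv. assert (cIv : cont2 (fun p => Im (v p))) by apply cv.
    assert (cRW : cont2 (fun p => Re (W p))) by apply cW. assert (cIW : cont2 (fun p => Im (W p))) by apply cW.
    assert (cA : cont2 A) by (apply cont2_plus; now apply cont2_mult).
    assert (cB : cont2 Bb) by (apply cont2_minus; now apply cont2_mult).
    assert (cT1 : cont2 T1).
    { apply cont2_mult; auto. apply (ccont2_mult (fun p => Cconj (v p)) (fun p => Cmult (mu, 1) (pd j W1 W2 p))); [now apply ccont2_conj|].
      apply (ccont2_mult (fun _ => (mu, 1))); [apply ccont2_const|]. destruct j; auto. }
    assert (cT2 : cont2 T2).
    { apply cont2_plus.
      - apply cont2_mult; auto. apply (cont2_mult (fun _ => mu)); [apply cont2_const|]. apply cont2_plus; now apply cont2_mult.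
      - apply (cont2_mult (fun _ => 2 * (q - 1))); [apply cont2_const|]. apply cont2_mult; [eapply cont2_hp; eauto|].
        apply cont2_minus; [apply (cont2_mult (fun _ => mu)); [apply cont2_const|]|]; now apply cont2_mult. }
    assert (Z : TI T1 + TI T2 = 0).
    { rewrite <- TI_plus by auto. rewrite <- HM. apply TI_ext. intros p. unfold T1, T2, A, Bb, g.
      replace (q - 2) with (q - 1 - 1) by ring.
      destruct j; cbn [pd]; unfold dh; subst W; cbn [pd] in *; unfold Re, Im, Cmult, Cconj; simpl; ring. }
    assert (L : dl * TI (fun p => g p * Cmod (W p) ^ 2) <= TI T2).
    { assert (cWm : cont2 (fun p => g p * Cmod (W p) ^ 2)) by (apply cont2_mult; auto; now apply cont2_pow, cont2_Cmod).
      rewrite <- TI_scal by auto. apply TI_le; [apply (cont2_mult (fun _ => dl)); auto; apply cont2_const|auto|].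
      intros p. unfold T2. rewrite Cmod2_alt.
      assert (Eg : g p = hh v p * hp v (q - 2) p) by (unfold g; rewrite <- hp_1, <- hp_plus; f_equal; ring).
      rewrite Eg. pose proof (hp_pos v (q - 2) p) as g2. set (G2 := hp v (q - 2) p) in *.
      specialize (QP (A p) (Bb p)).
      assert (AB : A p * A p + Bb p * Bb p = (hh v p - 1) * (Re (W p) ^ 2 + Im (W p) ^ 2)) by (unfold A, Bb, hh; ring).
      set (E := Re (W p) ^ 2 + Im (W p) ^ 2) in *. assert (E0 : 0 <= E) by (unfold E; pose proof (pow2_ge_0 (Re (W p))); pose proof (pow2_ge_0 (Im (W p))); lra).
      replace (Re (W p) * Re (W p) + Im (W p) * Im (W p)) with E by (unfold E; ring).
      assert (0 <= G2 * ((mu - dl) * hh v p * E + 2 * (q - 1) * (mu * (A p * A p) - A p * Bb p))).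
      { apply Rmult_le_pos; [lra|]. rewrite AB in QP. assert (0 <= (mu - dl) * E) by (apply Rmult_le_pos; lra).
        replace ((mu - dl) * hh v p * E) with ((mu - dl) * ((hh v p - 1) * E) + (mu - dl) * E) by ring. lra. }
      lra. }
    change (TI T1 <= - dl * TI (fun p => g p * Cmod (W p) ^ 2)). lra. }
  pose proof (DIR true V1 V11 V12 eq_refl H1) as Q1. pose proof (DIR false V2 V21 V22 eq_refl H2) as Q2. cbn [pd] in Q1, Q2.
  pose proof (CTC1_cont _ _ _ Hv) as (cv & cV1 & cV2). pose proof (CTC1_cont _ _ _ H1) as (_ & c11 & _). pose proof (CTC1_cont _ _ _ H2) as (_ & _ & c22).
  assert (cT : forall W, ccont2 W -> cont2 (fun p => g p * Re (Cmult (Cconj (v p)) (Cmult (mu, 1) (W p))))).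
  { intros W cW. apply cont2_mult; auto. apply (ccont2_mult (fun p => Cconj (v p)) (fun p => Cmult (mu, 1) (W p))); [now apply ccont2_conj|].
    apply (ccont2_mult (fun _ => (mu, 1))); [apply ccont2_const|auto]. }
  unfold Dis. rewrite (TI_ext (fun p => hp v (q - 1) p * (dvn V1 V2 true p ^ 2 + dvn V1 V2 false p ^ 2)) (fun p => g p * Cmod (V1 p) ^ 2 + g p * Cmod (V2 p) ^ 2)) by (intros; unfold g, dvn, pd; ring).
  rewrite TI_plus by (apply cont2_mult; auto; now apply cont2_pow, cont2_Cmod).
  rewrite (TI_ext _ (fun p => g p * Re (Cmult (Cconj (v p)) (Cmult (mu, 1) (V11 p))) + g p * Re (Cmult (Cconj (v p)) (Cmult (mu, 1) (V22 p))))).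
  - rewrite TI_plus by (now apply cT). lra.
  - intros p. fold (g p). unfold Re, Cmult, Cplus, Cconj; simpl. ring.
Qed.

(** * Pairing distributions of negative regularity with powers of the solution *)

Lemma pow2_between x : 1 <= x -> exists j, x <= 2 ^ j <= 2 * x.
Proof.
  intros Hx. destruct (pow2_unbounded x) as [N HN]. induction N as [|N IH].
  - exists 0%nat. simpl in *. lra.
  - destruct (Rle_dec x (2 ^ N)) as [H|H]; [auto|]. exists (S N). simpl in *. lra.
Qed.

(** Absorption of a sublinear power: beyond a threshold Y the factor K^{-ep} is small, and below it
    the left side is bounded by a constant. *)
Lemma young_eps ep a c : 0 < ep < 1 -> 0 <= a -> 0 < c -> exists D, 0 <= D /\ forall K, 1 <= K -> a * Rpower K (1 - ep) <= c * K + D.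
Proof.
  intros Hep Ha Hc. set (Y := Rpower ((a + 1) / c) (/ ep)). exists (a * (Y + 1)).
  assert (Y0 : 0 < Y) by apply exp_pos. split; [nra|]. intros K HK.
  assert (E : Rpower K (1 - ep) = K * Rpower K (- ep)) by (unfold Rminus; rewrite Rpower_plus, Rpower_1 by lra; ring).
  destruct (Rle_dec K Y) as [H|H].
  - assert (Rpower K (1 - ep) <= K).
    { rewrite <- (Rpower_1 K) at 2 by lra. apply Rle_Rpower; lra. }
    nra.
  - assert (Q : Rpower K (- ep) <= c / (a + 1)).
    { apply Rle_trans with (Rpower Y (- ep)).
      - rewrite !Rpower_Ropp. apply Rinv_le_contravar; [apply exp_pos|]. apply Rle_Rpower_l; lra.
      - unfold Y. rewrite Rpower_mult. replace (/ ep * - ep) with (- (1)) by (field; lra).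
        rewrite Rpower_Ropp, Rpower_1 by (apply Rdiv_lt_0_compat; lra). apply Req_le. field. lra. }
    rewrite E. assert (a * (K * Rpower K (- ep)) <= a * (K * (c / (a + 1)))) by (apply Rmult_le_compat_l; auto; apply Rmult_le_compat_l; lra).
    assert (a * (K * (c / (a + 1))) <= c * K).
    { replace (a * (K * (c / (a + 1)))) with (c * K * (a / (a + 1))) by (field; lra).
      assert (a / (a + 1) <= 1) by (apply (Rmult_le_reg_r (a + 1)); [lra|]; unfold Rdiv; rewrite Rmult_assoc, Rinv_l; lra).
      assert (0 < c * K) by nra. nra. }
    assert (0 <= a * (Y + 1)) by nra. lra.
Qed.

Ltac rpos := first [lra | apply Rlt_le, pow_lt; lra | apply Rmult_le_pos; rpos].

Section Pairing.
Variables chi rho : R -> R.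
Hypothesis HD : dyadic_partition chi rho.
Notation b := (blk chi rho).
Notation bes := (besov_le chi rho).

(* Potential of a high-frequency block: Delta_n G = d_1 W_1 + d_2 W_2. *)
Lemma block_potential : exists C, 0 < C /\ forall al B G M n, 0 < al < 1 -> supp B G -> bes (- al) G M -> (1 <= n)%nat ->
  exists W : bool -> fdist, (forall j, supp B (W j)) /\ (forall k, mul (b n) G k = Cplus (Dk true (W true) k) (Dk false (W false) k)) /\
   (forall j x, Cmod (ev B (W j) x) <= C * M * wt (al - 1) n).
Proof.
  destruct (radial_L1 _ _ HD) as (C & C0 & H). exists (C * 16 * 6). split; [lra|].
  intros al B G M n Hal SG HG Hn. pose proof (bes_nonneg _ _ _ _ _ HG) as M0. destruct n as [|n]; [lia|].
  (* Up to the factor -i this is the symbol of d_j composed with the inverse Laplacian, restricted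
     to block n, where |k| does not vanish. *)
  set (r := fun j k => / (2 * PI) * (IZR (kc j k) / znorm k ^ 2) * b (S n) k).
  exists (fun j k => Cmult (0, -1) (mul (r j) G k)).
  assert (SW : forall j, supp B (fun k => Cmult (0, -1) (mul (r j) G k))).
  { intros j k Hk. unfold mul. rewrite SG by auto. ring. }
  pose proof PI_RGT_0 as PIp. split; [auto|split].
  - intros k. unfold Dk, mul, r, kc. destruct (classic (b (Datatypes.S n) k = 0)) as [->|Hb].
    + rewrite !Rmult_0_r. ring.
    + pose proof (blk_lo _ _ HD (Datatypes.S n) k ltac:(lia) Hb) as L. pose proof (pow2_ge1 (Datatypes.S n)).
      assert (Z : znorm k ^ 2 <> 0) by nra. pose proof (znorm_sq k) as ZE.
      destruct (G k) as [g1 g2]. unfold Cplus, Cmult, RtoC; cbn [fst snd].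
      set (x := IZR (fst k)) in *. set (y := IZR (snd k)) in *.
      rewrite ZE. f_equal; field; split; auto; lra.
  - intros j x. set (Bn := (B + 3 * 2 ^ (Datatypes.S n + 1))%nat).
    rewrite (ev_supp B Bn); [|apply SW|apply supp_le with B; [unfold Bn; lia|apply SW]].
    rewrite ev_scal, Cmod_mult.
    replace (Cmod (0, -1)) with 1 by (unfold Cmod; cbn [fst snd]; replace (0 ^ 2 + (-1) ^ 2) with 1 by ring; now rewrite sqrt_1).
    rewrite Rmult_1_l.
    set (g := fun k => Csum (nearl (Datatypes.S n)) (fun i => mul (b i) G k)).
    assert (Hg : forall y, Cmod (ev Bn g y) <= 3 * (Rpower 2 (Rabs (- al)) * M * wt (- - al) (Datatypes.S n))).
    { intros y. apply (fat_bound chi rho HD); auto. unfold Bn; lia. }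
    (* For s > 1/2 the profile 1/s and its first two derivatives are at most 2, 4 and 16 in
       modulus. *)
    destruct (H n 16 (fun s => / s) (fun s => - / s ^ 2) (fun s => 2 / s ^ 3) ltac:(lra)) with (B := Bn) (f := g)
      (M := 3 * (Rpower 2 (Rabs (- al)) * M * wt (- - al) (Datatypes.S n))) (x := x) as [_ Q]; auto.
    { intros s Hs. auto_derive; [lra|]. field. lra. }
    { intros s Hs. auto_derive; [nra|]. field. lra. }
    { intros s Hs. assert (I : 0 < / s <= 2).
      { split; [apply Rinv_0_lt_compat; lra|]. replace 2 with (/ (1/2)) by field. apply Rinv_le_contravar; lra. }
      assert (E2 : / s ^ 2 = / s * / s) by (field; lra). assert (E3 : 2 / s ^ 3 = 2 * (/ s * / s * / s)) by (field; lra).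
      rewrite E2, E3, Rabs_Ropp, !Rabs_pos_eq; repeat split; nra. }
    specialize (Q j).
    assert (P2 : 0 < 2 ^ n) by (apply pow_lt; lra).
    assert (EQ : forall k, mul (r j) G k = Cmult (RtoC (/ (2 * PI) * / 2 ^ n))
       (mul (fun k => IZR (kc j k) / 2 ^ n * (b (Datatypes.S n) k * / (znorm k ^ 2 / 4 ^ n))) g k)).
    { intros k. unfold mul, g, mul. rewrite Csum_scal_r, <- RtoC_Rsum, !Cmult_assoc, <- !RtoC_mult. f_equal. f_equal. unfold r.
      rewrite <- (blk_fat _ _ HD (Datatypes.S n) k) at 1.
      destruct (classic (b (Datatypes.S n) k = 0)) as [->|Hb]; [ring|].
      pose proof (blk_lo _ _ HD (Datatypes.S n) k ltac:(lia) Hb) as L. pose proof (pow2_ge1 (Datatypes.S n)).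
      rewrite <- pow2_sq. field. repeat split; auto; lra. }
    rewrite (ev_ext Bn _ _ x (fun k _ => EQ k)), ev_scal, Cmod_mult, Cmod_R.
    assert (I1 : 0 < / (2 * PI) <= 1).
    { split; [apply Rinv_0_lt_compat; lra|]. rewrite <- Rinv_1. pose proof PI2_3_2. apply Rinv_le_contravar; lra. }
    assert (I2 : 0 < / 2 ^ n) by (now apply Rinv_0_lt_compat).
    rewrite Rabs_pos_eq by nra.
    assert (W1 : wt (al - 1) (Datatypes.S n) = wt al (Datatypes.S n) * / 2 ^ n).
    { unfold Rminus. rewrite wt_plus. f_equal. unfold wt. rewrite S_INR.
      replace ((INR n + 1 - 1) * - (1)) with (- INR n) by ring. rewrite Rpower_Ropp, Rpower_pow by lra. reflexivity. }
    rewrite W1. rewrite Ropp_involutive in Q.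
    assert (R2 : 0 < Rpower 2 (Rabs (- al)) <= 2).
    { split; [apply exp_pos|]. rewrite Rabs_Ropp, Rabs_pos_eq by lra. rewrite <- (Rpower_1 2) at 2 by lra. apply Rpower2_le. lra. }
    pose proof (wt_pos al (Datatypes.S n)) as wp.
    set (T := M * wt al (Datatypes.S n)). assert (T0 : 0 <= T) by (unfold T; apply Rmult_le_pos; lra).
    apply Rle_trans with (1 * / 2 ^ n * (C * 16 * (3 * (2 * T)))).
    + apply Rmult_le_compat; [nra|apply Cmod_ge_0|apply Rmult_le_compat_r; lra|].
      eapply Rle_trans; [apply Q|]. apply Rmult_le_compat_l; [lra|]. apply Rmult_le_compat_l; [lra|].
      rewrite Rmult_assoc. fold T. apply Rmult_le_compat_r; lra.
    + apply Req_le. unfold T. ring.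
Qed.

(** Duality between W^{1,1} and C^{-al} with a free frequency cut-off L. *)
Lemma pairing al : 0 < al < 1 -> exists C, 0 < C /\ forall F F1 F2 B G M L, CTC1 F F1 F2 -> supp B G -> bes (- al) G M ->
  Cmod (CTI (fun p => Cmult (F p) (ev B G p))) <=
   C * M * (wt al L * TI (fun p => Cmod (F p)) + wt (al - 1) L * (TI (fun p => Cmod (F1 p)) + TI (fun p => Cmod (F2 p)))).
Proof.
  intros Hal. destruct block_potential as (C & C0 & HW).
  set (q1 := Rpower 2 (- al)). set (q2 := Rpower 2 (al - 1)).
  assert (Hq : forall e, e < 0 -> 0 < Rpower 2 e < 1).
  { intros e He. split; [apply exp_pos|]. rewrite <- (Rpower_O 2) by lra. apply Rpower_lt; lra. }
  assert (Hq1 : 0 < q1 < 1) by (apply Hq; lra). assert (Hq2 : 0 < q2 < 1) by (apply Hq; lra).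
  exists ((2 + 2 * C) * (2 / (1 - q1) + 2 / (1 - q2))).
  assert (I1 : 0 < / (1 - q1)) by (apply Rinv_0_lt_compat; lra). assert (I2 : 0 < / (1 - q2)) by (apply Rinv_0_lt_compat; lra).
  split; [unfold Rdiv; nra|]. intros F F1 F2 B G M L HF SG HG.
  pose proof (bes_nonneg _ _ _ _ _ HG) as M0.
  pose proof (CTC1_cont _ _ _ HF) as (cF & cF1 & cF2).
  set (f := TI (fun p => Cmod (F p))). set (f1 := TI (fun p => Cmod (F1 p))). set (f2 := TI (fun p => Cmod (F2 p))).
  assert (f0 : 0 <= f) by (apply TI_ge0; [now apply cont2_Cmod|intros; apply Cmod_ge_0]).
  assert (f10 : 0 <= f1) by (apply TI_ge0; [now apply cont2_Cmod|intros; apply Cmod_ge_0]).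
  assert (f20 : 0 <= f2) by (apply TI_ge0; [now apply cont2_Cmod|intros; apply Cmod_ge_0]).
  destruct (sN_box _ _ HD B) as [J HJ]. set (l := seq 0 (Datatypes.S J)).
  assert (DEC : forall k, G k = Csum l (fun i => mul (b i) G k)).
  { intros k. unfold mul. rewrite Csum_scal_r, <- RtoC_Rsum. unfold l. rewrite <- sN_Rsum.
    destruct (classic (inbox B k)) as [Hk|Hk]; [rewrite (HJ J (le_n _) k Hk); ring|rewrite SG by auto; ring]. }
  assert (sup : forall (H : R * R -> Complex.C) g s, ccont2 H -> ccont2 g -> (forall p, Cmod (g p) <= s) ->
     Cmod (CTI (fun p => Cmult (H p) (g p))) <= 2 * (s * TI (fun p => Cmod (H p)))).
  { intros H g s cH cg Hs. eapply Rle_trans; [apply CTI_Cmod; now apply ccont2_mult|]. apply Rmult_le_compat_l; [lra|].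
    rewrite <- TI_scal by now apply cont2_Cmod. apply TI_le.
    - apply cont2_Cmod. now apply ccont2_mult.
    - apply (cont2_mult (fun _ => s)); [apply cont2_const|now apply cont2_Cmod].
    - intros p. rewrite Cmod_mult, Rmult_comm. apply Rmult_le_compat_r; [apply Cmod_ge_0|auto]. }
  set (U := wt al L * f). set (V := wt (al - 1) L * (f1 + f2)).
  assert (U0 : 0 <= U) by (unfold U; apply Rmult_le_pos; auto; apply Rlt_le, wt_pos).
  assert (V0 : 0 <= V) by (unfold V; apply Rmult_le_pos; [apply Rlt_le, wt_pos|lra]).
  assert (TERM : forall n, Cmod (CTI (fun p => Cmult (F p) (ev B (mul (b n) G) p))) <=
     (2 + 2 * C) * M * U * q1 ^ ((n - L) + (L - n)) + (2 + 2 * C) * M * V * q2 ^ ((n - L) + (L - n))).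
  { intros n. pose proof (pow_lt q1 ((n - L) + (L - n)) ltac:(lra)) as qp1. pose proof (pow_lt q2 ((n - L) + (L - n)) ltac:(lra)) as qp2.
    assert (geo : forall e a, Rpower 2 e ^ a = Rpower 2 (INR a * e)) by (intros; rewrite <- Rpower_pow by apply exp_pos; rewrite Rpower_mult; f_equal; ring).
    assert (CM : 0 <= C * M) by nra.
    (* Blocks n <= L are paired through their sup norm, blocks n > L through their potentials after
       integrating by parts onto F. Both families decay geometrically away from L. *)
    destruct (le_lt_dec n L) as [Hn|Hn].
    - apply Rle_trans with (2 * (M * wt al n * f)).
      + apply sup; auto using ccont2_ev. intros p.
        rewrite (ev_supp B (3 * 2 ^ n)) by (apply supp_mul_l, (blk_out _ _ HD) || now apply supp_mul).
        rewrite <- LPblock_ev. rewrite bes_iff in HG. specialize (HG n p). now rewrite Ropp_involutive in HG.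
      + replace ((n - L) + (L - n))%nat with (L - n)%nat in * by lia.
        assert (E : wt al n = wt al L * q1 ^ (L - n)).
        { unfold q1, wt. rewrite geo, <- Rpower_plus, minus_INR by auto. f_equal. ring. }
        rewrite E. replace (M * (wt al L * q1 ^ (L - n)) * f) with (M * U * q1 ^ (L - n)) by (unfold U; ring).
        assert (0 <= C * M * U * q1 ^ (L - n)) by (apply Rmult_le_pos; [nra|lra]).
        assert (0 <= (2 + 2 * C) * M * V * q2 ^ (L - n)) by (rpos). lra.
    - destruct (HW al B G M n Hal SG HG ltac:(lia)) as (W & SW & EW & BW).
      rewrite (CTI_ext _ (fun p => Cplus (Cmult (F p) (ev B (Dk true (W true)) p)) (Cmult (F p) (ev B (Dk false (W false)) p)))).
      2: { intros p. rewrite (ev_ext B _ _ p (fun k _ => EW k)), ev_plus. ring. }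
      rewrite CTI_plus by (apply ccont2_mult; auto; apply ccont2_ev).
      pose proof (CTI_parts true _ _ _ _ _ _ HF (CTC1_ev B (W true))) as P1. pose proof (CTI_parts false _ _ _ _ _ _ HF (CTC1_ev B (W false))) as P2.
      cbn [pd] in P1, P2. rewrite P1, P2. eapply Rle_trans; [apply Cmod_triangle|]. rewrite !Cmod_opp.
      pose proof (sup F1 (ev B (W true)) (C * M * wt (al - 1) n) cF1 (ccont2_ev _ _) (BW true)) as Q1.
      pose proof (sup F2 (ev B (W false)) (C * M * wt (al - 1) n) cF2 (ccont2_ev _ _) (BW false)) as Q2. fold f1 in Q1. fold f2 in Q2.
      replace ((n - L) + (L - n))%nat with (n - L)%nat in * by lia.
      assert (E : wt (al - 1) n = wt (al - 1) L * q2 ^ (n - L)).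
      { unfold q2, wt. rewrite geo, <- Rpower_plus, minus_INR by lia. f_equal. ring. }
      assert (E2 : C * M * wt (al - 1) n * f1 + C * M * wt (al - 1) n * f2 = C * M * V * q2 ^ (n - L)) by (rewrite E; unfold V; ring).
      assert (0 <= M * V * q2 ^ (n - L)) by (apply Rmult_le_pos; [nra|lra]).
      assert (0 <= (2 + 2 * C) * M * U * q1 ^ (n - L)) by (rpos). lra. }
  rewrite (CTI_ext _ (fun p => Csum l (fun n => Cmult (F p) (ev B (mul (b n) G) p)))).
  2: { intros p. rewrite Csum_scal. f_equal. rewrite (ev_ext B _ _ p (fun k _ => DEC k)). now rewrite ev_Csum. }
  rewrite (CTI_Csum l (fun n p => Cmult (F p) (ev B (mul (b n) G) p))) by (intros; apply ccont2_mult; auto; apply ccont2_ev).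
  eapply Rle_trans; [apply Cmod_Csum|]. eapply Rle_trans; [apply Rsum_le; intros n _; apply TERM|].
  rewrite Rsum_plus, !Rsum_scal.
  pose proof (geom_sum_near q1 L (Datatypes.S J) Hq1) as G1. pose proof (geom_sum_near q2 L (Datatypes.S J) Hq2) as G2.
  change (seq 0 (Datatypes.S J)) with l in G1, G2.
  assert (X1 : 0 <= (2 + 2 * C) * M * U) by (rpos).
  assert (X2 : 0 <= (2 + 2 * C) * M * V) by (rpos).
  apply Rle_trans with ((2 + 2 * C) * M * U * (2 / (1 - q1)) + (2 + 2 * C) * M * V * (2 / (1 - q2))).
  - apply Rplus_le_compat; apply Rmult_le_compat_l; auto.
  - change (wt al L * f) with U. change (wt (al - 1) L * (f1 + f2)) with V. unfold Rdiv.
    assert (0 <= (2 + 2 * C) * M * U * / (1 - q2)) by (apply Rmult_le_pos; lra).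
    assert (0 <= (2 + 2 * C) * M * V * / (1 - q1)) by (apply Rmult_le_pos; lra). lra.
Qed.

Variables (m : nat) (q : R).
Hypothesis Hm : (1 <= m)%nat.
Hypothesis Hq : INR m + 1/2 < q.
Notation r := (q + INR m).

(** The cut-off of [pairing] is taken at 2^L of order K^4. The high part gets a factor K^{-4(1-al)}
    <= K^{-2}, which cancels the K^2 of [TI_grad]. The low part costs K^(4 al) <= K^(1/(4r)), half
    of the gain K^{-1/(2r)} of [TI_low], so the exponent 1 - 1/(4r) remains. *)
Lemma pair_K al : 0 < al <= / (16 * r) -> exists C, 0 < C /\ forall v V1 V2 F e c B G M, CTC1 v V1 V2 ->
  PB v V1 V2 e c F -> e <= r - 1/2 -> supp B G -> bes (- al) G M ->
  Cmod (CTI (fun p => Cmult (F p) (ev B G p))) <= C * M * c * Rpower (KK v V1 V2 q m) (1 - / (4 * r)).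
Proof.
  intros Hal. assert (m1 : 1 <= INR m) by (now apply (le_INR 1)).
  assert (ir : 0 < / (16 * r) <= 1/16).
  { split; [apply Rinv_0_lt_compat; lra|]. replace (1/16) with (/ 16) by field. apply Rinv_le_contravar; lra. }
  destruct (pairing al ltac:(lra)) as (C & C0 & HP).
  exists (C * (4 + 2 * (1 + q + INR m) ^ 2)). split; [pose proof (pow2_ge_0 (1 + q + INR m)); nra|].
  intros v V1 V2 F e c B G M Hv (F1 & F2 & HF & HB) He SG HG.
  pose proof (bes_nonneg _ _ _ _ _ HG) as M0.
  set (K := KK v V1 V2 q m). assert (K1 : 1 <= K) by (eapply KK_ge1; eauto).
  assert (c0 : 0 <= c).
  { destruct (HB (0, 0)) as [h _]. pose proof (Cmod_ge_0 (F (0, 0))). pose proof (hp_pos v e (0, 0)). nra. }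
  pose proof (CTC1_cont _ _ _ HF) as (cF & cF1 & cF2).
  assert (K4 : 1 <= K ^ 4) by now apply pow_R1_Rle.
  destruct (pow2_between (K ^ 4) K4) as [j Hj].
  (* Block number j + 1 has weight (2^j)^a, whence the shift in the cut-off index. *)
  specialize (HP F F1 F2 B G M (Datatypes.S j) HF SG HG).
  assert (T0 : TI (fun p => Cmod (F p)) <= c * (2 * Rpower K (1 - / (2 * r)))).
  { apply Rle_trans with (TI (fun p => c * hp v e p)).
    - apply TI_le; [now apply cont2_Cmod|apply (cont2_mult (fun _ => c)); [apply cont2_const|eapply cont2_hp; eauto]|]. intros p. apply HB.
    - rewrite TI_scal by (eapply cont2_hp; eauto). apply Rmult_le_compat_l; auto. apply (TI_low v V1 V2 Hv q m Hq Hm e). exact He. }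
  assert (T1 : forall jj, TI (fun p => Cmod (pd jj F1 F2 p)) <= c * ((1 + q + INR m) ^ 2 * K ^ 2)).
  { intros jj. apply Rle_trans with (TI (fun p => c * (hp v (e - 1/2) p * dvn V1 V2 jj p))).
    - apply TI_le.
      + apply cont2_Cmod. destruct jj; auto.
      + apply (cont2_mult (fun _ => c)); [apply cont2_const|apply cont2_mult; [eapply cont2_hp; eauto|eapply cont2_dvn; eauto]].
      + intros p. rewrite <- Rmult_assoc. apply HB.
    - rewrite TI_scal by (apply cont2_mult; [eapply cont2_hp; eauto|eapply cont2_dvn; eauto]). apply Rmult_le_compat_l; auto.
      apply (TI_grad v V1 V2 Hv q m Hq Hm e jj). exact He. }
  pose proof (T1 true) as Tt. pose proof (T1 false) as Tf. cbn [pd] in Tt, Tf.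
  assert (RK : forall x y, x <= y -> Rpower K x <= Rpower K y) by (intros; apply Rle_Rpower; lra).
  assert (wtS : forall a, wt a (Datatypes.S j) = Rpower (2 ^ j) a).
  { intros a. unfold wt. rewrite S_INR. replace ((INR j + 1 - 1) * a) with (INR j * a) by ring. rewrite <- Rpower_mult, Rpower_pow by lra. reflexivity. }
  assert (K4R : K ^ 4 = Rpower K 4) by (rewrite <- (Rpower_pow 4) by lra; f_equal; simpl; ring).
  assert (wA : wt al (Datatypes.S j) <= 2 * Rpower K (4 * al)).
  { rewrite wtS. apply Rle_trans with (Rpower (2 * K ^ 4) al); [apply Rle_Rpower_l; [lra|]; split; [apply pow_lt|]; lra|].
    rewrite <- Rpower_mult_distr, K4R, Rpower_mult by lra. apply Rmult_le_compat_r; [apply Rlt_le, exp_pos|].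
    rewrite <- (Rpower_1 2) at 2 by lra. apply Rpower2_le. lra. }
  assert (wB : wt (al - 1) (Datatypes.S j) <= Rpower K (- (2))).
  { rewrite wtS. apply Rle_trans with (Rpower (K ^ 4) (al - 1)).
    - replace (al - 1) with (- (1 - al)) by ring. rewrite !Rpower_Ropp. apply Rinv_le_contravar; [apply exp_pos|]. apply Rle_Rpower_l; lra.
    - rewrite K4R, Rpower_mult. apply RK. lra. }
  set (E := Rpower K (1 - / (4 * r))).
  assert (E1 : Rpower K (4 * al) * Rpower K (1 - / (2 * r)) <= E).
  { rewrite <- Rpower_plus. apply RK. replace (/ (16 * r)) with (/ 16 * / r) in Hal by (field; lra).
    replace (/ (2 * r)) with (/ 2 * / r) by (field; lra). replace (/ (4 * r)) with (/ 4 * / r) by (field; lra). lra. }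
  assert (E2 : Rpower K (- (2)) * K ^ 2 = 1).
  { rewrite <- (Rpower_pow 2) by lra. rewrite <- Rpower_plus. simpl INR. replace (- (2) + (1 + 1)) with 0 by ring. apply Rpower_O. lra. }
  assert (E3 : 1 <= E).
  { unfold E. apply Rle_trans with (Rpower K 0); [rewrite Rpower_O; lra|]. apply RK.
    assert (H : / (4 * r) <= / 1); [apply Rinv_le_contravar; lra|]. rewrite Rinv_1 in H. lra. }
  set (Q := (1 + q + INR m) ^ 2) in *. assert (Q0 : 0 <= Q) by apply pow2_ge_0.
  eapply Rle_trans; [apply HP|].
  replace (C * (4 + 2 * Q) * M * c * E) with (C * M * ((4 + 2 * Q) * c * E)) by ring.
  apply Rmult_le_compat_l; [nra|].
  assert (A1 : wt al (Datatypes.S j) * TI (fun p => Cmod (F p)) <= (2 * Rpower K (4 * al)) * (c * (2 * Rpower K (1 - / (2 * r))))).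
  { apply Rmult_le_compat; auto; [apply Rlt_le, wt_pos|]. apply TI_ge0; [now apply cont2_Cmod|intros; apply Cmod_ge_0]. }
  assert (A2 : wt (al - 1) (Datatypes.S j) * (TI (fun p => Cmod (F1 p)) + TI (fun p => Cmod (F2 p))) <= Rpower K (- (2)) * (2 * (c * (Q * K ^ 2)))).
  { apply Rmult_le_compat; [apply Rlt_le, wt_pos| |auto|lra].
    apply Rplus_le_le_0_compat; (apply TI_ge0; [now apply cont2_Cmod|intros; apply Cmod_ge_0]). }
  replace (2 * Rpower K (4 * al) * (c * (2 * Rpower K (1 - / (2 * r))))) with (4 * c * (Rpower K (4 * al) * Rpower K (1 - / (2 * r)))) in A1 by ring.
  replace (Rpower K (- (2)) * (2 * (c * (Q * K ^ 2)))) with (2 * Q * c * (Rpower K (- (2)) * K ^ 2)) in A2 by ring. rewrite E2 in A2.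
  assert (4 * c * (Rpower K (4 * al) * Rpower K (1 - / (2 * r))) <= 4 * c * E) by (apply Rmult_le_compat_l; lra).
  assert (2 * Q * c * 1 <= 2 * Q * c * E) by (apply Rmult_le_compat_l; [nra|lra]). lra.
Qed.

End Pairing.

(** Coefficients [f] of finite support represent the function [g]. The box is existentially
    quantified so that supports need not be tracked through sums, products and powers. *)
Definition trig (f : fdist) (g : R * R -> C) : Prop := exists B, supp B f /\ forall x, ev B f x = g x.

Lemma trig_ev B f : supp B f -> trig f (ev B f).
Proof. intros H. exists B. auto. Qed.

Lemma trig_eval B f g x : trig f g -> supp B f -> ev B f x = g x.
Proof. intros (B' & S & H) SB. rewrite <- H. now apply ev_supp. Qed.

Lemma trig_common f g f' g' : trig f g -> trig f' g' ->
  exists B, supp B f /\ supp B f' /\ (forall x, ev B f x = g x) /\ (forall x, ev B f' x = g' x).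
Proof.
  intros H H'. pose proof H as (B & S & _). pose proof H' as (B' & S' & _).
  assert (SB : supp (B + B') f) by (apply supp_le with B; auto; lia).
  assert (SB' : supp (B + B') f') by (apply supp_le with B'; auto; lia).
  exists (B + B')%nat. repeat split; auto; intros; now apply trig_eval.
Qed.

Lemma trig_plus f g f' g' : trig f g -> trig f' g' -> trig (fun k => Cplus (f k) (f' k)) (fun x => Cplus (g x) (g' x)).
Proof.
  intros H H'. destruct (trig_common _ _ _ _ H H') as (B & S & S' & E & E'). exists B. split.
  - intros k Hk. rewrite S, S' by auto. ring.
  - intros x. now rewrite ev_plus, E, E'.
Qed.

Lemma trig_scal c f g : trig f g -> trig (fun k => Cmult c (f k)) (fun x => Cmult c (g x)).
Proof.
  intros (B & S & E). exists B. split; [intros k Hk; rewrite S by auto; ring|]. intros x. now rewrite ev_scal, E.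
Qed.

Lemma trig_conj f g : trig f g -> trig (dconj f) (fun x => Cconj (g x)).
Proof.
  intros (B & S & E). exists B. split; [|intros x; now rewrite ev_dconj, E].
  intros k Hk. unfold dconj. rewrite S; [unfold Cconj, RtoC; simpl; f_equal; ring|].
  intros [h1 h2]. apply Hk. simpl in *. split; lia.
Qed.

Lemma trig_Csum {A} (l : list A) f g : (forall a, In a l -> trig (f a) (g a)) ->
  trig (fun k => Csum l (fun a => f a k)) (fun x => Csum l (fun a => g a x)).
Proof.
  induction l as [|a l IH]; intros H.
  - exists 0%nat. split; [intros k _; reflexivity|]. intros x. unfold ev, Bsum. rewrite Csum_0; [reflexivity|]. intros k _. apply Cmult_0_l.
  - apply (trig_plus (f a) (g a) _ _ (H a (or_introl eq_refl)) (IH (fun a' h => H a' (or_intror h)))).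
Qed.

Lemma trig_done : trig done (fun _ => RtoC 1).
Proof. exists 0%nat. split; [apply supp_done|]. intros; apply ev_done. Qed.

Lemma trig_ext f f' g g' : trig f g -> (forall k, f k = f' k) -> (forall x, g x = g' x) -> trig f' g'.
Proof.
  intros (B & S & E) Ef Eg. exists B. split; [intros k Hk; rewrite <- Ef; auto|].
  intros x. rewrite <- Eg, <- E. apply ev_ext. auto.
Qed.

Lemma binom_gt n : forall k, (n < k)%nat -> binom n k = 0%nat.
Proof. induction n as [|n IH]; intros [|k] H; try lia; simpl; auto. rewrite !IH by lia. reflexivity. Qed.

Lemma binom_diag n : binom n n = 1%nat.
Proof. induction n as [|n IH]; [reflexivity|]. simpl. rewrite IH, binom_gt by lia. reflexivity. Qed.

Ltac cc := cbv beta; match goal with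
  | |- ccont2 (fun p => Cmult (@?f p) (@?g p)) => apply (ccont2_mult f g); cc
  | |- ccont2 (fun p => Cplus (@?f p) (@?g p)) => apply (ccont2_plus f g); cc
  | |- ccont2 (fun p => Csum ?l (@?f p)) => apply (ccont2_Csum l (fun a p => f p a)); intros; cc
  | H : ccont2 ?F |- ccont2 (fun p => ?F p) => exact H
  | H : (forall i j, ccont2 (?F i j)) |- ccont2 (fun p => ?F ?a ?b p) => exact (H a b)
  | |- _ => apply ccont2_const
  end.

Lemma CTI_plus5 F1 F2 F3 F4 F5 : ccont2 F1 -> ccont2 F2 -> ccont2 F3 -> ccont2 F4 -> ccont2 F5 ->
  CTI (fun p => Cplus (F1 p) (Cplus (F2 p) (Cplus (F3 p) (Cplus (F4 p) (F5 p))))) =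
  Cplus (CTI F1) (Cplus (CTI F2) (Cplus (CTI F3) (Cplus (CTI F4) (CTI F5)))).
Proof.
  intros c1 c2 c3 c4 c5. pose proof (ccont2_plus _ _ c4 c5) as c45. pose proof (ccont2_plus _ _ c3 c45) as c345.
  pose proof (ccont2_plus _ _ c2 c345) as c2345.
  rewrite (CTI_plus _ _ c1 c2345), (CTI_plus _ _ c2 c345), (CTI_plus _ _ c3 c45), (CTI_plus _ _ c4 c5). reflexivity.
Qed.

(** Splits the tested equation term by term, for arbitrary ingredients. The damping -v of the linear
    part merges with (b+1) v into b v. *)
Lemma CTI_decomp (l l' : list nat) (c : nat -> nat -> C) (a b : C) H v L Y W (M Z : nat -> nat -> R * R -> C) :
  ccont2 H -> ccont2 v -> ccont2 L -> ccont2 Y -> ccont2 W -> (forall i j, ccont2 (M i j)) -> (forall i j, ccont2 (Z i j)) ->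
  CTI (fun p => Cmult (H p) (Cplus (Cplus (Copp (v p)) (L p))
    (Cplus (Cplus (Cmult a (Csum l (fun i => Csum l' (fun j => Cmult (c i j) (Cmult (M i j p) (Z i j p))))))
       (Cmult (Cplus b (RtoC 1)) (Cplus (v p) (Y p)))) (W p)))) =
  Cplus (CTI (fun p => Cmult (H p) (L p)))
   (Cplus (Cmult a (Csum l (fun i => Csum l' (fun j => Cmult (c i j) (CTI (fun p => Cmult (Cmult (H p) (M i j p)) (Z i j p)))))))
    (Cplus (Cmult b (CTI (fun p => Cmult (H p) (v p))))
     (Cplus (Cmult (Cplus b (RtoC 1)) (CTI (fun p => Cmult (H p) (Y p)))) (CTI (fun p => Cmult (H p) (W p)))))).
Proof.
  intros cH cv cL cY cW cM cZ.
  transitivity (CTI (fun p => Cplus (Cmult (H p) (L p))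
    (Cplus (Cmult a (Csum l (fun i => Csum l' (fun j => Cmult (c i j) (Cmult (Cmult (H p) (M i j p)) (Z i j p))))))
     (Cplus (Cmult b (Cmult (H p) (v p))) (Cplus (Cmult (Cplus b (RtoC 1)) (Cmult (H p) (Y p))) (Cmult (H p) (W p))))))).
  { apply CTI_ext. intros p.
    rewrite (Csum_ext l (fun i => Csum l' (fun j => Cmult (c i j) (Cmult (Cmult (H p) (M i j p)) (Z i j p))))
      (fun i => Cmult (H p) (Csum l' (fun j => Cmult (c i j) (Cmult (M i j p) (Z i j p)))))).
    2: { intros i _. rewrite <- Csum_scal. apply Csum_ext. intros j _. ring. }
    rewrite Csum_scal. ring. }
  rewrite (CTI_plus5 (fun p => Cmult (H p) (L p)) (fun p => Cmult a (Csum l (fun i => Csum l' (fun j => Cmult (c i j) (Cmult (Cmult (H p) (M i j p)) (Z i j p))))))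
    (fun p => Cmult b (Cmult (H p) (v p))) (fun p => Cmult (Cplus b (RtoC 1)) (Cmult (H p) (Y p))) (fun p => Cmult (H p) (W p))) by cc.
  rewrite (CTI_scal a (fun p => Csum l (fun i => Csum l' (fun j => Cmult (c i j) (Cmult (Cmult (H p) (M i j p)) (Z i j p)))))) by cc.
  rewrite (CTI_scal b (fun p => Cmult (H p) (v p))) by cc.
  rewrite (CTI_scal (Cplus b (RtoC 1)) (fun p => Cmult (H p) (Y p))) by cc.
  f_equal. f_equal. f_equal.
  rewrite (CTI_Csum l (fun i p => Csum l' (fun j => Cmult (c i j) (Cmult (Cmult (H p) (M i j p)) (Z i j p))))) by (intros; cc).
  apply Csum_ext. intros i _.
  rewrite (CTI_Csum l' (fun j p => Cmult (c i j) (Cmult (Cmult (H p) (M i j p)) (Z i j p)))) by (intros; cc).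
  apply Csum_ext. intros j _. apply (CTI_scal (c i j) (fun p => Cmult (Cmult (H p) (M i j p)) (Z i j p))). cc.
Qed.

(** * The tested equation at a fixed time *)

Section Energy.
Variables chi rho : R -> R.
Hypothesis HD : dyadic_partition chi rho.
Notation bes := (besov_le chi rho).

Lemma trig_dmul f g f' g' : trig f g -> trig f' g' -> trig (dmul chi rho f f') (fun x => Cmult (g x) (g' x)).
Proof.
  intros H H'. destruct (trig_common _ _ _ _ H H') as (B & S & S' & E & E').
  exists (B + B)%nat. split; [now apply supp_dmul|]. intros x. now rewrite ev_dmul, E, E'.
Qed.

Lemma trig_dpow f g n : trig f g -> trig (dpow chi rho f n) (fun x => Cpow (g x) n).
Proof.
  intros H. induction n as [|n IH]; [apply trig_done|]. simpl.
  eapply trig_ext; [exact (trig_dmul _ _ _ _ IH H)|reflexivity|]. intros x. apply Cmult_comm.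
Qed.

Variables (m : nat) (nu tau : C) (mu q : R).
Hypothesis Hm : (1 <= m)%nat.
Hypothesis Hnu : 0 < Re nu.
Hypothesis Hmu : 0 < mu.
Hypothesis Hq : INR m + 1/2 < q.
Hypothesis Hq2 : (q - 1) ^ 2 < mu ^ 2 * (2 * q - 1).
Notation r := (q + INR m).

Definition mono (v : R * R -> C) (i j : nat) (x : R * R) : C := Cmult (Cpow (v x) i) (Cpow (Cconj (v x)) j).

Lemma trig_PsiG v g z zg : trig v g -> (forall i j, (i <= m + 1)%nat -> (j <= m)%nat -> trig (z i j) (zg i j)) ->
  trig (PsiG chi rho m nu tau z v) (fun x => Cplus (Cmult (Copp nu) (Csum (seq 0 (m + 2)) (fun i => Csum (seq 0 (Datatypes.S m)) (fun j =>
        Cmult (RtoC (INR (binom (m + 1) i) * INR (binom m j))) (Cmult (mono g i j x) (zg (m + 1 - i)%nat (m - j)%nat x))))))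
    (Cmult (Cplus tau (RtoC 1)) (Cplus (g x) (zg 1%nat 0%nat x)))).
Proof.
  intros Hv Hz. unfold PsiG. apply trig_plus.
  - apply trig_scal. apply trig_Csum. intros i _. apply trig_Csum. intros j _. apply trig_scal.
    apply trig_dmul; [|apply Hz; lia]. apply trig_dmul; apply trig_dpow; auto using trig_conj.
  - apply trig_scal. apply trig_plus; auto. apply Hz; lia.
Qed.

(** The derivative of h^q in the direction w is 2 q Re(F0 w); including the conjugate here keeps all
    pairings bilinear. *)
Definition F0 (v : R * R -> C) (p : R * R) : C := Cmult (RtoC (hp v (q - 1) p)) (Cconj (v p)).

Lemma PB_F0 v V1 V2 : CTC1 v V1 V2 -> PB v V1 V2 (q - 1/2) (2 * (1 + 2 * Rabs (q - 1)) * 1) (F0 v).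
Proof.
  intros Hv. replace (q - 1/2) with (q - 1 + 1/2) by lra. apply PB_mult; [now apply PB_hp|]. apply PB_conj. now apply PB_v.
Qed.

Definition cF : R := 2 * (1 + 2 * Rabs (q - 1)) * 1.
Definition cm (i j : nat) : R := 2 * cF * (2 * (2 * 1) ^ i * (2 * 1) ^ j).

(** The exponent is at most q + m - 1/2 exactly when i + j <= 2m, so every term except the top one,
    i = m + 1 and j = m, falls under [pair_K]. *)
Lemma PB_mono v V1 V2 i j : CTC1 v V1 V2 ->
  PB v V1 V2 (q - 1/2 + (INR i * (1/2) + INR j * (1/2))) (cm i j) (fun p => Cmult (F0 v p) (mono v i j p)).
Proof.
  intros Hv. apply PB_mult; [now apply PB_F0|]. apply PB_mult; apply PB_pow; [|apply PB_conj]; now apply PB_v.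
Qed.

Lemma ev_Asym B f x : ev B (fun k => Cmult (Asym mu k) (f k)) x =
  Cplus (Copp (ev B f x)) (Cmult (mu, 1) (Cplus (ev B (Dk true (Dk true f)) x) (ev B (Dk false (Dk false f)) x))).
Proof.
  rewrite <- ev_plus, <- ev_scal. replace (Copp (ev B f x)) with (Cmult (RtoC (-1)) (ev B f x)) by (unfold Cmult, Copp, RtoC; simpl; f_equal; ring).
  rewrite <- ev_scal, <- ev_plus. apply ev_ext. intros k _. unfold Asym, Dk, kc. cbv zeta. rewrite znorm_sq.
  destruct (f k) as [a b]. unfold Cmult, Cplus, RtoC; simpl. f_equal; ring.
Qed.

(** If h >= 2 then h - 1 >= h/2; otherwise h^r is at most 2^r, which is subtracted. *)
Lemma main_lower v p : (/ 2) ^ (m + 1) * hp v r p - Rpower 2 r <= hp v (q - 1) p * (hh v p - 1) ^ (m + 1).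
Proof.
  pose proof (hh_ge1 v p) as h1. pose proof (hp_pos v (q - 1) p) as hq. pose proof (hp_pos v r p) as hr.
  assert (E : hp v r p = hp v (q - 1) p * hh v p ^ (m + 1)).
  { replace r with (q - 1 + INR (m + 1)) by (rewrite plus_INR; simpl; ring). rewrite hp_plus. f_equal.
    unfold hp. apply Rpower_pow. lra. }
  destruct (Rle_dec 2 (hh v p)) as [H|H].
  - assert ((/ 2 * hh v p) ^ (m + 1) <= (hh v p - 1) ^ (m + 1)) by (apply pow_incr; lra).
    rewrite Rpow_mult_distr in H0. pose proof (Rpower_pos 2 r) as e.
    rewrite E. apply Rle_trans with (hp v (q - 1) p * ((/ 2) ^ (m + 1) * hh v p ^ (m + 1))); [lra|]. apply Rmult_le_compat_l; lra.
  - assert (hp v r p <= Rpower 2 r) by (apply Rle_Rpower_l; pose proof (pos_INR m); lra).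
    assert ((/ 2) ^ (m + 1) <= 1) by (rewrite <- (pow1 (m + 1)); apply pow_incr; lra).
    assert (0 <= (hh v p - 1) ^ (m + 1)) by (apply pow_le; lra). nra.
Qed.

(** The top monomial tested against [F0] is h^(q-1) |v|^(2m+2), real and nonnegative; the sign of Re
    nu then gives damping whatever the imaginary part of nu. *)
Lemma main_pointwise v p : Cmult (F0 v p) (mono v (m + 1) m p) = RtoC (hp v (q - 1) p * (hh v p - 1) ^ (m + 1)).
Proof.
  unfold F0, mono. rewrite hh_Cmod. replace (1 + Cmod (v p) ^ 2 - 1) with (Cmod (v p) ^ 2) by ring.
  rewrite RtoC_mult. rewrite <- Cmult_assoc. f_equal. rewrite RtoC_pow, RtoC_pow.
  replace (RtoC (Cmod (v p)) ^ 2)%C with (Cmult (v p) (Cconj (v p))).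
  2: { rewrite <- RtoC_pow. rewrite Cmod2_conj. reflexivity. }
  rewrite Cpow_mult_l, !(Nat.add_1_r m). simpl. ring.
Qed.

Notation cb i j := (INR (binom (m + 1) i) * INR (binom m j)).

(** [CE] depends on the Wick powers through [Mz] only, and neither on f nor on the boxes. [Rm]
    leaves room for the truncation error. [Q] gathers the coefficients of all terms of order
    K^(1-1/(4r)), which [young_eps] absorbs into the dissipation and the top-degree term. *)
Lemma energy_point al Mz : 0 < al <= / (16 * r) -> 0 <= Mz -> exists CE, 0 <= CE /\ forall B f z Rm B' G,
  supp B f -> (forall i j, (i <= m + 1)%nat -> (j <= m)%nat -> supp B (z i j) /\ bes (- al) (z i j) Mz) ->
  z 0%nat 0%nat = done -> supp B' Rm -> bes (- al) Rm 1 -> supp B' G ->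
  (forall k, G k = Cplus (Cmult (Asym mu k) (f k)) (Cplus (PsiG chi rho m nu tau z f k) (Rm k))) ->
  Re (CTI (fun p => Cmult (F0 (ev B f) p) (ev B' G p))) <= CE.
Proof.
  intros Hal HMz. assert (m1 : 1 <= INR m) by (now apply (le_INR 1)).
  destruct (pair_K _ _ HD m q Hm Hq al Hal) as (Cp & Cp0 & HP).
  destruct (coercive mu q Hmu ltac:(lra) Hq2) as (dl & dl0 & HC).
  assert (cF0 : 0 <= cF) by (unfold cF; pose proof (Rabs_pos (q - 1)); lra).
  assert (cm0 : forall i j, 0 <= cm i j).
  { intros i j. unfold cm. rpos. }
  set (D := fun i j => cb i j * (Cp * Mz * cm i j)).
  set (S1 := Rsum (seq 0 (m + 1)) (fun i => Rsum (seq 0 (Datatypes.S m)) (D i)) + Rsum (seq 0 m) (D (m + 1)%nat)).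
  set (Q := Cmod nu * S1 + Cmod tau * (Cp * wt (- al) 0 * cm 1 0) + Cmod (Cplus tau (RtoC 1)) * (Cp * Mz * cm 0 0) + Cp * 1 * cm 0 0).
  assert (cb0 : forall i j, 0 <= cb i j) by (intros; apply Rmult_le_pos; apply pos_INR).
  assert (D0 : forall i j, 0 <= D i j) by (intros i j; unfold D; pose proof (cm0 i j); apply Rmult_le_pos; [auto|]; rpos).
  assert (S10 : 0 <= S1) by (unfold S1; apply Rplus_le_le_0_compat; repeat (apply Rsum_ge0; intros); auto).
  assert (Q0 : 0 <= Q).
  { unfold Q. pose proof (Cmod_ge_0 nu). pose proof (Cmod_ge_0 tau). pose proof (Cmod_ge_0 (Cplus tau (RtoC 1))).
    pose proof (wt_pos (- al) 0).
    repeat apply Rplus_le_le_0_compat; rpos. }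
  set (th := Re nu * (/ 2) ^ (m + 1)). assert (th0 : 0 < th) by (apply Rmult_lt_0_compat; auto; apply pow_lt; lra).
  set (c1 := Rmin dl th). assert (c10 : 0 < c1) by (apply Rmin_glb_lt; auto).
  assert (ir : 0 < / (4 * r) < 1).
  { split; [apply Rinv_0_lt_compat; lra|]. rewrite <- Rinv_1. apply Rinv_lt_contravar; lra. }
  destruct (young_eps (/ (4 * r)) Q c1 ir Q0 c10) as (DY & DY0 & HY).
  pose proof (Rpower_pos 2 r) as e2.
  (* The three contributions are the summand 1 of [KK], the remainder of [young_eps] and the loss in
     [main_lower]. *)
  exists (c1 + DY + Re nu * Rpower 2 r). split; [nra|]. intros B f z Rm B' G Sf Hz z0 SR HR SG EG.
  set (v := ev B f). set (V1 := ev B (Dk true f)). set (V2 := ev B (Dk false f)).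
  assert (Hv : CTC1 v V1 V2) by apply CTC1_ev.
  set (K := KK v V1 V2 q m). assert (K1 : 1 <= K) by (eapply KK_ge1; eauto). set (E := Rpower K (1 - / (4 * r))).
  set (H := F0 v).
  assert (cv : ccont2 v) by apply ccont2_ev.
  assert (cH : ccont2 H) by (apply ccont2_mult; [apply ccont2_RtoC; eapply cont2_hp; eauto|now apply ccont2_conj]).
  assert (cmn : forall i j, ccont2 (mono v i j)) by (intros; apply ccont2_mult; apply ccont2_pow; auto using ccont2_conj).
  assert (cz : forall i j, ccont2 (ev B (z i j))) by (intros; apply ccont2_ev).
  assert (TG : trig G (fun x => Cplus (Cplus (Copp (v x)) (Cmult (mu, 1) (Cplus (ev B (Dk true (Dk true f)) x) (ev B (Dk false (Dk false f)) x))))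
     (Cplus (Cplus (Cmult (Copp nu) (Csum (seq 0 (m + 2)) (fun i => Csum (seq 0 (Datatypes.S m)) (fun j =>
        Cmult (RtoC (cb i j)) (Cmult (mono v i j x) (ev B (z (m + 1 - i)%nat (m - j)%nat) x))))))
    (Cmult (Cplus tau (RtoC 1)) (Cplus (v x) (ev B (z 1%nat 0%nat) x)))) (ev B' Rm x)))).
  { eapply (trig_ext (fun k => Cplus (Cmult (Asym mu k) (f k)) (Cplus (PsiG chi rho m nu tau z f k) (Rm k))) G); [|intros k; symmetry; apply EG|intros y; reflexivity].
    apply trig_plus; [|apply trig_plus; [|now apply trig_ev]].
    - exists B. split; [|intros; apply ev_Asym]. intros k Hk. rewrite Sf by auto. apply Cmult_0_r.
    - apply (trig_PsiG f v z (fun i j => ev B (z i j))); [now apply trig_ev|]. intros i j Hi Hj. apply trig_ev. now apply Hz. }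
  pose proof (fun x => trig_eval B' _ _ x TG SG) as EVG. cbv beta in EVG.
  set (T := fun i j => CTI (fun p => Cmult (Cmult (H p) (mono v i j p)) (ev B (z (m + 1 - i)%nat (m - j)%nat) p))).
  assert (TB : forall i j, (i <= m + 1)%nat -> (j <= m)%nat -> (i + j <= 2 * m)%nat -> Cmod (Cmult (RtoC (cb i j)) (T i j)) <= D i j * E).
  { intros i j Hi Hj Hij. rewrite Cmod_mult, Cmod_R, Rabs_pos_eq by auto. replace (D i j * E) with (cb i j * (Cp * Mz * cm i j * E)) by (unfold D; ring). apply Rmult_le_compat_l; auto.
    destruct (Hz (m + 1 - i)%nat (m - j)%nat ltac:(lia) ltac:(lia)) as [Sz Bz].
    refine (HP v V1 V2 _ _ (cm i j) B _ Mz Hv (PB_mono v V1 V2 i j Hv) _ Sz Bz).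
    apply le_INR in Hij. rewrite plus_INR, mult_INR in Hij. change (INR 2) with 2 in Hij. lra. }
  set (X := CTI (fun p => Cmult (Cmult (H p) (mono v 1 0 p)) (ev B done p))).
  set (Y := CTI (fun p => Cmult (Cmult (H p) (mono v 0 0 p)) (ev B (z 1%nat 0%nat) p))).
  set (W := CTI (fun p => Cmult (Cmult (H p) (mono v 0 0 p)) (ev B' Rm p))).
  assert (XB : Cmod X <= Cp * wt (- al) 0 * cm 1 0 * E).
  { refine (HP v V1 V2 _ _ (cm 1 0) B _ _ Hv (PB_mono v V1 V2 1 0 Hv) _ (supp_done B) (bes_done _ _ HD _)). simpl INR. lra. }
  assert (YB : Cmod Y <= Cp * Mz * cm 0 0 * E).
  { destruct (Hz 1%nat 0%nat ltac:(lia) ltac:(lia)) as [Sz Bz].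
    refine (HP v V1 V2 _ _ (cm 0 0) B _ _ Hv (PB_mono v V1 V2 0 0 Hv) _ Sz Bz). simpl INR. lra. }
  assert (WB : Cmod W <= Cp * 1 * cm 0 0 * E).
  { refine (HP v V1 V2 _ _ (cm 0 0) B' _ _ Hv (PB_mono v V1 V2 0 0 Hv) _ SR HR). simpl INR. lra. }
  set (L := CTI (fun p => Cmult (H p) (Cmult (mu, 1) (Cplus (ev B (Dk true (Dk true f)) p) (ev B (Dk false (Dk false f)) p))))).
  assert (LB : Re L <= - dl * Dis v V1 V2 q).
  { unfold L. rewrite Re_CTI. eapply Rle_trans; [|apply (HC v V1 V2 _ _ _ _ Hv (CTC1_ev B (Dk true f)) (CTC1_ev B (Dk false f)))].
    apply Req_le, TI_ext. intros p. unfold H, F0. rewrite <- Cmult_assoc. unfold Re, Cmult, RtoC; simpl. ring. }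
  assert (TOT : CTI (fun p => Cmult (H p) (ev B' G p)) =
     Cplus L (Cplus (Cmult (Copp nu) (Csum (seq 0 (m + 2)) (fun i => Csum (seq 0 (Datatypes.S m)) (fun j => Cmult (RtoC (cb i j)) (T i j)))))
       (Cplus (Cmult tau X) (Cplus (Cmult (Cplus tau (RtoC 1)) Y) W)))).
  { rewrite (CTI_ext _ _ (fun p => f_equal (Cmult (H p)) (EVG p))). unfold T, X, Y, W, L.
    rewrite (CTI_ext (fun p => Cmult (Cmult (H p) (mono v 1 0 p)) _) (fun p => Cmult (H p) (v p))) by (intros p; rewrite ev_done; unfold mono; simpl; ring).
    rewrite (CTI_ext (fun p => Cmult (Cmult (H p) (mono v 0 0 p)) (ev B _ p)) (fun p => Cmult (H p) (ev B (z 1%nat 0%nat) p))) by (intros p; unfold mono; simpl; ring).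
    rewrite (CTI_ext (fun p => Cmult (Cmult (H p) (mono v 0 0 p)) (ev B' _ p)) (fun p => Cmult (H p) (ev B' Rm p))) by (intros p; unfold mono; simpl; ring).
    refine (CTI_decomp _ _ (fun i j => RtoC (cb i j)) (Copp nu) tau H v (fun p => Cmult (mu, 1) (Cplus (ev B (Dk true (Dk true f)) p) (ev B (Dk false (Dk false f)) p)))
      (ev B (z 1%nat 0%nat)) (ev B' Rm) (mono v) (fun i j => ev B (z (m + 1 - i)%nat (m - j)%nat)) cH cv _ (ccont2_ev _ _) (ccont2_ev _ _) cmn (fun i j => cz _ _)).
    apply ccont2_mult; [apply ccont2_const|apply ccont2_plus; apply ccont2_ev]. }
  change (Re (CTI (fun p => Cmult (H p) (ev B' G p))) <= c1 + DY + Re nu * Rpower 2 r). rewrite TOT.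
  set (Xm := TI (fun p => hp v (q - 1) p * (hh v p - 1) ^ (m + 1))).
  assert (TM : T (m + 1)%nat m = RtoC Xm).
  { unfold T, Xm. rewrite !Nat.sub_diag, z0. rewrite (CTI_ext _ (fun p => RtoC (hp v (q - 1) p * (hh v p - 1) ^ (m + 1)))).
    - unfold CTI, RtoC, Re, Im; cbn [fst snd]. now rewrite TI_const.
    - intros p. rewrite ev_done, Cmult_1_r. apply main_pointwise. }
  assert (XL : (/ 2) ^ (m + 1) * Xn v q m - Rpower 2 r <= Xm).
  { unfold Xn, Xm. rewrite <- TI_scal by (eapply cont2_hp; eauto). rewrite <- (TI_const (Rpower 2 r)).
    rewrite <- TI_minus; [|apply (cont2_mult (fun _ => _)); [apply cont2_const|eapply cont2_hp; eauto]|apply cont2_const].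
    apply TI_le.
    - apply cont2_minus; [|apply cont2_const]. apply (cont2_mult (fun _ => _)); [apply cont2_const|eapply cont2_hp; eauto].
    - apply cont2_mult; [eapply cont2_hp; eauto|]. apply (cont2_pow (fun p => hh v p - 1)). apply cont2_minus; [|apply cont2_const].
      eapply cont2_ext; [intros p; apply hp_1|eapply cont2_hp; eauto].
    - intros p. apply main_lower. }
  set (S2 := Cplus (Csum (seq 0 (m + 1)) (fun i => Csum (seq 0 (Datatypes.S m)) (fun j => Cmult (RtoC (cb i j)) (T i j))))
       (Csum (seq 0 m) (fun j => Cmult (RtoC (cb (m + 1)%nat j)) (T (m + 1)%nat j)))).
  assert (SPLIT : Csum (seq 0 (m + 2)) (fun i => Csum (seq 0 (Datatypes.S m)) (fun j => Cmult (RtoC (cb i j)) (T i j))) = Cplus S2 (RtoC Xm)).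
  { replace (m + 2)%nat with (Datatypes.S (m + 1)) by lia. rewrite (seq_S (m + 1)), Csum_app. unfold S2.
    rewrite <- Cplus_assoc. f_equal. rewrite Csum_cons. simpl (0 + (m + 1))%nat. rewrite (seq_S m), Csum_app. simpl (0 + m)%nat.
    unfold Csum at 2 3; simpl. rewrite TM, !binom_diag. simpl INR. rewrite Rmult_1_l. ring. }
  rewrite SPLIT.
  assert (S2B : Cmod S2 <= S1 * E).
  { unfold S2, S1. rewrite Rmult_plus_distr_r. eapply Rle_trans; [apply Cmod_triangle|]. apply Rplus_le_compat.
    - eapply Rle_trans; [apply Cmod_Csum|]. rewrite Rmult_comm, <- Rsum_scal. apply Rsum_le. intros i Hi. apply in_seq in Hi.
      eapply Rle_trans; [apply Cmod_Csum|]. rewrite <- Rsum_scal. apply Rsum_le. intros j Hj. apply in_seq in Hj. rewrite (Rmult_comm E). apply TB; lia.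
    - eapply Rle_trans; [apply Cmod_Csum|]. rewrite Rmult_comm, <- Rsum_scal. apply Rsum_le. intros j Hj. apply in_seq in Hj.
      rewrite (Rmult_comm E). apply TB; lia. }
  assert (RM : forall a b, Re (Cmult a b) <= Cmod a * Cmod b).
  { intros a b. rewrite <- Cmod_mult. eapply Rle_trans; [apply Rle_abs|]. apply (proj1 (Cmod_comp _)). }
  replace (Cmult (Copp nu) (Cplus S2 (RtoC Xm))) with (Cplus (Cmult (Copp nu) S2) (Copp (Cmult nu (RtoC Xm)))) by ring.
  assert (REP : forall a b, Re (Cplus a b) = Re a + Re b) by reflexivity. rewrite !REP.
  pose proof (RM (Copp nu) S2) as P1. pose proof (RM tau X) as P2. pose proof (RM (Cplus tau (RtoC 1)) Y) as P3.
  assert (P4 : Re W <= Cmod W) by (eapply Rle_trans; [apply Rle_abs|]; apply (proj1 (Cmod_comp _))).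
  rewrite Cmod_opp in P1.
  assert (P5 : Re (Copp (Cmult nu (RtoC Xm))) = - (Re nu * Xm)) by (unfold Re, Copp, Cmult, RtoC; simpl; ring). rewrite P5.
  assert (A1 : Cmod nu * Cmod S2 <= Cmod nu * (S1 * E)) by (apply Rmult_le_compat_l; auto; apply Cmod_ge_0).
  assert (A2 : Cmod tau * Cmod X <= Cmod tau * (Cp * wt (- al) 0 * cm 1 0 * E)) by (apply Rmult_le_compat_l; auto; apply Cmod_ge_0).
  assert (A3 : Cmod (Cplus tau (RtoC 1)) * Cmod Y <= Cmod (Cplus tau (RtoC 1)) * (Cp * Mz * cm 0 0 * E)) by (apply Rmult_le_compat_l; auto; apply Cmod_ge_0).
  assert (QE : Q * E <= c1 * K + DY) by (apply HY; auto).
  assert (QX : Q * E = Cmod nu * (S1 * E) + Cmod tau * (Cp * wt (- al) 0 * cm 1 0 * E) + Cmod (Cplus tau (RtoC 1)) * (Cp * Mz * cm 0 0 * E) + Cp * 1 * cm 0 0 * E) by (unfold Q; ring).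
  assert (DD : 0 <= Dis v V1 V2 q) by (eapply Dis_ge0; eauto). assert (XX : 0 <= Xn v q m) by (eapply Xn_ge0; eauto).
  assert (B1 : c1 * Dis v V1 V2 q <= dl * Dis v V1 V2 q) by (apply Rmult_le_compat_r; auto; apply Rmin_l).
  assert (B2 : c1 * Xn v q m <= th * Xn v q m) by (apply Rmult_le_compat_r; auto; apply Rmin_r).
  assert (B3 : Re nu * ((/ 2) ^ (m + 1) * Xn v q m - Rpower 2 r) <= Re nu * Xm) by (apply Rmult_le_compat_l; lra).
  assert (B4 : th * Xn v q m = Re nu * ((/ 2) ^ (m + 1) * Xn v q m)) by (unfold th; ring).
  assert (KE : c1 * K = c1 + c1 * Dis v V1 V2 q + c1 * Xn v q m) by (unfold K, KK; ring).
  lra.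
Qed.

End Energy.

(** * Energy growth and the a priori bound *)

(** The integral over a period does not depend on the base point, since its derivative g(b) - g(b-1)
    vanishes; the reflection is an affine change of variable. Convolution requires this
    invariance. *)
Lemma RInt_periodic (g : R -> R) a : (forall x, continuous g x) -> (forall x, g (x + 1) = g x) ->
  RInt (fun y => g (a - y)) 0 1 = RInt g 0 1.
Proof.
  intros Hc Hp.
  assert (D : forall x, is_derive (fun b => RInt g 0 b) x (g x)).
  { intros x. apply (is_derive_RInt (V := R_NormedModule) g (fun b => RInt g 0 b) 0 x); [|apply Hc].
    exists (mkposreal 1 Rlt_0_1). intros y _. apply (RInt_correct (V := R_CompleteNormedModule)). now apply ex_RInt_cont. }
  set (Ph := fun b => RInt g 0 b - RInt g 0 (b - 1)).
  assert (DP : forall x : R, is_derive Ph x zero).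
  { intros x. unfold Ph. evar_last.
    - apply (is_derive_minus (V := R_NormedModule) (fun b => RInt g 0 b) (fun b => RInt g 0 (b - 1))); [apply D|].
      apply (is_derive_comp (V := R_NormedModule) (fun b => RInt g 0 b) (fun b => b - 1)); [apply D|]. auto_derive; auto.
    - rewrite <- (Hp (x - 1)). replace (x - 1 + 1) with x by ring. unfold minus, plus, opp, scal, zero; simpl. unfold mult; simpl. match goal with |- ?a = ?b => change (@eq R a b) end. ring. }
  assert (CP : forall x y, x < y -> Ph x = Ph y) by (intros x y H; apply (eq_is_derive (V := R_NormedModule)); auto).
  assert (E : Ph a = Ph 1) by (destruct (Rtotal_order a 1) as [h|[h|h]]; [auto|now subst|symmetry; auto]).
  unfold Ph in E. replace (1 - 1) with 0 in E by ring. rewrite RInt_point in E.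
  transitivity (RInt g (a - 1) a).
  - rewrite <- (opp_RInt_swap g) by now apply ex_RInt_cont.
    transitivity (opp (RInt (fun y => scal (-1) (g (-1 * y + a))) 0 1)).
    + rewrite <- (RInt_opp (fun y => scal (-1) (g (-1 * y + a)))).
      * apply RInt_ext. intros x _. unfold opp, scal; simpl. unfold mult; simpl. replace (-1 * x + a) with (a - x) by ring. match goal with |- ?a = ?b => change (@eq R a b) end. ring.
      * apply (ex_RInt_comp_lin g (-1) a 0 1). now apply ex_RInt_cont.
    + f_equal. rewrite (RInt_comp_lin g) by now apply ex_RInt_cont. f_equal; ring.
  - rewrite <- (RInt_Chasles g (a - 1) 0 a) by now apply ex_RInt_cont.
    rewrite <- (opp_RInt_swap g) by now apply ex_RInt_cont. unfold plus, opp; simpl. unfold zero in E; simpl in E. lra.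
Qed.

Lemma TI_trans F x : cont2 F -> (forall p, F (fst p + 1, snd p) = F p) -> (forall p, F (fst p, snd p + 1) = F p) ->
  TI (fun y => F (fst x - fst y, snd x - snd y)) = TI F.
Proof.
  intros Hc H1 H2. unfold TI. cbn [fst snd].
  rewrite <- (RInt_periodic (fun u => RInt (fun v => F (u, v)) 0 1) (fst x)).
  - apply RInt_ext. intros u _. apply (RInt_periodic (fun v => F (fst x - u, v)) (snd x)).
    + intros v. now apply cont2_slice2.
    + intros v. apply (H2 (fst x - u, v)).
  - apply cont_inner; auto; lra.
  - intros u. apply RInt_ext. intros v _. apply (H1 (u, v)).
Qed.

Lemma ek_per k p : ek k (fst p + 1, snd p) = ek k p /\ ek k (fst p, snd p + 1) = ek k p.
Proof.
  assert (G : forall x n, cos (x + 2 * PI * IZR n) = cos x /\ sin (x + 2 * PI * IZR n) = sin x).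
  { intros x n. destruct (Z_le_gt_dec 0 n) as [h|h].
    - rewrite <- (Z2Nat.id n h), <- INR_IZR_INZ.
      replace (2 * PI * INR (Z.to_nat n)) with (2 * INR (Z.to_nat n) * PI) by ring. split; [apply cos_period|apply sin_period].
    - set (y := x + 2 * PI * IZR n). replace x with (y + 2 * INR (Z.to_nat (- n)) * PI).
      + split; symmetry; [apply cos_period|apply sin_period].
      + unfold y. rewrite INR_IZR_INZ, Z2Nat.id by lia. rewrite opp_IZR. ring. }
  unfold ek. cbn [fst snd]. split.
  - destruct (G (2 * PI * (IZR (fst k) * fst p + IZR (snd k) * snd p)) (fst k)) as [a b].
    rewrite <- a, <- b. f_equal; f_equal; ring.
  - destruct (G (2 * PI * (IZR (fst k) * fst p + IZR (snd k) * snd p)) (snd k)) as [a b].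
    rewrite <- a, <- b. f_equal; f_equal; ring.
Qed.

Lemma ev_per B f p : ev B f (fst p + 1, snd p) = ev B f p /\ ev B f (fst p, snd p + 1) = ev B f p.
Proof. split; apply Csum_ext; intros k _; f_equal; apply ek_per. Qed.

(** Above the level ep one has |z| <= ep^(1-2q) |z|^(2q). With ep free, this takes the place of
    Hölder's inequality in [Lp_block]. *)
Lemma Cmod_trunc q ep z : 1 <= q -> 0 < ep -> Cmod z <= ep + Rpower ep (1 - 2 * q) * Rpower (1 + Cmod z ^ 2) q.
Proof.
  intros Hq He. pose proof (Rpower_pos ep (1 - 2 * q)) as P.
  pose proof (Rpower_pos (1 + Cmod z ^ 2) q) as P2.
  destruct (Rle_dec (Cmod z) ep) as [H|H]; [nra|]. set (a := Cmod z) in *.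
  assert (E : a = Rpower a (1 - 2 * q) * Rpower (a ^ 2) q).
  { rewrite <- (Rpower_pow 2) by lra. rewrite Rpower_mult, <- Rpower_plus. simpl INR.
    replace (1 - 2 * q + (1 + 1) * q) with 1 by ring. rewrite Rpower_1; lra. }
  assert (A : Rpower a (1 - 2 * q) <= Rpower ep (1 - 2 * q)).
  { replace (1 - 2 * q) with (- (2 * q - 1)) by ring. rewrite !Rpower_Ropp. apply Rinv_le_contravar; [apply exp_pos|]. apply Rle_Rpower_l; lra. }
  assert (B : Rpower (a ^ 2) q <= Rpower (1 + a ^ 2) q) by (apply Rle_Rpower_l; [lra|]; split; [apply pow_lt|]; lra).
  assert (a <= Rpower ep (1 - 2 * q) * Rpower (1 + a ^ 2) q); [|lra].
  rewrite E at 1. apply Rmult_le_compat; auto; apply Rlt_le, exp_pos.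
Qed.

(** Tangent inequality for the convex function (1+|z|^2)^q at the point a. It bounds increments of
    the energy by a pairing with [F0] at one of the two times, so that the integral need not be
    differentiated in time. *)
Lemma hp_convex q (a b : C) : 1 <= q -> Rpower (1 + Cmod a ^ 2) q - Rpower (1 + Cmod b ^ 2) q <=
  2 * q * (Rpower (1 + Cmod a ^ 2) (q - 1) * Re (Cmult (Cconj a) (Cminus a b))).
Proof.
  intros Hq. pose proof (pow2_ge_0 (Cmod a)) as a0. pose proof (pow2_ge_0 (Cmod b)) as b0.
  set (x := 1 + Cmod a ^ 2) in *. set (y := 1 + Cmod b ^ 2) in *.
  (* Bernoulli's inequality, from the concavity of the logarithm at the convex combination [c] of
     t^q and 1. *)
  assert (BER : forall t, 0 < t -> 1 + q * (t - 1) <= Rpower t q).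
  { intros t Ht. set (s := Rpower t q). assert (s0 : 0 < s) by apply exp_pos.
    set (c := / q * s + (1 - / q)). assert (iq : 0 < / q <= 1) by (split; [apply Rinv_0_lt_compat; lra|rewrite <- Rinv_1; apply Rinv_le_contravar; lra]).
    assert (c0 : 0 < c) by (unfold c; nra).
    assert (L : forall u, 0 < u -> ln u - ln c <= u / c - 1).
    { intros u Hu. rewrite <- ln_div by lra. pose proof (exp_ineq1_le (ln (u / c))) as e. rewrite exp_ln in e by (now apply Rdiv_lt_0_compat). lra. }
    pose proof (L s s0) as L1. pose proof (L 1 Rlt_0_1) as L2. rewrite ln_1 in L2.
    assert (ln s = q * ln t) by (unfold s, Rpower; apply ln_exp).
    assert (/ q * (s / c - 1) + (1 - / q) * (1 / c - 1) = 0) by (unfold c; field; split; apply Rgt_not_eq; lra).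
    assert (ln t <= ln c).
    { assert (/ q * (ln s - ln c) <= / q * (s / c - 1)) by (apply Rmult_le_compat_l; lra).
      assert ((1 - / q) * (0 - ln c) <= (1 - / q) * (1 / c - 1)) by (apply Rmult_le_compat_l; lra).
      assert (/ q * ln s = ln t) by (rewrite H; field; lra). lra. }
    assert (t <= c). { destruct H1 as [h|h]; [left; now apply ln_lt_inv|right; now apply ln_inv]. }
    assert (q * t <= q * c) by (apply Rmult_le_compat_l; lra). replace (q * c) with (s + (q - 1)) in H3 by (unfold c; field; lra). lra. }
  assert (x1 : 1 <= x) by (unfold x; lra). assert (y1 : 1 <= y) by (unfold y; lra).
  assert (Hr : y - x >= - 2 * Re (Cmult (Cconj a) (Cminus a b))).
  { unfold x, y.
    pose proof (hh_Cmod (fun _ => a) (0, 0)) as Ea. pose proof (hh_Cmod (fun _ => b) (0, 0)) as Eb. unfold hh in Ea, Eb.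
    rewrite <- Ea, <- Eb. unfold Re, Im, Cmult, Cconj, Cminus, Cplus, Copp; simpl.
    pose proof (pow2_ge_0 (fst a - fst b)). pose proof (pow2_ge_0 (snd a - snd b)). nra. }
  assert (P : 0 < Rpower x q) by apply exp_pos.
  assert (T : Rpower y q >= Rpower x q + q * Rpower x (q - 1) * (y - x)).
  { replace (Rpower y q) with (Rpower x q * Rpower (y / x) q) by (rewrite Rpower_mult_distr; [f_equal; field; lra|lra|apply Rdiv_lt_0_compat; lra]).
    pose proof (BER (y / x) ltac:(apply Rdiv_lt_0_compat; lra)) as h.
    replace (Rpower x (q - 1)) with (Rpower x q / x) by (unfold Rminus; rewrite Rpower_plus, Rpower_Ropp, Rpower_1 by lra; reflexivity).
    replace (Rpower x q + q * (Rpower x q / x) * (y - x)) with (Rpower x q * (1 + q * (y / x - 1))) by (field; lra). nra. }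
  assert (P' : 0 < Rpower x (q - 1)) by apply exp_pos. assert (0 < q * Rpower x (q - 1)) by (apply Rmult_lt_0_compat; lra). nra.
Qed.

Lemma dini_growth (f : R -> R) a b M : a <= b ->
  (forall t, a < t <= b -> forall eps, 0 < eps -> exists d, 0 < d /\ forall s, a <= s -> t - d < s < t -> f t - f s <= (M + eps) * (t - s)) ->
  (forall t, a <= t < b -> forall eps, 0 < eps -> exists d, 0 < d /\ forall s, s <= b -> t < s < t + d -> f s - f t <= eps) ->
  f b <= f a + M * (b - a).
Proof.
  intros Hab H1 H2. destruct Hab as [Hab| ->]; [|lra].
  assert (G : forall eps, 0 < eps -> f b - f a <= (M + eps) * (b - a)).
  (* Times are negated because [completeness] provides suprema and the infimum of the good times is
     wanted. *)
  { intros eps He. set (P := fun x => exists s, x = - s /\ a <= s <= b /\ f b - f s <= (M + eps) * (b - s)).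
    destruct (completeness P) as [l [lub lle]].
    - exists (- a). intros x (s & -> & hs & _). lra.
    - exists (- b). exists b. repeat split; lra.
    - set (s0 := - l). assert (s0b : s0 <= b). { assert (- b <= l); [apply lub; exists b; repeat split; lra|unfold s0; lra]. }
      assert (s0a : a <= s0). { assert (l <= - a); [apply lle; intros x (s & -> & hs & _); lra|unfold s0; lra]. }
      assert (INS : f b - f s0 <= (M + eps) * (b - s0)).
      { destruct (Rle_lt_or_eq_dec _ _ s0b) as [hb|hb]; [|rewrite hb; lra].
        apply Rnot_lt_le. intros Hlt. set (gap := f b - f s0 - (M + eps) * (b - s0)). assert (g0 : 0 < gap) by (unfold gap; lra).
        destruct (H2 s0 ltac:(lra) (gap / 4) ltac:(lra)) as (d & d0 & Hd).
        set (d' := Rmin d (gap / (4 * (Rabs (M + eps) + 1)))).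
        assert (aM : 0 < Rabs (M + eps) + 1) by (pose proof (Rabs_pos (M + eps)); lra).
        assert (d'0 : 0 < d') by (apply Rmin_glb_lt; auto; apply Rdiv_lt_0_compat; lra).
        destruct (classic (exists s, s0 <= s < s0 + d' /\ a <= s <= b /\ f b - f s <= (M + eps) * (b - s))) as [(s & hs & hab & Hs)|N].
        - destruct (Req_dec s s0) as [->|hne]; [unfold gap in g0; lra|].
          pose proof (Rmin_l d (gap / (4 * (Rabs (M + eps) + 1)))) as m1. pose proof (Rmin_r d (gap / (4 * (Rabs (M + eps) + 1)))) as m2. fold d' in m1, m2.
          pose proof (Hd s ltac:(lra) ltac:(lra)) as h.
          assert (Rabs (M + eps) * (s - s0) <= gap / 4).
          { apply Rle_trans with ((Rabs (M + eps) + 1) * (gap / (4 * (Rabs (M + eps) + 1)))).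
            - apply Rmult_le_compat; try lra. apply Rabs_pos.
            - apply Req_le. field. lra. }
          pose proof (Rle_abs (- (M + eps))) as ra. rewrite Rabs_Ropp in ra.
          assert ((M + eps) * (b - s) <= (M + eps) * (b - s0) + gap / 4) by nra. unfold gap in *. lra.
        - assert (l <= l - d'); [|lra]. apply lle. intros x (s & -> & hs & Hs).
          destruct (Rlt_le_dec s (s0 + d')) as [h|h]; [|unfold s0 in h; lra]. exfalso. apply N. exists s. split; [|auto].
          split; auto. assert (- s <= l); [apply lub; exists s; auto|unfold s0; lra]. }
      destruct (Rle_lt_or_eq_dec _ _ s0a) as [ha|ha]; [|rewrite ha; auto].
      destruct (H1 s0 ltac:(lra) eps He) as (d & d0 & Hd). set (s := Rmax a (s0 - d / 2)).
      assert (s < s0) by (apply Rmax_lub_lt; lra). assert (a <= s) by apply Rmax_l. assert (s0 - d / 2 <= s) by apply Rmax_r.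
      pose proof (Hd s ltac:(lra) ltac:(lra)) as h.
      assert (- s <= l); [|unfold s0 in *; lra]. apply lub. exists s. repeat split; lra. }
  apply Rnot_lt_le. intros Hlt. set (gap := f b - f a - M * (b - a)). assert (0 < gap) by (unfold gap; lra).
  pose proof (G (gap / (2 * (b - a))) ltac:(apply Rdiv_lt_0_compat; lra)) as h.
  replace ((M + gap / (2 * (b - a))) * (b - a)) with (M * (b - a) + gap / 2) in h by (field; lra). unfold gap in *. lra.
Qed.

Lemma Rle_Cmod z : Re z <= Cmod z.
Proof. eapply Rle_trans; [apply Rle_abs|]. apply (proj1 (Cmod_comp _)). Qed.

Lemma ev_Cmod B f x : Cmod (ev B f x) <= Rsum (box B) (fun k => Cmod (f k)).
Proof.
  eapply Rle_trans; [apply Cmod_Csum|]. apply Req_le, Rsum_ext. intros k _. rewrite Cmod_mult, Cmod_ek. ring.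
Qed.

Lemma cont2_hp_ev B f s : cont2 (hp (ev B f) s).
Proof. eapply cont2_hp. apply CTC1_ev. Qed.

Section LpBlock.
Variables chi rho : R -> R.
Hypothesis HD : dyadic_partition chi rho.
Notation b := (blk chi rho).
Notation bl := (LPblock chi rho).

(* Bernstein's inequality. *)
Lemma Lp_block : exists C, 0 < C /\ forall q n B f E, 1 <= q -> supp B f -> TI (hp (ev B f) q) <= E ->
  forall x, Cmod (bl n f x) <= C * (1 + E) * Rpower 2 (INR n / q).
Proof.
  destruct (blk_kernel _ _ HD) as (C & C1 & HK). exists (2 * (C + 49)). split; [lra|]. intros q n B f E Hq Sf HE x.
  set (N := (3 * 2 ^ n)%nat). set (K := ev N (fun k => RtoC (b n k))).
  assert (Sb : supp N (fun k => RtoC (b n k))) by (intros k Hk; rewrite (blk_out _ _ HD); auto).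
  assert (EQ : forall y, ev B f (fst x - fst y, snd x - snd y) = Bsum B (fun l => Cmult (Cmult (f l) (ek l x)) (ek (kopp l) y))).
  { intros y. apply Csum_ext. intros k _. rewrite ek_minus. ring. }
  assert (cf : ccont2 (fun y => ev B f (fst x - fst y, snd x - snd y))).
  { apply ccont2_ext with (fun y => Bsum B (fun l => Cmult (Cmult (f l) (ek l x)) (ek (kopp l) y))); [intros; now rewrite EQ|].
    apply ccont2_Csum. intros k. apply (ccont2_mult (fun _ => Cmult (f k) (ek k x)) (ek (kopp k))); [apply ccont2_const|apply ccont2_ek]. }
  assert (E0 : bl n f x = CTI (fun y => Cmult (K y) (ev B f (fst x - fst y, snd x - snd y)))).
  { rewrite (CTI_ext _ (fun y => Cmult (K y) (Bsum B (fun l => Cmult (Cmult (f l) (ek l x)) (ek (kopp l) y))))) by (intros; now rewrite EQ).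
    unfold K. rewrite (CTI_double N B _ (fun l => Cmult (f l) (ek l x)) Sb).
    rewrite LPblock_ev. rewrite (ev_supp _ B); [|now apply supp_mul_l; intros; apply (blk_out _ _ HD)|now apply supp_mul].
    apply Csum_ext. intros k _. unfold mul. ring. }
  (* This level balances the two parts of [Cmod_trunc]: ep^(1-2q) times 4^n, the order of the sup of
     the kernel, equals ep ([EP]). *)
  set (ep := Rpower 2 (INR n / q)). assert (ep0 : 0 < ep) by apply exp_pos.
  assert (KS : forall y, Cmod (K y) <= 49 * 4 ^ n).
  { intros y. eapply Rle_trans; [apply ev_Cmod|]. apply Rle_trans with (Rsum (box N) (fun _ => 1)).
    - apply Rsum_le. intros k _. rewrite Cmod_R. pose proof (blk_bounds _ _ HD n k). rewrite Rabs_pos_eq; lra.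
    - rewrite Rsum_const, length_box, mult_INR, plus_INR, mult_INR. unfold N. rewrite mult_INR, INR_pow2, <- pow2_sq. simpl INR.
      pose proof (pow2_ge1 n). nra. }
  set (g := fun y => hp (ev B f) q (fst x - fst y, snd x - snd y)).
  assert (cg : cont2 g).
  { apply cont2_ext with (fun y => Rpower (1 + Cmod (ev B f (fst x - fst y, snd x - snd y)) ^ 2) q).
    - intros y. unfold g, hp. now rewrite hh_Cmod.
    - apply (cont2_comp (fun u => Rpower (1 + u ^ 2) q) (fun y => Cmod (ev B f (fst x - fst y, snd x - snd y)))); [|now apply cont2_Cmod].
      intros p. set (u := Cmod _). apply (continuous_comp (fun u => 1 + u ^ 2) (fun z => Rpower z q)).
      + apply is_derive_cont with (2 * u). auto_derive; auto. ring.
      + pose proof (pow2_ge_0 u). eapply is_derive_cont. apply is_derive_Rpow. lra. }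
  assert (TG : TI g = TI (hp (ev B f) q)).
  { apply (TI_trans (hp (ev B f) q) x); [apply cont2_hp_ev| |]; intros p; unfold hp, hh; destruct (ev_per B f p) as [e1 e2]; now rewrite ?e1, ?e2. }
  rewrite E0. eapply Rle_trans; [apply CTI_Cmod; apply ccont2_mult; auto; apply ccont2_ev|].
  replace (2 * (C + 49) * (1 + E) * ep) with (2 * ((C + 49) * (1 + E) * ep)) by ring. apply Rmult_le_compat_l; [lra|].
  assert (EP : Rpower ep (1 - 2 * q) * 4 ^ n = ep).
  { unfold ep. rewrite <- pow2_sq, <- (Rpower_pow n 2), <- (Rpower_pow 2) by (lra || apply exp_pos). rewrite !Rpower_mult, <- Rpower_plus.
    f_equal. simpl. field. lra. }
  apply Rle_trans with (TI (fun y => ep * Cmod (K y) + 49 * ep * g y)).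
  - apply TI_le.
    + apply cont2_Cmod. apply ccont2_mult; auto; apply ccont2_ev.
    + apply cont2_plus; apply (cont2_mult (fun _ => _)); try apply cont2_const; auto. apply cont2_Cmod, ccont2_ev.
    + intros y. rewrite Cmod_mult. pose proof (Cmod_trunc q ep (ev B f (fst x - fst y, snd x - snd y)) Hq ep0) as T.
      rewrite <- (hh_Cmod (ev B f)) in T. change (Rpower (hh (ev B f) (fst x - fst y, snd x - snd y)) q) with (g y) in T.
      pose proof (Cmod_ge_0 (K y)) as k0. assert (g0 : 0 <= g y) by (apply Rlt_le, hp_pos).
      assert (P : 0 < Rpower ep (1 - 2 * q)) by apply exp_pos. assert (Pg : 0 <= Rpower ep (1 - 2 * q) * g y) by nra.
      apply Rle_trans with (Cmod (K y) * (ep + Rpower ep (1 - 2 * q) * g y)); [now apply Rmult_le_compat_l|].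
      replace (49 * ep * g y) with (49 * 4 ^ n * (Rpower ep (1 - 2 * q) * g y)) by (rewrite <- EP at 2; ring).
      assert (Cmod (K y) * (Rpower ep (1 - 2 * q) * g y) <= 49 * 4 ^ n * (Rpower ep (1 - 2 * q) * g y)) by (now apply Rmult_le_compat_r). lra.
  - rewrite TI_plus, !TI_scal, TG; auto.
    + change (TI (fun y => Cmod (K y))) with (L1 N (fun k => RtoC (b n k))). pose proof (HK n) as h. fold N in h.
      assert (Ep : 0 <= TI (hp (ev B f) q)) by (apply TI_ge0; [apply cont2_hp_ev|intros; apply Rlt_le, hp_pos]).
      assert (ep * L1 N (fun k => RtoC (b n k)) <= ep * C) by (apply Rmult_le_compat_l; lra).
      assert (49 * ep * TI (hp (ev B f) q) <= 49 * ep * E) by (apply Rmult_le_compat_l; lra).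
      assert (0 <= ep * E) by nra. assert (0 <= C * (ep * E)) by nra. lra.
    + apply cont2_Cmod, ccont2_ev.
    + apply (cont2_mult (fun _ => _)); [apply cont2_const|]. apply cont2_Cmod, ccont2_ev.
    + apply (cont2_mult (fun _ => _)); [apply cont2_const|auto].
Qed.

End LpBlock.

Lemma ccont2_F0 q B f : ccont2 (F0 q (ev B f)).
Proof.
  apply ccont2_mult; [apply ccont2_RtoC, cont2_hp_ev|apply ccont2_conj, ccont2_ev].
Qed.

(** Displays the pairing as a finite linear combination of the coefficients, which can be
    differentiated in time term by term. *)
Lemma CTI_ev_modes H B f : ccont2 H ->
  CTI (fun p => Cmult (H p) (ev B f p)) = Csum (box B) (fun k => Cmult (CTI (fun p => Cmult (H p) (ek k p))) (f k)).
Proof.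
  intros cH. rewrite (CTI_ext _ (fun p => Csum (box B) (fun k => Cmult (f k) (Cmult (H p) (ek k p))))).
  2: { intros p. unfold ev, Bsum. rewrite <- Csum_scal. apply Csum_ext. intros k _. ring. }
  rewrite (CTI_Csum (box B) (fun k p => Cmult (f k) (Cmult (H p) (ek k p)))).
  - apply Csum_ext. intros k _. rewrite CTI_scal by (apply ccont2_mult; [auto|apply ccont2_ek]). ring.
  - intros k. apply ccont2_mult; [apply ccont2_const|]. apply ccont2_mult; [auto|apply ccont2_ek].
Qed.

(** By convexity at the later time t, left increments of the energy are bounded by those of the
    linear functional [ell t], whose derivative is the assumed rate. Convexity at the later time s
    together with continuity of the coefficients excludes upward jumps, and [dini_growth]
    concludes. *)
Lemma energy_growth q B (W W' : R -> fdist) a b CE : 1 <= q -> a <= b ->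
  (forall t k, a <= t <= b -> Cder (fun s => W s k) t (W' t k)) ->
  (forall t, a <= t <= b -> Re (CTI (fun p => Cmult (F0 q (ev B (W t)) p) (ev B (W' t) p))) <= CE) ->
  TI (hp (ev B (W b)) q) <= TI (hp (ev B (W a)) q) + 2 * q * CE * (b - a).
Proof.
  intros Hq Hab HW HE.
  set (ell := fun t s => Re (CTI (fun p => Cmult (F0 q (ev B (W t)) p) (ev B (W s) p)))).
  assert (CONV : forall t s, TI (hp (ev B (W t)) q) - TI (hp (ev B (W s)) q) <=
     2 * q * Re (CTI (fun p => Cmult (F0 q (ev B (W t)) p) (Cminus (ev B (W t) p) (ev B (W s) p))))).
  { intros t s. assert (cc1 : ccont2 (fun p => Cmult (F0 q (ev B (W t)) p) (Cminus (ev B (W t) p) (ev B (W s) p)))).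
    { apply ccont2_mult; [apply ccont2_F0|]. apply ccont2_ext with (ev B (fun k => Cminus (W t k) (W s k))); [intros; apply ev_minus|apply ccont2_ev]. }
    rewrite <- TI_minus by apply cont2_hp_ev. rewrite Re_CTI, <- TI_scal by apply cc1. apply TI_le.
    - apply cont2_minus; apply cont2_hp_ev.
    - apply (cont2_mult (fun _ => _)); [apply cont2_const|apply cc1].
    - intros p. unfold hp at 1 2. rewrite !hh_Cmod. eapply Rle_trans; [now apply hp_convex|].
      apply Req_le. f_equal. unfold F0, hp. rewrite hh_Cmod. rewrite <- Cmult_assoc. unfold Re, Cmult, RtoC; simpl. ring. }
  assert (ELL : forall t s, Re (CTI (fun p => Cmult (F0 q (ev B (W t)) p) (Cminus (ev B (W t) p) (ev B (W s) p)))) = ell t t - ell t s).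
  { intros t s. unfold ell. rewrite (CTI_ext _ (fun p => Cmult (F0 q (ev B (W t)) p) (ev B (fun k => Cminus (W t k) (W s k)) p))) by (intros; now rewrite ev_minus).
    rewrite !CTI_ev_modes by apply ccont2_F0.
    rewrite (Csum_ext _ _ (fun k => Cminus (Cmult (CTI (fun p => Cmult (F0 q (ev B (W t)) p) (ek k p))) (W t k)) (Cmult (CTI (fun p => Cmult (F0 q (ev B (W t)) p) (ek k p))) (W s k)))) by (intros; ring).
    rewrite Csum_minus. reflexivity. }
  set (dlt := fun s t => Rsum (box B) (fun k => Cmod (Cminus (W s k) (W t k)))).
  assert (DL : forall t, a <= t <= b -> forall eps, 0 < eps -> exists d, 0 < d /\ forall s, Rabs (s - t) < d -> dlt s t <= eps).
  { intros t Ht. unfold dlt. induction (box B) as [|k l IH]; intros eps He.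
    - exists 1. split; [lra|]. intros s _. unfold Rsum; simpl. lra.
    - destruct (IH (eps / 2) ltac:(lra)) as (d1 & d10 & H1). destruct (Cder_cont _ _ _ (HW t k Ht) (eps / 2) ltac:(lra)) as (d2 & d20 & H2).
      exists (Rmin d1 d2). split; [now apply Rmin_glb_lt|]. intros s Hs. rewrite Rsum_cons.
      rmin d1 d2. specialize (H1 s ltac:(lra)). specialize (H2 s ltac:(lra)). lra. }
  apply dini_growth with (f := fun t => TI (hp (ev B (W t)) q)) (M := 2 * q * CE); auto.
  - intros t Ht eps He.
    assert (DER : is_derive (ell t) t (Re (CTI (fun p => Cmult (F0 q (ev B (W t)) p) (ev B (W' t) p))))).
    { apply is_derive_ext with (fun s => Re (Csum (box B) (fun k => Cmult (CTI (fun p => Cmult (F0 q (ev B (W t)) p) (ek k p))) (W s k)))).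
      - intros s. unfold ell. now rewrite CTI_ev_modes by apply ccont2_F0.
      - rewrite CTI_ev_modes by apply ccont2_F0.
        apply (proj1 (Cder_Csum (box B) (fun k s => Cmult (CTI (fun p => Cmult (F0 q (ev B (W t)) p) (ek k p))) (W s k)) _ t
          (fun k => Cder_scal _ _ _ _ (HW t k (conj (Rlt_le _ _ (proj1 Ht)) (proj2 Ht)))))). }
    pose proof (HE t ltac:(lra)) as HEt. set (l := Re _) in DER, HEt.
    apply is_derive_Reals in DER. destruct (DER (eps / (2 * q)) ltac:(apply Rdiv_lt_0_compat; lra)) as (d & Hd).
    exists d. split; [apply cond_pos|]. intros s Has Hs. eapply Rle_trans; [apply CONV|]. rewrite ELL.
    specialize (Hd (s - t) ltac:(lra) ltac:(rewrite Rabs_left; lra)). replace (t + (s - t)) with s in Hd by ring.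
    apply Rabs_def2 in Hd. assert (X : ell t t - ell t s <= (l + eps / (2 * q)) * (t - s)).
    { assert (E : ell t t - ell t s = (ell t s - ell t t) / (s - t) * (t - s)) by (field; lra). rewrite E. apply Rmult_le_compat_r; lra. }
    assert (Y : (l + eps / (2 * q)) * (t - s) <= (CE + eps / (2 * q)) * (t - s)) by (apply Rmult_le_compat_r; lra).
    apply Rle_trans with (2 * q * ((CE + eps / (2 * q)) * (t - s))); [apply Rmult_le_compat_l; lra|]. apply Req_le. field. lra.
  - intros t Ht eps He.
    set (S0 := Rsum (box B) (fun k => Cmod (W t k)) + 1).
    assert (S01 : 1 <= S0) by (unfold S0; pose proof (Rsum_ge0 (box B) (fun k => Cmod (W t k)) (fun k _ => Cmod_ge_0 _)); lra).
    set (Zb := Rpower (1 + S0 ^ 2) (q - 1) * S0). assert (Z0 : 0 < Zb) by (apply Rmult_lt_0_compat; [apply exp_pos|lra]).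
    destruct (DL t ltac:(lra) (Rmin 1 (eps / (4 * q * Zb)))) as (d & d0 & Hd).
    { apply Rmin_glb_lt; [lra|]. apply Rdiv_lt_0_compat; [lra|]. apply Rmult_lt_0_compat; [lra|exact Z0]. }
    exists d. split; auto. intros s Hsb Hs. specialize (Hd s ltac:(rewrite Rabs_pos_eq; lra)).
    pose proof (Rmin_l 1 (eps / (4 * q * Zb))) as m1. pose proof (Rmin_r 1 (eps / (4 * q * Zb))) as m2.
    assert (SS : forall p, Cmod (ev B (W s) p) <= S0).
    { intros p. eapply Rle_trans; [apply ev_Cmod|]. unfold S0. apply Rle_trans with (Rsum (box B) (fun k => Cmod (W t k)) + dlt s t); [|lra].
      unfold dlt. rewrite <- Rsum_plus. apply Rsum_le. intros k _. replace (W s k) with (Cplus (W t k) (Cminus (W s k) (W t k))) at 1 by ring. apply Cmod_triangle. }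
    eapply Rle_trans; [apply CONV|].
    assert (FS : forall p, Cmod (F0 q (ev B (W s)) p) <= Zb).
    { intros p. unfold F0, Zb. rewrite Cmod_mult, Cmod_R, Cmod_conj, Rabs_pos_eq by apply Rlt_le, hp_pos.
      pose proof (SS p) as h. pose proof (Cmod_ge_0 (ev B (W s) p)) as h0.
      apply Rmult_le_compat; auto; [apply Rlt_le, hp_pos|]. unfold hp. rewrite hh_Cmod.
      apply Rle_Rpower_l; [lra|]. pose proof (pow2_ge_0 (Cmod (ev B (W s) p))). assert (Cmod (ev B (W s) p) ^ 2 <= S0 ^ 2) by (apply pow_incr; lra). lra. }
    assert (cc1 : ccont2 (fun p => Cmult (F0 q (ev B (W s)) p) (Cminus (ev B (W s) p) (ev B (W t) p)))).
    { apply ccont2_mult; [apply ccont2_F0|]. apply ccont2_ext with (ev B (fun k => Cminus (W s k) (W t k))); [intros; apply ev_minus|apply ccont2_ev]. }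
    assert (Q : Re (CTI (fun p => Cmult (F0 q (ev B (W s)) p) (Cminus (ev B (W s) p) (ev B (W t) p)))) <= 2 * (Zb * dlt s t)).
    { eapply Rle_trans; [apply Rle_Cmod|]. eapply Rle_trans; [now apply CTI_Cmod|]. apply Rmult_le_compat_l; [lra|].
      rewrite <- (TI_const (Zb * dlt s t)). apply TI_le; [now apply cont2_Cmod|apply cont2_const|]. intros p. rewrite Cmod_mult.
      apply Rmult_le_compat; auto using Cmod_ge_0. rewrite <- ev_minus. apply ev_Cmod. }
    apply Rle_trans with (2 * q * (2 * (Zb * (eps / (4 * q * Zb))))).
    + apply Rmult_le_compat_l; [lra|]. eapply Rle_trans; [apply Q|]. apply Rmult_le_compat_l; [lra|]. apply Rmult_le_compat_l; lra.
    + apply Req_le. field. lra.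
Qed.

(** * The a priori bound, uniform in the truncation *)

Section Apriori.
Variables chi rho : R -> R.
Hypothesis HD : dyadic_partition chi rho.
Notation b := (blk chi rho).
Notation bl := (LPblock chi rho).
Notation bes := (besov_le chi rho).
Notation SNf := (SN chi rho).

(** C^be embeds into L^inf for be > 0, by geometric summation of the blocks; uniformity in N serves
    to bound the energy at the starting time. *)
Lemma ev_SN_sup be : 0 < be -> exists C, 0 < C /\ forall f A N x, bes be f A -> Cmod (ev (3 * 2 ^ N) (SNf N f) x) <= C * A.
Proof.
  intros Hb. set (qq := Rpower 2 (- be)).
  assert (Hqq : 0 < qq < 1).
  { split; [apply exp_pos|]. rewrite <- (Rpower_O 2) by lra. apply Rpower_lt; lra. }
  assert (iq : 0 < / (1 - qq)) by (apply Rinv_0_lt_compat; lra).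
  assert (P2 : 0 < Rpower 2 be) by apply exp_pos.
  exists (Rpower 2 be * / (1 - qq)). split; [now apply Rmult_lt_0_compat|]. intros f A N x Hf.
  pose proof (bes_nonneg _ _ _ _ _ Hf) as A0. rewrite bes_iff in Hf.
  rewrite (ev_ext _ _ (fun k => Csum (seq 0 (S N)) (fun n => mul (b n) f k))).
  2: { intros k _. unfold SN, mul. rewrite Csum_scal_r, <- RtoC_Rsum. reflexivity. }
  rewrite ev_Csum. eapply Rle_trans; [apply Cmod_Csum|].
  apply Rle_trans with (Rsum (seq 0 (S N)) (fun n => A * Rpower 2 be * qq ^ n)).
  - apply Rsum_le. intros n Hn. apply in_seq in Hn. rewrite <- bl_ev; auto.
    + eapply Rle_trans; [apply Hf|]. apply Req_le. unfold wt, qq. rewrite <- Rpower_pow by apply exp_pos.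
      rewrite Rpower_mult, Rmult_assoc, <- Rpower_plus. f_equal. f_equal. ring.
    + assert (2 ^ n <= 2 ^ N)%nat by (apply Nat.pow_le_mono_r; lia). lia.
  - rewrite Rsum_scal. pose proof (geom_sum qq (S N) Hqq) as G.
    replace (Rpower 2 be * / (1 - qq) * A) with (A * Rpower 2 be * / (1 - qq)) by ring. apply Rmult_le_compat_l; [nra|auto].
Qed.

Lemma SN_done N k : SNf N done k = done k.
Proof.
  unfold SN, mul. destruct (classic (k = (0%Z, 0%Z))) as [->|Hk].
  - rewrite (sN_one _ _ HD); [ring|]. unfold znorm; simpl. rewrite !Rmult_0_l, Rplus_0_l, sqrt_0. pose proof (pow2_ge1 N). lra.
  - rewrite done_k by auto. ring.
Qed.

Variables (m : nat) (nu tau : C) (mu q be al : R).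
Hypothesis Hm : (1 <= m)%nat.
Hypothesis Hnu : 0 < Re nu.
Hypothesis Hmu : 0 < mu.
Hypothesis Hq : INR m + 1/2 < q.
Hypothesis Hq2 : (q - 1) ^ 2 < mu ^ 2 * (2 * q - 1).
Hypothesis Hal : 0 < al <= / (16 * (q + INR m)).
Hypothesis Halb : al < be.
Notation PG := (PsiG chi rho m nu tau).

(** The commutator of S_N with the nonlinearity. Lowering the regularity from be to be2 and from
    -al/2 to -al makes it small as N grows, which is why the Wick powers are bounded in C^{-al/2}
    here. [N0] depends on the bound A of v; the final bound 1 does not. *)
Lemma SN_remainder A Mz : 1 <= A -> 1 <= Mz -> exists N0, forall N z v, (N0 <= N)%nat -> bes be v A ->
  (forall i j, (i <= m + 1)%nat -> (j <= m)%nat -> bes (- (al / 2)) (z i j) Mz) ->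
  bes (- al) (dsub (SNf N (PG z v)) (PG (fun i j => SNf N (z i j)) (SNf N v))) 1.
Proof.
  intros HA HMz. set (be2 := (be + al) / 2).
  destruct (PsiG_bes _ _ HD m nu tau be (al / 2) ltac:(lra)) as (C1 & C10 & H1).
  destruct (PsiG_bes _ _ HD m nu tau be2 al ltac:(unfold be2; lra)) as (C2 & C20 & H2).
  destruct (bes_SN _ _ HD) as (C3 & C31 & H3). destruct (bes_SN_tail _ _ HD) as (C4 & C41 & H4).
  set (w1 := Rpower 2 (be - be2)). set (w2 := Rpower 2 (- (al / 2) - - al)).
  assert (W1 : 1 <= w1) by (unfold w1; rewrite <- (Rpower_O 2) by lra; apply Rpower2_le; unfold be2; lra).
  assert (W2 : 1 <= w2) by (unfold w2; rewrite <- (Rpower_O 2) by lra; apply Rpower2_le; lra).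
  set (A2 := w1 * (C3 * A)). set (M2 := w2 * (C3 * Mz)).
  assert (CA : 1 <= C3 * A) by nra. assert (CM : 1 <= C3 * Mz) by nra.
  assert (HA2 : 1 <= A2) by (unfold A2; nra). assert (HM2 : 1 <= M2) by (unfold M2; nra).
  pose proof (pow_lt A (2 * m + 1) ltac:(lra)) as PA. pose proof (pow_lt A2 (2 * m) ltac:(lra)) as PA2. pose proof (pow_lt A2 (2 * m + 1) ltac:(lra)) as PA3.
  set (K1 := C4 * (C1 * (A ^ (2 * m + 1) * Mz)) + C2 * (A2 ^ (2 * m + 1) * (C4 * Mz))).
  set (K2 := C2 * (A2 ^ (2 * m) * (C4 * A) * M2)).
  assert (K10 : 0 < K1) by (unfold K1; apply Rplus_lt_0_compat; repeat apply Rmult_lt_0_compat; lra).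
  assert (K20 : 0 < K2) by (unfold K2; assert (0 < M2) by lra; repeat apply Rmult_lt_0_compat; lra).
  destruct (wt_to_0 (al / 2) (/ (2 * K1)) ltac:(lra) ltac:(apply Rinv_0_lt_compat; lra)) as [N1 HN1].
  destruct (wt_to_0 (be - be2) (/ (2 * K2)) ltac:(unfold be2; lra) ltac:(apply Rinv_0_lt_compat; lra)) as [N2 HN2].
  exists (Nat.max N1 N2). intros N z v HN Hv Hz.
  specialize (HN1 N ltac:(lia)). specialize (HN2 N ltac:(lia)).
  assert (V2 : bes be2 v A2).
  { eapply bes_le; [|apply (bes_weaken _ _ be be2 v A); [unfold be2; lra|auto]]. fold w1. unfold A2. apply Rmult_le_compat_l; [lra|nra]. }
  assert (V3 : bes be2 (SNf N v) A2) by (apply (bes_weaken _ _ be be2); [unfold be2; lra|apply H3; auto]).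
  assert (V4 : bes be2 (dsub v (SNf N v)) (C4 * wt (- (be - be2)) N * A)).
  { replace be2 with (be - (be - be2)) at 1 by ring. apply (H4 be (be - be2) v A N); [unfold be2; lra|auto]. }
  assert (Z2 : forall i j, (i <= m + 1)%nat -> (j <= m)%nat -> bes (- al) (z i j) M2 /\ bes (- al) (SNf N (z i j)) M2 /\
     bes (- al) (dsub (z i j) (SNf N (z i j))) (C4 * wt (- (al / 2)) N * Mz)).
  { intros i j Hi Hj. split; [|split].
    - eapply bes_le; [|apply (bes_weaken _ _ (- (al / 2)) (- al) _ Mz); [lra|auto]]. fold w2. unfold M2. apply Rmult_le_compat_l; [lra|nra].
    - apply (bes_weaken _ _ (- (al / 2)) (- al)); [lra|apply H3; auto].
    - replace (- al) with (- (al / 2) - al / 2) by field. apply (H4 (- (al / 2)) (al / 2) _ Mz N); [lra|auto]. }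
  destruct (H1 v v z z A Mz (A + A) (Mz + Mz) HA HMz Hv Hv) as [P1 _].
  { apply bes_minus; auto. }
  { intros i j Hi Hj. repeat split; auto. apply bes_minus; auto. }
  pose proof (H4 (- (al / 2)) (al / 2) _ _ N ltac:(lra) P1) as Q1. replace (- (al / 2) - al / 2) with (- al) in Q1 by field.
  destruct (H2 v (SNf N v) z (fun i j => SNf N (z i j)) A2 M2 _ _ HA2 HM2 V2 V3 V4 Z2) as [_ Q2].
  assert (X1 : K1 * wt (- (al / 2)) N <= / 2).
  { apply Rle_trans with (K1 * / (2 * K1)); [apply Rmult_le_compat_l; lra|]. apply Req_le. field. lra. }
  assert (X2 : K2 * wt (- (be - be2)) N <= / 2).
  { apply Rle_trans with (K2 * / (2 * K2)); [apply Rmult_le_compat_l; lra|]. apply Req_le. field. lra. }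
  eapply bes_le; [|eapply bes_ext; [|apply (bes_minus _ _ _ _ _ _ _ Q2 Q1)]].
  - unfold K1 in X1. unfold K2 in X2. lra.
  - intros k. unfold dsub. ring.
Qed.

(** Only the size A0 of v at the starting time a enters the bound. The bound A on the whole interval
    is qualitative: it affects [N0] alone, and N can be taken as large as needed. *)
Lemma apriori : exists CL CS, 0 < CL /\ 0 < CS /\ forall Mz, 1 <= Mz -> exists CE, 0 <= CE /\ forall v z a t A A0,
  a <= t -> (forall s, a <= s <= t -> z s 0%nat 0%nat = done) ->
  (forall s i j, a <= s <= t -> (i <= m + 1)%nat -> (j <= m)%nat -> bes (- (al / 2)) (z s i j) Mz) ->
  (forall s k, a <= s <= t -> Cder (fun s => v s k) s (Cplus (Cmult (Asym mu k) (v s k)) (PG (z s) (v s) k))) ->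
  (forall s, a <= s <= t -> bes be (v s) A) -> bes be (v a) A0 ->
  bes (- / q) (v t) (CL * (1 + Rpower (1 + (CS * A0) ^ 2) q + CE * (t - a))).
Proof.
  assert (q1 : 1 < q) by (pose proof (le_INR 1 m Hm) as h; simpl in h; lra).
  destruct (Lp_block _ _ HD) as (CB & CB0 & HB). destruct (ev_SN_sup be ltac:(lra)) as (CS & CS0 & HS).
  destruct (bes_SN _ _ HD) as (C3 & C31 & H3).
  set (w2 := Rpower 2 (- (al / 2) - - al)). assert (W2 : 0 < w2) by apply exp_pos.
  exists (CB * Rpower 2 (/ q)), CS. split; [apply Rmult_lt_0_compat; [auto|apply exp_pos]|split; auto]. intros Mz HMz.
  destruct (energy_point _ _ HD m nu tau mu q Hm Hnu Hmu Hq Hq2 al (w2 * (C3 * Mz)) Hal) as (CE & CE0 & HE).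
  { repeat apply Rmult_le_pos; lra. }
  exists (2 * q * CE). split; [nra|]. intros v z a t A A0 Hat Hz0 Hz Hode HvA Hva.
  destruct (SN_remainder (Rmax 1 A) Mz (Rmax_l _ _) HMz) as [N0 HN0].
  assert (G : forall N, (N0 <= N)%nat -> TI (hp (ev (3 * 2 ^ N) (SNf N (v t))) q) <= Rpower (1 + (CS * A0) ^ 2) q + 2 * q * CE * (t - a)).
  { intros N HN. set (B := (3 * 2 ^ N)%nat).
    apply Rle_trans with (TI (hp (ev B (SNf N (v a))) q) + 2 * q * CE * (t - a)).
    - apply (energy_growth q B (fun s => SNf N (v s)) (fun s => SNf N (fun k => Cplus (Cmult (Asym mu k) (v s k)) (PG (z s) (v s) k)))); try lra.
      + intros s k Hs. unfold SN, mul. apply Cder_scal. now apply Hode.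
      + intros s Hs. set (zN := fun i j => SNf N (z s i j)). set (Rm := dsub (SNf N (PG (z s) (v s))) (PG zN (SNf N (v s)))).
        destruct (trig_PsiG chi rho HD m nu tau Hm (SNf N (v s)) _ zN (fun i j => ev B (zN i j)) (trig_ev B _ (supp_SN _ _ HD N _))) as (B1 & S1 & _).
        { intros i j _ _. apply trig_ev. apply (supp_SN _ _ HD). }
        set (G := SNf N (fun k => Cplus (Cmult (Asym mu k) (v s k)) (PG (z s) (v s) k))).
        assert (SG : supp (B + B1) G) by (apply supp_le with B; [lia|apply (supp_SN _ _ HD)]).
        assert (E : forall x, ev B G x = ev (B + B1) G x) by (intros; apply ev_supp; auto; apply (supp_SN _ _ HD)).
        rewrite (CTI_ext _ (fun p => Cmult (F0 q (ev B (SNf N (v s))) p) (ev (B + B1) G p))) by (intros; now rewrite E).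
        apply (HE B (SNf N (v s)) zN Rm (B + B1)%nat G).
        * apply (supp_SN _ _ HD).
        * intros i j Hi Hj. split; [apply (supp_SN _ _ HD)|].
          apply (bes_weaken _ _ (- (al / 2)) (- al)); [lra|]. apply H3. now apply Hz.
        * unfold zN. rewrite (Hz0 s Hs). apply functional_extensionality. intros k. apply SN_done.
        * intros k Hk. unfold Rm, dsub. rewrite (supp_le B1 (B + B1) _ ltac:(lia) S1 k Hk).
          rewrite (supp_le B (B + B1) _ ltac:(lia) (supp_SN _ _ HD N (PG (z s) (v s))) k Hk). ring.
        * apply HN0; auto. eapply bes_le; [apply Rmax_r|]. now apply HvA.
        * exact SG.
        * intros k. unfold G, Rm, dsub. generalize (PG zN (SNf N (v s)) k). intros X. unfold SN, mul. ring.
    - apply Rplus_le_compat_r. rewrite <- (TI_const (Rpower (1 + (CS * A0) ^ 2) q)). apply TI_le; [apply cont2_hp_ev|apply cont2_const|].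
      intros p. unfold hp. rewrite hh_Cmod. pose proof (HS (v a) A0 N p Hva) as h. fold B in h.
      pose proof (Cmod_ge_0 (ev B (SNf N (v a)) p)) as h0. pose proof (pow2_ge_0 (Cmod (ev B (SNf N (v a)) p))).
      assert (Cmod (ev B (SNf N (v a)) p) ^ 2 <= (CS * A0) ^ 2) by (apply pow_incr; lra). apply Rle_Rpower_l; lra. }
  (* The truncation is taken late enough to leave block n unchanged. *)
  apply bes_iff. intros n x. set (N := (N0 + (n + 1))%nat).
  rewrite <- (bl_SN_low _ _ HD n N) by (unfold N; lia).
  eapply Rle_trans; [apply (HB q n (3 * 2 ^ N)%nat _ _ ltac:(lra) (supp_SN _ _ HD N _) (G N ltac:(unfold N; lia)))|].
  apply Req_le. rewrite Ropp_involutive. unfold wt.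
  replace (INR n / q) with (/ q + (INR n - 1) * / q) by (unfold Rdiv; ring). rewrite Rpower_plus. ring.
Qed.

End Apriori.

(** * Mild solutions and global existence *)

Definition int_to (f : R -> C) (t : R) (l : C) : Prop :=
  is_RInt_gen (V := C_R_NormedModule) f (at_right 0) (at_point t) l.

Lemma at_right_0 (Q : R -> Prop) : at_right 0 Q <-> exists d, 0 < d /\ forall e, 0 < e < d -> Q e.
Proof.
  split.
  - intros [d H]. exists d. split; [apply cond_pos|]. intros e He. apply H; [|lra].
    unfold ball; simpl; unfold AbsRing_ball; simpl. unfold abs, minus, plus, opp; simpl. apply Rabs_def1; lra.
  - intros (d & d0 & H). exists (mkposreal d d0). intros e He Hpos. apply H. split; auto.
    unfold ball in He; simpl in He; unfold AbsRing_ball in He; simpl in He. unfold abs, minus, plus, opp in He; simpl in He.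
    apply Rabs_def2 in He. lra.
Qed.

(** Unfolds the filter formulation of the improper integral into real integrals over [e,t] with e ->
    0, separately for the two components. *)
Lemma int_to_iff f t l : 0 < t -> int_to f t l <-> forall eps, 0 < eps -> exists d, 0 < d /\ forall e, 0 < e < d ->
  exists y1 y2, is_RInt (fun s => Re (f s)) e t y1 /\ is_RInt (fun s => Im (f s)) e t y2 /\ Rabs (y1 - Re l) < eps /\ Rabs (y2 - Im l) < eps.
Proof.
  intros Ht. split.
  - intros H eps He. specialize (H (fun y => ball (M := C_R_NormedModule) l (mkposreal eps He) y) (locally_ball l (mkposreal eps He))).
    destruct H as [Q Rr HQ HR HP]. apply at_right_0 in HQ. destruct HQ as (d & d0 & Hd). exists d. split; auto. intros e Hee.
    destruct (HP e t (Hd e Hee) HR) as (y & Hy & By). exists (fst y), (snd y). split; [|split].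
    + apply (is_RInt_fct_extend_fst (U := R_NormedModule) (V := R_NormedModule) f e t y Hy).
    + apply (is_RInt_fct_extend_snd (U := R_NormedModule) (V := R_NormedModule) f e t y Hy).
    + destruct By as [b1 b2]. split; [exact b1|exact b2].
  - intros H P [eps HP]. destruct (H eps (cond_pos eps)) as (d & d0 & Hd).
    apply Filter_prod with (Q := fun e => 0 < e < d) (R := fun x => x = t).
    + apply at_right_0. exists d. auto.
    + reflexivity.
    + intros e x He ->. destruct (Hd e He) as (y1 & y2 & H1 & H2 & H3 & H4). exists (y1, y2). split.
      * apply (is_RInt_fct_extend_pair (U := R_NormedModule) (V := R_NormedModule) f e t); auto.
      * apply HP. split; [exact H3|exact H4].
Qed.

Lemma int_to_unique f t l l' : 0 < t -> int_to f t l -> int_to f t l' -> l = l'.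
Proof.
  intros Ht H H'. rewrite int_to_iff in H, H' by auto.
  assert (G : forall eps, 0 < eps -> Rabs (Re l - Re l') < 2 * eps /\ Rabs (Im l - Im l') < 2 * eps).
  { intros eps He. destruct (H eps He) as (d & d0 & Hd). destruct (H' eps He) as (d' & d0' & Hd').
    set (e := Rmin d d' / 2). assert (0 < Rmin d d') by (now apply Rmin_glb_lt). rmin d d'.
    destruct (Hd e ltac:(unfold e; lra)) as (y1 & y2 & I1 & I2 & B1 & B2). destruct (Hd' e ltac:(unfold e; lra)) as (z1 & z2 & J1 & J2 & D1 & D2).
    rewrite <- (is_RInt_unique _ _ _ _ I1), <- (is_RInt_unique _ _ _ _ I2) in *. rewrite <- (is_RInt_unique _ _ _ _ J1), <- (is_RInt_unique _ _ _ _ J2) in *.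
    apply Rabs_def2 in B1, B2, D1, D2. split; apply Rabs_def1; lra. }
  assert (Z : forall x y, (forall eps, 0 < eps -> Rabs (x - y) < 2 * eps) -> x = y).
  { intros x y Hxy. apply Rminus_diag_uniq. apply NNPP. intros Hn. pose proof (Rabs_pos_lt _ Hn) as hp. specialize (Hxy (Rabs (x - y) / 2) ltac:(lra)). lra. }
  destruct l as [l1 l2], l' as [l1' l2']. f_equal; apply Z; intros eps He; now destruct (G eps He).
Qed.

Section Mild.
Variable mu : R.
Hypothesis mu_pos : 0 < mu.
Notation P := (Pmult mu).
Notation ode := (modeODE mu).

Lemma Pmult_near k t eps : 0 < eps -> exists d, 0 < d /\ forall s, Rabs s < d -> Cmod (Cminus (P (t - s) k) (P t k)) <= eps.
Proof.
  intros He. pose proof (Cder_cont _ _ _ (Pmult_der_back mu k t 0) eps He) as (d & d0 & H). exists d. split; auto.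
  intros s Hs. specialize (H s ltac:(now rewrite Rminus_0_r)). cbv beta in H. now rewrite Rminus_0_r in H.
Qed.

(** The function s -> P_{t-s} y_s has the integrand as derivative; the fundamental theorem of
    calculus on [e,t] and the initial condition as e -> 0 give the mild formula. *)
Lemma ode_int_to T psi y u0 t k : ode T psi y -> init y u0 -> (forall s, 0 < s < T -> Ccont (fun s => psi s k) s) -> 0 < t < T ->
  int_to (fun s => Cmult (P (t - s) k) (psi s k)) t (Cminus (y t k) (Cmult (P t k) (u0 k))).
Proof.
  intros Ho Hi Hc Ht. apply int_to_iff; [lra|]. intros eps He.
  set (g := fun s => Cmult (P (t - s) k) (y s k)).
  assert (DG : forall s, 0 < s < T -> Cder g s (Cmult (P (t - s) k) (psi s k))).
  { intros s Hs. eapply Cder_eq; [|apply Cder_mult; [apply Pmult_der_back|apply Ho; auto]]. cbv beta. ring. }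
  set (U := Cmod (u0 k)). assert (U0 : 0 <= U) by apply Cmod_ge_0.
  set (Q := Cmod (P t k)). assert (Q0 : 0 <= Q) by apply Cmod_ge_0.
  set (e1 := Rmin 1 (eps / (2 * (U + 1 + Q + 1)))).
  assert (e10 : 0 < e1) by (apply Rmin_glb_lt; [lra|]; apply Rdiv_lt_0_compat; lra).
  destruct (Hi k e1 e10) as (d1 & d10 & H1). destruct (Pmult_near k t e1 e10) as (d2 & d20 & H2).
  exists (Rmin t (Rmin d1 d2)). split; [repeat apply Rmin_glb_lt; lra|]. intros e Hee.
  rmin t (Rmin d1 d2). rmin d1 d2.
  exists (Re (g t) - Re (g e)), (Im (g t) - Im (g e)).
  assert (CC : forall s, e <= s <= t -> Ccont (fun s => Cmult (P (t - s) k) (psi s k)) s).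
  { intros s Hs. apply Ccont_mult; [eapply Cder_cont; apply Pmult_der_back|apply Hc; lra]. }
  split; [|split].
  - apply (is_RInt_derive (V := R_CompleteNormedModule) (fun s => Re (g s))).
    + intros s Hs. rewrite Rmin_left, Rmax_right in Hs by lra. apply (proj1 (DG s ltac:(lra))).
    + intros s Hs. rewrite Rmin_left, Rmax_right in Hs by lra. apply (proj1 (proj1 (Ccont_comp _ _) (CC s Hs))).
  - apply (is_RInt_derive (V := R_CompleteNormedModule) (fun s => Im (g s))).
    + intros s Hs. rewrite Rmin_left, Rmax_right in Hs by lra. apply (proj2 (DG s ltac:(lra))).
    + intros s Hs. rewrite Rmin_left, Rmax_right in Hs by lra. apply (proj2 (proj1 (Ccont_comp _ _) (CC s Hs))).
  - assert (GT : g t = y t k) by (unfold g; rewrite Rminus_diag, Pmult_0; ring).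
    assert (D : Cmod (Cminus (Cmult (P t k) (u0 k)) (g e)) < eps).
    { unfold g. specialize (H1 e ltac:(lra)). specialize (H2 e ltac:(rewrite Rabs_pos_eq; lra)).
      replace (Cminus (Cmult (P t k) (u0 k)) (Cmult (P (t - e) k) (y e k))) with
        (Copp (Cplus (Cmult (Cminus (P (t - e) k) (P t k)) (Cplus (Cminus (y e k) (u0 k)) (u0 k))) (Cmult (P t k) (Cminus (y e k) (u0 k))))) by ring.
      rewrite Cmod_opp. eapply Rle_lt_trans; [apply Cmod_triangle|]. rewrite !Cmod_mult.
      assert (X1 : Cmod (Cplus (Cminus (y e k) (u0 k)) (u0 k)) <= 1 + U).
      { eapply Rle_trans; [apply Cmod_triangle|]. fold U. pose proof (Rmin_l 1 (eps / (2 * (U + 1 + Q + 1)))) as m0. fold e1 in m0. lra. }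
      fold Q. assert (X2 : Cmod (Cminus (P (t - e) k) (P t k)) * Cmod (Cplus (Cminus (y e k) (u0 k)) (u0 k)) <= e1 * (1 + U)).
      { apply Rmult_le_compat; auto using Cmod_ge_0. }
      assert (X4 : e1 * (2 * (U + 1 + Q + 1)) <= eps).
      { pose proof (Rmin_r 1 (eps / (2 * (U + 1 + Q + 1)))) as m0. fold e1 in m0.
        apply Rle_trans with (eps / (2 * (U + 1 + Q + 1)) * (2 * (U + 1 + Q + 1))); [apply Rmult_le_compat_r; lra|]. apply Req_le. field. lra. }
      nra. }
    rewrite GT. destruct (Cmod_comp (Cminus (Cmult (P t k) (u0 k)) (g e))) as [c1 c2].
    set (a := Cmult (P t k) (u0 k)) in *. split.
    + replace (Re (y t k) - Re (g e) - Re (Cminus (y t k) a)) with (fst (Cminus a (g e))) by (unfold Re, Cminus, Cplus, Copp; simpl; ring). lra.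
    + replace (Im (y t k) - Im (g e) - Im (Cminus (y t k) a)) with (snd (Cminus a (g e))) by (unfold Im, Cminus, Cplus, Copp; simpl; ring). lra.
Qed.

(** By uniqueness of the improper integral a mild solution coincides with P_t u0 plus the Duhamel
    term, and the latter satisfies the modewise equation by [Duh_spec]. *)
Lemma int_to_ode T psi y u0 ka : 0 < T -> ka < 1 -> (forall k s, 0 < s < T -> Ccont (fun s => psi s k) s) ->
  (forall k, exists K, forall s, 0 < s < T -> Cmod (psi s k) <= K * Rpower s (- ka)) ->
  (forall t k, 0 < t < T -> int_to (fun s => Cmult (P (t - s) k) (psi s k)) t (Cminus (y t k) (Cmult (P t k) (u0 k)))) ->
  ode T psi y /\ init y u0.
Proof.
  intros HT Hka Hc Hb Hy. destruct (Duh_spec mu mu_pos T psi ka HT Hka Hc Hb) as [Do Di].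
  assert (E : forall t k, 0 < t < T -> y t k = Cplus (Cmult (P t k) (u0 k)) (Duh mu T psi t k)).
  { intros t k Ht. pose proof (ode_int_to T psi (Duh mu T psi) _ t k Do Di (Hc k) Ht) as I. cbv beta in I.
    pose proof (int_to_unique _ _ _ _ (proj1 Ht) (Hy t k Ht) I) as Q.
    replace (y t k) with (Cplus (Cminus (y t k) (Cmult (P t k) (u0 k))) (Cmult (P t k) (u0 k))) by ring. rewrite Q. ring. }
  split.
  - intros k t Ht. rewrite E by auto.
    apply Cder_ext_loc with (fun s => Cplus (Cmult (P s k) (u0 k)) (Duh mu T psi s k)).
    { exists (Rmin t (T - t)). split; [apply Rmin_glb_lt; lra|]. intros s Hs. symmetry. apply E.
      rmin t (T - t). apply Rabs_def2 in Hs. lra. }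
    eapply Cder_eq; [|apply Cder_plus; [apply Cder_mult; [apply Pmult_der|apply Cder_const]|apply Do; auto]]. cbv beta. ring.
  - intros k eps He. destruct (Di k (eps / 2) ltac:(lra)) as (d1 & d10 & H1).
    set (U := Cmod (u0 k)). assert (U0 : 0 <= U) by apply Cmod_ge_0.
    destruct (Pmult_near k 0 (eps / (2 * (U + 1))) ltac:(apply Rdiv_lt_0_compat; lra)) as (d2 & d20 & H2).
    exists (Rmin T (Rmin d1 d2)). split; [repeat apply Rmin_glb_lt; lra|]. intros t Ht.
    rmin T (Rmin d1 d2). rmin d1 d2.
    rewrite E by lra. specialize (H1 t ltac:(lra)). specialize (H2 (- t) ltac:(rewrite Rabs_Ropp, Rabs_pos_eq; lra)).
    replace (0 - - t) with t in H2 by ring. rewrite Pmult_0 in H2.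
    replace (Cminus (Cplus (Cmult (P t k) (u0 k)) (Duh mu T psi t k)) (u0 k)) with
      (Cplus (Cmult (Cminus (P t k) (RtoC 1)) (u0 k)) (Cminus (Duh mu T psi t k) (RtoC 0))) by ring.
    eapply Rle_trans; [apply Cmod_triangle|]. rewrite Cmod_mult. fold U.
    assert (HF : Cmod (Cminus (P t k) (RtoC 1)) * U <= eps / (2 * (U + 1)) * (U + 1)).
    { apply Rmult_le_compat; auto using Cmod_ge_0. lra. }
    replace (eps / (2 * (U + 1)) * (U + 1)) with (eps / 2) in HF by (field; lra). lra.
Qed.

End Mild.

(** * The Wick nonlinearity meets the hypotheses of the local theory *)

Section GoodPsi.
Variables chi rho : R -> R.
Hypothesis HD : dyadic_partition chi rho.
Notation bes := (besov_le chi rho).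
Variables (m : nat) (nu tau : C) (Z0 : R -> fdist) (Zf : nat -> nat -> R -> fdist).
Hypothesis HL : in_calL chi rho m Z0 Zf.
Hypothesis Hm : (1 <= m)%nat.
Notation z := (zfam Z0 Zf).
Definition PsZ (s : R) (v : fdist) : fdist := PsiG chi rho m nu tau (z s) v.

Lemma cont_unif al t eps : 0 < al < 1 -> 0 < t -> 0 < eps -> exists d, 0 < d /\ forall s i j, 0 < s -> Rabs (s - t) < d ->
  (i <= m + 1)%nat -> (j <= m)%nat -> bes (- al) (dsub (z s i j) (z t i j)) eps.
Proof.
  intros Hal Ht He.
  assert (E : forall i, (i <= m + 1)%nat -> forall N, (N <= m)%nat -> exists d, 0 < d /\ forall s j, 0 < s -> Rabs (s - t) < d -> (j <= N)%nat -> bes (- al) (dsub (z s i j) (z t i j)) eps).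
  { intros i Hi N. induction N as [|N IH]; intros HN.
    - destruct (proj2 (zfam_cont _ _ HD m Z0 Zf HL al i 0 Hal Hi HN) t Ht eps He) as (d & d0 & H).
      exists d. split; auto. intros s j Hs Hst Hj. replace j with 0%nat by lia. now apply H.
    - destruct (IH ltac:(lia)) as (d1 & d10 & H1). destruct (proj2 (zfam_cont _ _ HD m Z0 Zf HL al i (S N) Hal Hi HN) t Ht eps He) as (d2 & d20 & H2).
      exists (Rmin d1 d2). split; [now apply Rmin_glb_lt|]. intros s j Hs Hst Hj. rmin d1 d2.
      destruct (Nat.eq_dec j (S N)) as [->|hj]; [apply H2|apply H1]; auto; try lra; lia. }
  assert (E2 : forall N, (N <= m + 1)%nat -> exists d, 0 < d /\ forall s i j, 0 < s -> Rabs (s - t) < d -> (i <= N)%nat -> (j <= m)%nat -> bes (- al) (dsub (z s i j) (z t i j)) eps).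
  { induction N as [|N IH]; intros HN.
    - destruct (E 0%nat HN m (le_n _)) as (d & d0 & H). exists d. split; auto. intros s i j Hs Hst Hi Hj. replace i with 0%nat by lia. now apply H.
    - destruct (IH ltac:(lia)) as (d1 & d10 & H1). destruct (E (S N) HN m (le_n _)) as (d2 & d20 & H2).
      exists (Rmin d1 d2). split; [now apply Rmin_glb_lt|]. intros s i j Hs Hst Hi Hj. rmin d1 d2.
      destruct (Nat.eq_dec i (S N)) as [->|hi]; [apply H2|apply H1]; auto; try lra; lia. }
  apply (E2 (m + 1)%nat (le_n _)).
Qed.

Lemma PsZ_cont be al v a b : 0 < al < be -> al < 1 -> 0 <= a -> cont_on chi rho (fun t => a < t < b) be v ->
  forall k t, a < t < b -> Ccont (fun s => PsZ s (v s) k) t.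
Proof.
  intros Hal Hal1 Ha [v1 v2] k t Ht eps He.
  destruct (PsiG_bes _ _ HD m nu tau be al Hal) as (C & C0 & HP). destruct (bes_coef _ _ HD (- al) k) as (Ck & Ck0 & HCk).
  destruct (v1 t Ht) as [A1 HA1]. destruct (zfam_bound _ _ HD m Z0 Zf HL Hm al (1/2) (t + 1) ltac:(lra) ltac:(lra) ltac:(lra)) as (B1 & B11 & HB1).
  set (A := Rmax 1 A1 + 1). set (B := Rmax 1 (B1 * Rpower t (- (1/2))) + 1).
  assert (HA : 2 <= A) by (unfold A; pose proof (Rmax_l 1 A1); lra). assert (HB : 2 <= B) by (unfold B; pose proof (Rmax_l 1 (B1 * Rpower t (- (1/2)))); lra).
  pose proof (pow_lt A (2 * m) ltac:(lra)) as PA. pose proof (pow_lt A (2 * m + 1) ltac:(lra)) as PA1.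
  set (Q := Ck * (C * (A ^ (2 * m) * B + A ^ (2 * m + 1)))).
  assert (Q0 : 0 < Q). { unfold Q. apply Rmult_lt_0_compat; auto. apply Rmult_lt_0_compat; auto. nra. }
  set (e := Rmin 1 (eps / Q)). assert (e0 : 0 < e) by (apply Rmin_glb_lt; [lra|now apply Rdiv_lt_0_compat]).
  pose proof (Rmin_l 1 (eps / Q)) as m1. pose proof (Rmin_r 1 (eps / Q)) as m2. fold e in m1, m2.
  destruct (v2 t Ht e e0) as (d1 & d10 & H1). destruct (cont_unif al t e ltac:(lra) ltac:(lra) e0) as (d2 & d20 & H2).
  exists (Rmin (Rmin (t - a) (b - t)) (Rmin d1 d2)). split; [repeat apply Rmin_glb_lt; lra|]. intros s Hs.
  rmin (Rmin (t - a) (b - t)) (Rmin d1 d2).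
  rmin (t - a) (b - t). rmin d1 d2.
  assert (Hab : a < s < b) by (apply Rabs_def2 in Hs; lra).
  assert (Vt : bes be (v t) A) by (eapply bes_le; [|apply HA1]; unfold A; pose proof (Rmax_r 1 A1); lra).
  assert (Vd : bes be (dsub (v s) (v t)) e) by (apply H1; auto; lra).
  assert (Vs : bes be (v s) A).
  { eapply bes_ext; [|eapply bes_le; [|apply (bes_plus _ _ _ _ _ _ _ HA1 Vd)]].
    - intros x. unfold dsub. ring.
    - unfold A. pose proof (Rmax_r 1 A1). lra. }
  destruct (HP (v s) (v t) (z s) (z t) A B e e ltac:(lra) ltac:(lra) Vs Vt Vd) as [_ HL2].
  { intros i j Hi Hj. pose proof (HB1 t i j ltac:(lra) Hi Hj) as Zt. pose proof (H2 s i j ltac:(lra) ltac:(lra) Hi Hj) as Zd.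
    pose proof (Rmax_r 1 (B1 * Rpower t (- (1/2)))) as mr. split; [|split; auto].
    - eapply bes_ext; [|eapply bes_le; [|apply (bes_plus _ _ _ _ _ _ _ Zt Zd)]].
      + intros x. unfold dsub. ring.
      + unfold B. lra.
    - eapply bes_le; [|apply Zt]. unfold B. lra. }
  eapply Rle_trans; [apply (HCk _ _ HL2)|].
  apply Rle_trans with (Q * (eps / Q)); [|apply Req_le; field; lra].
  replace (Ck * (C * (A ^ (2 * m) * e * B + A ^ (2 * m + 1) * e))) with (Q * e) by (unfold Q; ring). apply Rmult_le_compat_l; lra.
Qed.

Lemma good_PsZ be al et T : 0 < al < be -> al < 1 -> 0 < et < 1 -> 0 < T -> exists K, 0 <= K /\ good chi rho be al et (2 * m) T K PsZ.
Proof.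
  intros Hal Hal1 Het HT.
  destruct (PsiG_bes _ _ HD m nu tau be al Hal) as (C & C0 & HP).
  destruct (zfam_bound _ _ HD m Z0 Zf HL Hm al et T ltac:(lra) Het HT) as (B1 & B11 & HB1).
  (* [PsiG_bes] requires a bound on the Wick powers that is at least 1; the factor 1 + T^et ensures
     this for B s^{-et} on (0,T). *)
  set (B := B1 * (1 + Rpower T et)). assert (TP : 0 < Rpower T et) by apply exp_pos.
  assert (BB : B1 <= B) by (unfold B; nra).
  assert (BS : forall s, 0 < s < T -> 1 <= B * Rpower s (- et)).
  { intros s Hs. assert (1 <= Rpower T et * Rpower s (- et)).
    { apply Rle_trans with (Rpower s et * Rpower s (- et)).
      - rewrite <- Rpower_plus, Rplus_opp_r, Rpower_O; lra.
      - apply Rmult_le_compat_r; [apply Rlt_le, exp_pos|]. apply Rle_Rpower_l; lra. }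
    pose proof (Rpower_pos s (- et)) as ep. unfold B. nra. }
  assert (ZB : forall s i j, 0 < s < T -> (i <= m + 1)%nat -> (j <= m)%nat -> bes (- al) (z s i j) (B * Rpower s (- et)) /\
     bes (- al) (z s i j) (B * Rpower s (- et)) /\ bes (- al) (dsub (z s i j) (z s i j)) 0).
  { intros s i j Hs Hi Hj. assert (Z1 : bes (- al) (z s i j) (B * Rpower s (- et))).
    { eapply bes_le; [|apply HB1; auto; lra]. apply Rmult_le_compat_r; [apply Rlt_le, exp_pos|auto]. }
    repeat split; auto. apply bes_0; [lra|]. intros k. unfold dsub. ring. }
  exists (C * B). split; [nra|]. split; [|split].
  - intros s v A Hs HA Hv. destruct (HP v v (z s) (z s) A (B * Rpower s (- et)) (A + A) 0 HA (BS s Hs) Hv Hv) as [H _].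
    + apply bes_minus; auto.
    + intros i j Hi Hj. now apply ZB.
    + eapply bes_le; [|apply H]. replace (S (2 * m)) with (2 * m + 1)%nat by lia. apply Req_le. ring.
  - intros s v w A d Hs HA Hv Hw Hd. destruct (HP v w (z s) (z s) A (B * Rpower s (- et)) d 0 HA (BS s Hs) Hv Hw Hd) as [_ H].
    + intros i j Hi Hj. now apply ZB.
    + eapply bes_le; [|apply H]. apply Req_le. ring.
  - intros v a b Ha Hb Hv k t Ht. apply (PsZ_cont be al v a b); auto.
Qed.

End GoodPsi.

(** * Continuation to all times *)

Section Global.
Variables chi rho : R -> R.
Hypothesis HD : dyadic_partition chi rho.
Variable mu : R.
Hypothesis mu_pos : 0 < mu.
Variables be al bt ga et al1 : R.
Variable p : nat.
Hypothesis Hal : 0 < al < be.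
Hypothesis Hbt : be < bt.
Hypothesis Habt : al + bt < 2.
Hypothesis Het : 0 < et.
Hypothesis Hga : 0 < ga.
Hypothesis Hka : kap ga et p < 1.
Hypothesis Hom : 0 < omg al bt ga et p.
Hypothesis Hal1 : 0 < al1.
Hypothesis Hini : (al1 + bt) / 2 < ga.
Variable Ps : R -> fdist -> fdist.
Variable u0 : fdist.
Variable Rr : R.
Notation bes := (besov_le chi rho).
Notation Sol T u := (Sol chi rho mu be ga T u).
Notation good := (good chi rho be al et p).
Hypothesis Hgood : forall T, 0 < T -> exists K, 0 <= K /\ good T K Ps.
Hypothesis Hu0 : bes (- al1) u0 Rr.
Hypothesis Hap : forall T a A0, 0 < a < T -> exists Rs, forall T' v, T' <= T -> Sol T' u0 Ps v -> bes be (v a) A0 ->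
  forall t, a <= t < T' -> bes (- al1) (v t) Rs.

(** All continuations share the value at time a = h0/2 of the first local solution, hence the same a
    priori bound [Rs], hence a restart step that never shrinks. Finitely many extensions by h/2
    reach T. *)
Lemma extension T : 0 < T -> exists v, Sol T u0 Ps v.
Proof.
  intros HT.
  destruct (local_theory _ _ HD mu mu_pos be al bt ga et al1 p Hal Hbt Habt Het Hga Hka Hom Hal1 Hini) as (CC & C0 & CC0 & C00 & _ & EX).
  destruct (Hgood (T + 2) ltac:(lra)) as (K & K0 & HG).
  pose proof (bes_nonneg _ _ _ _ _ Hu0) as Rr0.
  assert (SS : forall Q, 0 <= Q -> exists h, 0 < h <= 1 /\ forall h', 0 < h' <= h -> CC * K * (C0 * Q + 1) ^ S p * Rpower h' (omg al bt ga et p) <= / 2).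
  { intros Q HQ. apply (step_size be al bt ga et p Hal Hbt Habt Hom). apply Rmult_le_pos; [nra|]. apply pow_le. nra. }
  destruct (SS Rr Rr0) as (h0 & h0p & Hh0).
  destruct (EX h0 K Rr Ps u0 h0p K0 Rr0) as [v0 Hv0]; auto.
  { eapply good_le; [|apply HG]. lra. }
  { apply Hh0. lra. }
  set (a := h0 / 2). destruct (proj1 (Sol_cont _ _ _ _ _ _ _ _ _ Hv0) a ltac:(unfold a; lra)) as [A0 HA0].
  destruct (Hap (T + 1) a A0 ltac:(unfold a; lra)) as [Rs HRs].
  set (Q := Rmax 0 Rs). assert (Q0 : 0 <= Q) by apply Rmax_l.
  destruct (SS Q Q0) as (h1 & h1p & Hh1). set (h := Rmin h0 h1).
  assert (hp : 0 < h) by (apply Rmin_glb_lt; lra). pose proof (Rmin_l h0 h1) as hl. pose proof (Rmin_r h0 h1) as hr. fold h in hl, hr.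
  (* The clause [v a = v0 a] keeps [Rs] valid for the next solution; the horizon is capped at T + 1,
     for which the a priori bound was obtained. *)
  assert (IND : forall n, exists v, Sol (Rmin (T + 1) (h0 + INR n * (h / 2))) u0 Ps v /\ v a = v0 a).
  { induction n as [|n (v & Hv & Ev)].
    - exists v0. split; auto. simpl. rewrite Rmult_0_l, Rplus_0_r. eapply Sol_le; [apply Rmin_r|]. auto.
    - rewrite S_INR. set (T' := Rmin (T + 1) (h0 + INR n * (h / 2))) in *. pose proof (pos_INR n) as n0.
      assert (nh : 0 <= INR n * (h / 2)) by nra.
      destruct (Rle_dec (T + 1) (h0 + INR n * (h / 2))) as [HL|HL].
      + exists v. split; auto. eapply Sol_le; [|apply Hv]. unfold T'. rewrite (Rmin_left _ _ HL). apply Rmin_l.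
      + assert (ET : T' = h0 + INR n * (h / 2)) by (unfold T'; apply Rmin_right; lra).
        set (t0 := T' - h / 2). assert (t0a : a <= t0) by (unfold t0, a; lra).
        assert (GH : good h K (fun s => Ps (t0 + s))).
        { eapply good_le; [|apply (good_shift chi rho be al et p Het (T + 2) K Ps t0 K0); [unfold a in t0a; lra|auto]]. unfold t0. lra. }
        assert (Rt : bes (- al1) (v t0) Q).
        { eapply bes_le; [|apply (HRs T' v); auto]; [apply Rmax_r|apply Rmin_l|rewrite Ev; auto|unfold t0 in *; lra]. }
        destruct (EX h K Q (fun s => Ps (t0 + s)) (v t0) ltac:(lra) K0 Q0 GH Rt (Hh1 h ltac:(lra))) as [w Hw].
        destruct (glue _ _ HD mu mu_pos be al bt ga et al1 p Hal Hbt Habt Het Hga Hka Hom Hal1 Hini T' K Ps u0 v t0 h w) as (u & Hu & Eu); auto.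
        * unfold t0, a in *. lra.
        * unfold t0. lra.
        * eapply good_le; [|apply HG]. unfold t0. lra.
        * exists u. split; [|rewrite Eu; auto; unfold t0, a in *; lra]. eapply Sol_le; [|apply Hu].
          eapply Rle_trans; [apply Rmin_r|]. unfold t0. lra. }
  destruct (nfloor_ex (T / (h / 2))) as [n [_ Hn]]; [apply Rmult_le_pos; [lra|apply Rlt_le, Rinv_0_lt_compat; lra]|].
  destruct (IND (S n)) as (v & Hv & _). exists v. eapply Sol_le; [|apply Hv]. rewrite S_INR.
  apply (Rmult_lt_compat_r (h / 2)) in Hn; [|lra]. unfold Rdiv in Hn at 1. rewrite Rmult_assoc, Rinv_l, Rmult_1_r in Hn by lra.
  apply Rmin_glb; lra.
Qed.

Lemma Sol_ext T v w : 0 < T -> (forall t, 0 < t < T -> v t = w t) -> Sol T u0 Ps v -> Sol T u0 Ps w.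
Proof.
  intros HT E [c o i b]. split.
  - split.
    + intros t Ht. rewrite <- E by auto. now apply c.
    + intros t Ht eps He. destruct (proj2 c t Ht eps He) as (d & d0 & H). exists d. split; auto.
      intros s Hs Hst. rewrite <- !E by auto. auto.
  - intros k t Ht. rewrite <- E by auto. apply Cder_ext_loc with (fun s => v s k); [|apply o; auto].
    exists (Rmin t (T - t)). split; [apply Rmin_glb_lt; lra|]. intros s Hs. rmin t (T - t).
    apply Rabs_def2 in Hs. rewrite E; auto. lra.
  - intros k eps He. destruct (i k eps He) as (d & d0 & H). exists (Rmin d T). split; [now apply Rmin_glb_lt|]. intros t Ht.
    rmin d T. rewrite <- E by lra. apply H. lra.
  - intros T' HT'. destruct (b T' HT') as [M HM]. exists M. intros t Ht. rewrite <- E by lra. auto.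
Qed.

Lemma Sol_unique T v w : Sol T u0 Ps v -> Sol T u0 Ps w -> forall t, 0 < t < T -> v t = w t.
Proof.
  intros Hv Hw t Ht. destruct (Hgood T ltac:(lra)) as (K & K0 & HG). apply functional_extensionality. intros k.
  apply (uniqueness _ _ HD mu mu_pos be al bt ga et al1 p Hal Hbt Habt Het Hga Hka Hom Hal1 Hini T K Ps u0 v w); auto.
Qed.

(** A solution is chosen on each horizon; by uniqueness the diagonal t -> V (t+1) t agrees with
    every one of them. *)
Lemma global_solution : exists v, forall T, 0 < T -> Sol T u0 Ps v.
Proof.
  assert (H : forall T, exists v, 0 < T -> Sol T u0 Ps v).
  { intros T. destruct (Rlt_dec 0 T) as [h|h]; [destruct (extension T h) as [v Hv]; exists v; auto|exists (fun _ => u0); lra]. }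
  set (V := fun T => proj1_sig (constructive_indefinite_description _ (H T))).
  assert (HV : forall T, 0 < T -> Sol T u0 Ps (V T)) by (intros T; unfold V; exact (proj2_sig (constructive_indefinite_description _ (H T)))).
  exists (fun t => V (t + 1) t). intros T HT. apply Sol_ext with (V T); auto. intros t Ht.
  apply (Sol_unique (Rmin T (t + 1))).
  - eapply Sol_le; [apply Rmin_l|]. auto.
  - eapply Sol_le; [apply Rmin_r|]. apply HV. lra.
  - split; [lra|]. apply Rmin_glb_lt; lra.
Qed.

End Global.

(** Since s^2 = mu^2 (1 + 2s), the number 1 + s is the root of (q-1)^2 = mu^2 (2q-1) above 1. The
    condition on mu puts m + 1/2 below this root, and 1/(1+s) <= alpha0 < 2 gamma - beta leaves room
    for 1/q, so q slightly below 1 + s satisfies all three requirements. *)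
Lemma exponent_choice (m : nat) mu alpha0 beta gamma : 0 < mu -> 2 + 2 * mu * (mu + sqrt (1 + mu ^ 2)) > 2 * INR m + 1 ->
  1 / (1 + mu * (mu + sqrt (1 + mu ^ 2))) <= alpha0 -> 0 < beta -> (alpha0 + beta) / 2 < gamma ->
  exists q, INR m + 1/2 < q /\ (q - 1) ^ 2 < mu ^ 2 * (2 * q - 1) /\ / q + beta < 2 * gamma.
Proof.
  intros Hmu Hp Ha Hb Hg. set (s := mu * (mu + sqrt (1 + mu ^ 2))) in *.
  assert (sq : sqrt (1 + mu ^ 2) ^ 2 = 1 + mu ^ 2) by (apply pow2_sqrt; nra).
  assert (s0 : 0 < s). { unfold s. pose proof (sqrt_pos (1 + mu ^ 2)). nra. }
  assert (Es : s ^ 2 = mu ^ 2 * (1 + 2 * s)). { unfold s. nra. }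
  assert (Hp' : INR m + 1/2 < 1 + s). { unfold s. lra. }
  set (g := 2 * gamma - beta).
  assert (ig : / (1 + s) < g) by (unfold Rdiv in Ha; rewrite Rmult_1_l in Ha; unfold g; lra).
  assert (i0 : 0 < / (1 + s)) by (apply Rinv_0_lt_compat; lra).
  assert (ig2 : / g < 1 + s). { rewrite <- (Rinv_inv (1 + s)). apply Rinv_lt_contravar; [|auto]. apply Rmult_lt_0_compat; lra. }
  (* The lower limits on q; s/2 + 1 ensures that q - 1 is positive. The witness is the midpoint of x
     and 1 + s. *)
  set (x := Rmax (Rmax (/ g) (INR m + 1/2)) (s / 2 + 1)).
  assert (X : x < 1 + s) by (repeat apply Rmax_lub_lt; lra).
  assert (X1 : / g <= x) by (eapply Rle_trans; [apply Rmax_l|apply Rmax_l]).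
  assert (X2 : INR m + 1/2 <= x) by (eapply Rle_trans; [apply Rmax_r|apply Rmax_l]).
  assert (X3 : s / 2 + 1 <= x) by apply Rmax_r.
  exists ((x + 1 + s) / 2). set (q := (x + 1 + s) / 2). assert (Q1 : x < q < 1 + s) by (unfold q; lra).
  split; [lra|split].
  - set (y := q - 1). assert (Y : 0 < y < s) by (unfold y; lra). replace (2 * q - 1) with (1 + 2 * y) by (unfold y; ring).
    assert (ys : 0 < y * s) by (apply Rmult_lt_0_compat; lra).
    assert (K : 0 < (s - y) * (y + s + 2 * y * s)) by (apply Rmult_lt_0_compat; lra).
    assert (K2 : (mu ^ 2 * (1 + 2 * y) - y ^ 2) * (1 + 2 * s) = (s - y) * (y + s + 2 * y * s)).
    { replace ((mu ^ 2 * (1 + 2 * y) - y ^ 2) * (1 + 2 * s)) with (mu ^ 2 * (1 + 2 * s) * (1 + 2 * y) - y ^ 2 * (1 + 2 * s)) by ring. rewrite <- Es. ring. }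
    rewrite <- K2 in K. apply Rnot_le_lt. intros h. assert ((mu ^ 2 * (1 + 2 * y) - y ^ 2) * (1 + 2 * s) <= 0) by (apply (Rmult_le_compat_r (1 + 2 * s)) in h; lra). lra.
  - assert (/ q < g); [|unfold g in *; lra].
    rewrite <- (Rinv_inv g). apply Rinv_lt_contravar; [|lra].
    assert (0 < / g) by (apply Rinv_0_lt_compat; lra). apply Rmult_lt_0_compat; lra.
Qed.

(** * Mild solutions against modewise solutions *)

Section Equiv.
Variables chi rho : R -> R.
Hypothesis HD : dyadic_partition chi rho.
Variables (m : nat) (nu tau : C) (mu be ga al et : R) (Z0 : R -> fdist) (Zf : nat -> nat -> R -> fdist) (u0 : fdist).
Hypothesis mu_pos : 0 < mu.
Hypothesis Hm : (1 <= m)%nat.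
Hypothesis HL : in_calL chi rho m Z0 Zf.
Hypothesis Hal : 0 < al < be.
Hypothesis Hal1 : al < 1.
Hypothesis Het : 0 < et < 1.
Hypothesis Hga : 0 < ga.
Hypothesis Hka : kap ga et (2 * m) < 1.
Notation bes := (besov_le chi rho).
Notation Ps := (PsZ chi rho m nu tau Z0 Zf).
Notation Sol T := (Sol chi rho mu be ga T u0 Ps).
Notation mild T w := (mild_solution chi rho m mu nu tau be ga u0 Z0 Zf T w).

Lemma weighted_bes t M f : 0 < t -> (forall n x, Rpower t ga * (Rpower 2 ((INR n - 1) * be) * Cmod (LPblock chi rho n f x)) <= M) <->
  bes be f (M * Rpower t (- ga)).
Proof.
  intros Ht. assert (E : Rpower t ga * Rpower t (- ga) = 1) by (rewrite <- Rpower_plus, Rplus_opp_r, Rpower_O; lra).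
  pose proof (Rpower_pos t ga) as e1.
  split; intros H n x; specialize (H n x).
  - apply (Rmult_le_reg_l (Rpower t ga)); auto. replace (Rpower t ga * (M * Rpower t (- ga))) with (M * (Rpower t ga * Rpower t (- ga))) by ring. rewrite E. lra.
  - apply (Rmult_le_compat_l (Rpower t ga)) in H; [|lra]. replace (Rpower t ga * (M * Rpower t (- ga))) with (M * (Rpower t ga * Rpower t (- ga))) in H by ring.
    rewrite E in H. lra.
Qed.

(** The mild formulation includes the end point t = T whereas [Sol] lives on an open interval, hence
    the margin T + 1. *)
Lemma Sol_mild v T : 0 < T -> Sol (T + 1) v -> mild T v.
Proof.
  intros HT [c o i b]. split; [|split].
  - apply (cont_on_sub chi rho be (fun t => 0 < t <= T) (fun t => 0 < t < T + 1)); auto. intros; lra.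
  - destruct (b T ltac:(lra)) as [M HM]. exists M. intros t Ht. apply weighted_bes; [lra|]. now apply HM.
  - intros t Ht k. apply (ode_int_to mu (T + 1) (fun s => Ps s (v s)) v u0 t k o i); [|lra].
    intros s Hs. apply (PsZ_cont chi rho HD m nu tau Z0 Zf HL Hm be al v 0 (T + 1)); auto. lra.
Qed.

Lemma mild_Sol w : cont_on chi rho (fun t => 0 < t) be w -> (forall T, 0 < T -> mild T w) -> forall T, 0 < T -> Sol T w.
Proof.
  intros Hc Hw T HT.
  assert (CT : cont_on chi rho (fun t => 0 < t < T) be w) by (apply (cont_on_sub chi rho be _ (fun t => 0 < t)); auto; intros; lra).
  destruct (Hw T HT) as (_ & (M & HM) & HI).
  assert (BW : forall t, 0 < t <= T -> bes be (w t) (M * Rpower t (- ga))).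
  { intros t Ht. apply weighted_bes; [lra|]. now apply HM. }
  destruct (good_PsZ chi rho HD m nu tau Z0 Zf HL Hm be al et T Hal Hal1 Het HT) as (K & K0 & HG).
  (* Raised to at least T^ga so that M' s^{-ga} >= 1, as the growth bound in [good] requires. *)
  set (M' := Rmax M (Rpower T ga)).
  assert (OI : modeODE mu T (fun s => Ps s (w s)) w /\ init w u0).
  { apply (int_to_ode mu mu_pos T (fun s => Ps s (w s)) w u0 (kap ga et (2 * m)) HT Hka).
    - intros k s Hs. apply (PsZ_cont chi rho HD m nu tau Z0 Zf HL Hm be al w 0 T); auto. lra.
    - intros k. destruct (bes_coef _ _ HD (- al) k) as (Ck & Ck0 & HCk). exists (Ck * (K * M' ^ S (2 * m))). intros s Hs.
      assert (W : bes be (w s) (M' * Rpower s (- ga))).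
      { eapply bes_le; [|apply BW; lra]. apply Rmult_le_compat_r; [apply Rlt_le, exp_pos|apply Rmax_l]. }
      assert (W1 : 1 <= M' * Rpower s (- ga)).
      { apply Rle_trans with (Rpower s ga * Rpower s (- ga)); [rewrite <- Rpower_plus, Rplus_opp_r, Rpower_O; lra|].
        apply Rmult_le_compat_r; [apply Rlt_le, exp_pos|]. apply Rle_trans with (Rpower T ga); [apply Rle_Rpower_l; lra|apply Rmax_r]. }
      pose proof (HCk _ _ (proj1 HG s (w s) _ Hs W1 W)) as B. eapply Rle_trans; [apply B|]. apply Req_le.
      rewrite Rpow_mult_distr, Rpower_pow_mult. replace (- kap ga et (2 * m)) with (- et + INR (S (2 * m)) * - ga) by (unfold kap; rewrite S_INR; ring).
      rewrite Rpower_plus. ring.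
    - intros t k Ht. apply (HI t ltac:(lra) k). }
  destruct OI as [o i]. split; auto. intros T' HT'. exists M. intros t Ht. apply BW. lra.
Qed.

Variables (q al1 : R).
Hypothesis Hnu : 0 < Re nu.
Hypothesis Hq : INR m + 1/2 < q.
Hypothesis Hq2 : (q - 1) ^ 2 < mu ^ 2 * (2 * q - 1).
Hypothesis Halq : al <= / (16 * (q + INR m)).
Hypothesis Hqal1 : / q <= al1.

(** On [a,T] the Wick powers are bounded by B a^{-1/2}, and [Sol_bound] supplies the qualitative
    bound needed by [apriori]. [Rs] is fixed before the solution and its lifetime T', which is what
    the continuation argument needs. *)
Lemma apriori_Sol T a A0 : 0 < a < T -> exists Rs, forall T' v, T' <= T -> Sol T' v -> bes be (v a) A0 ->
  forall t, a <= t < T' -> bes (- al1) (v t) Rs.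
Proof.
  intros Ha.
  destruct (apriori _ _ HD m nu tau mu q be al Hm Hnu mu_pos Hq Hq2 ltac:(lra) ltac:(lra)) as (CL & CS & CL0 & CS0 & H).
  destruct (zfam_bound _ _ HD m Z0 Zf HL Hm (al / 2) (1/2) T ltac:(lra) ltac:(lra) ltac:(lra)) as (B & B1 & HB).
  set (Mz := Rmax 1 (B * Rpower a (- (1/2)))).
  destruct (H Mz (Rmax_l _ _)) as (CE & CE0 & HE).
  exists (Rpower 2 (- / q - - al1) * (CL * (1 + Rpower (1 + (CS * A0) ^ 2) q + CE * T))).
  intros T' v HT' Hv Hva t Ht. apply bes_weaken; [lra|].
  destruct (Sol_bound _ _ _ _ _ _ _ _ _ Hv t ltac:(lra)) as [M HM].
  assert (MON : forall s e, a <= s -> 0 <= e -> Rpower s (- e) <= Rpower a (- e)).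
  { intros s e Hs He. rewrite !Rpower_Ropp. apply Rinv_le_contravar; [apply exp_pos|]. apply Rle_Rpower_l; lra. }
  eapply bes_le; [|apply (HE v (zfam Z0 Zf) a t (Rabs M * Rpower a (- ga)) A0)]; try lra.
  - apply Rmult_le_compat_l; [lra|]. apply Rplus_le_compat_l. apply Rmult_le_compat_l; lra.
  - intros s _. apply zfam_00.
  - intros s i j Hs Hi Hj. eapply bes_le; [|apply (HB s i j); auto; lra]. eapply Rle_trans; [|apply Rmax_r].
    apply Rmult_le_compat_l; [lra|]. apply MON; lra.
  - intros s k Hs. apply (Sol_ode _ _ _ _ _ _ _ _ _ Hv k s). lra.
  - intros s Hs. eapply bes_le; [|apply HM; lra].
    pose proof (MON s ga ltac:(lra) ltac:(lra)) as h. pose proof (Rpower_pos s (- ga)) as h1.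
    pose proof (Rle_abs M). pose proof (Rabs_pos M).
    apply Rle_trans with (Rabs M * Rpower s (- ga)); [apply Rmult_le_compat_r; lra|apply Rmult_le_compat_l; lra].
  - exact Hva.
Qed.

End Equiv.

Theorem mainTheorem8 :
  forall (chi rho : R -> R), dyadic_partition chi rho ->
  forall (m : nat) (mu : R) (nu tau : C),
  (1 <= m)%nat -> 0 < Re nu -> 0 < mu ->
  2 + 2 * mu * (mu + sqrt (1 + mu ^ 2)) > 2 * INR m + 1 ->
  forall alpha0 beta gamma : R,
  1 / (1 + mu * (mu + sqrt (1 + mu ^ 2))) <= alpha0 ->
  alpha0 <= 2 / (2 * INR m + 1) ->
  0 < beta ->
  (alpha0 + beta) / 2 < gamma -> gamma < 1 / (2 * INR m + 1) ->
  forall (u0 : fdist), in_besov chi rho (- alpha0) u0 ->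
  forall (Z0 : R -> fdist) (Zf : nat -> nat -> R -> fdist),
  in_calL chi rho m Z0 Zf ->
  exists v : R -> fdist,
    (cont_on chi rho (fun t => 0 < t) beta v /\
     forall T, 0 < T -> mild_solution chi rho m mu nu tau beta gamma u0 Z0 Zf T v) /\
    (forall w : R -> fdist,
       cont_on chi rho (fun t => 0 < t) beta w ->
       (forall T, 0 < T -> mild_solution chi rho m mu nu tau beta gamma u0 Z0 Zf T w) ->
       forall t, 0 < t -> forall k, w t k = v t k).
Proof.
  intros chi rho HD m mu nu tau Hm Hnu Hmu Hp alpha0 beta gamma Ha0 Ha1 Hb Hg1 Hg2 u0 [R0 Hu0] Z0 Zf HL.
  destruct (exponent_choice m mu alpha0 beta gamma Hmu Hp Ha0 Hb Hg1) as (q & Hq & Hq2 & Hqg).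
  assert (m1 : 1 <= INR m) by (now apply (le_INR 1)).
  assert (s0 : 0 < alpha0).
  { eapply Rlt_le_trans; [|apply Ha0]. apply Rdiv_lt_0_compat; [lra|]. pose proof (sqrt_pos (1 + mu ^ 2)). nra. }
  assert (G : (2 * INR m + 1) * gamma < 1).
  { apply (Rmult_lt_compat_l (2 * INR m + 1)) in Hg2; [|lra]. replace ((2 * INR m + 1) * (1 / (2 * INR m + 1))) with 1 in Hg2 by (field; lra). lra. }
  (* The weakest regularity from which a solution is started: alpha0 for the data, 1/q for the a
     priori bound. *)
  set (al1 := Rmax alpha0 (/ q)). pose proof (Rmax_l alpha0 (/ q)) as l1. pose proof (Rmax_r alpha0 (/ q)) as l2. fold al1 in l1, l2.
  assert (l3 : al1 + beta < 2 * gamma) by (unfold al1, Rmax; destruct (Rle_dec alpha0 (/ q)); lra).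
  assert (g3 : 3 * gamma < 1) by nra.
  (* Half of the slack 2 gamma - al1 - beta makes bt exceed beta, the other half keeps (al1 + bt)/2
     < gamma. *)
  set (bt := beta + (2 * gamma - al1 - beta) / 2).
  (* Half of the slack in (2m+1) gamma < 1 is left to the singularity of the Wick powers, so that
     [kap] stays below 1. *)
  set (et := (1 - (2 * INR m + 1) * gamma) / 2).
  assert (i16 : 0 < / (16 * (q + INR m))) by (apply Rinv_0_lt_compat; lra).
  (* beta/2 keeps products with v well defined, al1 gives [omg > 0], and the last bound is the one
     required by [pair_K]. *)
  set (al := Rmin (Rmin (beta / 2) al1) (/ (16 * (q + INR m)))).
  assert (al0 : 0 < al) by (repeat apply Rmin_glb_lt; lra).
  assert (ala : al <= beta / 2) by (eapply Rle_trans; [apply Rmin_l|apply Rmin_l]).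
  assert (alb : al <= al1) by (eapply Rle_trans; [apply Rmin_l|apply Rmin_r]).
  assert (alc : al <= / (16 * (q + INR m))) by apply Rmin_r.
  assert (Hal : 0 < al < beta) by lra.
  assert (Het : 0 < et < 1) by (unfold et; split; [lra|]; nra).
  assert (pm : INR (2 * m) = 2 * INR m) by (rewrite mult_INR; reflexivity).
  assert (kE : kap gamma et (2 * m) = et + (2 * INR m + 1) * gamma) by (unfold kap; now rewrite pm).
  assert (Hka : kap gamma et (2 * m) < 1) by (rewrite kE; unfold et; lra).
  assert (Hom : 0 < omg al bt gamma et (2 * m)) by (unfold omg; rewrite kE; unfold et, bt; lra).
  assert (Hu1 : besov_le chi rho (- al1) u0 (Rpower 2 (- alpha0 - - al1) * R0)) by (apply bes_weaken; [lra|auto]).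
  assert (GOOD : forall T, 0 < T -> exists K, 0 <= K /\ good chi rho beta al et (2 * m) T K (PsZ chi rho m nu tau Z0 Zf)).
  { intros T HT. apply (good_PsZ chi rho HD m nu tau Z0 Zf HL Hm beta al et T); auto. lra. }
  destruct (global_solution chi rho HD mu Hmu beta al bt gamma et al1 (2 * m) Hal ltac:(unfold bt; lra) ltac:(unfold bt; lra) ltac:(lra) ltac:(lra)
     Hka Hom ltac:(lra) ltac:(unfold bt; lra) (PsZ chi rho m nu tau Z0 Zf) u0 _ GOOD Hu1) as [v Hv].
  { intros T a A0. apply (apriori_Sol chi rho HD m nu tau mu beta gamma al Z0 Zf u0 Hmu Hm HL Hal ltac:(lra) ltac:(lra) q al1); auto. }
  exists v. split; [split|].
  - split.
    + intros t Ht. apply (proj1 (Sol_cont _ _ _ _ _ _ _ _ _ (Hv (t + 1) ltac:(lra)))). lra.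
    + intros t Ht eps He. destruct (proj2 (Sol_cont _ _ _ _ _ _ _ _ _ (Hv (t + 1) ltac:(lra))) t ltac:(lra) eps He) as (d & d0 & H).
      exists (Rmin d 1). split; [apply Rmin_glb_lt; lra|]. intros s Hs Hst. rmin d 1.
      apply H; [|lra]. apply Rabs_def2 in Hst. lra.
  - intros T HT. apply (Sol_mild chi rho HD m nu tau mu beta gamma al Z0 Zf u0 Hm HL Hal ltac:(lra)); auto. apply Hv. lra.
  - intros w Hwc Hwm t Ht k.
    assert (Hw : Sol chi rho mu beta gamma (t + 1) u0 (PsZ chi rho m nu tau Z0 Zf) w).
    { apply (mild_Sol chi rho HD m nu tau mu beta gamma al et Z0 Zf u0 Hmu Hm HL Hal ltac:(lra) Het ltac:(lra) Hka w Hwc Hwm). lra. }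
    rewrite (Sol_unique chi rho HD mu Hmu beta al bt gamma et al1 (2 * m) Hal ltac:(unfold bt; lra) ltac:(unfold bt; lra) ltac:(lra) ltac:(lra)
     Hka Hom ltac:(lra) ltac:(unfold bt; lra) (PsZ chi rho m nu tau Z0 Zf) u0 GOOD (t + 1) w v Hw (Hv (t + 1) ltac:(lra))); auto. lra.
Qed.
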